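(* Let $q\ge1$ be an integer, let $X$ be an essentially $(q+1)$-regular infinite graph which is either periodic or self-similar, put $d=q+1$, and let $A$ be its adjacency operator. Let $$\Omega=\Bigl\{(z,u)\in\mathbb{C}^2: z\neq0,\ \frac{1+(1-u)(q+u)z^2}{z}\in[-d,d]\Bigr\}.$$ Then $\Omega$ does not disconnect $\mathbb{C}^2$ (that is, $\mathcal{V}=\mathbb{C}^2\setminus\Omega$ is connected), and the function $$(z,u)\mapsto \det\nolimits_\tau\bigl((1+(1-u)(q+u)z^2)I-zA\bigr)$$ is a non-vanishing analytic function on $\mathcal{V}$.
   Context: All graphs $X=(VX,EX)$ are simple (edges are unordered pairs of distinct vertices), countable, connected, and of bounded degree. $X$ is essentially $(q+1)$-regular if $\deg(v)=q+1$ for all but finitely many vertices and $\sup_v\deg(v)=q+1$. The adjacency operator $A$ on $\ell^2(VX)$ has matrix $A(v,w)=1$ if $v\sim w$ and $0$ otherwise; it is bounded, self-adjoint, with $\|A\|\le \sup_v\deg(v)$. Periodic graph: a pair $(X,\Gamma)$, where $\Gamma$ is a countable discrete group of automorphisms of $X$ acting freely (no $\gamma\neq\mathrm{id}$ has fixed points) with finite quotient $X/\Gamma$. Let $\mathcal{F}_0\subset VX$ be a set of representatives of $VX/\Gamma$. Self-similar graph: For a subgraph $K$ of $X$, the frontier $\mathcal{F}(K)$ is the set of vertices in $VK$ having distance 1 from $VX\setminus VK$; $|K|:=|VK|$. A local isomorphism is a triple $(S(\gamma),R(\gamma),\gamma)$ with $S(\gamma),R(\gamma)$ subgraphs of $X$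 and $\gamma:S(\gamma)\to R(\gamma)$ a graph isomorphism. An amenable exhaustion is an increasing sequence of finite subgraphs $\{K_n\}$ with $\bigcup_n K_n=X$ and $|\mathcal{F}(K_n)|/|K_n|\to0$. A countably infinite $X$ is self-similar if it has an amenable exhaustion $\{K_n\}$ such that: (i) for every $n$ there is a finite set $\mathcal{G}(n,n+1)$ of local isomorphisms with $S(\gamma)=K_n$ for all $\gamma\in\mathcal{G}(n,n+1)$, $\bigcup_{\gamma\in\mathcal{G}(n,n+1)}\gamma(K_n)=K_{n+1}$, and $V(\gamma K_n)\cap V(\gamma'K_n)=\mathcal{F}(\gamma K_n)\cap\mathcal{F}(\gamma'K_n)$ for $\gamma\ne\gamma'$ in $\mathcal{G}(n,n+1)$; (ii) for $n<m$ let $\mathcal{G}(n,m)$ be the set of all admissible products $\gamma_{m-1}\cdots\gamma_n$ with $\gamma_i\in\mathcal{G}(i,i+1)$ (admissible: the range of $\gamma_j$ is contained in the source of $\gamma_{j+1}$), $\mathcal{G}(n,n)=\{\mathrm{id}_{K_n}\}$, $\mathcal{G}(n)=\bigcup_{m\ge n}\mathcal{G}(n,m)$; with $\mathcal{F}_{\mathcal{G}}(K_n)=\bigcup_{\gamma\in\mathcal{G}(n)}\gamma^{-1}\mathcal{F}(\gamma K_n)$ one requires $|\mathcal{F}_{\mathcal{G}}(K_n)|/|K_n|\to0$. Trace: for $T$ in the C$^*$-algebra generated by $I$ and $A$, $\tau(T)=\sum_{x\in\mathcal{F}_0}T(x,x)$ in the periodic case, and $\tau(T)=\lim_n\frac1{|K_n|}\sum_{x\in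 VK_n}T(x,x)$ in the self-similar case (the limit exists). Determinant: for an operator $T$ in this algebra with $0\notin\operatorname{conv}\sigma(T)$ (convex hull of the spectrum), $$\det\nolimits_\tau(T)=\exp\Bigl(\tau\Bigl(\frac1{2\pi i}\int_{\partial R}\log\lambda\,(\lambda-T)^{-1}d\lambda\Bigr)\Bigr),$$ where $R$ is a connected, simply connected region containing $\operatorname{conv}\sigma(T)$ and $\log$ is a branch of the logarithm whose domain contains $R$ (and its boundary). This is well defined, and $\det_\tau$ is analytic on the set of such $T$.
   Formalization: In the definition of self-similar graph, the subgraphs K_n and the sources and ranges of local isomorphisms are taken to be full (induced) subgraphs; for arbitrary subgraphs the limit defining the trace can fail to exist. *)

(* Defs.v *)
From HB Require Import structures.
From mathcomp Require Import all_boot finmap.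
From Stdlib Require Import Reals Lra Psatz ClassicalEpsilon FunctionalExtensionality ProofIrrelevance.
From Coquelicot Require Import Coquelicot.
From mathcomp Require Import ssrnat.

Set Implicit Arguments.
Unset Strict Implicit.
Unset Printing Implicit Defensive.

Local Open Scope fset_scope.
Local Open Scope R_scope.

HB.instance Definition _ := Monoid.isComLaw.Build R 0 Rplus
  (fun x y z => esym (Rplus_assoc x y z)) Rplus_comm Rplus_0_l.
HB.instance Definition _ := Monoid.isComLaw.Build C (RtoC 0) Cplus
  Cplus_assoc Cplus_comm Cplus_0_l.

Section NormBuilder.
Variables (K : AbsRing) (M : ModuleSpace K) (nrm : M -> R).
Hypothesis nrm_triangle : forall x y, nrm (plus x y) <= nrm x + nrm y.
Hypothesis nrm_scal : forall (l : K) x, nrm (scal l x) <= abs l * nrm x.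
Hypothesis nrm_eq0 : forall x, nrm x = 0 -> x = zero.

Lemma nrm_zero_ : nrm zero = 0.
Proof.
have h0 : nrm zero <= 0.
  have := nrm_scal zero zero.
  by rewrite scal_zero_l abs_zero Rmult_0_l.
have := nrm_triangle zero zero; rewrite plus_zero_l; lra.
Qed.

Lemma nrm_opp_ x : nrm (opp x) <= nrm x.
Proof.
have := nrm_scal (opp one) x.
by rewrite scal_opp_one abs_opp_one Rmult_1_l.
Qed.

Definition nrm_ball (x : M) (e : R) (y : M) := nrm (minus y x) < e.

Lemma nrm_ball_center (x : M) (e : posreal) : nrm_ball x e x.
Proof. rewrite /nrm_ball minus_eq_zero nrm_zero_; exact: cond_pos. Qed.

Lemma nrm_ball_sym (x y : M) (e : R) : nrm_ball x e y -> nrm_ball y e x.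
Proof.
rewrite /nrm_ball => h; apply: Rle_lt_trans h.
rewrite -(opp_minus y x); exact: nrm_opp_.
Qed.

Lemma nrm_ball_triangle (x y z : M) (e1 e2 : R) :
  nrm_ball x e1 y -> nrm_ball y e2 z -> nrm_ball x (e1 + e2) z.
Proof.
rewrite /nrm_ball => h1 h2.
have -> : minus z x = plus (minus z y) (minus y x) by exact: (minus_trans y).
by rewrite Rplus_comm; apply: Rle_lt_trans (nrm_triangle _ _) _; exact: Rplus_lt_compat.
Qed.

Definition nrm_UniformSpace_mixin := UniformSpace.Mixin M zero nrm_ball
  nrm_ball_center nrm_ball_sym nrm_ball_triangle.

Definition nrm_Aux_class :=
  NormedModuleAux.Class K M (ModuleSpace.class K M) nrm_UniformSpace_mixin.

Lemma nrm_compat2 (x y : NormedModuleAux.Pack K M nrm_Aux_class M) (eps : posreal) :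
  ball x eps y -> nrm (minus y x) < 1 * eps.
Proof. by rewrite Rmult_1_l. Qed.

Definition normed_module_class : NormedModule.class_of K M :=
  NormedModule.Class K M nrm_Aux_class
    (NormedModule.Mixin K (NormedModuleAux.Pack K M nrm_Aux_class M) nrm 1
       nrm_triangle nrm_scal (fun _ _ _ h => h) nrm_compat2 nrm_eq0).
End NormBuilder.

(** Restriction of scalars from [C] to [R]; [is_RInt] needs real scalars. *)

Section Realify.
Variable M : NormedModule C_AbsRing.

Definition real_scal (r : R) (x : M) : M := scal (RtoC r) x.

Lemma real_scal_assoc (r s : R) (x : M) :
  real_scal r (real_scal s x) = real_scal (mult r s) x.
Proof. by rewrite /real_scal scal_assoc; congr scal; exact: (esym (RtoC_mult r s)). Qed.
Lemma real_scal_one (x : M) : real_scal one x = x.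
Proof. exact: (@scal_one C_Ring). Qed.
Lemma real_scal_distr_l (r : R) (x y : M) :
  real_scal r (plus x y) = plus (real_scal r x) (real_scal r y).
Proof. exact: scal_distr_l. Qed.
Lemma real_scal_distr_r (r s : R) (x : M) :
  real_scal (plus r s) x = plus (real_scal r x) (real_scal s x).
Proof.
rewrite /real_scal -(scal_distr_r (RtoC r) (RtoC s)).
by congr scal; exact: (RtoC_plus r s).
Qed.

Definition real_ModuleSpace : ModuleSpace R_Ring :=
  ModuleSpace.Pack R_Ring M
    (ModuleSpace.Class R_Ring M (AbelianGroup.class M)
       (ModuleSpace.Mixin R_Ring M real_scal real_scal_assoc real_scal_one
          real_scal_distr_l real_scal_distr_r)) M.

Definition real_Aux : NormedModuleAux R_AbsRing :=
  NormedModuleAux.Pack R_AbsRing M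
    (NormedModuleAux.Class R_AbsRing M (ModuleSpace.class _ real_ModuleSpace)
       (UniformSpace.class M)) M.

Lemma real_norm_scal (r : R) (x : M) :
  norm (real_scal r x) <= abs r * norm x.
Proof.
apply: Rle_trans (norm_scal (RtoC r) x) _; right; congr (_ * _).
exact: Cmod_R.
Qed.

Definition realify : NormedModule R_AbsRing :=
  NormedModule.Pack R_AbsRing M
    (NormedModule.Class R_AbsRing M (NormedModuleAux.class _ real_Aux)
       (NormedModule.Mixin R_AbsRing real_Aux (@norm _ M) (@norm_factor _ M)
          (@norm_triangle _ M) real_norm_scal (@norm_compat1 _ M)
          (@norm_compat2 _ M) (@norm_eq_zero _ M))) M.
End Realify.

Section L2.
Variable V : countType.
Implicit Types (f g : V -> C) (A : {fset V}).

Definition sumsq f A : R := \big[Rplus/0]_(x <- A) (Cmod (f x)) ^ 2.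

Record l2 := MkL2 {
  l2_fun :> V -> C;
  l2_summable : exists M, forall A, sumsq l2_fun A <= M }.

Definition l2_norm (f : l2) : R :=
  sqrt (real (Lub_Rbar (fun r => exists A, r = sumsq f A))).

Lemma l2_eq (f g : l2) : (forall x, f x = g x) -> f = g.
Proof.
case: f g => [f hf] [g hg] /= /functional_extensionality h; subst g.
by rewrite (proof_irrelevance _ hf hg).
Qed.

Lemma sumsq_ge0 f A : 0 <= sumsq f A.
Proof.
rewrite /sumsq; apply: (big_ind (fun r => 0 <= r)); [lra| |].
  by move=> x y hx hy; lra.
by move=> i _; exact: pow2_ge_0.
Qed.

Lemma l2_norm_ge0 (f : l2) : 0 <= l2_norm f.
Proof. exact: sqrt_pos. Qed.

Lemma sumsq_le_norm (f : l2) A : sumsq f A <= (l2_norm f) ^ 2.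
Proof.
rewrite /l2_norm; set E := fun r => _.
have [hub hlub] := Lub_Rbar_correct E.
have [M hM] := l2_summable f.
have hE B : Rbar_le (sumsq f B) (Lub_Rbar E) by apply: hub; exists B.
have hfin : Rbar_le (Lub_Rbar E) M by apply: hlub => _ [B ->] /=; exact: hM.
move: (hE A) hfin; case: (Lub_Rbar E) => [r| |] // hr _.
have hr' : sumsq f A <= r by [].
rewrite pow2_sqrt //; exact: Rle_trans (sumsq_ge0 f A) hr'.
Qed.

Lemma l2_norm_le (f : l2) N :
  0 <= N -> (forall A, sumsq f A <= N ^ 2) -> l2_norm f <= N.
Proof.
move=> hN h; rewrite /l2_norm; set E := fun r => _.
have [hub hlub] := Lub_Rbar_correct E.
have hfin : Rbar_le (Lub_Rbar E) (N ^ 2) by apply: hlub => _ [B ->] /=; exact: h.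
have h0 : Rbar_le (sumsq f fset0) (Lub_Rbar E) by apply: hub; exists fset0.
rewrite -(sqrt_pow2 N) //; apply: sqrt_le_1_alt.
by move: hfin h0; case: (Lub_Rbar E) => [r| |].
Qed.

Lemma sumsq_minkowski f g (h : V -> C) (s : seq V) :
  (forall x, Cmod (h x) <= Cmod (f x) + Cmod (g x)) ->
  sqrt (\big[Rplus/0]_(x <- s) (Cmod (h x)) ^ 2) <=
  sqrt (\big[Rplus/0]_(x <- s) (Cmod (f x)) ^ 2) +
  sqrt (\big[Rplus/0]_(x <- s) (Cmod (g x)) ^ 2).
Proof.
move=> hfg.
have ge0 (k : V -> C) (t : seq V) : 0 <= \big[Rplus/0]_(x <- t) (Cmod (k x)) ^ 2.
  apply: (big_ind (fun r => 0 <= r)); [lra| |].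
    by move=> x y hx hy; lra.
  by move=> i _; exact: pow2_ge_0.
elim: s => [|a s IH]; first by rewrite !big_nil sqrt_0; lra.
rewrite !big_cons.
set W := \big[_/_]_(x <- s) _ in IH *.
set P := \big[_/_]_(x <- s) _ in IH *.
set Q := \big[_/_]_(x <- s) _ in IH *.
have hW : 0 <= W by exact: ge0.
have hP : 0 <= P by exact: ge0.
have hQ : 0 <= Q by exact: ge0.
have CmodE (u v : R) : Cmod (u, v) = sqrt (v ^ 2 + u ^ 2).
  by rewrite /Cmod /=; congr sqrt; ring.
have hC := Cmod_triangle (sqrt P, Cmod (f a)) (sqrt Q, Cmod (g a)).
have hs : Cplus (sqrt P, Cmod (f a)) (sqrt Q, Cmod (g a)) =
  (sqrt P + sqrt Q, Cmod (f a) + Cmod (g a)) by [].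
move: hC; rewrite hs !CmodE (pow2_sqrt P hP) (pow2_sqrt Q hQ) => hC.
apply: Rle_trans hC; apply: sqrt_le_1_alt.
have hWs : W <= (sqrt P + sqrt Q) ^ 2.
  rewrite -(pow2_sqrt W hW); apply: pow_incr; split=> //; exact: sqrt_pos.
apply: Rplus_le_compat hWs; apply: pow_incr.
by split; [exact: Cmod_ge_0 | exact: hfg].
Qed.

Lemma sumsq_triangle f g (h : V -> C) N1 N2 A :
  (forall x, Cmod (h x) <= Cmod (f x) + Cmod (g x)) ->
  0 <= N1 -> 0 <= N2 -> sumsq f A <= N1 ^ 2 -> sumsq g A <= N2 ^ 2 ->
  sumsq h A <= (N1 + N2) ^ 2.
Proof.
move=> hfg p1 p2 h1 h2.
have := @sumsq_minkowski f g h A hfg; rewrite -/(sumsq f A) -/(sumsq g A) -/(sumsq h A).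
have : sqrt (sumsq f A) <= N1.
  by rewrite -(sqrt_pow2 N1) //; apply: sqrt_le_1_alt.
have : sqrt (sumsq g A) <= N2.
  by rewrite -(sqrt_pow2 N2) //; apply: sqrt_le_1_alt.
have := sqrt_pos (sumsq h A); have := sqrt_sqrt _ (sumsq_ge0 h A); nra.
Qed.

Lemma sumsq_scal (c : C) f A :
  sumsq (fun x => c * f x)%C A = (Cmod c) ^ 2 * sumsq f A.
Proof.
rewrite /sumsq; elim/big_ind2: _ => [|x1 x2 y1 y2 -> ->|i _]; try ring.
rewrite Cmod_mult; ring.
Qed.

Lemma l2_plus_summable (f g : l2) :
  exists M, forall A, sumsq (fun x => f x + g x)%C A <= M.
Proof.
exists ((l2_norm f + l2_norm g) ^ 2) => A.
apply: (@sumsq_triangle f g) (l2_norm_ge0 f) (l2_norm_ge0 g)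
  (sumsq_le_norm f A) (sumsq_le_norm g A).
by move=> x; exact: Cmod_triangle.
Qed.

Lemma l2_scal_summable (c : C) (f : l2) :
  exists M, forall A, sumsq (fun x => c * f x)%C A <= M.
Proof.
exists ((Cmod c) ^ 2 * (l2_norm f) ^ 2) => A; rewrite sumsq_scal.
apply: Rmult_le_compat_l (sumsq_le_norm f A); exact: pow2_ge_0.
Qed.

Lemma l2_zero_summable : exists M, forall A, sumsq (fun=> RtoC 0) A <= M.
Proof.
exists 0 => A; rewrite /sumsq big1; first lra.
by move=> i _; rewrite Cmod_0; ring.
Qed.

Definition l2_plus (f g : l2) : l2 := MkL2 (l2_plus_summable f g).
Definition l2_scal (c : C) (f : l2) : l2 := MkL2 (l2_scal_summable c f).
Definition l2_zero : l2 := MkL2 l2_zero_summable.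
Definition l2_opp (f : l2) : l2 := l2_scal (RtoC (-1)) f.

Lemma l2_plusC (f g : l2) : l2_plus f g = l2_plus g f.
Proof. by apply: l2_eq => x; exact: Cplus_comm. Qed.
Lemma l2_plusA (f g h : l2) : l2_plus f (l2_plus g h) = l2_plus (l2_plus f g) h.
Proof. by apply: l2_eq => x; exact: Cplus_assoc. Qed.
Lemma l2_plus0 (f : l2) : l2_plus f l2_zero = f.
Proof. by apply: l2_eq => x; exact: Cplus_0_r. Qed.
Lemma l2_plusN (f : l2) : l2_plus f (l2_opp f) = l2_zero.
Proof. by apply: l2_eq => x /=; ring. Qed.

Definition l2_AbelianMonoid_mixin :=
  AbelianMonoid.Mixin l2 l2_plus l2_zero l2_plusC l2_plusA l2_plus0.
Canonical l2_AbelianMonoid := AbelianMonoid.Pack l2 l2_AbelianMonoid_mixin l2.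
Definition l2_AbelianGroup_mixin :=
  AbelianGroup.Mixin l2_AbelianMonoid l2_opp l2_plusN.
Canonical l2_AbelianGroup :=
  AbelianGroup.Pack l2 (AbelianGroup.Class l2 _ l2_AbelianGroup_mixin) l2.

Lemma l2_scalA (a b : C) (f : l2) : l2_scal a (l2_scal b f) = l2_scal (mult a b) f.
Proof. by apply: l2_eq => x; exact: Cmult_assoc. Qed.
Lemma l2_scal1 (f : l2) : l2_scal one f = f.
Proof. by apply: l2_eq => x; exact: Cmult_1_l. Qed.
Lemma l2_scalDr (a : C) (f g : l2) :
  l2_scal a (plus f g) = plus (l2_scal a f) (l2_scal a g).
Proof. by apply: l2_eq => x; exact: Cmult_plus_distr_l. Qed.
Lemma l2_scalDl (a b : C) (f : l2) :
  l2_scal (plus a b) f = plus (l2_scal a f) (l2_scal b f).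
Proof. by apply: l2_eq => x; exact: Cmult_plus_distr_r. Qed.

Definition l2_ModuleSpace_mixin :=
  ModuleSpace.Mixin C_Ring l2_AbelianGroup l2_scal l2_scalA l2_scal1 l2_scalDr l2_scalDl.
Canonical l2_ModuleSpace :=
  ModuleSpace.Pack C_Ring l2
    (ModuleSpace.Class C_Ring l2 (AbelianGroup.class l2_AbelianGroup)
       l2_ModuleSpace_mixin) l2.

Lemma l2_norm_triangle (f g : l2) : l2_norm (plus f g) <= l2_norm f + l2_norm g.
Proof.
apply: l2_norm_le => [|A].
  by have := l2_norm_ge0 f; have := l2_norm_ge0 g; lra.
apply: (@sumsq_triangle f g) (l2_norm_ge0 f) (l2_norm_ge0 g)
  (sumsq_le_norm f A) (sumsq_le_norm g A).
by move=> x; exact: Cmod_triangle.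
Qed.

Lemma l2_norm_scal (c : C_Ring) (f : l2) : l2_norm (scal c f) <= Cmod c * l2_norm f.
Proof.
have hc := Cmod_ge_0 c.
apply: l2_norm_le => [|A]; first exact: Rmult_le_pos (l2_norm_ge0 f).
rewrite sumsq_scal Rpow_mult_distr.
apply: Rmult_le_compat_l (sumsq_le_norm f A); exact: pow2_ge_0.
Qed.

Lemma l2_norm_eq0 (f : l2) : l2_norm f = 0 -> f = zero.
Proof.
move=> h; apply: l2_eq => x /=; apply: Cmod_eq_0.
have := sumsq_le_norm f [fset x]; rewrite h /sumsq big_seq_fset1.
have := Cmod_ge_0 (f x); nra.
Qed.

Definition l2_NormedModule_class : NormedModule.class_of C_AbsRing l2 :=
  @normed_module_class C_AbsRing l2_ModuleSpace l2_norm
    l2_norm_triangle l2_norm_scal l2_norm_eq0.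
Canonical l2_UniformSpace :=
  UniformSpace.Pack l2 (NormedModuleAux.mixin _ _ (NormedModule.base _ _ l2_NormedModule_class)) l2.
Canonical l2_NormedModuleAux :=
  NormedModuleAux.Pack C_AbsRing l2 (NormedModule.base _ _ l2_NormedModule_class) l2.
Canonical l2_NormedModule :=
  NormedModule.Pack C_AbsRing l2 l2_NormedModule_class l2.

End L2.

Section BoundedOperators.
Variable U : NormedModule C_AbsRing.

Record bounded_op := MkBop { bop_fun :> U -> U; bop_linear : is_linear bop_fun }.

Lemma bop_eq (S T : bounded_op) : (forall x, S x = T x) -> S = T.
Proof.
case: S T => [S hS] [T hT] /= /functional_extensionality h; subst T.
by rewrite (proof_irrelevance _ hS hT).
Qed.

Definition op_norm (T : bounded_op) : R :=
  real (Glb_Rbar (fun M => 0 <= M /\ forall x : U, norm (T x) <= M * norm x)).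

Lemma op_norm_le (T : bounded_op) M :
  0 <= M -> (forall x : U, norm (T x) <= M * norm x) -> op_norm T <= M.
Proof.
move=> hM h; rewrite /op_norm; set E := fun M => _.
have [hlb hglb] := Glb_Rbar_correct E.
have h1 : Rbar_le (Glb_Rbar E) M by apply: hlb.
have h2 : Rbar_le 0 (Glb_Rbar E) by apply: hglb => r [].
by move: h1 h2; case: (Glb_Rbar E).
Qed.

Lemma op_norm_finite (T : bounded_op) : exists r : R, 0 <= r /\
  Glb_Rbar (fun M => 0 <= M /\ forall x : U, norm (T x) <= M * norm x) = Finite r.
Proof.
have [hlb hglb] := Glb_Rbar_correct
  (fun M => 0 <= M /\ forall x : U, norm (T x) <= M * norm x).
have [M [hM h]] := linear_norm _ (bop_linear T).
have h1 := hlb M (conj (Rlt_le _ _ hM) h).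
have h2 := hglb (Finite 0) (fun r hr => proj1 hr).
by move: h1 h2; case: (Glb_Rbar _) => [r| |] // _ h2; exists r.
Qed.

Lemma op_norm_ge0 (T : bounded_op) : 0 <= op_norm T.
Proof. by have [r [hr e]] := op_norm_finite T; rewrite /op_norm e. Qed.

Lemma norm_bop_le (T : bounded_op) (x : U) : norm (T x) <= op_norm T * norm x.
Proof.
case: (Req_dec (norm x) 0) => [h0|hn].
  have [M [hM h]] := linear_norm _ (bop_linear T).
  by have := h x; rewrite h0 !Rmult_0_r.
have hp : 0 < norm x by have := norm_ge_0 x; case=> // e; case: hn.
have [r [hr e]] := op_norm_finite T; rewrite /op_norm e /=.
apply/(Rmult_le_reg_r (/ norm x)); first exact: Rinv_0_lt_compat.
rewrite Rmult_assoc Rinv_r // Rmult_1_r.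
have [_ hglb] := Glb_Rbar_correct
  (fun M => 0 <= M /\ forall x : U, norm (T x) <= M * norm x).
rewrite e in hglb.
apply: (hglb (Finite (norm (T x) * / norm x))) => M [hM h] /=.
apply/(Rmult_le_reg_r (norm x)) => //.
by rewrite Rmult_assoc Rinv_l // Rmult_1_r.
Qed.

Lemma op_plus_linear (S T : bounded_op) : is_linear (fun x => plus (S x) (T x)).
Proof.
split=> [x y|k x|].
- rewrite (linear_plus _ (bop_linear S)) (linear_plus _ (bop_linear T)).
  by rewrite -!plus_assoc; congr plus; rewrite !plus_assoc; congr plus; exact: plus_comm.
- by rewrite (linear_scal _ (bop_linear S)) (linear_scal _ (bop_linear T)) scal_distr_l.
- exists (op_norm S + op_norm T + 1); split.
    by have := op_norm_ge0 S; have := op_norm_ge0 T; lra.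
  move=> x; apply: Rle_trans (norm_triangle _ _) _.
  by have := norm_bop_le S x; have := norm_bop_le T x; have := norm_ge_0 x; nra.
Qed.

Lemma op_scal_linear (c : C) (T : bounded_op) : is_linear (fun x => scal (c : C_Ring) (T x)).
Proof.
split=> [x y|k x|].
- by rewrite (linear_plus _ (bop_linear T)) scal_distr_l.
- rewrite (linear_scal _ (bop_linear T)) !scal_assoc; congr scal; exact: Cmult_comm.
- exists (Cmod c * op_norm T + 1); split.
    by have := Rmult_le_pos _ _ (Cmod_ge_0 c) (op_norm_ge0 T); lra.
  move=> x; apply: Rle_trans (norm_scal (c : C_AbsRing) (T x)) _.
  have := Rmult_le_compat_l _ _ _ (Cmod_ge_0 c) (norm_bop_le T x).
  rewrite -/(Cmod c); have := norm_ge_0 x.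
  by rewrite /abs /=; lra.
Qed.

Lemma op_zero_linear : is_linear (fun _ : U => zero : U).
Proof. exact: is_linear_zero. Qed.

Lemma op_id_linear : is_linear (fun x : U => x).
Proof. exact: is_linear_id. Qed.

Lemma op_comp_linear (S T : bounded_op) : is_linear (fun x => S (T x)).
Proof. exact: is_linear_comp (bop_linear T) (bop_linear S). Qed.

Definition op_plus (S T : bounded_op) : bounded_op := MkBop (op_plus_linear S T).
Definition op_scal (c : C) (T : bounded_op) : bounded_op := MkBop (op_scal_linear c T).
Definition op_zero : bounded_op := MkBop op_zero_linear.
Definition op_opp (T : bounded_op) : bounded_op := op_scal (RtoC (-1)) T.
Definition op_id : bounded_op := MkBop op_id_linear.
Definition op_comp (S T : bounded_op) : bounded_op := MkBop (op_comp_linear S T).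

Lemma op_plusC (S T : bounded_op) : op_plus S T = op_plus T S.
Proof. by apply: bop_eq => x; exact: plus_comm. Qed.
Lemma op_plusA (S T W : bounded_op) : op_plus S (op_plus T W) = op_plus (op_plus S T) W.
Proof. by apply: bop_eq => x; exact: plus_assoc. Qed.
Lemma op_plus0 (T : bounded_op) : op_plus T op_zero = T.
Proof. by apply: bop_eq => x; exact: plus_zero_r. Qed.
Lemma op_plusN (T : bounded_op) : op_plus T (op_opp T) = op_zero.
Proof.
apply: bop_eq => x /=.
have -> : RtoC (-1) = opp (one : C_Ring) by rewrite RtoC_opp.
by rewrite scal_opp_one plus_opp_r.
Qed.

Definition bop_AbelianMonoid_mixin :=
  AbelianMonoid.Mixin bounded_op op_plus op_zero op_plusC op_plusA op_plus0.
Canonical bop_AbelianMonoid := AbelianMonoid.Pack bounded_op bop_AbelianMonoid_mixin bounded_op.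
Definition bop_AbelianGroup_mixin :=
  AbelianGroup.Mixin bop_AbelianMonoid op_opp op_plusN.
Canonical bop_AbelianGroup :=
  AbelianGroup.Pack bounded_op (AbelianGroup.Class bounded_op _ bop_AbelianGroup_mixin) bounded_op.

Lemma op_scalA (a b : C) (T : bounded_op) : op_scal a (op_scal b T) = op_scal (mult a b) T.
Proof. by apply: bop_eq => x; exact: (@scal_assoc C_Ring). Qed.
Lemma op_scal1 (T : bounded_op) : op_scal one T = T.
Proof. by apply: bop_eq => x; exact: (@scal_one C_Ring). Qed.
Lemma op_scalDr (a : C) (S T : bounded_op) :
  op_scal a (plus S T) = plus (op_scal a S) (op_scal a T).
Proof. by apply: bop_eq => x; exact: (@scal_distr_l C_Ring). Qed.
Lemma op_scalDl (a b : C) (T : bounded_op) :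
  op_scal (plus a b) T = plus (op_scal a T) (op_scal b T).
Proof. by apply: bop_eq => x; exact: (@scal_distr_r C_Ring). Qed.

Definition bop_ModuleSpace_mixin :=
  ModuleSpace.Mixin C_Ring bop_AbelianGroup op_scal op_scalA op_scal1 op_scalDr op_scalDl.
Canonical bop_ModuleSpace :=
  ModuleSpace.Pack C_Ring bounded_op
    (ModuleSpace.Class C_Ring bounded_op (AbelianGroup.class bop_AbelianGroup)
       bop_ModuleSpace_mixin) bounded_op.

Lemma op_norm_triangle (S T : bounded_op) : op_norm (plus S T) <= op_norm S + op_norm T.
Proof.
apply: op_norm_le => [|x].
  by have := op_norm_ge0 S; have := op_norm_ge0 T; lra.
apply: Rle_trans (norm_triangle _ _) _; rewrite Rmult_plus_distr_r.
by apply: Rplus_le_compat; exact: norm_bop_le.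
Qed.

Lemma op_norm_scal (c : C_Ring) (T : bounded_op) : op_norm (scal c T) <= Cmod c * op_norm T.
Proof.
apply: op_norm_le => [|x].
  exact: Rmult_le_pos (Cmod_ge_0 _) (op_norm_ge0 T).
apply: Rle_trans (norm_scal (c : C_AbsRing) (T x)) _; rewrite Rmult_assoc.
exact: Rmult_le_compat_l (Cmod_ge_0 _) (norm_bop_le T x).
Qed.

Lemma op_norm_eq0 (T : bounded_op) : op_norm T = 0 -> T = zero.
Proof.
move=> h; apply: bop_eq => x; apply: norm_eq_zero.
have := norm_bop_le T x; rewrite h Rmult_0_l.
by have := norm_ge_0 (T x); lra.
Qed.

Definition bop_NormedModule_class : NormedModule.class_of C_AbsRing bounded_op :=
  @normed_module_class C_AbsRing bop_ModuleSpace op_norm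
    op_norm_triangle op_norm_scal op_norm_eq0.
Canonical bop_UniformSpace :=
  UniformSpace.Pack bounded_op (NormedModuleAux.mixin _ _ (NormedModule.base _ _ bop_NormedModule_class)) bounded_op.
Canonical bop_NormedModuleAux :=
  NormedModuleAux.Pack C_AbsRing bounded_op (NormedModule.base _ _ bop_NormedModule_class) bounded_op.
Canonical bop_NormedModule :=
  NormedModule.Pack C_AbsRing bounded_op bop_NormedModule_class bounded_op.

Definition is_inverse (T S : bounded_op) := op_comp S T = op_id /\ op_comp T S = op_id.

(** Unspecified when [T] is not invertible. *)
Definition op_inv (T : bounded_op) : bounded_op := epsilon (inhabits op_zero) (is_inverse T).

Definition spectrum (T : bounded_op) (lam : C) : Prop :=
  ~ exists S, is_inverse (minus (op_scal lam op_id) T) S.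

End BoundedOperators.

(** A simple, countable, connected graph of bounded degree, given by the lists
    of neighbours of its vertices. *)
Record graph := MkGraph {
  VX : countType;
  nbr : VX -> seq VX;
  nbr_uniq : forall v, uniq (nbr v);
  nbr_sym : forall v w, (w \in nbr v) = (v \in nbr w);
  nbr_irrefl : forall v, v \notin nbr v;
  nbr_bounded : exists D : nat, forall v, (size (nbr v) <= D)%N;
  nbr_connected : forall v w, exists2 p, path (fun x y => y \in nbr x) v p & w = last v p }.

Definition adj (X : graph) (v w : VX X) : bool := w \in nbr v.
Definition deg (X : graph) (v : VX X) : nat := size (nbr v).

Definition infinite_graph (X : graph) : Prop :=
  forall F : {fset VX X}, exists v, v \notin F.

Definition essentially_regular (X : graph) (d : nat) : Prop :=
  (exists F : {fset VX X}, forall v, v \notin F -> deg v = d) /\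
  ((forall v : VX X, (deg v <= d)%N) /\
   forall b : nat, (forall v : VX X, (deg v <= b)%N) -> (d <= b)%N).

Section Adjacency.
Variable X : graph.

Definition adj_fun (f : VX X -> C) (v : VX X) : C :=
  \big[Cplus/RtoC 0]_(w <- nbr v) f w.

Lemma Cmod_sum_sqr (s : seq (VX X)) (f : VX X -> C) :
  Cmod (\big[Cplus/RtoC 0]_(w <- s) f w) ^ 2 <=
  INR (size s) * \big[Rplus/0]_(w <- s) (Cmod (f w)) ^ 2.
Proof.
elim: s => [|a s IH]; first by rewrite !big_nil Cmod_0 /=; lra.
rewrite !big_cons [size _]/= S_INR.
move: IH; set S := \big[Cplus/_]_(w <- s) _; set Q := \big[Rplus/_]_(w <- s) _ => IH.
have hQ : 0 <= Q.
  rewrite /Q; apply: (big_ind (fun r => 0 <= r)); [lra| |].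
    by move=> x y hx hy; lra.
  by move=> i _; exact: pow2_ge_0.
have hn := pos_INR (size s).
have h1 : Cmod (f a + S)%C ^ 2 <= (Cmod (f a) + Cmod S) ^ 2.
  by apply: pow_incr; split; [exact: Cmod_ge_0 | exact: Cmod_triangle].
apply: Rle_trans h1 _.
have hS := Cmod_ge_0 S; have ha := Cmod_ge_0 (f a).
move: (Cmod S) (Cmod (f a)) (INR (size s)) IH hS ha hn => {}S x n IH hS ha hn.
have h2 : 2 * x * S <= Q + n * x ^ 2.
  have h3 : (2 * x * S) ^ 2 <= (Q + n * x ^ 2) ^ 2.
    have := pow2_ge_0 (Q - n * x ^ 2); have := pow2_ge_0 x; nra.
  have hx2 := Rmult_le_pos _ _ hn (pow2_ge_0 x).
  by apply: Rsqr_incr_0; [rewrite /Rsqr; nra | nra | nra].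
nra.
Qed.

Lemma sumsq_adj (D : nat) (f : l2 (VX X)) (A : {fset VX X}) :
  (forall v : VX X, (size (nbr v) <= D)%N) ->
  sumsq (adj_fun f) A <= (INR D * l2_norm f) ^ 2.
Proof.
move=> hD.
pose F w := (Cmod (f w)) ^ 2.
have F0 w : 0 <= F w by exact: pow2_ge_0.
have sum_le (I : eqType) (s : seq I) (a b : I -> R) : (forall i, i \in s -> a i <= b i) ->
    \big[Rplus/0]_(i <- s) a i <= \big[Rplus/0]_(i <- s) b i.
  move=> h; rewrite big_seq [X in _ <= X]big_seq.
  apply: (big_ind2 (fun x y => x <= y)); [lra| |exact: h].
  by move=> *; lra.
pose t := [fset w | w in flatten [seq nbr v | v <- (A : seq _)]]%fset.
have step1 v : v \in A -> (Cmod (adj_fun f v)) ^ 2 <=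
    INR D * \big[Rplus/0]_(w <- t | w \in nbr v) F w.
  move=> hv; apply: Rle_trans (Cmod_sum_sqr _ _) _.
  have -> : \big[Rplus/0]_(w <- t | w \in nbr v) F w = \big[Rplus/0]_(w <- nbr v) F w.
    rewrite -big_filter; apply: perm_big; apply: uniq_perm.
    - by rewrite filter_uniq.
    - exact: nbr_uniq.
    - move=> w; rewrite mem_filter; case hw: (w \in nbr v) => //=.
      rewrite !inE /=; apply/flattenP; exists (nbr v) => //.
      by apply: map_f.
  apply: Rmult_le_compat_r.
    apply: (big_ind (fun r => 0 <= r)) => [|x y hx hy|i _]; [lra|lra|exact: F0].
  by apply/le_INR/leP/hD.
have h1 : sumsq (adj_fun f) A <=
    \big[Rplus/0]_(v <- A) (INR D * \big[Rplus/0]_(w <- t | w \in nbr v) F w).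
  exact: sum_le.
apply: Rle_trans h1 _.
have distr (I : Type) (s : seq I) c (a : I -> R) :
    \big[Rplus/0]_(i <- s) (c * a i) = c * \big[Rplus/0]_(i <- s) a i.
  by elim: s => [|i s IH]; rewrite ?big_nil ?big_cons ?IH; ring.
rewrite distr.
rewrite (exchange_big_dep xpredT) //.
have cnt w : \big[Rplus/0]_(v <- A | w \in nbr v) F w <= INR D * F w.
  have -> : \big[Rplus/0]_(v <- A | w \in nbr v) F w =
      INR (count (fun v => w \in nbr v) A) * F w.
    elim: (A : seq _) => [|v s IH]; first by rewrite big_nil /=; ring.
    rewrite big_cons /=; case: (w \in nbr v); rewrite IH ?add0n //.
    by rewrite add1n S_INR Rmult_plus_distr_r Rmult_1_l; exact: Rplus_comm.
  apply: Rmult_le_compat_r; first exact: F0.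
  apply/le_INR/leP; apply: leq_trans (hD w).
  rewrite -size_filter; apply: uniq_leq_size.
    by apply: filter_uniq; exact: fset_uniq.
  by move=> v; rewrite mem_filter => /andP [h _]; rewrite nbr_sym.
have h2 : \big[Rplus/0]_(w <- t) \big[Rplus/0]_(v <- A | w \in nbr v) F w <=
    INR D * sumsq f t.
  by rewrite /sumsq -distr; apply: sum_le => w _; exact: cnt.
have h3 := sumsq_le_norm f t; have hd := pos_INR D.
apply: Rle_trans (Rmult_le_compat_l _ _ _ hd h2) _.
have -> : (INR D * l2_norm f) ^ 2 = INR D * (INR D * (l2_norm f) ^ 2) by ring.
by do 2!apply: Rmult_le_compat_l => //.
Qed.

Lemma adj_summable (f : l2 (VX X)) : exists M, forall A, sumsq (adj_fun f) A <= M.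
Proof.
have [D hD] := nbr_bounded X.
by exists ((INR D * l2_norm f) ^ 2) => A; exact: sumsq_adj.
Qed.

Definition adj_l2 (f : l2 (VX X)) : l2 (VX X) := MkL2 (adj_summable f).

Lemma adj_linear : is_linear adj_l2.
Proof.
split=> [f g|k f|].
- by apply: l2_eq => v /=; rewrite /adj_fun -big_split.
- apply: l2_eq => v; rewrite /= /adj_fun.
  elim: (nbr v) => [|w s IH]; first by rewrite !big_nil Cmult_0_r.
  by rewrite !big_cons IH Cmult_plus_distr_l.
- have [D hD] := nbr_bounded X.
  exists (INR D + 1); have hd := pos_INR D; split; first lra.
  move=> f; apply: (@Rle_trans _ (INR D * l2_norm f)).
    apply: l2_norm_le => [|A]; last exact: sumsq_adj.
    exact: Rmult_le_pos (l2_norm_ge0 f).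
  apply: Rmult_le_compat_r; [exact: l2_norm_ge0 | lra].
Qed.

Definition adjacency : bounded_op (l2_NormedModule (VX X)) := MkBop adj_linear.

End Adjacency.

Section MatrixEntries.
Variable V : countType.

Lemma delta_summable (y : V) :
  exists M, forall A, sumsq (fun x => RtoC (if x == y then 1 else 0)) A <= M.
Proof.
exists 1 => A; rewrite /sumsq.
have z (s : seq V) : y \notin s ->
    \big[Rplus/0]_(x <- s) Cmod (RtoC (if x == y then 1 else 0)) ^ 2 = 0.
  move=> ys; rewrite big_seq big1 // => x xs.
  case: eqP => [e|_]; first by rewrite -e xs in ys.
  by rewrite Cmod_0; ring.
case: (boolP (y \in A)) => hy; last by rewrite z //; lra.
rewrite (big_rem y) //= z ?eqxx; last by rewrite mem_rem_uniqF // fset_uniq.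
by rewrite Cmod_1; lra.
Qed.

Definition delta (y : V) : l2 V := MkL2 (delta_summable y).

Definition entry (T : bounded_op (l2_NormedModule V)) (x y : V) : C := T (delta y) x.

(** [S] is the adjoint of [T], read off the matrices of the two bounded operators. *)
Definition is_adjoint (T S : bounded_op (l2_NormedModule V)) : Prop :=
  forall x y, entry S x y = Cconj (entry T y x).

(** Norm-closed *-subalgebras. *)
Record cstar_subalgebra (P : bounded_op (l2_NormedModule V) -> Prop) : Prop := {
  cstar_plus : forall S T, P S -> P T -> P (op_plus S T);
  cstar_scal : forall c T, P T -> P (op_scal c T);
  cstar_comp : forall S T, P S -> P T -> P (op_comp S T);
  cstar_adjoint : forall T S, P T -> is_adjoint T S -> P S;
  cstar_closed : forall T,
    (forall eps : posreal, exists2 S, P S & op_norm (minus T S) < eps) -> P T }.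

End MatrixEntries.

Lemma entry_adjacency (X : graph) (v w : VX X) :
  entry (adjacency X) v w = RtoC (if adj v w then 1 else 0).
Proof.
rewrite /entry /= /adj_fun /adj /=.
elim: (nbr v) (nbr_uniq v) => [|a s IH]; first by rewrite big_nil.
rewrite /= => /andP[has us]; rewrite big_cons IH // in_cons (eq_sym w a).
case: eqP => [<-|_] /=; last exact: Cplus_0_l.
by rewrite (negbTE has) Cplus_0_r.
Qed.

(** Membership in the C*-algebra generated by the identity and the adjacency
    operator. *)
Definition in_cstar (X : graph) (T : bounded_op (l2_NormedModule (VX X))) : Prop :=
  forall P : bounded_op (l2_NormedModule (VX X)) -> Prop, cstar_subalgebra P ->
    P (op_id _) -> P (adjacency X) -> P T.

Section Periodic.
Variable X : graph.

Definition automorphism (g : VX X -> VX X) : Prop :=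
  bijective g /\ forall x y, adj (g x) (g y) = adj x y.

(** The countability of [Gam] is implied: it acts freely on a countable set.
    [Gam] is a group of automorphisms acting freely on the vertices, and [F0] is
    a finite set of representatives of its orbits. *)
Record periodic (Gam : (VX X -> VX X) -> Prop) (F0 : {fset VX X}) : Prop := {
  periodic_aut : forall g, Gam g -> automorphism g;
  periodic_id : Gam (fun x => x);
  periodic_comp : forall g h, Gam g -> Gam h -> Gam (g \o h);
  periodic_inv : forall g, Gam g -> exists2 h, Gam h & cancel g h /\ cancel h g;
  periodic_free : forall g x, Gam g -> g x = x -> forall y, g y = y;
  periodic_repr : forall x, exists2 y, y \in F0 & exists2 g, Gam g & g y = x;
  periodic_repr_uniq : forall x y g, x \in F0 -> y \in F0 -> Gam g -> g x = y -> x = y }.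

End Periodic.

(** Subgraphs are full: a finite set of vertices stands for the subgraph that it
    spans. *)

Section SelfSimilar.
Variable X : graph.
Implicit Types (S : {fset VX X}) (g : VX X -> VX X).

Definition frontier S : {fset VX X} := [fset x in S | has (fun y => y \notin S) (nbr x)].

(** The isomorphism [g : S -> g(S)] is represented by a total map whose values
    outside [S] are irrelevant. *)
Definition local_iso S g : Prop :=
  {in S &, injective g} /\ {in S &, forall x y, adj (g x) (g y) = adj x y}.

Variables (K : nat -> {fset VX X}) (G : nat -> seq (VX X -> VX X)).

(** [gprod n m g] : [g] is an admissible product in [G(n,m)]. *)
Inductive gprod (n : nat) : nat -> (VX X -> VX X) -> Prop :=
| gprod_id : gprod n n (fun x => x)
| gprod_step m g h : gprod n m g -> List.In h (G m) -> (g @` K n `<=` K m) ->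
    gprod n m.+1 (h \o g).

Definition frontierG (n : nat) : {fset VX X} :=
  [fset x in K n | excluded_middle_informative
     (exists m g, gprod n m g /\ g x \in frontier (g @` K n))].

Record self_similar : Prop := {
  exhaustion_incr : forall n, K n `<=` K n.+1;
  exhaustion_union : forall x, exists n, x \in K n;
  exhaustion_amenable : is_lim_seq (fun n => INR #|` frontier (K n)| / INR #|` K n|) 0;
  similar_iso : forall n g, List.In g (G n) -> local_iso (K n) g;
  similar_vertices : forall n y,
    y \in K n.+1 <-> exists2 g, List.In g (G n) & y \in g @` K n;
  similar_edges : forall n x y, x \in K n.+1 -> y \in K n.+1 -> adj x y ->
    exists2 g, List.In g (G n) & (x \in g @` K n) && (y \in g @` K n);
  similar_overlap : forall n g h, List.In g (G n) -> List.In h (G n) ->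
    ~ {in K n, g =1 h} ->
    (g @` K n) `&` (h @` K n) = frontier (g @` K n) `&` frontier (h @` K n);
  similar_amenable : is_lim_seq (fun n => INR #|` frontierG n| / INR #|` K n|) 0 }.

End SelfSimilar.

Section Trace.
Variable X : graph.
Notation B := (bounded_op (l2_NormedModule (VX X))).

Definition diag_sum (T : B) (S : {fset VX X}) : C :=
  \big[Cplus/RtoC 0]_(x <- S) entry T x x.

Definition periodic_trace (F0 : {fset VX X}) (T : B) (t : C) : Prop :=
  in_cstar T /\ t = diag_sum T F0.

Definition self_similar_trace (K : nat -> {fset VX X}) (T : B) (t : C) : Prop :=
  in_cstar T /\
  filterlim (fun n => RtoC (/ INR #|` K n|) * diag_sum T (K n))%C eventually (locally t).

(** [canonical_trace tau] : [X] is periodic or self-similar, and [tau T t] means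
    that the corresponding trace of [T] is defined and equal to [t]. *)
Inductive canonical_trace : (B -> C -> Prop) -> Prop :=
| trace_of_periodic Gam F0 :
    periodic Gam F0 -> canonical_trace (periodic_trace F0)
| trace_of_self_similar K G :
    self_similar K G -> canonical_trace (self_similar_trace K).

End Trace.

Definition connected (T : UniformSpace) (S : T -> Prop) : Prop :=
  forall A B : T -> Prop, open A -> open B -> (forall x, S x -> A x \/ B x) ->
    (exists x, S x /\ A x) -> (exists x, S x /\ B x) -> exists x, S x /\ A x /\ B x.

Definition unit_interval (t : R) : Prop := 0 <= t <= 1.

(** Every loop in [S] is freely null-homotopic in [S]. *)
Definition simply_connected (S : C -> Prop) : Prop :=
  forall c : R -> C, continuous_on unit_interval c -> c 0 = c 1 ->
  (forall t, unit_interval t -> S (c t)) ->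
  exists (H : R * R -> C) (p : C),
    let square st := unit_interval (fst st) /\ unit_interval (snd st) in
    [/\ continuous_on square H,
        (forall st, square st -> S (H st)),
        (forall t, unit_interval t -> H (t, 0) = c t),
        (forall t, unit_interval t -> H (t, 1) = p) &
        (forall s, unit_interval s -> H (0, s) = H (1, s))].

Definition boundary (S : C -> Prop) (p : C) : Prop :=
  forall eps : posreal, (exists x, ball p eps x /\ S x) /\ (exists y, ball p eps y /\ ~ S y).

Definition convex (S : C -> Prop) : Prop :=
  forall x y t, S x -> S y -> 0 <= t <= 1 -> S (RtoC (1 - t) * x + RtoC t * y)%C.

Definition conv (S : C -> Prop) (p : C) : Prop :=
  forall P : C -> Prop, convex P -> (forall x, S x -> P x) -> P p.

(** [gam] is a piecewise C1 path on [0,1], and [dgam] is its derivative outside a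
    finite set of points, where [dgam] is arbitrary. *)
Definition piecewise_C1 (gam dgam : R -> C) : Prop :=
  continuous_on unit_interval gam /\
  (exists s : seq R, forall t, 0 < t < 1 -> ~ List.In t s ->
     is_derive (V := C_R_NormedModule) gam t (dgam t) /\ continuous dgam t) /\
  (forall t, 0 <= t < 1 -> exists l : C, filterlim dgam (at_right t) (locally l)) /\
  (forall t, 0 < t <= 1 -> exists l : C, filterlim dgam (at_left t) (locally l)).

Definition two_pi_i : C := (RtoC (2 * PI) * Ci)%C.

(** The path [gam] runs once through the boundary of the open set [S], with [S]
    on its left. *)
Record boundary_path (S : C -> Prop) (gam dgam : R -> C) : Prop := {
  bpath_C1 : piecewise_C1 gam dgam;
  bpath_closed : gam 0 = gam 1;
  bpath_simple : forall s t, 0 <= s < 1 -> 0 <= t < 1 -> gam s = gam t -> s = t;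
  bpath_image : forall p, boundary S p <-> exists2 t, unit_interval t & gam t = p;
  bpath_winding : forall p, S p ->
    is_RInt (V := C_R_NormedModule) (fun t => dgam t / (gam t - p))%C 0 1 two_pi_i }.

Definition Cexp (z : C) : C := (RtoC (exp (fst z)) * (cos (snd z), sin (snd z)))%C.

Record log_branch (D : C -> Prop) (L : C -> C) : Prop := {
  log_open : open D;
  log_continuous : forall z, D z -> continuous L z;
  log_exp : forall z, D z -> Cexp (L z) = z }.

Section Determinant.
Variable X : graph.
Notation B := (bounded_op (l2_NormedModule (VX X))).
Variable tau : B -> C -> Prop.

(** [is_log T Q] : [Q] is the value of
    (2 pi i)^-1 \int_{\partial S} log lam (lam - T)^-1 dlam
    for some admissible region [S] and branch [L] of the logarithm. *)
Definition is_log (T Q : B) : Prop :=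
  exists (S D : C -> Prop) (L : C -> C) (gam dgam : R -> C) (J : B),
  [/\ [/\ open S, connected S, simply_connected S & forall p, conv (spectrum T) p -> S p],
      boundary_path S gam dgam,
      log_branch D L /\ (forall p, S p \/ boundary S p -> D p),
      is_RInt (V := realify (bop_NormedModule (l2_NormedModule (VX X))))
        (fun t => op_scal (L (gam t) * dgam t)%C
                    (op_inv (minus (op_scal (gam t) (op_id _)) T))) 0 1 J &
      Q = op_scal (/ two_pi_i)%C J].

(** [is_det T w] : the determinant of [T] is defined and [w] is a value of it. *)
Definition is_det (T : B) (w : C) : Prop :=
  [/\ in_cstar T, ~ conv (spectrum T) (RtoC 0) &
      exists Q t, [/\ is_log T Q, tau Q t & w = Cexp t]].

End Determinant.

(** Near [p], [F] is the sum of an absolutely convergent double power series,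
    summed here by total degree. *)
Definition analytic_at (F : C * C -> C) (p : C * C) : Prop :=
  exists (r : posreal) (a : nat -> nat -> C),
  forall h k : C, Cmod h < r -> Cmod k < r ->
    let term i j := (a i j * h ^ i * k ^ j)%C in
    ex_series (fun n => sum_n (fun i => Cmod (term i (n - i)%N)) n) /\
    is_series (K := C_AbsRing) (V := C_NormedModule)
      (fun n => sum_n (fun i => term i (n - i)%N) n)
      (F (fst p + h, snd p + k)%C).

Definition ihara_coef (q : nat) (p : C * C) : C :=
  let: (z, u) := p in (1 + (1 - u) * (RtoC (INR q) + u) * z ^ 2)%C.

Definition Omega (q : nat) (p : C * C) : Prop :=
  fst p <> RtoC 0 /\
  exists t : R, - INR q.+1 <= t <= INR q.+1 /\ (ihara_coef q p / fst p)%C = RtoC t.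

Definition ihara_op (X : graph) (q : nat) (p : C * C) : bounded_op (l2_NormedModule (VX X)) :=
  minus (op_scal (ihara_coef q p) (op_id _)) (op_scal (fst p) (adjacency X)).

(* Main.v *)
Require Import Defs.
From mathcomp Require Import all_boot finmap.
From Stdlib Require Import Reals Lra Lia ClassicalEpsilon FunctionalExtensionality PropExtensionality.
From Coquelicot Require Import Coquelicot.
From mathcomp Require Import ssrnat.

(** For [z <> 0] put [w = (1+(1-u)(q+u)z^2)/z]. Away from [z = 0] the complement of [Omega] is
    parametrized by [w] off a segment and a nonzero complex number, and the points with
    [z = 0] are limits of the others; hence it is connected.

    The logarithm [Q] of [T] is unique up to [delta I] with [exp delta = 1]: along
    [T_s = l0 + s (T - l0)], with [l0] in the hull of the spectrum, the contour integral has
    derivative [(T - l0) T_s^-1], whatever the region and the branch, and at [s = 0] it is a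
    value of [log l0] by Cauchy's formula. As the trace of [I] is an integer, the determinant
    [exp (tr Q)] does not depend on the choices.

    Outside [Omega] the segment from [c - d z] to [c + d z] avoids [0], where [d = q+1] and
    [c = 1+(1-u)(q+u)z^2]. Hence its end points lie in an open disc centred at some [m] that
    does not contain [0], [c I - z A] is at distance less than [|m|] from [m I], and its
    logarithm is [log m - sum_n Y^(n+1)/(n+1)] with [Y = I - (c I - z A)/m], locally uniformly in
    [(z,u)]. Each [tr Y^n] is a polynomial in [(z,u)], so the determinant is locally a uniform
    limit of polynomials, and Cauchy's estimates turn this into a convergent double series. *)

Set Implicit Arguments.
Unset Strict Implicit.
Unset Printing Implicit Defensive.

Local Open Scope R_scope.

(** * Connectedness of the complement of [Omega] *)

(** A [boundary_path] prescribes the winding number inside the region and says nothing about the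
    outside. In place of the Jordan curve theorem, the Cauchy formula for [L] comes from a jump
    argument at the point of the curve farthest from the origin: beyond it a ray leaves the curve
    for good, and the Cauchy integrals vanish there. Operator-valued integrals are never
    differentiated: identities are tested on bounded functionals, in the end on matrix entries, and
    scalar Cauchy integrals are the same statements for operators on a one-dimensional space. The
    spectral theorem is avoided as well: the norm of [a I + b A] is bounded directly by the larger
    of the moduli of [a + d b] and [a - d b]. The trace is handled on norm limits of polynomials in
    [A], a class that contains the logarithms in question and on which the limit defining the
    self-similar trace is shown to exist by comparing closed walks in copies of the exhausting
    sets. *)

Lemma unit_interval_connected (A B : R -> Prop) :
  (forall t, unit_interval t -> A t -> locally t A) ->
  (forall t, unit_interval t -> B t -> locally t B) ->
  (forall t, unit_interval t -> A t \/ B t) -> A 0 ->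
  (forall t, unit_interval t -> ~ (A t /\ B t)) -> A 1.
Proof.
move=> oA oB cov A0 dis.
(* The supremum of this set satisfies [A] and equals 1. Openness of [A] and [B] is available only at
   points of [[0,1]], where a path is known to be continuous. *)
pose E r := unit_interval r /\ forall s, 0 <= s <= r -> A s.
have E0 : E 0 by split=> [|s hs]; [rewrite /unit_interval; lra | have -> : s = 0 by lra].
have bE : bound E by exists 1 => r [] []; lra.
have [l [lub least]] := completeness E bE (ex_intro _ 0 E0).
have l0 : 0 <= l by exact: lub.
have l1 : l <= 1 by apply: least => r [] []; lra.
have ul : unit_interval l by [].
have below s : 0 <= s < l -> A s.
  move=> hs; have us : unit_interval s by rewrite /unit_interval; lra.
  have [//|nAs] := cov s us.
  exfalso; have : is_upper_bound E s.
    move=> r [ur hr]; case: (Rle_lt_dec r s) => // hsr; exfalso.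
    by apply: (dis s us); split=> //; apply: hr; lra.
  by move/least; lra.
have Al : A l.
  have [//|Bl] := cov l ul.
  have [e he] := oB l ul Bl.
  case: (Req_dec l 0) => [->//|ln0].
  pose s := Rmax 0 (l - e / 2).
  have hs : 0 <= s < l /\ l - e < s.
    have := cond_pos e; rewrite /s /Rmax; case: Rle_dec => ? ?; lra.
  exfalso; apply: (dis s); first by rewrite /unit_interval; lra.
  split; first by apply: below; lra.
  apply: he; rewrite /ball /= /AbsRing_ball /abs /minus /plus /opp /=.
  apply: Rabs_def1; lra.
have [e he] := oA l ul Al.
case: (Req_dec l 1) => [<-//|ln1].
pose s := Rmin 1 (l + e / 2).
have hs : l < s <= 1 /\ s < l + e.
  have := cond_pos e; rewrite /s /Rmin; case: Rle_dec => ? ?; lra.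
have : s <= l.
  apply: lub; split; first by rewrite /unit_interval; lra.
  move=> r hr; case: (Rlt_le_dec r l) => hrl; first by apply: below; lra.
  apply: he; rewrite /ball /= /AbsRing_ball /abs /minus /plus /opp /=.
  apply: Rabs_def1; lra.
lra.
Qed.

Definition joined (T : UniformSpace) (S : T -> Prop) (x y : T) : Prop :=
  exists c : R -> T, [/\ forall t, unit_interval t -> continuous c t,
    forall t, unit_interval t -> S (c t), c 0 = x & c 1 = y].

Lemma joined_open_cover (T : UniformSpace) (S A B : T -> Prop) (x y : T) :
  open A -> open B -> (forall z, S z -> A z \/ B z) ->
  (forall z, S z -> ~ (A z /\ B z)) -> joined S x y -> A x -> A y.
Proof.
move=> oA oB cov dis [c [cc cS <- <-]] A0.
apply: (@unit_interval_connected (fun t => A (c t)) (fun t => B (c t))) => //.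
- by move=> t ut At; apply: cc => //; exact: oA.
- by move=> t ut At; apply: cc => //; exact: oB.
- by move=> t ut; apply: cov; exact: cS.
- by move=> t ut; apply: dis; exact: cS.
Qed.

Lemma joined_connected (T : UniformSpace) (S : T -> Prop) :
  (forall x y, S x -> S y -> joined S x y) -> connected S.
Proof.
move=> j A B oA oB cov [x [Sx Ax]] [y [Sy By]].
case: (excluded_middle_informative (exists z, S z /\ A z /\ B z)) => // dis.
exfalso; apply: (dis); exists y; split=> //; split=> //.
apply: (joined_open_cover oA oB cov _ (j _ _ Sx Sy) Ax) => z Sz [Az Bz].
by apply: dis; exists z.
Qed.

Lemma continuous_prod (T U V : UniformSpace) (a : T -> U) (b : T -> V) x :
  continuous a x -> continuous b x ->
  continuous (fun y => (a y, b y) : prod_UniformSpace U V) x.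
Proof.
move=> ha hb P [e he].
have h1 : locally x (fun y => ball (a x) e (a y)) := ha _ (locally_ball (a x) e).
have h2 : locally x (fun y => ball (b x) e (b y)) := hb _ (locally_ball (b x) e).
apply: filter_imp (filter_and _ _ h1 h2) => y [hya hyb]; exact: he.
Qed.

Section ContinuousComplex.
Variable T : UniformSpace.
Implicit Types f g : T -> C.

Lemma continuous_Cpair (a b : T -> R) x :
  continuous a x -> continuous b x -> continuous (fun y => (a y, b y) : C) x.
Proof. exact: continuous_prod. Qed.

Lemma continuous_Cfst f x : continuous f x -> continuous (fun y => fst (f y)) x.
Proof. by move=> hf; apply: (continuous_comp f fst) => //; exact: continuous_fst. Qed.

Lemma continuous_Csnd f x : continuous f x -> continuous (fun y => snd (f y)) x.
Proof. by move=> hf; apply: (continuous_comp f snd) => //; exact: continuous_snd. Qed.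

Lemma continuous_Cplus f g x :
  continuous f x -> continuous g x -> continuous (fun y => f y + g y)%C x.
Proof.
move=> hf hg; apply: continuous_Cpair.
  by apply: (continuous_plus (V := R_NormedModule)); exact: continuous_Cfst.
by apply: (continuous_plus (V := R_NormedModule)); exact: continuous_Csnd.
Qed.

Lemma continuous_Copp f x : continuous f x -> continuous (fun y => - f y)%C x.
Proof.
move=> hf; apply: continuous_Cpair.
  by apply: (continuous_opp (V := R_NormedModule)); exact: continuous_Cfst.
by apply: (continuous_opp (V := R_NormedModule)); exact: continuous_Csnd.
Qed.

Lemma continuous_Cmult f g x :
  continuous f x -> continuous g x -> continuous (fun y => f y * g y)%C x.
Proof.
move=> hf hg.
have := continuous_Cfst hf; have := continuous_Csnd hf.
have := continuous_Cfst hg; have := continuous_Csnd hg.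
move=> g2 g1 f2 f1; apply: continuous_Cpair.
  apply: (continuous_minus (V := R_NormedModule)); exact: (continuous_mult (K := R_AbsRing)).
apply: (continuous_plus (V := R_NormedModule)); exact: (continuous_mult (K := R_AbsRing)).
Qed.

Lemma continuous_Cinv f x : f x <> RtoC 0 -> continuous f x ->
  continuous (fun y => / f y)%C x.
Proof.
move=> fx0 hf.
have := continuous_Cfst hf; have := continuous_Csnd hf => f2 f1.
have hd : continuous (fun y => fst (f y) ^ 2 + snd (f y) ^ 2) x.
  apply: (continuous_plus (V := R_NormedModule)) => /=;
    do 2![apply: (continuous_mult (K := R_AbsRing)) => //]; exact: continuous_const.
have hi : continuous (fun y => / (fst (f y) ^ 2 + snd (f y) ^ 2)) x.
  apply: (continuous_comp _ Rinv) => //; apply: continuous_Rinv => h0; apply: fx0.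
  apply: injective_projections => /=; nra.
apply: continuous_Cpair; first exact: (continuous_mult (K := R_AbsRing)).
apply: (continuous_mult (K := R_AbsRing)) => //.
exact: (continuous_opp (V := R_NormedModule)).
Qed.

Lemma continuous_Cdiv f g x : g x <> RtoC 0 ->
  continuous f x -> continuous g x -> continuous (fun y => f y / g y)%C x.
Proof. by move=> *; apply: continuous_Cmult => //; exact: continuous_Cinv. Qed.

Lemma continuous_RtoC (a : T -> R) x : continuous a x -> continuous (fun y => RtoC (a y)) x.
Proof. by move=> h; apply: continuous_Cpair => //; exact: continuous_const. Qed.

End ContinuousComplex.

Lemma Cmod_fst (z : C) : Rabs (fst z) <= Cmod z.
Proof. by apply: Rle_trans (Rmax_l _ _) (Rmax_Cmod z). Qed.
Lemma Cmod_snd (z : C) : Rabs (snd z) <= Cmod z.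
Proof. by apply: Rle_trans (Rmax_r _ _) (Rmax_Cmod z). Qed.

Lemma ball_Cmod (z w : C) e : ball z e w -> Cmod (w - z)%C <= 2 * e.
Proof.
case=> /= h1 h2.
have h1' : Rabs (fst w + - fst z) < e := h1.
have h2' : Rabs (snd w + - snd z) < e := h2.
have h3 := Cmod_2Rmax (w - z)%C.
have hm : Rmax (Rabs (fst (w - z)%C)) (Rabs (snd (w - z)%C)) <= e.
  by apply: Rmax_lub; exact: Rlt_le.
have s2 : sqrt 2 <= 2 by rewrite -[X in _ <= X](sqrt_pow2 2); [apply: sqrt_le_1_alt; lra | lra].
have := sqrt_pos 2; have := Rabs_pos (fst (w - z)%C).
have := Rmax_l (Rabs (fst (w - z)%C)) (Rabs (snd (w - z)%C)); nra.
Qed.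

Lemma Cmod_ball (z w : C) e : Cmod (w - z)%C < e -> ball z e w.
Proof. by move=> h; exact: (@C_NormedModule_mixin_compat1 z w). Qed.

Lemma locally_Cmod (z : C) (P : C -> Prop) :
  locally z P <-> exists2 e, 0 < e & forall w, Cmod (w - z)%C < e -> P w.
Proof.
split=> [[e he]|[e e0 he]].
  by exists e; [exact: cond_pos | move=> w hw; apply: he; exact: Cmod_ball].
have e4 : 0 < e / 4 by lra.
by exists (mkposreal _ e4) => w /ball_Cmod /= hw; apply: he; lra.
Qed.

Lemma open_Cmod (D : C -> Prop) (z : C) : open D -> D z ->
  exists2 e, 0 < e & forall w, Cmod (w - z)%C < e -> D w.
Proof. by move=> oD Dz; apply/locally_Cmod; exact: oD. Qed.

Definition parabola (k s : R) : C := (s, k * (s * (1 - s))).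

(** Every point distinct from the end points lies on at most one of the parabolas
    [P + parabola k s * (P' - P)], so all large [k] avoid a finite set. *)
Lemma joined_compl_finite (bad : seq C) (P P' : C) :
  ~ List.In P bad -> ~ List.In P' bad ->
  exists k : R, forall s, 0 <= s <= 1 ->
    ~ List.In (P + parabola k s * (P' - P))%C bad.
Proof.
move=> hP hP'; case: (excluded_middle_informative (P = P')) => [<-|ne].
  exists 0 => s _.
  have -> : (P + parabola 0 s * (P - P))%C = P. by ring.
  exact hP.
have hd : (P' - P)%C <> RtoC 0.
  by move=> h; apply: ne; transitivity (P' - (P' - P))%C; [ring | rewrite h; ring].
suff [k0 hk] : exists k0, forall k, k0 < k -> forall s, 0 <= s <= 1 ->
    ~ List.In (P + parabola k s * (P' - P))%C bad.
  by exists (k0 + 1); apply: hk; lra.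
elim: bad hP hP' => [|b bad IH] hP hP'; first by exists 0.
have [k0 hk0] : exists k0, forall k, k0 < k -> forall s, 0 <= s <= 1 ->
    ~ List.In (P + parabola k s * (P' - P))%C bad.
  by apply: IH => h; [apply: hP | apply: hP']; right.
(* In the affine coordinate with [P] at 0 and [P'] at 1, the parabola through [b] has parameter
   [snd zeta / (fst zeta (1 - fst zeta))]. If the denominator vanishes, the quotient is a harmless
   default value: a parabola has first coordinate 0 or 1 only at its end points, which are not
   [b]. *)
pose zeta := ((b - P) / (P' - P))%C.
exists (Rmax k0 (snd zeta / (fst zeta * (1 - fst zeta)))) => k hk s hs [e|]; last first.
  by apply: hk0 => //; apply: Rle_lt_trans hk; exact: Rmax_l.
have ez : zeta = parabola k s.
  by rewrite /zeta e; field.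
have hlt : snd zeta / (fst zeta * (1 - fst zeta)) < k.
  by apply: Rle_lt_trans hk; exact: Rmax_r.
have s0 : s <> 0.
  move=> z; apply: hP; left; rewrite e z.
  have -> : parabola k 0 = RtoC 0 by congr (_, _); ring.
  by ring.
have s1 : s <> 1.
  move=> z; apply: hP'; left; rewrite e z.
  have -> : parabola k 1 = RtoC 1 by congr (_, _); ring.
  by ring.
move: hlt; rewrite ez /=.
have -> : k * (s * (1 - s)) / (s * (1 - s)) = k by field; split; lra.
lra.
Qed.

(** * Parametrization of the points of the complement with [z <> 0] *)

Section Complement.
Variable q : nat.
Let d : C := RtoC (INR q.+1).

Definition off_segment (w : C) : Prop :=
  forall t : R, - INR q.+1 <= t <= INR q.+1 -> w <> RtoC t.

(** With [y = 1/z], [v = u + (q-1)/2], [d = q+1] and [w = (1+(1-u)(q+u)z^2)/z], the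
    definition of [w] becomes [(y - w/2 - v) (y - w/2 + v) = (w^2 - d^2)/4]; the
    part [z <> 0] of the complement is thus parametrized by [w] and the first
    factor [P]. *)
Definition param_Q (P w : C) : C := ((w * w - d * d) / (RtoC 4 * P))%C.
Definition param_y (P w : C) : C := ((w + P + param_Q P w) / RtoC 2)%C.
Definition param (P w : C) : C * C :=
  (/ param_y P w, (param_Q P w - P) / RtoC 2 - (RtoC (INR q) - 1) / RtoC 2)%C.

(** [P = 0] makes [param_Q] meaningless; the other two values are the roots of
    [2 P y = (P + w/2)^2 - d^2/4], where [y] vanishes and [z = 1/y] does not exist. *)
Definition param_bad (w : C) : seq C :=
  [:: RtoC 0; (d - w) / RtoC 2; (- d - w) / RtoC 2]%C.

Lemma RtoC_neq0 (r : R) : r <> 0 -> RtoC r <> RtoC 0.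
Proof. by move=> h [] /h. Qed.

Lemma param_y_neq0 P w : ~ List.In P (param_bad w) -> param_y P w <> RtoC 0.
Proof.
move=> hP h; have P0 : P <> RtoC 0 by move=> e; apply: hP; left.
have h2 : RtoC 2 <> RtoC 0 by apply: RtoC_neq0; lra.
have h4 : RtoC 4 <> RtoC 0 by apply: RtoC_neq0; lra.
have e4 : RtoC 4 = (RtoC 2 * RtoC 2)%C by rewrite -RtoC_mult; congr RtoC; ring.
have : ((P - (d - w) / RtoC 2) * (P - (- d - w) / RtoC 2))%C = RtoC 0.
  transitivity (RtoC 2 * P * param_y P w)%C; last by rewrite h; ring.
  by rewrite /param_y /param_Q e4; field.
move=> e; have [e'|e'] : (P - (d - w) / RtoC 2)%C = RtoC 0 \/ (P - (- d - w) / RtoC 2)%C = RtoC 0.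
- case: (excluded_middle_informative ((P - (d - w) / RtoC 2)%C = RtoC 0)) => h1; [by left|right].
  by apply: NNPP => h3; exact: Cmult_neq_0 h1 h3 e.
- by apply: hP; right; left; rewrite -[LHS]Cplus_0_r -e'; ring.
- by apply: hP; right; right; left; rewrite -[LHS]Cplus_0_r -e'; ring.
Qed.

Lemma param_coef P w : ~ List.In P (param_bad w) ->
  (ihara_coef q (param P w) / fst (param P w))%C = w.
Proof.
move=> hP; have y0 := param_y_neq0 hP.
have P0 : P <> RtoC 0 by move=> e; apply: hP; left.
have h2 : RtoC 2 <> RtoC 0 by apply: RtoC_neq0; lra.
have h4 : RtoC 4 <> RtoC 0 by apply: RtoC_neq0; lra.
have e4 : RtoC 4 = (RtoC 2 * RtoC 2)%C by rewrite -RtoC_mult; congr RtoC; ring.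
have ed : d = (RtoC (INR q) + 1)%C by rewrite /d S_INR RtoC_plus.
have hQ : (RtoC 4 * P * param_Q P w)%C = (w * w - d * d)%C by rewrite /param_Q; field.
have hy : (RtoC 2 * param_y P w)%C = (w + P + param_Q P w)%C by rewrite /param_y; field.
rewrite /ihara_coef /param /=; move: y0 hQ hy.
move: (param_Q P w) (param_y P w) => Q y y0 hQ hy.
have hw : w = (RtoC 2 * y - P - Q)%C by rewrite hy; ring.
have e2 : RtoC 2 = (1 + 1)%C by rewrite -RtoC_plus; congr RtoC; ring.
have n2 : (1 + 1)%C <> RtoC 0 by rewrite -e2.
have key : ((RtoC (INR q) + 1) * (RtoC (INR q) + 1))%C = (w * w - RtoC 4 * P * Q)%C.
  by rewrite hQ ed; ring.
transitivity ((RtoC 4 * y * y + ((RtoC (INR q) + 1) * (RtoC (INR q) + 1)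
   - (Q - P) * (Q - P))) / (RtoC 4 * y))%C.
  by rewrite e4 e2; field.
rewrite key; transitivity ((w * (RtoC 4 * y)) / (RtoC 4 * y))%C; last by field; repeat split.
congr (_ / _)%C; by rewrite hw e4 e2; ring.
Qed.

Lemma param_off P w : off_segment w -> ~ List.In P (param_bad w) -> ~ Omega q (param P w).
Proof.
move=> hw hP [_ [t [ht e]]]; apply: (hw t ht).
by rewrite -e param_coef.
Qed.

(** [P] is read off as [1/z - w/2 - v]. It is nonzero because [4 P Q = w^2 - d^2] and [w] avoids [d]
    and [-d]; the other two excluded values would give [param_y P w = 0], whereas this number is
    [1/z]. *)
Lemma param_surj p : ~ Omega q p -> fst p <> RtoC 0 ->
  exists P w, [/\ off_segment w, ~ List.In P (param_bad w) & p = param P w].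
Proof.
case: p => z u hO /= z0.
have h2 : RtoC 2 <> RtoC 0 by apply: RtoC_neq0; lra.
have e2 : RtoC 2 = (1 + 1)%C by rewrite -RtoC_plus; congr RtoC; ring.
have n2 : (1 + 1)%C <> RtoC 0 by rewrite -e2.
have e4 : RtoC 4 = (RtoC 2 * RtoC 2)%C by rewrite -RtoC_mult; congr RtoC; ring.
have ed : d = (RtoC (INR q) + 1)%C by rewrite /d S_INR RtoC_plus.
pose w := (ihara_coef q (z, u) / z)%C.
pose v := (u + (RtoC (INR q) - 1) / RtoC 2)%C.
pose P := (/ z - w / RtoC 2 - v)%C.
have hw : off_segment w by move=> t ht e; apply: hO; split=> //=; exists t.
pose Q := (/ z - w / RtoC 2 + v)%C.
have hPQ : (RtoC 4 * P * Q)%C = (w * w - d * d)%C.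
  by rewrite ed /P /Q /v /w /= e4 e2; field.
have wd : (w * w - d * d)%C <> RtoC 0.
  have -> : (w * w - d * d = (w - d) * (w + d))%C by ring.
  have hd := pos_INR q.+1.
  apply: Cmult_neq_0 => h.
    by apply: (hw (INR q.+1)); [lra | rewrite -/d -[RHS]Cplus_0_r -h; ring].
  apply: (hw (- INR q.+1)); first lra.
  by rewrite RtoC_opp -/d -[RHS]Cplus_0_r -h; ring.
have P0 : P <> RtoC 0 by move=> e; apply: wd; rewrite -hPQ e; ring.
have n4 : RtoC 4 <> RtoC 0 by apply: RtoC_neq0; lra.
have eQ : param_Q P w = Q.
  by rewrite /param_Q -hPQ; field.
have ey : param_y P w = (/ z)%C.
  by rewrite /param_y eQ /P /Q e2; field.
exists P, w; split=> //; last first.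
  rewrite /param eQ ey; congr (_, _); first by field.
  by rewrite /P /Q /v e2; field.
case=> [e|[e|[e|//]]]; first by apply: P0.
- have : (RtoC 2 * P * param_y P w)%C = RtoC 0.
    transitivity ((P - (d - w) / RtoC 2) * (P - (- d - w) / RtoC 2))%C.
      by rewrite /param_y /param_Q e4; field.
    by rewrite -[X in (X - (d - w) / _)%C]e; ring.
  by apply: Cmult_neq_0; [exact: Cmult_neq_0 | rewrite ey => h; move: (Cinv_r _ z0); rewrite h Cmult_0_r => -[]; lra].
- have : (RtoC 2 * P * param_y P w)%C = RtoC 0.
    transitivity ((P - (d - w) / RtoC 2) * (P - (- d - w) / RtoC 2))%C.
      by rewrite /param_y /param_Q e4; field.
    by rewrite -[X in (X - (- d - w) / _)%C]e; ring.
  by apply: Cmult_neq_0; [exact: Cmult_neq_0 | rewrite ey => h; move: (Cinv_r _ z0); rewrite h Cmult_0_r => -[]; lra].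
Qed.

End Complement.

Section ComplementConnected.
Variable q : nat.

Lemma off_segment_im w : snd w <> 0 -> off_segment q w.
Proof. by move=> h t _ e; apply: h; rewrite e. Qed.

Lemma segment_joined_off w w' : off_segment q w -> off_segment q w' ->
  (forall s, 0 < s < 1 -> (1 - s) * snd w + s * snd w' <> 0) ->
  joined (off_segment q : C_UniformSpace -> Prop) w w'.
Proof.
move=> ow ow' h.
have e0 : (RtoC (1 - 0) * w + RtoC 0 * w' = w)%C by rewrite Rminus_0_r; ring.
have e1 : (RtoC (1 - 1) * w + RtoC 1 * w' = w')%C by rewrite Rminus_diag; ring.
exists (fun s : R => RtoC (1 - s) * w + RtoC s * w')%C; split.
- move=> t _; apply: continuous_Cplus; apply: continuous_Cmult; try exact: continuous_const.
    apply: continuous_RtoC; apply: (continuous_minus (V := R_NormedModule)).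
      exact: continuous_const.
    exact: continuous_id.
  by apply: continuous_RtoC; exact: continuous_id.
- move=> s us; case: (Req_dec s 0) => [->|s0].
    by rewrite e0.
  case: (Req_dec s 1) => [->|s1].
    by rewrite e1.
  apply: off_segment_im => /= e; apply: (h s); first by move: us; rewrite /unit_interval; lra.
  by rewrite -[RHS]e; ring.
- exact: e0.
- exact: e1.
Qed.

(** [P = w] is a continuous choice of an admissible [P] over every [w]: a forbidden value would
    force [w] to be 0 or a third of an end point, and these lie on the segment. *)
Lemma diag_not_bad w : off_segment q w -> ~ List.In w (param_bad q w).
Proof.
pose d := RtoC (INR q.+1).
have hd : 1 <= INR q.+1 by rewrite S_INR; have := pos_INR q; lra.
have e3 : RtoC 3 = (1 + RtoC 2)%C by rewrite -RtoC_plus; congr RtoC; ring.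
have n2 : RtoC 2 <> RtoC 0 by apply: RtoC_neq0; lra.
have n3 : RtoC 3 <> RtoC 0 by apply: RtoC_neq0; lra.
move=> ow [e|[e|[e|//]]].
- by apply: (ow 0); [lra | rewrite e].
- apply: (ow (INR q.+1 / 3)); first lra.
  rewrite RtoC_div; last lra.
  have h : (RtoC (INR q.+1) - w = RtoC 2 * w)%C.
    by rewrite -[X in (RtoC 2 * X)%C]e; field.
  have -> : RtoC (INR q.+1) = (RtoC 3 * w)%C.
    by rewrite e3 Cmult_plus_distr_r -h; ring.
  by field.
- apply: (ow (- INR q.+1 / 3)); first lra.
  rewrite RtoC_div; last lra.
  have -> : RtoC (- INR q.+1) = (RtoC 3 * w)%C.
    have h : (- RtoC (INR q.+1) - w = RtoC 2 * w)%C.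
      by rewrite -[X in (RtoC 2 * X)%C]e; field.
    by rewrite e3 RtoC_opp Cmult_plus_distr_r -h; ring.
  by field.
Qed.

Lemma continuous_param (T : UniformSpace) (P w : T -> C) x :
  continuous P x -> continuous w x -> ~ List.In (P x) (param_bad q (w x)) ->
  continuous (fun y => param q (P y) (w y) : prod_UniformSpace C_UniformSpace C_UniformSpace) x.
Proof.
move=> cP cw hP.
have P0 : P x <> RtoC 0 by move=> e; apply: hP; left.
have n2 : RtoC 2 <> RtoC 0 by apply: RtoC_neq0; lra.
have n4 : RtoC 4 <> RtoC 0 by apply: RtoC_neq0; lra.
have cc (c : C) : continuous (fun _ : T => c) x by exact: continuous_const.
have cQ : continuous (fun y => param_Q q (P y) (w y)) x.
  apply: continuous_Cdiv; first exact: Cmult_neq_0.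
    apply: continuous_Cplus; first exact: continuous_Cmult.
    by apply: continuous_Copp.
  exact: continuous_Cmult.
have cy : continuous (fun y => param_y q (P y) (w y)) x.
  apply: continuous_Cdiv => //; apply: continuous_Cplus => //.
  exact: continuous_Cplus.
have c1 : continuous (fun y => / param_y q (P y) (w y))%C x.
  by apply: continuous_Cinv => //; exact: param_y_neq0.
have c2 : continuous (fun y => (param_Q q (P y) (w y) - P y) / RtoC 2
    - (RtoC (INR q) - 1) / RtoC 2)%C x.
  apply: continuous_Cplus; last exact: cc.
  apply: continuous_Cdiv => //; apply: continuous_Cplus => //.
  exact: continuous_Copp.
exact: continuous_prod.
Qed.

(** Given a cover by [A] and [B], disjoint on the complement, membership of [A] is carried along
    paths: over a fixed [w] on a parabola that avoids the forbidden values of [P], and along the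
    section [P = w] while [w] moves off the segment. Points with [z = 0] are not joined to others by
    a path; they are approached inside the open set that contains them. *)
Lemma complement_connected :
  connected (T := prod_UniformSpace C_UniformSpace C_UniformSpace) (fun p => ~ Omega q p).
Proof.
move=> A B oA oB cov [x [Sx Ax]] [y [Sy By]].
apply: NNPP => ndis.
have dis z : ~ Omega q z -> ~ (A z /\ B z) by move=> Sz [Az Bz]; apply: ndis; exists z.
have step1 P P' w : off_segment q w -> ~ List.In P (param_bad q w) ->
    ~ List.In P' (param_bad q w) -> A (param q P w) -> A (param q P' w).
  move=> ow hP hP'; apply: (joined_open_cover oA oB cov dis).
  have [k hk] := joined_compl_finite hP hP'.
  exists (fun s => param q (P + parabola k s * (P' - P))%C w); split.
  - move=> s us; apply: continuous_param; [|exact: continuous_const|exact: hk].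
    apply: continuous_Cplus; first exact: continuous_const.
    apply: continuous_Cmult; last exact: continuous_const.
    apply: continuous_Cpair; first exact: continuous_id.
    apply: (continuous_mult (K := R_AbsRing)); first exact: continuous_const.
    apply: (continuous_mult (K := R_AbsRing)); first exact: continuous_id.
    apply: (continuous_minus (V := R_NormedModule)); first exact: continuous_const.
    exact: continuous_id.
  - by move=> s us; apply: param_off => //; exact: hk.
  - congr (param q _ _); have -> : parabola k 0 = RtoC 0 by congr (_, _); ring.
    by ring.
  - congr (param q _ _); have -> : parabola k 1 = RtoC 1 by congr (_, _); ring.
    by ring.
have step2 w w' : joined (off_segment q : C_UniformSpace -> Prop) w w' ->
    A (param q w w) -> A (param q w' w').
  move=> [c [cc cS c0 c1]]; apply: (joined_open_cover oA oB cov dis).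
  exists (fun s => param q (c s) (c s)); split.
  - by move=> t ut; apply: continuous_param; [exact: cc|exact: cc|apply: diag_not_bad; exact: cS].
  - by move=> t ut; apply: param_off; [exact: cS|apply: diag_not_bad; exact: cS].
  - by rewrite c0.
  - by rewrite c1.
have hq := pos_INR q.+1.
(* [up] and [dn] stand for the two half planes, real points off the segment being counted with the
   upper one; [far], beyond the end point [d], links the two around the segment. *)
pose up : C := (0, 1); pose dn : C := (0, -1); pose far : C := RtoC (INR q.+1 + 1).
have oup : off_segment q up by apply: off_segment_im => /=; lra.
have odn : off_segment q dn by apply: off_segment_im => /=; lra.
have ofar : off_segment q far by move=> t ht /RtoC_inj e; lra.
have step3 w : off_segment q w -> (A (param q w w) <-> A (param q far far)).
  move=> ow.
  have h1 : A (param q up up) <-> A (param q far far).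
    by split; apply: step2; apply: segment_joined_off => // s hs /=; lra.
  have h2 : A (param q dn dn) <-> A (param q far far).
    by split; apply: step2; apply: segment_joined_off => // s hs /=; lra.
  case: (Rle_lt_dec 0 (snd w)) => hw.
    apply: iff_trans h1; split; apply: step2; apply: segment_joined_off => // s hs /=; nra.
  apply: iff_trans h2; split; apply: step2; apply: segment_joined_off => // s hs /=; nra.
have step4 P w : off_segment q w -> ~ List.In P (param_bad q w) ->
    (A (param q P w) <-> A (param q far far)).
  move=> ow hP; apply: iff_trans (step3 w ow); split; apply: step1 => //; exact: diag_not_bad.
have nz (D : C * C -> Prop) p :
    open (D : prod_UniformSpace C_UniformSpace C_UniformSpace -> Prop) ->
    ~ Omega q p -> D p -> exists P w, [/\ off_segment q w, ~ List.In P (param_bad q w) & D (param q P w)].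
  move=> oD hp Dp; case: (excluded_middle_informative (fst p = RtoC 0)) => [p0|p0]; last first.
    by have [P [w [ow hP ep]]] := param_surj hp p0; exists P, w; split=> //; rewrite -ep.
  have [e he] := oD p Dp.
  case: p p0 hp Dp he => z u /= -> hp Dp he.
  pose a := Cmod ((1 - u) * (RtoC (INR q) + u))%C.
  have a0 : 0 <= a := Cmod_ge_0 _.
  have e0 := cond_pos e.
  (* If [(r, u)] were in [Omega], then [1 = r (t - (1 - u)(q + u) r)] with [|t| <= d], where the
     right side has modulus at most [r (d + a r)]; this choice of [r], which is at most 1, makes
     that smaller than 1. *)
  pose r := Rmin (e / 2) (/ (INR q.+1 + a + 1)).
  have ia : 0 < / (INR q.+1 + a + 1) by apply: Rinv_0_lt_compat; lra.
  have r0 : 0 < r by apply: Rmin_pos => //; lra.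
  have re : r < e by have := Rmin_l (e / 2) (/ (INR q.+1 + a + 1)); rewrite -/r; lra.
  have r1 : r * (INR q.+1 + a + 1) <= 1.
    have := Rmin_r (e / 2) (/ (INR q.+1 + a + 1)); rewrite -/r => h.
    have s0 : 0 <= INR q.+1 + a + 1 by lra.
    have := Rmult_le_compat_r _ _ _ s0 h; rewrite Rinv_l; lra.
  have rle1 : r <= 1 by nra.
  have Dr : D (RtoC r, u).
    apply: he; split; last exact: ball_center.
    apply: Cmod_ball => /=; have -> : (RtoC r - RtoC 0 = RtoC r)%C by ring.
    by rewrite Cmod_R Rabs_pos_eq; lra.
  have rn : RtoC r <> RtoC 0 by apply: RtoC_neq0; lra.
  have hO : ~ Omega q (RtoC r, u).
    case=> _ [t [ht]]; rewrite /fst /ihara_coef => et.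
    have e1 : RtoC 1 = (RtoC r * (RtoC t - (1 - u) * (RtoC (INR q) + u) * RtoC r))%C.
      by rewrite -et; field.
    have := f_equal Cmod e1; rewrite Cmod_1 Cmod_mult Cmod_R Rabs_pos_eq; last lra.
    have := Cmod_triangle (RtoC t) (- ((1 - u) * (RtoC (INR q) + u) * RtoC r))%C.
    rewrite Cmod_opp Cmod_mult -/a !Cmod_R (Rabs_pos_eq r); last lra.
    have : Rabs t <= INR q.+1 by apply/Rabs_le_between; lra.
    rewrite /Cminus; set X := Cmod _ => h1 h2 h3; nra.
  have [P [w [ow hP ep]]] := param_surj hO rn.
  by exists P, w; split=> //; rewrite -ep.
have [P [w [ow hP Aw]]] := nz _ _ oA Sx Ax.
have [P' [w' [ow' hP' Bw']]] := nz _ _ oB Sy By.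
apply: (dis (param q P' w')); first exact: param_off.
by split=> //; apply/step4 => //; apply/(step4 P w).
Qed.

End ComplementConnected.

(** * Completeness *)

Section SequentialCompleteness.
Variables (K : AbsRing) (V : NormedModule K).

Lemma norm_minus_triangle (x y z : V) :
  norm (minus x z) <= norm (minus x y) + norm (minus y z).
Proof. by rewrite (minus_trans y x z); exact: norm_triangle. Qed.

Lemma norm_minus_sym (x y : V) : norm (minus x y) = norm (minus y x).
Proof. by rewrite -norm_opp opp_minus. Qed.

Definition norm_cauchy (u : nat -> V) : Prop :=
  forall e, 0 < e -> exists N, forall n m, (N <= n)%N -> (N <= m)%N ->
    norm (minus (u n) (u m)) < e.

Definition norm_cvg (u : nat -> V) (l : V) : Prop :=
  forall e, 0 < e -> exists N, forall n, (N <= n)%N -> norm (minus (u n) l) < e.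

Definition seq_complete : Prop := forall u, norm_cauchy u -> exists l, norm_cvg u l.

Lemma norm_cvg_unique u l l' : norm_cvg u l -> norm_cvg u l' -> l = l'.
Proof.
move=> h h'; suff e : norm (minus l l') = 0.
  by have := norm_eq_zero _ e; rewrite -[X in _ = X -> _](minus_eq_zero l') => /plus_reg_r.
apply: Rle_antisym; last exact: norm_ge_0.
apply: le_epsilon => e e0; rewrite Rplus_0_l.
have e2 : 0 < e / 2 by lra.
have [N hN] := h _ e2; have [N' hN'] := h' _ e2.
have h1 := hN _ (leq_maxl N N'); have h2 := hN' _ (leq_maxr N N').
have := norm_minus_triangle l (u (maxn N N')) l'.
rewrite (norm_minus_sym l (u _)); lra.
Qed.

Hypothesis complete : seq_complete.

(** A Cauchy filter contains balls of radius [1/(n+1)]; their centres form a Cauchy sequence, as two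
    such balls always meet. The factor [c] is the constant that compares balls with the norm. *)
Lemma cauchy_filter_limit (F : (V -> Prop) -> Prop) : ProperFilter F -> cauchy F ->
  exists l, forall eps : posreal, F (ball l eps).
Proof.
move=> PF cF.
have hx n : exists x, F (ball x (/ (INR n + 1))).
  exact: (cF (mkposreal _ (RinvN_pos n))).
pose x n := projT1 (constructive_indefinite_description _ (hx n)).
have xP n : F (ball (x n) (/ (INR n + 1))).
  exact: (projT2 (constructive_indefinite_description _ (hx n))).
pose c : R := norm_factor (V := V); have c0 : 0 < c := norm_factor_gt_0.
have small e : 0 < e -> exists N : nat, forall n, (N <= n)%N -> / (INR n + 1) < e.
  move=> e0; have [N hN] := archimed_cor1 e e0; exists N => n le.
  case: hN => hN N0; apply: Rle_lt_trans hN.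
  have h0 := lt_0_INR _ N0; have /leP/le_INR h1 := le.
  by apply: Rinv_le_contravar; lra.
have cl (n m : nat) : norm (minus (x n) (x m)) <= c * / (INR n + 1) + c * / (INR m + 1).
  have [y [hn hm]] := filter_ex _ (filter_and _ _ (xP n) (xP m)).
  have hn' := norm_compat2 (x n) y (mkposreal _ (RinvN_pos n)) hn.
  have hm' := norm_compat2 (x m) y (mkposreal _ (RinvN_pos m)) hm.
  have := norm_minus_triangle (x n) y (x m).
  rewrite (norm_minus_sym (x n) y) => h.
  by rewrite /= -/c in hn' hm'; lra.
have [l hl] : exists l, norm_cvg x l.
  apply: complete => e e0.
  have e1 : 0 < e / (2 * c) by apply: Rdiv_lt_0_compat; lra.
  have [N hN] := small _ e1; exists N => n m hn hm.
  apply: Rle_lt_trans (cl n m) _.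
  have h1 := Rmult_lt_compat_l c _ _ c0 (hN n hn).
  have h2 := Rmult_lt_compat_l c _ _ c0 (hN m hm).
  have h3 : c * (e / (2 * c)) = e / 2 by field; lra.
  lra.
exists l => eps.
have e2 : 0 < eps / 2 by have := cond_pos eps; lra.
have [N hN] := hl _ e2; have [N' hN'] := small _ e2.
pose n := maxn N N'.
have := xP n; apply: filter_imp => y hy.
have -> : pos eps = eps / 2 + eps / 2 by lra.
apply: ball_triangle (ball_le _ _ _ _ _ hy).
  by apply: norm_compat1; apply: hN; exact: leq_maxl.
by apply: Rlt_le; apply: hN'; exact: leq_maxr.
Qed.

Definition filter_limit (F : (V -> Prop) -> Prop) : V :=
  epsilon (inhabits (zero : V)) (fun l : V => forall eps : posreal, F (ball l eps)).

Lemma filter_limit_spec (F : (V -> Prop) -> Prop) : ProperFilter F -> cauchy F ->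
  forall eps : posreal, F (ball (filter_limit F) eps).
Proof. by move=> PF cF; apply: epsilon_spec (cauchy_filter_limit PF cF). Qed.

Lemma filter_limit_close (F1 F2 : (V -> Prop) -> Prop) :
  filter_le F1 F2 -> filter_le F2 F1 -> close (filter_limit F1) (filter_limit F2).
Proof.
move=> h1 h2; have -> : filter_limit F1 = filter_limit F2.
  congr filter_limit; apply: functional_extensionality => P.
  by apply: propositional_extensionality; split => [/h2|/h1].
exact: close_refl.
Qed.

Definition complete_mixin : CompleteSpace.mixin_of V :=
  CompleteSpace.Mixin V filter_limit filter_limit_spec filter_limit_close.

(** Serves to integrate a continuous operator-valued function, for which the target space has to be
    complete in the sense of filters. *)
Definition complete_normed : CompleteNormedModule K :=
  CompleteNormedModule.Pack K V
    (CompleteNormedModule.Class K V (NormedModule.class K V) complete_mixin) V.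

End SequentialCompleteness.

Lemma C_seq_complete : seq_complete C_NormedModule.
Proof.
move=> u cu.
have comp (p : C -> R) : (forall z w, Rabs (p z - p w) <= Cmod (z - w)%C) ->
    exists l, Un_cv (fun n => p (u n)) l.
  move=> hp; have hc : Cauchy_crit (fun n => p (u n)).
    move=> e e0; have [N hN] := cu e e0; exists N => n m hn hm.
    have h : Cmod (u n - u m)%C < e by apply: (hN n m); exact/leP.
    exact: Rle_lt_trans (hp (u n) (u m)) h.
  have [l hl] := Rcomplete.R_complete _ hc.
  by exists l.
have [a ha] := comp fst (fun z w => Cmod_fst (z - w)%C).
have [b hb] := comp snd (fun z w => Cmod_snd (z - w)%C).
exists (a, b) => e e0; have e2 : 0 < e / 2 by lra.
have [N hN] := ha _ e2; have [N' hN'] := hb _ e2.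
exists (maxn N N') => n hn.
have h1 : Rabs (fst (u n) - a) < e / 2 by apply: hN; apply/leP; apply: leq_trans hn; exact: leq_maxl.
have h2 : Rabs (snd (u n) - b) < e / 2 by apply: hN'; apply/leP; apply: leq_trans hn; exact: leq_maxr.
have := Cmod_triangle (RtoC (fst (u n) - a)) (Ci * RtoC (snd (u n) - b))%C.
rewrite Cmod_mult Cmod_Ci Rmult_1_l !Cmod_R.
have -> : (RtoC (fst (u n) - a) + Ci * RtoC (snd (u n) - b) = u n - (a, b))%C.
  by apply: injective_projections => /=; ring.
move=> h; apply: Rle_lt_trans h _; lra.
Qed.

(** * Square-summable functions: completeness and density of finite support *)

Section L2Space.
Variable V : countType.
Notation H := (l2_NormedModule V).
Implicit Types f g : l2 V.

Lemma Cmod_le_norm f x : Cmod (f x) <= l2_norm f.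
Proof.
have := sumsq_le_norm f [fset x]%fset; rewrite /sumsq big_seq_fset1 => h.
apply: Rsqr_incr_0_var; last exact: l2_norm_ge0.
by rewrite !Rsqr_pow2.
Qed.

Lemma l2_minusE f g x : (minus (f : H) (g : H) : l2 V) x = (f x - g x)%C.
Proof. by rewrite /=; ring. Qed.

(** The limit is taken vertex by vertex. On a finite set [A], [u n - g] is split into [u n - u m]
    and [u m - g] with [m] depending on [A], and the resulting bound is uniform in [A]. *)
Lemma l2_seq_complete : seq_complete H.
Proof.
move=> u cu.
have hl x : exists l : C, norm_cvg (V := C_NormedModule) (fun n => (u n : l2 V) x) l.
  apply: C_seq_complete => e e0; have [N hN] := cu e e0.
  exists N => n m hn hm; apply: Rle_lt_trans (hN n m hn hm).
  apply: Rle_trans (Cmod_le_norm (minus (u n) (u m)) x).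
  by rewrite l2_minusE; exact: Rle_refl.
pose g x := projT1 (constructive_indefinite_description _ (hl x)).
have gP x : norm_cvg (V := C_NormedModule) (fun n => (u n : l2 V) x) (g x).
  exact: (projT2 (constructive_indefinite_description _ (hl x))).
have close e (s : seq V) : 0 < e -> exists N, forall m, (N <= m)%N ->
    \big[Rplus/0]_(x <- s) Cmod ((u m : l2 V) x - g x)%C ^ 2 <= e.
  elim: s e => [|a s IH] e e0; first by exists 0%N => m _; rewrite big_nil; lra.
  have e2 : 0 < e / 2 by lra.
  have [N hN] := IH _ e2; have [N' hN'] := gP a _ (sqrt_lt_R0 _ e2).
  exists (maxn N N') => m hm; rewrite big_cons.
  have h1 := hN m (leq_trans (leq_maxl _ _) hm).
  have h2 := hN' m (leq_trans (leq_maxr _ _) hm).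
  have h3 : Cmod ((u m : l2 V) a - g a)%C ^ 2 <= e / 2.
    rewrite -(pow2_sqrt (e / 2)); last lra.
    by apply: pow_incr; split; [exact: Cmod_ge_0 | exact: Rlt_le].
  lra.
have tail e : 0 < e -> exists N, forall n, (N <= n)%N -> forall A,
    sumsq (fun x => (u n : l2 V) x - g x)%C A <= (e + e) ^ 2.
  move=> e0; have [N hN] := cu e e0; exists N => n hn A.
  have [N' hN'] := close (e ^ 2) A (pow_lt _ _ e0).
  pose m := maxn N N'.
  have hm : sumsq (fun x => (u m : l2 V) x - g x)%C A <= e ^ 2 by apply: hN'; exact: leq_maxr.
  apply: (@sumsq_triangle _ (minus (u n) (u m) : l2 V) _ _ e e A _ _ _ _ hm); try lra.
    move=> x; rewrite l2_minusE.
    have -> : ((u n : l2 V) x - g x =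
       ((u n : l2 V) x - (u m : l2 V) x) + ((u m : l2 V) x - g x))%C by ring.
    exact: Cmod_triangle.
  apply: Rle_trans (sumsq_le_norm _ _) _; apply: pow_incr.
  split; first exact: l2_norm_ge0.
  by apply: Rlt_le; apply: hN => //; exact: leq_maxl.
have gs : exists M, forall A, sumsq g A <= M.
  have [N hN] := tail 1 Rlt_0_1.
  exists ((l2_norm (u N) + (1 + 1)) ^ 2) => A.
  apply: (@sumsq_triangle _ (u N : l2 V) (fun x => (u N : l2 V) x - g x)%C) => //.
  - move=> x; have -> : g x = ((u N : l2 V) x + - ((u N : l2 V) x - g x))%C by ring.
    apply: Rle_trans (Cmod_triangle _ _) _; rewrite Cmod_opp.
    have -> : ((u N : l2 V) x - ((u N : l2 V) x + - ((u N : l2 V) x - g x)))%C =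
      ((u N : l2 V) x - g x)%C by ring.
    exact: Rle_refl.
  - exact: l2_norm_ge0.
  - lra.
  - exact: sumsq_le_norm.
  - exact: hN.
exists (MkL2 gs : H) => e e0; have e4 : 0 < e / 4 by lra.
have [N hN] := tail _ e4; exists N => n hn.
apply: (@Rle_lt_trans _ (e / 4 + e / 4)); last lra.
apply: l2_norm_le => [|A]; first lra.
apply: Rle_trans (hN n hn A); right.
by congr (sumsq _ A); apply: functional_extensionality => x; rewrite l2_minusE.
Qed.

Definition fin_comb (f : V -> C) (s : seq V) : H :=
  foldr (fun y acc => plus (scal (f y : C_Ring) (delta y : H)) acc) zero s.

Lemma fin_combE (f : V -> C) s x : uniq s ->
  (fin_comb f s : l2 V) x = if x \in s then f x else RtoC 0.
Proof.
elim: s => [//|a s IH] /= /andP[has us]; rewrite IH // in_cons.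
case: eqP => [->|_] /=; last by rewrite Cmult_0_r Cplus_0_l.
by rewrite (negbTE has) Cmult_1_r Cplus_0_r.
Qed.

(** Any finite set whose sum of squares is within [(e/2)^2] of the supremum works: the squares over
    a finite set disjoint from it add up to less than that. *)
Lemma fin_comb_dense f e : 0 < e ->
  exists A : {fset V}, norm (minus (f : H) (fin_comb f A)) < e.
Proof.
move=> e0.
pose E r := exists A, r = sumsq f A.
have bE : bound E by exists (l2_norm f ^ 2) => _ [A ->]; exact: sumsq_le_norm.
have [l [ub least]] := completeness E bE (ex_intro _ _ (ex_intro _ fset0 erefl)).
have e2 : 0 < (e / 2) ^ 2 by apply: pow_lt; lra.
have [A hA] : exists A, l - (e / 2) ^ 2 < sumsq f A.
  apply: NNPP => h; have : is_upper_bound E (l - (e / 2) ^ 2).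
    by move=> _ [A ->]; apply: Rnot_lt_le => hA; apply: h; exists A.
  by move/least; lra.
exists A; apply: (@Rle_lt_trans _ (e / 2)); last lra.
apply: l2_norm_le => [|B]; first lra.
have -> : sumsq (minus (f : H) (fin_comb f A) : l2 V) B = sumsq f (B `\` A)%fset.
  have -> : sumsq (minus (f : H) (fin_comb f A) : l2 V) B =
      sumsq (fun x => f x - (fin_comb f A : l2 V) x)%C B.
    by congr (sumsq _ B); apply: functional_extensionality => x; exact: l2_minusE.
  rewrite /sumsq [RHS](perm_big [seq x <- B | x \notin A]) /=; last first.
    apply: uniq_perm; [exact: fset_uniq | exact: filter_uniq (fset_uniq _) |].
    by move=> x; rewrite mem_filter !inE.
  rewrite big_filter [RHS]big_mkcond; apply: eq_bigr => x _.
  rewrite fin_combE ?fset_uniq //; case: (x \in A).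
    have -> : (f x - f x)%C = RtoC 0 by ring.
    by rewrite Cmod_0 /=; ring.
  by have -> : (f x - RtoC 0)%C = f x by ring.
have : sumsq f (A `|` (B `\` A))%fset = sumsq f A + sumsq f (B `\` A)%fset.
  rewrite /sumsq -big_cat; apply: perm_big; apply: uniq_perm.
  - exact: fset_uniq.
  - rewrite cat_uniq !fset_uniq /= andbT; apply/hasPn => x.
    by rewrite !inE => /andP[].
  - by move=> x; rewrite mem_cat !inE.
have : sumsq f (A `|` (B `\` A))%fset <= l by apply: ub; exists (A `|` (B `\` A))%fset.
lra.
Qed.

(** Holds by density of the finite combinations of the [delta y]. Identities between operator-valued
    integrals are proved through it, one matrix entry at a time. *)
Lemma entry_inj (S T : bounded_op H) : (forall x y, entry S x y = entry T x y) -> S = T.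
Proof.
move=> h; apply: bop_eq => f.
have hd y : S (delta y) = T (delta y) by apply: l2_eq => x; exact: h.
have hc s : S (fin_comb f s) = T (fin_comb f s).
  elim: s => [|a s IH] /=; first by rewrite !(linear_zero _ (bop_linear _)).
  by rewrite !(linear_plus _ (bop_linear _)) !(linear_scal _ (bop_linear _)) hd IH.
pose W : bounded_op H := minus S T.
have hW g : W g = minus (S g) (T g).
  by rewrite /W /minus /=; congr plus; exact: (scal_opp_one (V := H)).
suff : norm (W f) = 0.
  by move/norm_eq_zero; rewrite hW => e; rewrite -[S f]plus_zero_r -(plus_opp_l (T f)) plus_assoc
     -/(minus (S f) (T f)) e plus_zero_l.
apply: Rle_antisym; last exact: norm_ge_0.
apply: le_epsilon => e e0; rewrite Rplus_0_l.
have n0 := op_norm_ge0 W.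
have e1 : 0 < e / (op_norm W + 1) by apply: Rdiv_lt_0_compat; lra.
have [A hA] := fin_comb_dense f e1.
have -> : W f = W (minus (f : H) (fin_comb f A)).
  rewrite (linear_plus _ (bop_linear W)) (linear_opp _ _ (bop_linear W)) hW.
  by rewrite (hW (fin_comb _ _)) hc minus_eq_zero opp_zero plus_zero_r.
apply: Rle_trans (norm_bop_le _ _) _.
apply: (@Rle_trans _ ((op_norm W + 1) * (e / (op_norm W + 1)))); last by right; field; lra.
have := norm_ge_0 (minus (f : H) (fin_comb f A)); nra.
Qed.

End L2Space.

(** * Bounded operators *)

Section OperatorAlgebra.
Variable U : NormedModule C_AbsRing.
Notation B := (bounded_op U).
Implicit Types S T W X Y : B.

Lemma bop_minusE S T x : (minus S T : B) x = minus (S x) (T x).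
Proof.
rewrite /minus /=; congr plus.
have -> : RtoC (-1) = opp (one : C_Ring) by rewrite RtoC_opp.
exact: scal_opp_one.
Qed.

Lemma op_oppE T : opp (T : bop_AbelianGroup U) = op_scal (RtoC (-1)) T.
Proof. by []. Qed.

Lemma op_compA S T W : op_comp S (op_comp T W) = op_comp (op_comp S T) W.
Proof. exact: bop_eq. Qed.
Lemma op_comp1l T : op_comp (op_id U) T = T.
Proof. exact: bop_eq. Qed.
Lemma op_comp1r T : op_comp T (op_id U) = T.
Proof. exact: bop_eq. Qed.
Lemma op_compDl S T W : op_comp (plus S T) W = plus (op_comp S W) (op_comp T W).
Proof. exact: bop_eq. Qed.
Lemma op_compDr S T W : op_comp W (plus S T) = plus (op_comp W S) (op_comp W T).
Proof. by apply: bop_eq => x /=; rewrite (linear_plus _ (bop_linear W)). Qed.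
Lemma op_compZl c S T : op_comp (op_scal c S) T = op_scal c (op_comp S T).
Proof. exact: bop_eq. Qed.
Lemma op_compZr c S T : op_comp S (op_scal c T) = op_scal c (op_comp S T).
Proof. by apply: bop_eq => x /=; rewrite (linear_scal _ (bop_linear S)). Qed.
Lemma op_compBl S T W : op_comp (minus S T) W = minus (op_comp S W) (op_comp T W).
Proof. by rewrite /minus op_compDl !op_oppE op_compZl. Qed.
Lemma op_compBr S T W : op_comp W (minus S T) = minus (op_comp W S) (op_comp W T).
Proof. by rewrite /minus op_compDr !op_oppE op_compZr. Qed.
Lemma op_comp0l T : op_comp zero T = zero.
Proof. exact: bop_eq. Qed.
Lemma op_comp0r T : op_comp T zero = zero.
Proof. by apply: bop_eq => x /=; exact: linear_zero (bop_linear T). Qed.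

Lemma op_norm_comp S T : op_norm (op_comp S T) <= op_norm S * op_norm T.
Proof.
apply: op_norm_le => [|x].
  exact: Rmult_le_pos (op_norm_ge0 _) (op_norm_ge0 _).
apply: Rle_trans (norm_bop_le S (T x)) _; rewrite Rmult_assoc.
by apply: Rmult_le_compat_l (norm_bop_le T x); exact: op_norm_ge0.
Qed.

Lemma op_norm_id : op_norm (op_id U) <= 1.
Proof. by apply: op_norm_le => [|x]; [lra | rewrite Rmult_1_l; exact: Rle_refl]. Qed.

Lemma op_norm_minusC S T : op_norm (minus S T) = op_norm (minus T S).
Proof. exact: (@norm_minus_sym _ (bop_NormedModule U)). Qed.

Lemma op_norm_zero : op_norm (zero : bop_NormedModule U) = 0.
Proof. exact: (@norm_zero _ (bop_NormedModule U)). Qed.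

Lemma op_norm_minus_triangle S T W :
  op_norm (minus S W) <= op_norm (minus S T) + op_norm (minus T W).
Proof. exact: (@norm_minus_triangle _ (bop_NormedModule U)). Qed.

Lemma op_norm_plus S T : op_norm (plus S T) <= op_norm S + op_norm T.
Proof. exact: op_norm_triangle. Qed.

Lemma op_norm_scale c T : op_norm (op_scal c T) <= Cmod c * op_norm T.
Proof. exact: op_norm_scal. Qed.

Lemma op_norm_lower S T : op_norm S <= op_norm T + op_norm (minus S T).
Proof.
have := op_norm_minus_triangle S T zero; rewrite !minus_zero_r; lra.
Qed.

Lemma op_minus_small S T : (forall e, 0 < e -> op_norm (minus S T) <= e) -> S = T.
Proof.
move=> h; suff e : op_norm (minus S T) = 0.
  have := op_norm_eq0 e; rewrite -[X in _ = X -> _](minus_eq_zero (T : bop_AbelianGroup U)).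
  exact: plus_reg_r.
apply: Rle_antisym; last exact: op_norm_ge0.
by apply: le_epsilon => e e0; rewrite Rplus_0_l; exact: h.
Qed.

Lemma is_inverse_unique T S W : is_inverse T S -> is_inverse T W -> S = W.
Proof.
move=> [ST TS] [WT TW].
by rewrite -[S]op_comp1r -TW op_compA ST op_comp1l.
Qed.

Lemma op_invP T : (exists S, is_inverse T S) -> is_inverse T (op_inv T).
Proof. by move=> h; exact: epsilon_spec. Qed.

Lemma op_inv_eq T S : is_inverse T S -> op_inv T = S.
Proof.
move=> h; have hi : is_inverse T (op_inv T) by apply: op_invP; exists S.
exact: is_inverse_unique hi h.
Qed.

Lemma bop_seq_complete : seq_complete U -> seq_complete (bop_NormedModule U).
Proof.
move=> hU u cu.
have pt (n m : nat) x : norm (minus ((u n : B) x) ((u m : B) x)) <=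
    op_norm (minus (u n) (u m)) * norm x.
  by rewrite -bop_minusE; exact: norm_bop_le.
have hl x : exists l, norm_cvg (fun n => (u n : B) x) l.
  apply: hU => e e0; have x0 := norm_ge_0 x.
  have e1 : 0 < e / (norm x + 1) by apply: Rdiv_lt_0_compat; lra.
  have [N hN] := cu _ e1; exists N => n m hn hm.
  apply: Rle_lt_trans (pt n m x) _.
  have h : op_norm (minus (u n) (u m)) < e / (norm x + 1) := hN n m hn hm.
  have h0 := op_norm_ge0 (minus (u n) (u m)).
  apply: (@Rlt_le_trans _ (e / (norm x + 1) * (norm x + 1))).
    by nra.
  by right; field; lra.
pose g x := projT1 (constructive_indefinite_description _ (hl x)).
have gP x : norm_cvg (fun n => (u n : B) x) (g x).
  exact: (projT2 (constructive_indefinite_description _ (hl x))).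
have tail e : 0 < e -> exists N, forall n, (N <= n)%N -> forall x,
    norm (minus ((u n : B) x) (g x)) <= e * norm x.
  move=> e0; have [N hN] := cu e e0; exists N => n hn x.
  apply: le_epsilon => d d0; have [N' hN'] := gP x d d0.
  pose m := maxn N N'.
  have h1 := norm_minus_triangle ((u n : B) x) ((u m : B) x) (g x).
  have h2 := hN' m (leq_maxr _ _); have h3 := pt n m x.
  have h4 : op_norm (minus (u n) (u m)) < e := hN n m hn (leq_maxl _ _).
  have := norm_ge_0 x; nra.
have lin : is_linear g.
  split.
  - move=> x y; apply: (norm_cvg_unique (gP _)) => e e0; have e2 : 0 < e / 2 by lra.
    have [N hN] := gP x _ e2; have [N' hN'] := gP y _ e2.
    exists (maxn N N') => n hn.
    have h1 := hN n (leq_trans (leq_maxl _ _) hn).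
    have h2 := hN' n (leq_trans (leq_maxr _ _) hn).
    rewrite (linear_plus _ (bop_linear _)).
    have -> : minus (plus ((u n : B) x) ((u n : B) y)) (plus (g x) (g y)) =
       plus (minus ((u n : B) x) (g x)) (minus ((u n : B) y) (g y)).
      rewrite /minus opp_plus -!plus_assoc; congr plus.
      by rewrite plus_comm -plus_assoc; congr plus; exact: plus_comm.
    apply: Rle_lt_trans (norm_triangle _ _) _; lra.
  - move=> k x; apply: (norm_cvg_unique (gP _)) => e e0.
    have k0 : 0 <= abs k := abs_ge_0 k.
    have e1 : 0 < e / (abs k + 1) by apply: Rdiv_lt_0_compat; lra.
    have [N hN] := gP x _ e1; exists N => n hn.
    rewrite (linear_scal _ (bop_linear _)) -scal_minus_distr_l.
    have h := hN n hn; apply: Rle_lt_trans (norm_scal _ _) _.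
    apply: Rle_lt_trans (Rmult_le_compat_l _ _ _ k0 (Rlt_le _ _ h)) _.
    have -> : abs k * (e / (abs k + 1)) = e - e / (abs k + 1) by field; lra.
    lra.
  - have [N hN] := tail 1 Rlt_0_1; exists (op_norm (u N) + 2).
    have h0 := op_norm_ge0 (u N); split; first lra.
    move=> x; have h1 := hN N (leqnn _) x; have h2 := norm_bop_le (u N) x.
    have h3 := norm_minus_triangle (g x) ((u N : B) x) zero.
    rewrite (norm_minus_sym (g x) ((u N : B) x)) !minus_zero_r in h3.
    have := norm_ge_0 x; lra.
exists (MkBop lin : bop_NormedModule U) => e e0; have e2 : 0 < e / 2 by lra.
have [N hN] := tail _ e2; exists N => n hn.
apply: (@Rle_lt_trans _ (e / 2)); last lra.
apply: op_norm_le => [|x]; first lra.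
by rewrite bop_minusE; exact: hN.
Qed.

Fixpoint op_psum (a : nat -> B) (n : nat) : B :=
  if n is m.+1 then plus (op_psum a m) (a m) else zero.

Fixpoint op_pow (Y : B) (n : nat) : B :=
  if n is m.+1 then op_comp Y (op_pow Y m) else op_id U.

Lemma op_pow_norm Y k n : op_norm Y <= k -> op_norm (op_pow Y n) <= k ^ n.
Proof.
move=> hk; elim: n => [|n IH] /=; first exact: op_norm_id.
apply: Rle_trans (op_norm_comp _ _) _.
by apply: Rmult_le_compat => //; exact: op_norm_ge0.
Qed.

Lemma op_powSr Y n : op_comp (op_pow Y n) Y = op_comp Y (op_pow Y n).
Proof.
elim: n => [|n IH] /=; first by rewrite op_comp1l op_comp1r.
by rewrite -op_compA IH.
Qed.

Lemma op_psum_comp Y n :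
  op_comp (minus (op_id U) Y) (op_psum (op_pow Y) n) = minus (op_id U) (op_pow Y n).
Proof.
elim: n => [|n IH] /=; first by rewrite op_comp0r minus_eq_zero.
by rewrite op_compDr IH op_compBl op_comp1l -minus_trans.
Qed.

Lemma op_psum_compr Y n :
  op_comp (op_psum (op_pow Y) n) (minus (op_id U) Y) = minus (op_id U) (op_pow Y n).
Proof.
elim: n => [|n IH] /=; first by rewrite op_comp0l minus_eq_zero.
by rewrite op_compDl IH op_compBr op_comp1r op_powSr -minus_trans.
Qed.

Hypothesis complete : seq_complete U.

Lemma op_series_cvg (a : nat -> B) M k : 0 <= M -> 0 <= k < 1 ->
  (forall n, op_norm (a n) <= M * k ^ n) ->
  exists S, forall n, op_norm (minus S (op_psum a n)) <= M * k ^ n / (1 - k).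
Proof.
move=> M0 hk ha.
have step n j : op_norm (minus (op_psum a (n + j)) (op_psum a n)) <= M * k ^ n / (1 - k).
  suff h : op_norm (minus (op_psum a (n + j)) (op_psum a n)) <=
      M * k ^ n * (1 - k ^ j) / (1 - k).
    apply: Rle_trans h _; apply: Rmult_le_compat_r.
      by apply: Rlt_le; apply: Rinv_0_lt_compat; lra.
    have h1 : 0 <= k ^ j by apply: pow_le; lra.
    have h2 : 0 <= k ^ n by apply: pow_le; lra.
    have := Rmult_le_pos _ _ M0 h2; nra.
  elim: j => [|j IH].
    by rewrite addn0 minus_eq_zero op_norm_zero /=; right; field; lra.
  rewrite addnS /=.
  have -> : minus (plus (op_psum a (n + j)) (a (n + j)%N)) (op_psum a n) =
    plus (minus (op_psum a (n + j)) (op_psum a n)) (a (n + j)%N).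
    by rewrite /minus -!plus_assoc; congr plus; exact: plus_comm.
  apply: Rle_trans (op_norm_plus _ _) _.
  have := ha (n + j)%N; rewrite -plusE pow_add => h.
  apply: Rle_trans (Rplus_le_compat _ _ _ _ IH h) _; right; field; lra.
have [S hS] : exists S, norm_cvg (V := bop_NormedModule U) (op_psum a) S.
  apply: (bop_seq_complete complete) => e e0.
  have e1 : 0 < e * (1 - k) / (2 * (M + 1)).
    by apply: Rdiv_lt_0_compat; [apply: Rmult_lt_0_compat|]; lra.
  have [N hN] := pow_lt_1_zero k (Rabs_def1 _ _ (proj2 hk) ltac:(lra)) _ e1.
  have hs n j : (N <= n)%N -> op_norm (minus (op_psum a (n + j)) (op_psum a n)) < e.
    move=> /leP hn; apply: Rle_lt_trans (step n j) _.
    have kn : 0 <= k ^ n by apply: pow_le; lra.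
    have := hN n hn; rewrite Rabs_pos_eq // => h.
    apply: (@Rle_lt_trans _ ((M + 1) * (e * (1 - k) / (2 * (M + 1))) / (1 - k))).
      apply: Rmult_le_compat_r; first by apply: Rlt_le; apply: Rinv_0_lt_compat; lra.
      nra.
    have -> : (M + 1) * (e * (1 - k) / (2 * (M + 1))) / (1 - k) = e / 2 by field; lra.
    lra.
  exists N => n m hn hm; case: (leqP m n) => hmn.
    by rewrite -(subnKC hmn); exact: hs.
  rewrite norm_minus_sym -(subnKC (ltnW hmn)); exact: hs.
exists S => n; apply: le_epsilon => e e0; have [N hN] := hS e e0.
pose m := maxn N n.
have h1 : op_norm (minus (op_psum a m) S) < e := hN m (leq_maxl _ _).
have h2 := op_norm_minus_triangle S (op_psum a m) (op_psum a n).
rewrite op_norm_minusC in h1.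
have := step n (m - n)%N; rewrite subnKC ?leq_maxr // => h3; lra.
Qed.

Lemma pow_vanish k M e : 0 <= k < 1 -> 0 <= M -> 0 < e -> exists n, M * k ^ n < e.
Proof.
move=> hk M0 e0; have e1 : 0 < e / (M + 1) by apply: Rdiv_lt_0_compat; lra.
have [N hN] := pow_lt_1_zero k (Rabs_def1 _ _ (proj2 hk) ltac:(lra)) _ e1.
exists N; have := hN N (le_n _); rewrite Rabs_pos_eq; last by apply: pow_le; lra.
move=> h; apply: (@Rlt_le_trans _ ((M + 1) * (e / (M + 1)))); last by right; field; lra.
have : 0 <= k ^ N by apply: pow_le; lra.
nra.
Qed.

(** The geometric remainder is kept because the logarithmic series is later obtained by integrating
    these partial sums. *)
Lemma neumann Y k : 0 <= k < 1 -> op_norm Y <= k ->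
  exists S, [/\ is_inverse (minus (op_id U) Y) S, op_norm S <= / (1 - k) &
    forall n, op_norm (minus S (op_psum (op_pow Y) n)) <= k ^ n / (1 - k)].
Proof.
move=> hk hY.
have [S hS] : exists S, forall n,
    op_norm (minus S (op_psum (op_pow Y) n)) <= 1 * k ^ n / (1 - k).
  by apply: op_series_cvg => // [|n]; [lra | rewrite Rmult_1_l; exact: op_pow_norm].
exists S; split; last by move=> n; have := hS n; rewrite Rmult_1_l.
- pose I := op_id U; have ik : 0 < / (1 - k) by apply: Rinv_0_lt_compat; lra.
  have n0 := op_norm_ge0 (minus I Y).
  pose M := (op_norm (minus I Y) * / (1 - k) + 1).
  have M0 : 0 <= M by rewrite /M; nra.
  have small e : 0 < e -> exists n, op_norm (minus I Y) * op_norm (minus S (op_psum (op_pow Y) n)) + op_norm (op_pow Y n) < e.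
    move=> e0; have [n hn] := pow_vanish hk M0 e0; exists n; apply: Rle_lt_trans hn.
    have h1 := Rmult_le_compat_l _ _ _ n0 (hS n); have h2 := op_pow_norm n hY.
    rewrite /M; apply: Rle_trans (Rplus_le_compat _ _ _ _ h1 h2) _.
    by right; rewrite Rmult_1_l /Rdiv; ring.
  split; apply: op_minus_small => e /small [n hn]; apply: Rle_trans (Rlt_le _ _ hn).
  + apply: Rle_trans (op_norm_minus_triangle _ (op_comp (op_psum (op_pow Y) n) (minus I Y)) _) _.
    rewrite -op_compBl op_psum_compr; apply: Rplus_le_compat.
      by rewrite Rmult_comm; exact: op_norm_comp.
    by rewrite op_norm_minusC /minus opp_plus opp_opp plus_assoc plus_opp_r plus_zero_l; right.
  + apply: Rle_trans (op_norm_minus_triangle _ (op_comp (minus I Y) (op_psum (op_pow Y) n)) _) _.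
    rewrite -op_compBr op_psum_comp; apply: Rplus_le_compat.
      exact: op_norm_comp.
    by rewrite op_norm_minusC /minus opp_plus opp_opp plus_assoc plus_opp_r plus_zero_l; right.
- have := hS 0%N; rewrite /= minus_zero_r => h; apply: Rle_trans h _.
  by right; field; lra.
Qed.

(** [X' = X (I - S (X - X'))], and the Neumann series inverts the second factor with norm at most
    2. *)
Lemma is_inverse_near X X' S : is_inverse X S ->
  op_norm S * op_norm (minus X X') <= / 2 ->
  exists S', is_inverse X' S' /\ op_norm S' <= 2 * op_norm S.
Proof.
move=> [SX XS] h; pose Y := op_comp S (minus X X').
have hY : op_norm Y <= / 2 by apply: Rle_trans (op_norm_comp _ _) h.
have [W [[WY YW] nW _]] := neumann (k := / 2) ltac:(lra) hY.
have e : op_comp S X' = minus (op_id U) Y.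
  rewrite /Y op_compBr SX /minus opp_plus opp_opp plus_assoc plus_opp_r.
  by rewrite plus_zero_l.
have e' : X' = op_comp X (minus (op_id U) Y) by rewrite -e op_compA XS op_comp1l.
exists (op_comp W S); split.
  split; first by rewrite -op_compA e.
  by rewrite {1}e' -op_compA (op_compA _ W) YW op_comp1l.
apply: Rle_trans (op_norm_comp _ _) _; apply: Rmult_le_compat_r (op_norm_ge0 _) _.
by apply: Rle_trans nW _; lra.
Qed.

Lemma inverse_difference X X' S S' : is_inverse X S -> is_inverse X' S' ->
  minus S' S = op_comp S' (op_comp (minus X X') S).
Proof.
move=> [SX XS] [SX' XS'].
by rewrite op_compBl op_compBr XS op_comp1r op_compA SX' op_comp1l.
Qed.

(** Applying [S' - S = S' (X - X') S] twice turns the left side into [S' (X - X') S (X - X') S].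
    This quadratic remainder is the source of the derivatives of resolvents below. *)
Lemma inverse_second_order X X' S : is_inverse X S ->
  op_norm S * op_norm (minus X X') <= / 2 ->
  op_norm (minus (minus (op_inv X') S) (op_comp S (op_comp (minus X X') S))) <=
  2 * op_norm S ^ 3 * op_norm (minus X X') ^ 2.
Proof.
move=> iS h; have [S' [iS' nS']] := is_inverse_near iS h.
rewrite (op_inv_eq iS') (inverse_difference iS iS') -op_compBl (inverse_difference iS iS').
have s0 := op_norm_ge0 S; have d0 := op_norm_ge0 (minus X X').
set D := op_comp (minus X X') S.
have hD : op_norm D <= op_norm (minus X X') * op_norm S := op_norm_comp _ _.
have hD0 := op_norm_ge0 D.
apply: Rle_trans (op_norm_comp _ _) _.
apply: Rle_trans (Rmult_le_compat_r _ _ _ hD0 (op_norm_comp _ _)) _.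
apply: (@Rle_trans _ (2 * op_norm S * (op_norm (minus X X') * op_norm S) *
   (op_norm (minus X X') * op_norm S))); last by right; ring.
apply: Rmult_le_compat => //; last by apply: Rmult_le_compat => //; exact: op_norm_ge0.
by apply: Rmult_le_pos => //; exact: op_norm_ge0.
Qed.

End OperatorAlgebra.

(** * The norm of an affine function of the adjacency operator *)

Lemma Rsum_le (I : eqType) (s : seq I) (a b : I -> R) : (forall i, i \in s -> a i <= b i) ->
  \big[Rplus/0]_(i <- s) a i <= \big[Rplus/0]_(i <- s) b i.
Proof.
move=> h; rewrite big_seq [X in _ <= X]big_seq.
apply: (big_ind2 (fun x y => x <= y)); [lra| |exact: h].
by move=> *; lra.
Qed.

Lemma Rsum_scal (I : Type) (s : seq I) c (a : I -> R) :
  \big[Rplus/0]_(i <- s) (c * a i) = c * \big[Rplus/0]_(i <- s) a i.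
Proof. by elim: s => [|i s IH]; rewrite ?big_nil ?big_cons ?IH; ring. Qed.

Lemma Rsum_ge0 (I : Type) (s : seq I) (a : I -> R) :
  (forall i, 0 <= a i) -> 0 <= \big[Rplus/0]_(i <- s) a i.
Proof. by move=> h; apply: (big_ind (fun r => 0 <= r)) => [|x y hx hy|i _]; [lra|lra|exact: h]. Qed.

Lemma Cmod_sqr_plus (x y : C) :
  Cmod (x + y)%C ^ 2 = Cmod x ^ 2 + Cmod y ^ 2 + 2 * fst (x * Cconj y)%C.
Proof. by rewrite !Cmod2_alt /Re /Im /=; ring. Qed.

Lemma sumsq_subset (V : countType) (f : V -> C) (A B : {fset V}) :
  (A `<=` B)%fset -> sumsq f A <= sumsq f B.
Proof.
move=> AB; rewrite /sumsq [X in _ <= X](bigID (fun x => x \in A)) /=.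
have -> : \big[Rplus/0]_(x <- B | x \in A) Cmod (f x) ^ 2 = \big[Rplus/0]_(x <- A) Cmod (f x) ^ 2.
  rewrite -big_filter; apply: perm_big; apply: uniq_perm.
  - exact: filter_uniq (fset_uniq _).
  - exact: fset_uniq.
  - move=> x; rewrite mem_filter; case hx: (x \in A) => //=.
    by move/fsubsetP: AB => /(_ x hx) ->.
rewrite -[X in _ + X]big_filter.
rewrite -[X in X <= _]Rplus_0_r; apply: Rplus_le_compat_l.
by apply: Rsum_ge0 => x; exact: pow2_ge_0.
Qed.

Section AffineNorm.
Variables (X : graph) (d : nat).
Hypothesis deg_le : forall v : VX X, (deg v <= d)%N.
Notation H := (l2_NormedModule (VX X)).

(** By symmetry of adjacency, the sum of [f v] times the conjugate of [A f v] is real, so only the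
    real part of [c] survives. Then [|f v| |f w|] is at most half of [|f v|^2 + |f w|^2], and each
    vertex occurs in at most [d] pairs. *)
Lemma adj_form (f : l2 (VX X)) (A B : {fset VX X}) (c : C) :
  (forall x, x \notin A -> f x = RtoC 0) -> (A `<=` B)%fset ->
  Rabs (\big[Rplus/0]_(v <- B) fst (c * (f v * Cconj (adj_fun f v)))%C) <=
  Rabs (fst c) * (INR d * l2_norm f ^ 2).
Proof.
move=> f0 AB.
pose r v w := if w \in nbr v then fst (f v * Cconj (f w))%C else 0.
pose i v w := if w \in nbr v then snd (f v * Cconj (f w))%C else 0.
have step v : fst (c * (f v * Cconj (adj_fun f v)))%C =
    \big[Rplus/0]_(w <- A) (fst c * r v w - snd c * i v w).
  transitivity (\big[Rplus/0]_(w <- nbr v) fst (c * (f v * Cconj (f w)))%C).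
    rewrite /adj_fun; apply: (big_morph (fun z => fst (c * (f v * Cconj z))%C)).
      by move=> x y /=; ring.
    by rewrite /=; ring.
  transitivity (\big[Rplus/0]_(w <- A | w \in nbr v) fst (c * (f v * Cconj (f w)))%C).
    rewrite (bigID (fun w => w \in A)) /= [X in _ + X]big1 ?Rplus_0_r; last first.
      by move=> w hw; rewrite (f0 w) //=; ring.
    rewrite -[LHS]big_filter -[RHS]big_filter; apply: perm_big; apply: uniq_perm.
    - exact: filter_uniq (nbr_uniq _).
    - exact: filter_uniq (fset_uniq _).
    - by move=> w; rewrite !mem_filter andbC.
  rewrite big_mkcond; apply: eq_bigr => w _; rewrite /r /i.
  by case: (w \in nbr v); rewrite /=; ring.
have -> : \big[Rplus/0]_(v <- B) fst (c * (f v * Cconj (adj_fun f v)))%C =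
    \big[Rplus/0]_(v <- A) fst (c * (f v * Cconj (adj_fun f v)))%C.
  rewrite (bigID (fun w => w \in A)) /= [X in _ + X]big1 ?Rplus_0_r; last first.
    by move=> w hw; rewrite (f0 w) //=; ring.
  rewrite -[LHS]big_filter; apply: perm_big; apply: uniq_perm.
  - exact: filter_uniq (fset_uniq _).
  - exact: fset_uniq.
  - move=> w; rewrite mem_filter; case hw: (w \in A) => //=.
    by move/fsubsetP: AB => /(_ w hw) ->.
rewrite (eq_bigr _ (fun v _ => step v)).
have split2 v : \big[Rplus/0]_(w <- A) (fst c * r v w - snd c * i v w) =
    fst c * \big[Rplus/0]_(w <- A) r v w + - snd c * \big[Rplus/0]_(w <- A) i v w.
  rewrite -!Rsum_scal -big_split; apply: eq_bigr => w _ /=; ring.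
rewrite (eq_bigr _ (fun v _ => split2 v)) big_split !Rsum_scal /=.
(* Exchanging the two variables changes the sign of [i]. *)
have -> : \big[Rplus/0]_(v <- A) \big[Rplus/0]_(w <- A) i v w = 0.
  have : \big[Rplus/0]_(v <- A) \big[Rplus/0]_(w <- A) i v w =
      - 1 * \big[Rplus/0]_(v <- A) \big[Rplus/0]_(w <- A) i v w.
    rewrite [LHS]exchange_big /= -Rsum_scal; apply: eq_bigr => v _.
    rewrite -Rsum_scal; apply: eq_bigr => w _; rewrite /i nbr_sym.
    by case: (w \in nbr v) => /=; ring.
  lra.
rewrite Rmult_0_r Rplus_0_r Rabs_mult.
apply: Rmult_le_compat_l (Rabs_pos _) _.
pose F v := Cmod (f v) ^ 2; have F0 v : 0 <= F v by exact: pow2_ge_0.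
have cnt w : \big[Rplus/0]_(v <- A) (if w \in nbr v then F w else 0) <= INR d * F w.
  have -> : \big[Rplus/0]_(v <- A) (if w \in nbr v then F w else 0) =
      INR (count (fun v => w \in nbr v) A) * F w.
    elim: (A : seq _) => [|v s IH]; first by rewrite big_nil /=; ring.
    rewrite big_cons /= IH; case: (w \in nbr v); last by rewrite add0n Rplus_0_l.
    by rewrite add1n S_INR Rmult_plus_distr_r Rmult_1_l; exact: Rplus_comm.
  apply: Rmult_le_compat_r; first exact: F0.
  apply/le_INR/leP; apply: leq_trans (deg_le w); rewrite -size_filter.
  apply: uniq_leq_size; first exact: filter_uniq (fset_uniq _).
  by move=> v; rewrite mem_filter => /andP [h _]; rewrite nbr_sym.
have hr v w : Rabs (r v w) <= / 2 * (if w \in nbr v then F w else 0)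
    + / 2 * (if v \in nbr w then F v else 0).
  rewrite /r (nbr_sym v w); case: (v \in nbr w); last by rewrite Rabs_R0; lra.
  apply: Rle_trans (Cmod_fst _) _; rewrite Cmod_mult Cmod_conj /F.
  have := pow2_ge_0 (Cmod (f v) - Cmod (f w)); lra.
have tri (s : seq (VX X)) (a : VX X -> R) :
    Rabs (\big[Rplus/0]_(v <- s) a v) <= \big[Rplus/0]_(v <- s) Rabs (a v).
  apply: (big_ind2 (fun x y => Rabs x <= y)) => [|x1 x2 y1 y2 h1 h2|v _].
  - by rewrite Rabs_R0; lra.
  - by apply: Rle_trans (Rabs_triang _ _) _; lra.
  - exact: Rle_refl.
apply: Rle_trans (tri _ _) _.
apply: (@Rle_trans _ (\big[Rplus/0]_(v <- A) \big[Rplus/0]_(w <- A)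
   (/ 2 * (if w \in nbr v then F w else 0) + / 2 * (if v \in nbr w then F v else 0)))).
  apply: Rsum_le => v _; apply: Rle_trans (tri _ _) _; apply: Rsum_le => w _; exact: hr.
have -> : \big[Rplus/0]_(v <- A) \big[Rplus/0]_(w <- A)
   (/ 2 * (if w \in nbr v then F w else 0) + / 2 * (if v \in nbr w then F v else 0)) =
   \big[Rplus/0]_(w <- A) \big[Rplus/0]_(v <- A) (if w \in nbr v then F w else 0).
  transitivity (/ 2 * (\big[Rplus/0]_(v <- A) \big[Rplus/0]_(w <- A) (if w \in nbr v then F w else 0))
     + / 2 * (\big[Rplus/0]_(v <- A) \big[Rplus/0]_(w <- A) (if v \in nbr w then F v else 0))).
    rewrite -!Rsum_scal -big_split; apply: eq_bigr => v _ /=.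
    by rewrite -!Rsum_scal -big_split.
  rewrite [X in / 2 * X + _]exchange_big /=; lra.
apply: Rle_trans (Rsum_le (b := fun w => INR d * F w) _) _.
  by move=> w _; exact: cnt.
rewrite Rsum_scal; apply: Rmult_le_compat_l; [exact: pos_INR | exact: sumsq_le_norm].
Qed.

(** Replaces the spectral theorem: expand the square of the modulus of [a f + b A f], bound the
    quadratic term by [|A f| <= d |f|] and the cross term by [adj_form]. This is done for finite
    support and extended by density. *)
Lemma affine_norm (a b : C) (rho : R) :
  Cmod (a + RtoC (INR d) * b)%C <= rho -> Cmod (a - RtoC (INR d) * b)%C <= rho ->
  op_norm (plus (op_scal a (op_id H)) (op_scal b (adjacency X))) <= rho.
Proof.
move=> h1 h2; have r0 : 0 <= rho by apply: Rle_trans h1; exact: Cmod_ge_0.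
have hd := pos_INR d.
set T := plus _ _.
(* The left side is the larger of the squared moduli of [a + d b] and [a - d b], and it is exactly
   what the estimates of the three terms add up to. *)
have key : Cmod a ^ 2 + Cmod b ^ 2 * INR d ^ 2 + 2 * INR d * Rabs (fst (a * Cconj b)%C) <= rho ^ 2.
  have s1 : Cmod (a + RtoC (INR d) * b)%C ^ 2 <= rho ^ 2.
    by apply: pow_incr; split=> //; exact: Cmod_ge_0.
  have s2 : Cmod (a - RtoC (INR d) * b)%C ^ 2 <= rho ^ 2.
    by apply: pow_incr; split=> //; exact: Cmod_ge_0.
  move: s1 s2; rewrite /Cminus !Cmod_sqr_plus Cmod_opp Cmod_mult Cmod_R Rabs_pos_eq //.
  have -> : fst (a * Cconj (RtoC (INR d) * b))%C = INR d * fst (a * Cconj b)%C by rewrite /=; ring.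
  have -> : fst (a * Cconj (- (RtoC (INR d) * b)))%C = - (INR d * fst (a * Cconj b)%C) by rewrite /=; ring.
  by rewrite /Rabs; case: Rcase_abs => _; nra.
have fin (f : l2 (VX X)) (A : {fset VX X}) : (forall x, x \notin A -> f x = RtoC 0) ->
    l2_norm (T f) <= rho * l2_norm f.
  move=> f0; have n0 := l2_norm_ge0 f.
  apply: l2_norm_le => [|B]; first exact: Rmult_le_pos.
  pose W := (A `|` B)%fset.
  have -> : (rho * l2_norm f) ^ 2 = rho ^ 2 * l2_norm f ^ 2 by ring.
  have hsub : sumsq (T f : l2 _) B <= sumsq (T f : l2 _) W.
    exact: sumsq_subset (fsubsetUr _ _).
  apply: Rle_trans hsub _.
  have exp x : Cmod ((T f : l2 _) x) ^ 2 = Cmod a ^ 2 * Cmod (f x) ^ 2 +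
      (Cmod b ^ 2 * Cmod (adj_fun f x) ^ 2 +
      2 * fst ((a * Cconj b) * (f x * Cconj (adj_fun f x)))%C).
    have -> : (T f : l2 _) x = (a * f x + b * adj_fun f x)%C by [].
    rewrite Cmod_sqr_plus !Cmod_mult.
    have -> : (a * f x * Cconj (b * adj_fun f x) = a * Cconj b * (f x * Cconj (adj_fun f x)))%C.
      by rewrite Cmult_conj; ring.
    ring.
  rewrite /sumsq (eq_bigr _ (fun x _ => exp x)) !big_split !Rsum_scal.
  have q1 := sumsq_le_norm f W.
  have q2 : sumsq (adj_fun f) W <= (INR d * l2_norm f) ^ 2 := sumsq_adj _ _ deg_le.
  have q3 := adj_form (a * Cconj b)%C f0 (fsubsetUl A B).
  have q4 := Rle_abs (\big[Rplus/0]_(v <- W) fst (a * Cconj b * (f v * Cconj (adj_fun f v)))%C).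
  move: q3 q4; rewrite -/W; set Z := \big[_/_]_(v <- W) fst _ => q3 q4.
  have p1 := Rmult_le_compat_l _ _ _ (pow2_ge_0 (Cmod a)) q1.
  have p2 := Rmult_le_compat_l _ _ _ (pow2_ge_0 (Cmod b)) q2.
  have p3 := Rmult_le_compat_r _ _ _ (pow2_ge_0 (l2_norm f)) key.
  move: p1 p2; rewrite /sumsq => p1 p2.
  apply: Rle_trans p3.
  have q5 := Rle_trans _ _ _ q4 q3.
  apply: Rle_trans (Rplus_le_compat _ _ _ _ p1 (Rplus_le_compat _ _ _ _ p2
    (Rmult_le_compat_l 2 _ _ _ q5))) _; first lra.
  by right; ring.
apply: op_norm_le => // f; apply: le_epsilon => e e0.
have t0 := op_norm_ge0 T.
have e1 : 0 < e / (op_norm T + rho + 1) by apply: Rdiv_lt_0_compat; lra.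
have [A hA] := fin_comb_dense f e1.
set g := fin_comb f A in hA.
have hg : l2_norm (T g) <= rho * l2_norm g.
  by apply: (fin _ A) => x xA; rewrite fin_combE ?fset_uniq // (negbTE xA).
have t1 := norm_minus_triangle (T f) (T g) zero.
have t2 := norm_minus_triangle g f zero.
rewrite !minus_zero_r in t1 t2; rewrite (norm_minus_sym g f) in t2.
have t3 : norm (minus (T f) (T g)) <= op_norm T * norm (minus (f : H) g).
  have -> : minus (T f) (T g) = T (minus (f : H) g).
    by rewrite /minus (linear_plus _ (bop_linear T)) (linear_opp _ _ (bop_linear T)).
  exact: norm_bop_le.
have t4 := norm_ge_0 (minus (f : H) g).
have t5 : norm (T g) <= rho * norm g := hg.
have t6 := Rmult_le_compat_l _ _ _ r0 t2.
have t7 : (op_norm T + rho) * norm (minus (f : H) g) <= e.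
  apply: (@Rle_trans _ ((op_norm T + rho + 1) * (e / (op_norm T + rho + 1)))); last by right; field; lra.
  by apply: Rmult_le_compat; lra.
change (norm (T f) <= rho * norm (f : H) + e); lra.
Qed.

End AffineNorm.

(** * Contour integrals *)

Lemma norm_C_R (z : C) : norm (z : C_R_NormedModule) = Cmod z.
Proof. by rewrite /norm /= /prod_norm /Cmod !pow2_abs. Qed.

Lemma is_derive_epsP (V : NormedModule R_AbsRing) (f : R -> V) x l :
  is_derive f x l <-> forall e, 0 < e -> exists2 d, 0 < d &
    forall y, Rabs (y - x) < d ->
      norm (minus (minus (f y) (f x)) (scal (y - x) l)) <= e * Rabs (y - x).
Proof.
split=> [[_ /(_ x (fun P h => h)) h] e e0|h].
  have [d hd] := h (mkposreal e e0).
  by exists d; [exact: cond_pos | move=> y hy; exact: (hd y hy)].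
split; first exact: is_linear_scal_l.
move=> x' hx'; have <- : x = x' by apply: is_filter_lim_locally_unique hx'.
move=> e; have [d d0 hd] := h e (cond_pos e).
by exists (mkposreal d d0) => y hy; exact: hd.
Qed.

Lemma is_derive_CP (f : R -> C) x (l : C) :
  is_derive (V := C_R_NormedModule) f x l <-> forall e, 0 < e -> exists2 d, 0 < d &
    forall y, Rabs (y - x) < d ->
      Cmod (f y - f x - RtoC (y - x) * l)%C <= e * Rabs (y - x).
Proof.
have e1 y : minus (minus (f y : C_R_NormedModule) (f x)) (scal (y - x) (l : C_R_NormedModule)) =
    (f y - f x - RtoC (y - x) * l)%C.
  apply: injective_projections.
    change (fst (f y) + - fst (f x) + - ((y - x) * fst l) =
      fst (f y) + - fst (f x) + - ((y - x) * fst l - 0 * snd l) :> R); ring.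
  change (snd (f y) + - snd (f x) + - ((y - x) * snd l) =
      snd (f y) + - snd (f x) + - ((y - x) * snd l + 0 * fst l) :> R); ring.
split=> [/is_derive_epsP h e e0|h].
  have [d d0 hd] := h e e0; exists d => // y hy.
  by rewrite -e1 -norm_C_R; exact: hd.
apply/is_derive_epsP => e e0; have [d d0 hd] := h e e0; exists d => // y hy.
by rewrite norm_C_R e1; exact: hd.
Qed.

Lemma is_derive_CRP (f : R -> R) x l :
  is_derive f x l <-> forall e, 0 < e -> exists2 d, 0 < d &
    forall y, Rabs (y - x) < d -> Rabs (f y - f x - (y - x) * l) <= e * Rabs (y - x).
Proof. exact: is_derive_epsP. Qed.

Lemma is_derive_Cfst (f : R -> C) x (l : C) :
  is_derive (V := C_R_NormedModule) f x l -> is_derive (fun t => fst (f t)) x (fst l).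
Proof.
move/is_derive_CP => h; apply/is_derive_CRP => e e0; have [d d0 hd] := h e e0.
exists d => // y hy; apply: Rle_trans (hd y hy); apply: Rle_trans (Cmod_fst _).
have h2 : fst (f y - f x - RtoC (y - x) * l)%C = fst (f y) - fst (f x) - (y - x) * fst l.
  by rewrite /=; ring.
by rewrite h2; right.
Qed.

Lemma is_derive_Csnd (f : R -> C) x (l : C) :
  is_derive (V := C_R_NormedModule) f x l -> is_derive (fun t => snd (f t)) x (snd l).
Proof.
move/is_derive_CP => h; apply/is_derive_CRP => e e0; have [d d0 hd] := h e e0.
exists d => // y hy; apply: Rle_trans (hd y hy); apply: Rle_trans (Cmod_snd _).
have h2 : snd (f y - f x - RtoC (y - x) * l)%C = snd (f y) - snd (f x) - (y - x) * snd l.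
  by rewrite /=; ring.
by rewrite h2; right.
Qed.

(** The exceptional points, taken one at a time, cut the interval into pieces where the mean value
    theorem applies; continuity glues the pieces. *)
Lemma const_finite_derive_R (F : R -> R) s a b : a <= b ->
  (forall t, a <= t <= b -> continuous F t) ->
  (forall t, a < t < b -> ~ List.In t s -> is_derive F t 0) -> F b = F a.
Proof.
elim: s a b => [|x s IH] a b ab cF dF.
  have [c [_ hc]] : exists c, Rmin a b <= c <= Rmax a b /\ F b - F a = 0 * (b - a).
    apply: (MVT_gen F a b (fun=> 0)); rewrite Rmin_left // Rmax_right // => t ht.
      exact: dF.
    by apply/continuity_pt_filterlim; exact: cF.
  by lra.
case: (Rlt_le_dec a x) => hax; last first.
  apply: IH => // t ht ns; apply: dF => // -[e|//]; lra.
case: (Rlt_le_dec x b) => hxb; last first.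
  apply: IH => // t ht ns; apply: dF => // -[e|//]; lra.
transitivity (F x); apply: IH; try lra.
- by move=> t ht; apply: cF; lra.
- by move=> t ht ns; apply: dF; [lra | case=> [e|//]; lra].
- by move=> t ht; apply: cF; lra.
- by move=> t ht ns; apply: dF; [lra | case=> [e|//]; lra].
Qed.

Lemma const_finite_derive (F : R -> C) s a b : a <= b ->
  (forall t, a <= t <= b -> continuous F t) ->
  (forall t, a < t < b -> ~ List.In t s -> is_derive (V := C_R_NormedModule) F t (RtoC 0)) ->
  F b = F a.
Proof.
move=> ab cF dF; apply: injective_projections.
  apply: (@const_finite_derive_R (fun t => fst (F t)) s) => // t ht.
    exact: continuous_Cfst (cF t ht).
  by move=> ns; exact: is_derive_Cfst (dF t ht ns).
apply: (@const_finite_derive_R (fun t => snd (F t)) s) => // t ht.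
  exact: continuous_Csnd (cF t ht).
by move=> ns; exact: is_derive_Csnd (dF t ht ns).
Qed.

Lemma continuous_CP (T : UniformSpace) (f : T -> C) x :
  continuous f x <-> forall e, 0 < e -> locally x (fun y => Cmod (f y - f x)%C < e).
Proof.
split=> [h e e0|h P /locally_Cmod [e e0 he]].
  by apply (h (fun w => Cmod (w - f x)%C < e)); apply/locally_Cmod; exists e.
change (locally x (fun y => P (f y))).
by apply: filter_imp (h e e0) => y; exact: he.
Qed.

Definition pw_continuous (f : R -> C) : Prop :=
  [/\ exists s : seq R, forall t, 0 < t < 1 -> ~ List.In t s -> continuous f t,
      forall t, 0 <= t < 1 -> exists l : C, filterlim f (at_right t) (locally l) &
      forall t, 0 < t <= 1 -> exists l : C, filterlim f (at_left t) (locally l)].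

(** Between two exceptional points the one-sided limits extend [f] to a continuous function, and the
    values of [f] at the end points do not affect the integral. *)
Lemma ex_RInt_pw (f : R -> C) a b : pw_continuous f -> 0 <= a -> a <= b -> b <= 1 ->
  ex_RInt (V := C_R_NormedModule) f a b.
Proof.
case=> -[s hs] hr hl a0 ab b1.
have : forall t, a < t < b -> ~ List.In t s -> continuous f t.
  by move=> t ht; apply: hs; lra.
elim: s {hs} a b a0 ab b1 => [|x s IH] a b a0 ab b1 hs.
  case: ab => [ab|<-]; last exact: ex_RInt_point.
  have [la hla] := hr a ltac:(lra); have [lb hlb] := hl b ltac:(lra).
  have [g [cg [eg _]]] := @C0_extension_lt C_UniformSpace f la lb a b ab
    (fun c hc => hs c hc (fun h => h)) hla hlb.
  apply: (@ex_RInt_ext C_R_NormedModule g).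
    by move=> t; rewrite Rmin_left ?Rmax_right; try lra; exact: eg.
  by apply: (@ex_RInt_continuous C_R_CompleteNormedModule) => z _; exact: cg.
case: (Rlt_le_dec a x) => hax; last first.
  apply: IH => // t ht ns; apply: hs => // -[e|//]; lra.
case: (Rlt_le_dec x b) => hxb; last first.
  apply: IH => // t ht ns; apply: hs => // -[e|//]; lra.
apply: (ex_RInt_Chasles _ a x b); apply: IH; try lra.
- by move=> t ht ns; apply: hs; [lra | case=> [e|//]; lra].
- by move=> t ht ns; apply: hs; [lra | case=> [e|//]; lra].
Qed.

Lemma filterlim_Cmult (T : Type) (F : (T -> Prop) -> Prop) {FF : Filter F}
    (f g : T -> C) (a b : C) :
  filterlim f F (locally a) -> filterlim g F (locally b) ->
  filterlim (fun t => f t * g t)%C F (locally (a * b)%C).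
Proof.
move=> hf hg.
have c := @continuous_Cmult (prod_UniformSpace C_UniformSpace C_UniformSpace) fst snd (a, b)
  (@continuous_fst C_UniformSpace C_UniformSpace a b) (@continuous_snd C_UniformSpace C_UniformSpace a b).
refine (filterlim_comp_2 f g Cmult hf hg _).
move=> P hP; have [e he] := c P hP.
by exists (ball a e) (ball b e); [exact: locally_ball|exact: locally_ball|move=> x y hx hy; exact: (he (x, y))].
Qed.

Lemma within_at_right (f : R -> C) t : 0 <= t < 1 -> continuous_on unit_interval f ->
  filterlim f (at_right t) (locally (f t)).
Proof.
move=> ht cf P hP; have ut : unit_interval t by rewrite /unit_interval; lra.
have [d hd] := cf t ut P hP.
have d0 : 0 < Rmin d (1 - t) by apply: Rmin_pos; [exact: cond_pos | lra].
exists (mkposreal _ d0) => y hy ty.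
have hy' : Rabs (y - t) < Rmin d (1 - t) := hy.
have h1 := Rmin_l d (1 - t); have h2 := Rmin_r d (1 - t).
apply: hd; first by apply: (Rlt_le_trans _ _ _ hy').
by move: hy'; rewrite /unit_interval /Rabs; case: Rcase_abs => ? ?; lra.
Qed.

Lemma within_at_left (f : R -> C) t : 0 < t <= 1 -> continuous_on unit_interval f ->
  filterlim f (at_left t) (locally (f t)).
Proof.
move=> ht cf P hP; have ut : unit_interval t by rewrite /unit_interval; lra.
have [d hd] := cf t ut P hP.
have d0 : 0 < Rmin d t by apply: Rmin_pos; [exact: cond_pos | lra].
exists (mkposreal _ d0) => y hy ty.
have hy' : Rabs (y - t) < Rmin d t := hy.
have h1 := Rmin_l d t; have h2 := Rmin_r d t.
apply: hd; first by apply: (Rlt_le_trans _ _ _ hy').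
by move: hy'; rewrite /unit_interval /Rabs; case: Rcase_abs => ? ?; lra.
Qed.

Lemma within_interior (T : UniformSpace) (f : R -> T) t : 0 < t < 1 ->
  continuous_on unit_interval f -> continuous f t.
Proof.
move=> ht cf P hP; have ut : unit_interval t by rewrite /unit_interval; lra.
have [d hd] := cf t ut P hP.
have d0 : 0 < Rmin d (Rmin t (1 - t)).
  by apply: Rmin_pos; [exact: cond_pos | apply: Rmin_pos; lra].
exists (mkposreal _ d0) => y hy.
have hy' : Rabs (y - t) < Rmin d (Rmin t (1 - t)) := hy.
have h1 := Rmin_l d (Rmin t (1 - t)); have h2 := Rmin_r d (Rmin t (1 - t)).
have h3 := Rmin_l t (1 - t); have h4 := Rmin_r t (1 - t).
apply: hd; first by apply: (Rlt_le_trans _ _ _ hy').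
by move: hy'; rewrite /unit_interval /Rabs; case: Rcase_abs => ? ?; lra.
Qed.

(** Extends a function on [[0,1]] to the line by its end values, so that relative continuity on
    [[0,1]] becomes continuity everywhere. *)
Definition clamp (t : R) : R := Rmax 0 (Rmin 1 t).

Lemma clampE t : 0 <= t <= 1 -> clamp t = t.
Proof. by move=> h; rewrite /clamp Rmin_right ?Rmax_right; lra. Qed.

Lemma clamp_unit t : unit_interval (clamp t).
Proof.
by split; [exact: Rmax_l | apply: Rmax_lub; [lra | exact: Rmin_l]].
Qed.

Lemma clamp_lip s t : Rabs (clamp s - clamp t) <= Rabs (s - t).
Proof.
rewrite /clamp /Rmax /Rmin /Rabs.
by repeat destruct (Rle_dec _ _); repeat destruct (Rcase_abs _); lra.
Qed.

Lemma continuous_clamp (T : UniformSpace) (f : R -> T) t :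
  continuous_on unit_interval f -> continuous (fun s => f (clamp s)) t.
Proof.
move=> cf P hP; have [d hd] := cf (clamp t) (clamp_unit t) P hP.
exists d => y hy; apply: hd; last exact: clamp_unit.
exact: Rle_lt_trans (clamp_lip y t) hy.
Qed.

Lemma locally_clamp t : 0 < t < 1 -> locally t (fun s => clamp s = s).
Proof.
move=> ht; have d0 : 0 < Rmin t (1 - t) by apply: Rmin_pos; lra.
exists (mkposreal _ d0) => y hy; have hy' : Rabs (y - t) < Rmin t (1 - t) := hy.
have h1 := Rmin_l t (1 - t); have h2 := Rmin_r t (1 - t).
by apply: clampE; move: hy'; rewrite /Rabs; case: Rcase_abs => ? ?; lra.
Qed.

Lemma continuous_on_bounded (f : R -> C) : continuous_on unit_interval f ->
  exists M, forall t, unit_interval t -> Cmod (f t) <= M.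
Proof.
move=> cf.
have ex : ex_RInt (V := C_R_NormedModule) (fun s => f (clamp s)) 0 1.
  by apply: (@ex_RInt_continuous C_R_CompleteNormedModule) => z _; exact: (@continuous_clamp C_UniformSpace f z cf).
have [M hM] := ex_RInt_ub _ _ _ ex; exists M => t ut.
have := hM t; rewrite Rmin_left ?Rmax_right; try lra.
by rewrite norm_C_R clampE // => h; apply: h.
Qed.

Section ContourIntegral.
Variables gam dgam : R -> C.
Hypothesis C1 : piecewise_C1 gam dgam.

Lemma gam_continuous : continuous_on unit_interval gam.
Proof. by case: C1. Qed.

Lemma dgam_pw : pw_continuous dgam.
Proof.
case: C1 => _ [[s hs] [hr hl]]; split=> //; exists s => t ht ns.
by have [] := hs t ht ns.
Qed.

(** The line integral of [k] along the path, written through the given [dgam] so that it matches the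
    integrals in [boundary_path] and [is_log]. *)
Definition cint (k : R -> C) : C :=
  RInt (V := C_R_CompleteNormedModule) (fun t => k t * dgam t)%C 0 1.

Lemma pw_continuous_mult (k : R -> C) : continuous_on unit_interval k ->
  pw_continuous (fun t => k t * dgam t)%C.
Proof.
move=> ck; have [[s hs] hr hl] := dgam_pw; split.
- exists s => t ht ns; apply: continuous_Cmult; last exact: hs.
  exact: within_interior ht ck.
- move=> t ht; have [l h] := hr t ht; exists (k t * l)%C.
  by apply: filterlim_Cmult => //; exact: within_at_right.
- move=> t ht; have [l h] := hl t ht; exists (k t * l)%C.
  by apply: filterlim_Cmult => //; exact: within_at_left.
Qed.

Lemma cint_correct (k : R -> C) : continuous_on unit_interval k ->
  is_RInt (V := C_R_NormedModule) (fun t => k t * dgam t)%C 0 1 (cint k).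
Proof.
move=> ck; apply: (@RInt_correct C_R_CompleteNormedModule).
by apply: ex_RInt_pw; try lra; exact: pw_continuous_mult.
Qed.

Lemma cint_unique (k : R -> C) (l : C) :
  is_RInt (V := C_R_NormedModule) (fun t => k t * dgam t)%C 0 1 l -> cint k = l.
Proof. exact: (@is_RInt_unique C_R_CompleteNormedModule). Qed.

Lemma cint_ext (f g : R -> C) : (forall t, unit_interval t -> f t = g t) -> cint f = cint g.
Proof.
move=> h; apply: (@RInt_ext C_R_CompleteNormedModule) => t.
by rewrite Rmin_left ?Rmax_right; try lra; move=> ht; rewrite h //; rewrite /unit_interval; lra.
Qed.

Lemma cint_bound : exists2 M, 0 < M & forall k e, continuous_on unit_interval k ->
  (forall t, unit_interval t -> Cmod (k t) <= e) -> Cmod (cint k) <= e * M.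
Proof.
have [M hM] := @ex_RInt_ub C_R_NormedModule _ _ _ (ex_RInt_pw dgam_pw (Rle_refl 0) Rle_0_1 (Rle_refl 1)).
exists (Rmax M 1); first by apply: Rlt_le_trans Rlt_0_1 (Rmax_r _ _).
move=> k e ck hk; rewrite -norm_C_R.
have -> : e * Rmax M 1 = (1 - 0) * (e * Rmax M 1) by ring.
apply: (norm_RInt_le_const _ 0 1 _ _ Rle_0_1 _ (cint_correct ck)) => t ht.
have h1 := hM t; rewrite Rmin_left ?Rmax_right in h1; try lra.
rewrite norm_C_R Cmod_mult; apply: Rmult_le_compat; try exact: Cmod_ge_0.
  exact: hk.
by apply: Rle_trans (Rmax_l _ _); rewrite -norm_C_R; exact: h1.
Qed.

(** The derivative of [F] is prescribed for every derivative [l] of [gam], because [dgam] is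
    arbitrary at finitely many points. [F] minus the indefinite integral of [k dgam] is continuous
    with zero derivative off a finite set, hence constant. *)
Lemma cint_FTC (F k : R -> C) : continuous_on unit_interval F -> continuous_on unit_interval k ->
  (forall t l, 0 < t < 1 -> is_derive (V := C_R_NormedModule) gam t l ->
     is_derive (V := C_R_NormedModule) F t (k t * l)%C) ->
  cint k = (F 1 - F 0)%C.
Proof.
move=> cF ck dF.
pose f t := (k t * dgam t)%C.
have pf : pw_continuous f := pw_continuous_mult ck.
pose I t : C := RInt (V := C_R_CompleteNormedModule) f 0 t.
have hI t : 0 <= t <= 1 -> is_RInt (V := C_R_NormedModule) f 0 t (I t).
  by move=> ht; apply: (@RInt_correct C_R_CompleteNormedModule); apply: ex_RInt_pw => //; lra.
have [M hM] := @ex_RInt_ub C_R_NormedModule _ _ _ (ex_RInt_pw pf (Rle_refl 0) Rle_0_1 (Rle_refl 1)).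
have M0 : 0 <= M.
  have h := hM 0; rewrite Rmin_left ?Rmax_right in h; try lra.
  by apply: Rle_trans (norm_ge_0 _) (h _); lra.
have lip s t : 0 <= s <= t -> t <= 1 -> Cmod (I t - I s)%C <= M * (t - s).
  move=> hs ht.
  have hst : ex_RInt (V := C_R_NormedModule) f s t by apply: ex_RInt_pw => //; lra.
  have ch := @RInt_Chasles C_R_CompleteNormedModule f 0 s t
    (ex_intro _ _ (hI s ltac:(lra))) hst.
  have -> : (I t - I s)%C = RInt (V := C_R_CompleteNormedModule) f s t.
    rewrite /I -ch; set x := RInt _ _ _; set y := RInt _ _ _.
    by change ((x + y - x)%C = y); ring.
  rewrite -norm_C_R Rmult_comm.
  apply: (norm_RInt_le_const _ s t _ _ (proj2 hs) _
    (@RInt_correct C_R_CompleteNormedModule _ _ _ hst)) => x hx.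
  by have := hM x; rewrite Rmin_left ?Rmax_right; try lra; apply; lra.
have lip' s t : unit_interval s -> unit_interval t -> Cmod (I t - I s)%C <= M * Rabs (t - s).
  rewrite /unit_interval => us ut; case: (Rle_lt_dec s t) => hst.
    by rewrite Rabs_pos_eq; [apply: lip; lra | lra].
  rewrite Rabs_left; last lra.
  have -> : (I t - I s = - (I s - I t))%C by ring.
  by rewrite Cmod_opp; apply: Rle_trans (lip t s _ _) _; lra.
have cI : continuous_on unit_interval I.
  move=> t ut P /locally_Cmod [e e0 he].
  have d0 : 0 < e / (M + 1) by apply: Rdiv_lt_0_compat; lra.
  exists (mkposreal _ d0) => y hy uy; apply: he.
  have hy' : Rabs (y - t) < e / (M + 1) := hy.
  apply: Rle_lt_trans (lip' _ _ ut uy) _.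
  apply: (@Rle_lt_trans _ (M * (e / (M + 1)))).
    by apply: Rmult_le_compat_l => //; lra.
  have -> : M * (e / (M + 1)) = e - e / (M + 1) by field; lra.
  lra.
pose D t := (F (clamp t) - I (clamp t))%C.
case: (C1) => _ [[s hs] _]; have [[s' hs'] _ _] := pf.
have : D 1 = D 0.
  apply: (@const_finite_derive D (s ++ s')) => [|t _|t ht ns]; first lra.
    apply: continuous_Cplus; first exact: (@continuous_clamp C_UniformSpace F t cF).
    by apply: continuous_Copp; exact: (@continuous_clamp C_UniformSpace I t cI).
  have ns1 : ~ List.In t s by move=> h; apply: ns; apply/List.in_or_app; left.
  have ns2 : ~ List.In t s' by move=> h; apply: ns; apply/List.in_or_app; right.
  have [dg _] := hs t ht ns1.
  have d1 := dF t _ ht dg.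
  have d2 : is_derive (V := C_R_NormedModule) I t (f t).
    apply: (@is_derive_RInt C_R_NormedModule f I 0 t); last exact: hs'.
    have d0 : 0 < Rmin t (1 - t) by apply: Rmin_pos; lra.
    exists (mkposreal _ d0) => y hy; have hy' : Rabs (y - t) < Rmin t (1 - t) := hy.
    have h1 := Rmin_l t (1 - t); have h2 := Rmin_r t (1 - t).
    by apply: hI; move: hy'; rewrite /Rabs; case: Rcase_abs => ? ?; lra.
  apply: (@is_derive_ext_loc _ C_R_NormedModule (fun y => minus (F y : C_R_NormedModule) (I y))).
    apply: filter_imp (locally_clamp ht) => y e.
    by rewrite /D e.
  have -> : RtoC 0 = minus (k t * dgam t : C_R_NormedModule)%C (f t).
    by rewrite minus_eq_zero.
  exact: is_derive_minus.
rewrite /D !clampE; try lra.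
have -> : I 0 = RtoC 0 by rewrite /I RInt_point.
have -> : I 1 = cint k by [].
move=> e; transitivity (F 1 - (F 1 - cint k))%C; first by ring.
by rewrite e; ring.
Qed.

End ContourIntegral.

(** A continuous linear map commutes with Riemann sums, so it passes through the integral. This is
    how functionals are applied to operator-valued integrals. *)
Lemma is_RInt_additive (V W : NormedModule R_AbsRing) (phi : V -> W) (f : R -> V) a b J :
  (forall x y, phi (plus x y) = plus (phi x) (phi y)) ->
  (forall (r : R) x, phi (scal r x) = scal r (phi x)) ->
  (forall x, continuous phi x) ->
  is_RInt f a b J -> is_RInt (fun t => phi (f t)) a b (phi J).
Proof.
move=> pD pZ pc h.
have p0 : phi zero = zero by rewrite -(scal_zero_l (zero : V)) pZ scal_zero_l.
have e ptd : scal (sign (b - a)) (Riemann_sum (fun t => phi (f t)) ptd) =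
    phi (scal (sign (b - a)) (Riemann_sum f ptd)).
  rewrite pZ; congr scal; rewrite /Riemann_sum.
  elim: (SF_t ptd) (SF_h ptd, zero) => [|x s IH] h0 /=; first by rewrite p0.
  by rewrite IH pD pZ.
rewrite /is_RInt; apply: (filterlim_ext (fun ptd => phi (scal (sign (b - a)) (Riemann_sum f ptd)))).
  by move=> ptd; rewrite e.
exact: filterlim_comp h (pc J).
Qed.

Section ContourLinearity.
Variables gam dgam : R -> C.
Hypothesis C1 : piecewise_C1 gam dgam.

Lemma cint_scale (a : C) k :
  continuous_on unit_interval k -> cint dgam (fun t => a * k t)%C = (a * cint dgam k)%C.
Proof.
move=> ck; apply: cint_unique.
have := @is_RInt_additive C_R_NormedModule C_R_NormedModule (fun z => a * z)%C _ 0 1 _ _ _ _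
  (cint_correct C1 ck).
move=> h; apply: (@is_RInt_ext C_R_NormedModule (fun t => a * (k t * dgam t))%C).
  by move=> t _; rewrite Cmult_assoc.
apply: h.
- by move=> x y; exact: Cmult_plus_distr_l.
- move=> r x.
  have e z : scal r (z : C_R_NormedModule) = (RtoC r * z)%C.
    apply: injective_projections.
      change (r * fst z = r * fst z - 0 * snd z); ring.
    change (r * snd z = r * snd z + 0 * fst z); ring.
  by rewrite !e; change ((a * (RtoC r * x))%C = (RtoC r * (a * x))%C :> C); ring.
- by move=> x; apply: continuous_Cmult; [exact: continuous_const | exact: continuous_id].
Qed.

Lemma cint_plus k k' : continuous_on unit_interval k -> continuous_on unit_interval k' ->
  cint dgam (fun t => k t + k' t)%C = (cint dgam k + cint dgam k')%C.
Proof.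
move=> ck ck'; apply: cint_unique.
apply: (@is_RInt_ext C_R_NormedModule (fun t => plus (k t * dgam t : C_R_NormedModule)%C (k' t * dgam t)%C)).
  by move=> t _; change ((k t * dgam t + k' t * dgam t)%C = ((k t + k' t) * dgam t)%C); ring.
exact: is_RInt_plus (cint_correct C1 ck) (cint_correct C1 ck').
Qed.

Lemma continuous_on_scale (a : C) k :
  continuous_on unit_interval k -> continuous_on unit_interval (fun t => a * k t)%C.
Proof.
move=> ck t ut; apply: (filterlim_Cmult _ (ck t ut)).
exact: filterlim_const.
Qed.

Lemma cint_minus k k' : continuous_on unit_interval k -> continuous_on unit_interval k' ->
  cint dgam (fun t => k t - k' t)%C = (cint dgam k - cint dgam k')%C.
Proof.
move=> ck ck'.
have e : (cint dgam k - cint dgam k')%C = (cint dgam k + RtoC (-1) * cint dgam k')%C.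
  by apply: injective_projections => /=; ring.
rewrite e -cint_scale // -cint_plus //; last exact: continuous_on_scale.
by apply: cint_ext => t _; apply: injective_projections => /=; ring.
Qed.

End ContourLinearity.

Lemma continuous_on_CP (f : R -> C) : continuous_on unit_interval f <->
  forall t, unit_interval t -> forall e, 0 < e -> exists2 d, 0 < d &
    forall t', unit_interval t' -> Rabs (t' - t) < d -> Cmod (f t' - f t)%C < e.
Proof.
split=> [h t ut e e0|h t ut P /locally_Cmod [e e0 he]].
  have hl : locally (f t) (fun w => Cmod (w - f t)%C < e) by apply/locally_Cmod; exists e.
  have [d hd] := h t ut _ hl; exists d; first exact: cond_pos.
  by move=> t' ut' ht; apply: hd.
have [d d0 hd] := h t ut e e0.
by exists (mkposreal d d0) => y hy uy; apply: he; apply: hd.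
Qed.

(** * Bounded functionals and continuous families of operators *)

Section Functionals.
Variable U : NormedModule C_AbsRing.
Notation B := (bounded_op U).

Record op_functional (l : B -> C) : Prop := {
  functional_plus : forall S T, l (plus S T) = (l S + l T)%C;
  functional_scal : forall c T, l (op_scal c T) = (c * l T)%C;
  functional_bound : exists2 M, 0 <= M & forall T, Cmod (l T) <= M * op_norm T }.

Lemma functional_minus l S T : op_functional l -> l (minus S T) = (l S - l T)%C.
Proof.
move=> h; rewrite /minus (functional_plus h) op_oppE (functional_scal h).
by apply: injective_projections => /=; ring.
Qed.

Lemma functional_comp l W : op_functional l -> op_functional (fun T => l (op_comp W T)).
Proof.
move=> h; split=> [S T|c T|].
- by rewrite op_compDr (functional_plus h).
- by rewrite op_compZr (functional_scal h).
- have [M M0 hM] := functional_bound h; exists (M * op_norm W).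
    exact: Rmult_le_pos (op_norm_ge0 _).
  move=> T; apply: Rle_trans (hM _) _; rewrite Rmult_assoc.
  by apply: Rmult_le_compat_l (op_norm_comp _ _).
Qed.

Definition op_continuous_on (F : R -> B) : Prop :=
  forall t, unit_interval t -> forall e, 0 < e -> exists2 d, 0 < d &
    forall t', unit_interval t' -> Rabs (t' - t) < d -> op_norm (minus (F t') (F t)) < e.

Lemma op_continuous_functional l F : op_functional l -> op_continuous_on F ->
  continuous_on unit_interval (fun t => l (F t)).
Proof.
move=> hl cF; apply/continuous_on_CP => t ut e e0.
have [M M0 hM] := functional_bound hl.
have e1 : 0 < e / (M + 1) by apply: Rdiv_lt_0_compat; lra.
have [d d0 hd] := cF t ut _ e1; exists d => // t' ut' ht.
rewrite -(functional_minus _ _ hl); apply: Rle_lt_trans (hM _) _.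
apply: Rle_lt_trans (Rmult_le_compat_l _ _ _ M0 (Rlt_le _ _ (hd t' ut' ht))) _.
have -> : M * (e / (M + 1)) = e - e / (M + 1) by field; lra.
lra.
Qed.

Lemma op_continuous_bounded F : op_continuous_on F ->
  exists2 M, 0 < M & forall t, unit_interval t -> op_norm (F t) <= M.
Proof.
move=> cF.
have c : continuous_on unit_interval (fun t => RtoC (op_norm (F t))).
  apply/continuous_on_CP => t ut e e0; have [d d0 hd] := cF t ut e e0.
  exists d => // t' ut' ht; apply: Rle_lt_trans (hd t' ut' ht).
  rewrite -RtoC_minus Cmod_R; have h1 := op_norm_lower (F t') (F t).
  have := op_norm_lower (F t) (F t'); rewrite (op_norm_minusC (F t)) => h2.
  by apply/Rabs_le_between; lra.
have [M hM] := continuous_on_bounded c.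
exists (Rmax M 1); first by apply: Rlt_le_trans Rlt_0_1 (Rmax_r _ _).
move=> t ut; have := hM t ut; rewrite Cmod_R Rabs_pos_eq; last exact: op_norm_ge0.
by move=> h; apply: Rle_trans h (Rmax_l _ _).
Qed.

Definition invertible (T : B) : Prop := exists S, is_inverse T S.

Definition commute (S T : B) : Prop := op_comp S T = op_comp T S.

Lemma commute_inverse X S T : commute X T -> is_inverse X S -> commute S T.
Proof.
move=> c [SX XS]; rewrite /commute -[T in LHS]op_comp1r -XS.
by rewrite (op_compA T) -c !op_compA SX op_comp1l.
Qed.

Lemma commute_minus S T W : commute S T -> commute W T -> commute (minus S W) T.
Proof. by move=> h1 h2; rewrite /commute op_compBl op_compBr h1 h2. Qed.
Lemma commute_scal c S T : commute S T -> commute (op_scal c S) T.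
Proof. by move=> h; rewrite /commute op_compZl op_compZr h. Qed.
Lemma commute_id T : commute (op_id U) T.
Proof. by rewrite /commute op_comp1l op_comp1r. Qed.

Lemma invertible_scalar (c : C) : c <> RtoC 0 ->
  is_inverse (op_scal c (op_id U)) (op_scal (/ c)%C (op_id U)).
Proof.
move=> c0; split; rewrite op_compZl op_comp1l op_scalA; [rewrite (_ : mult _ _ = one) | rewrite (_ : mult _ _ = one)];
  try exact: op_scal1.
  by change ((/ c * c)%C = RtoC 1); field.
by change ((c * / c)%C = RtoC 1); field.
Qed.

Hypothesis complete : seq_complete U.

Lemma op_continuous_inverse (F : R -> B) : op_continuous_on F ->
  (forall t, unit_interval t -> invertible (F t)) ->
  op_continuous_on (fun t => op_inv (F t)).
Proof.
move=> cF iF t ut e e0; have iS := op_invP (iF t ut).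
set S := op_inv (F t) in iS *; have s0 := op_norm_ge0 S.
have d1 : 0 < Rmin (/ (2 * (op_norm S + 1))) (e / (2 * op_norm S ^ 2 + 1)).
  have := pow2_ge_0 (op_norm S) => ?.
  by apply: Rmin_pos; [apply: Rinv_0_lt_compat | apply: Rdiv_lt_0_compat]; lra.
have [d d0 hd] := cF t ut _ d1; exists d => // t' ut' ht.
have h := hd t' ut' ht; rewrite op_norm_minusC in h.
have h1 := Rlt_le_trans _ _ _ h (Rmin_l _ _).
have h2 := Rlt_le_trans _ _ _ h (Rmin_r _ _).
have n0 := op_norm_ge0 (minus (F t) (F t')).
have hs : op_norm S * op_norm (minus (F t) (F t')) <= / 2.
  apply: (@Rle_trans _ ((op_norm S + 1) * / (2 * (op_norm S + 1)))).
    by apply: Rmult_le_compat; lra.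
  by right; field; lra.
have [S' [iS' nS']] := is_inverse_near complete iS hs.
rewrite (op_inv_eq iS') (inverse_difference iS iS').
apply: Rle_lt_trans (op_norm_comp _ _) _.
apply: Rle_lt_trans (Rmult_le_compat _ _ _ _ (op_norm_ge0 _) (op_norm_ge0 _) nS' (op_norm_comp _ _)) _.
have q0 := pow2_ge_0 (op_norm S).
apply: (@Rle_lt_trans _ (2 * op_norm S ^ 2 * (e / (2 * op_norm S ^ 2 + 1)))).
  have -> : 2 * op_norm S * (op_norm (minus (F t) (F t')) * op_norm S) =
    2 * op_norm S ^ 2 * op_norm (minus (F t) (F t')) by ring.
  by apply: Rmult_le_compat_l; lra.
have -> : 2 * op_norm S ^ 2 * (e / (2 * op_norm S ^ 2 + 1)) =
  e - e / (2 * op_norm S ^ 2 + 1) by field; lra.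
have : 0 < e / (2 * op_norm S ^ 2 + 1) by apply: Rdiv_lt_0_compat; lra.
lra.
Qed.

End Functionals.

(** * Contour integrals of resolvents *)

Lemma continuous_on_Cmult (k k' : R -> C) : continuous_on unit_interval k ->
  continuous_on unit_interval k' -> continuous_on unit_interval (fun t => k t * k' t)%C.
Proof. by move=> ck ck' t ut; exact: filterlim_Cmult (ck t ut) (ck' t ut). Qed.

Lemma continuous_on_Cminus (k k' : R -> C) : continuous_on unit_interval k ->
  continuous_on unit_interval k' -> continuous_on unit_interval (fun t => k t - k' t)%C.
Proof.
move=> ck ck'; apply/continuous_on_CP => t ut e e0.
have e2 : 0 < e / 2 by lra.
have [d d0 hd] := proj1 (continuous_on_CP _) ck t ut _ e2.
have [d' d0' hd'] := proj1 (continuous_on_CP _) ck' t ut _ e2.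
exists (Rmin d d'); first exact: Rmin_pos.
move=> t' ut' ht; have h1 := hd t' ut' (Rlt_le_trans _ _ _ ht (Rmin_l _ _)).
have h2 := hd' t' ut' (Rlt_le_trans _ _ _ ht (Rmin_r _ _)).
have -> : (k t' - k' t' - (k t - k' t) = (k t' - k t) + - (k' t' - k' t))%C by ring.
by apply: Rle_lt_trans (Cmod_triangle _ _) _; rewrite Cmod_opp; lra.
Qed.

Lemma continuous_on_Cinv (k : R -> C) : continuous_on unit_interval k ->
  (forall t, unit_interval t -> k t <> RtoC 0) ->
  continuous_on unit_interval (fun t => / k t)%C.
Proof.
move=> ck k0 t ut.
have c := @continuous_Cinv C_UniformSpace (fun z : C => z) (k t) (k0 t ut) (continuous_id _).
exact: filterlim_comp (ck t ut) c.
Qed.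

Lemma is_derive_Cmult (f g : R -> C) x (a b : C) :
  is_derive (V := C_R_NormedModule) f x a -> is_derive (V := C_R_NormedModule) g x b ->
  is_derive (V := C_R_NormedModule) (fun t => f t * g t)%C x (a * g x + f x * b)%C.
Proof.
move=> /is_derive_CP hf /is_derive_CP hg; apply/is_derive_CP => e e0.
pose L := Cmod a + Cmod b + Cmod (f x) + Cmod (g x) + 2.
have [a0 b0 f0 g0] : [/\ 0 <= Cmod a, 0 <= Cmod b, 0 <= Cmod (f x) & 0 <= Cmod (g x)].
  by split; exact: Cmod_ge_0.
have L0 : 0 < L by rewrite /L; lra.
pose e' := Rmin 1 (e / (4 * L)).
have e'0 : 0 < e' by apply: Rmin_pos; [lra | apply: Rdiv_lt_0_compat; lra].
have e'1 : e' <= 1 := Rmin_l _ _.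
have e'L : e' * (4 * L) <= e.
  have := Rmult_le_compat_r (4 * L) _ _ ltac:(lra) (Rmin_r 1 (e / (4 * L))).
  by rewrite -/e' (_ : e / (4 * L) * (4 * L) = e) //; field; lra.
have [d d0 hd] := hf e' e'0; have [d' d0' hd'] := hg e' e'0.
have dl0 : 0 < e / (4 * L * L) by apply: Rdiv_lt_0_compat => //; apply: Rmult_lt_0_compat; lra.
exists (Rmin (Rmin d d') (e / (4 * L * L))); first by do 2?apply: Rmin_pos.
move=> y hy.
have h1 := hd y ltac:(have := Rmin_l (Rmin d d') (e / (4 * L * L)); have := Rmin_l d d'; lra).
have h2 := hd' y ltac:(have := Rmin_l (Rmin d d') (e / (4 * L * L)); have := Rmin_r d d'; lra).
have h3 : Rabs (y - x) * (4 * L * L) <= e.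
  have := Rmin_r (Rmin d d') (e / (4 * L * L)) => h.
  have h4 : Rabs (y - x) <= e / (4 * L * L) by lra.
  have := Rmult_le_compat_r (4 * L * L) _ _ ltac:(nra) h4.
  by rewrite (_ : e / (4 * L * L) * (4 * L * L) = e) //; field; lra.
set rf := (f y - f x - _)%C in h1; set rg := (g y - g x - _)%C in h2.
set t := Rabs (y - x) in h1 h2 h3 *.
have t0 : 0 <= t := Rabs_pos _.
pose Df := (RtoC (y - x) * a + rf)%C; pose Dg := (RtoC (y - x) * b + rg)%C.
have -> : (f y * g y - f x * g x - RtoC (y - x) * (a * g x + f x * b) =
    rf * g x + (f x * rg + Df * Dg))%C by rewrite /Df /Dg /rf /rg; ring.
have hDf : Cmod Df <= L * t.
  apply: Rle_trans (Cmod_triangle _ _) _; rewrite Cmod_mult Cmod_R -/t /L; nra.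
have hDg : Cmod Dg <= L * t.
  apply: Rle_trans (Cmod_triangle _ _) _; rewrite Cmod_mult Cmod_R -/t /L; nra.
apply: Rle_trans (Cmod_triangle _ _) _.
have := Cmod_triangle (f x * rg) (Df * Dg).
rewrite !Cmod_mult => h4.
have p1 : Cmod rf * Cmod (g x) <= e' * t * L.
  by apply: Rmult_le_compat => //; [exact: Cmod_ge_0 | rewrite /L; lra].
have p2 : Cmod (f x) * Cmod rg <= L * (e' * t).
  by apply: Rmult_le_compat => //; [exact: Cmod_ge_0 | rewrite /L; lra].
have p3 : Cmod Df * Cmod Dg <= L * t * (L * t).
  by apply: Rmult_le_compat => //; exact: Cmod_ge_0.
have p4 : e' * L * t <= e / 4 * t by apply: Rmult_le_compat_r => //; lra.
have p5 : t * L * L * t <= e / 4 * t by apply: Rmult_le_compat_r => //; lra.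
have p6 : 0 <= e * t by apply: Rmult_le_pos; lra.
lra.
Qed.

Section ResolventIntegral.
Variable U : NormedModule C_AbsRing.
Hypothesis complete : seq_complete U.
Notation B := (bounded_op U).
Notation I := (op_id U).
Variables (gam dgam : R -> C) (C1 : piecewise_C1 gam dgam).
Hypothesis closed : gam 0 = gam 1.
Variables (l0 : C) (T : B).

(** This is [gam t - T_s] for [T_s = l0 + s T]. In this section [T] plays the part of the difference
    between the operator and the scalar [l0]; at [s = 0] the pencil is scalar. *)
Definition pencil (s t : R) : B := minus (op_scal (gam t - l0)%C I) (op_scal (RtoC s) T).

Lemma pencil_minus s s' t t' : minus (pencil s t) (pencil s' t') =
  plus (op_scal (gam t - gam t')%C I) (op_scal (RtoC (s' - s)) T).
Proof.
apply: bop_eq => x; rewrite bop_minusE /pencil !bop_minusE /=.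
have e : (gam t - gam t' = (gam t - l0) - (gam t' - l0))%C by ring.
rewrite e RtoC_minus (scal_minus_distr_r (gam t - l0)%C (gam t' - l0)%C x)
  (scal_minus_distr_r (RtoC s') (RtoC s) (T x)).
rewrite /minus !opp_plus !opp_opp -!plus_assoc; congr plus.
rewrite [LHS]plus_comm -!plus_assoc; congr plus; exact: plus_comm.
Qed.

Lemma pencil_near s s' t t' :
  op_norm (minus (pencil s t) (pencil s' t')) <=
  Cmod (gam t - gam t')%C + Rabs (s' - s) * op_norm T.
Proof.
rewrite pencil_minus; apply: Rle_trans (op_norm_plus _ _) _.
apply: Rplus_le_compat; last by rewrite -Cmod_R; exact: op_norm_scale.
apply: Rle_trans (op_norm_scale _ _) _; rewrite -[X in _ <= X]Rmult_1_r.
by apply: Rmult_le_compat_l (op_norm_id _); exact: Cmod_ge_0.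
Qed.

Lemma pencil_continuous s : op_continuous_on (pencil s).
Proof.
move=> t ut e e0; have [d d0 hd] := proj1 (continuous_on_CP _) (gam_continuous C1) t ut e e0.
exists d => // t' ut' ht; apply: Rle_lt_trans (pencil_near _ _ _ _) _.
by rewrite Rminus_diag Rabs_R0 Rmult_0_l Rplus_0_r; exact: hd.
Qed.

Hypothesis inv : forall s t, unit_interval s -> unit_interval t -> invertible (pencil s t).

Notation P s t := (op_inv (pencil s t)).

Lemma pencil_inverse s t : unit_interval s -> unit_interval t -> is_inverse (pencil s t) (P s t).
Proof. by move=> us ut; apply: op_invP; exact: inv. Qed.

Lemma resolvent_continuous s l : unit_interval s -> op_functional l ->
  continuous_on unit_interval (fun t => l (P s t)).
Proof.
move=> us hl; apply: (op_continuous_functional hl).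
apply: (op_continuous_inverse complete) (@pencil_continuous s) _ => t ut; exact: inv.
Qed.

Lemma resolvent_bounded s : unit_interval s ->
  exists2 M, 0 < M & forall t, unit_interval t -> op_norm (P s t) <= M.
Proof.
move=> us; apply: op_continuous_bounded.
apply: (op_continuous_inverse complete) (@pencil_continuous s) _ => t ut; exact: inv.
Qed.

Lemma pencil_commute s t : commute (pencil s t) T.
Proof.
by apply: commute_minus; apply: commute_scal; [exact: commute_id|].
Qed.

Notation P2 s t := (op_comp (P s t) (P s t)).

Lemma resolvent2_continuous s l : unit_interval s -> op_functional l ->
  continuous_on unit_interval (fun t => l (P2 s t)).
Proof.
move=> us hl; apply: (op_continuous_functional hl).
have cP : op_continuous_on (fun t => P s t).
  apply: (op_continuous_inverse complete) (@pencil_continuous s) _ => t ut; exact: inv.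
have [M M0 hM] := op_continuous_bounded cP.
move=> t ut e e0; have d1 : 0 < e / (2 * M + 1) by apply: Rdiv_lt_0_compat; lra.
have [d d0 hd] := cP t ut _ d1; exists d => // t' ut' ht.
apply: Rle_lt_trans (op_norm_minus_triangle _ (op_comp (P s t) (P s t')) _) _.
rewrite -op_compBl -op_compBr.
have h := Rlt_le _ _ (hd t' ut' ht); have n0 := op_norm_ge0 (minus (P s t') (P s t)).
have h1 := op_norm_comp (minus (P s t') (P s t)) (P s t').
have h2 := op_norm_comp (P s t) (minus (P s t') (P s t)).
have h3 := Rmult_le_compat _ _ _ _ n0 (op_norm_ge0 _) h (hM t' ut').
have h4 := Rmult_le_compat _ _ _ _ (op_norm_ge0 _) n0 (hM t ut) h.
have : e / (2 * M + 1) * M + M * (e / (2 * M + 1)) = e - e / (2 * M + 1) by field; lra.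
lra.
Qed.

(** The derivative in [s] of the inverse [P] is [P T P], equal to [T P^2] because [T] commutes with
    the pencil. The remainder in [inverse_second_order] is uniform in [t], as [P] is bounded along
    the curve, which justifies differentiation under the integral. *)
Lemma cint_resolvent_derive (w : R -> C) l s : continuous_on unit_interval w ->
  op_functional l -> unit_interval s ->
  is_derive (V := C_R_NormedModule) (fun s' => cint dgam (fun t => w t * l (P s' t))%C) s
    (cint dgam (fun t => w t * l (op_comp T (P2 s t)))%C).
Proof.
move=> cw hl us; apply/is_derive_CP => e e0.
have [M M0 hM] := resolvent_bounded us.
have [Ml Ml0 hMl] := functional_bound hl.
have [W hW] := continuous_on_bounded cw.
have W0 : 0 <= W by apply: Rle_trans (Cmod_ge_0 _) (hW 0 _); rewrite /unit_interval; lra.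
have [G G0 hG] := cint_bound C1.
have nT := op_norm_ge0 T.
(* [c (s' - s)^2] bounds the integral of the second-order remainder: [W] bounds the weight, [Ml] the
   functional, [M] the inverses, and [G] comes from the speed of the path. *)
pose c := W * (Ml * (2 * M ^ 3 * op_norm T ^ 2)) * G.
have M3 : 0 < M ^ 3 by apply: pow_lt.
have c0 : 0 <= c.
  rewrite /c; apply: Rmult_le_pos; last lra; apply: Rmult_le_pos => //.
  apply: Rmult_le_pos => //; apply: Rmult_le_pos; [lra | exact: pow2_ge_0].
(* The first bound keeps the pencil close enough to stay invertible, the second turns the quadratic
   remainder into [e |s' - s|]. *)
pose d := Rmin (/ (2 * M * (op_norm T + 1))) (e / (c + 1)).
have d0 : 0 < d.
  apply: Rmin_pos; last by apply: Rdiv_lt_0_compat; lra.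
  by apply: Rinv_0_lt_compat; apply: Rmult_lt_0_compat; lra.
exists d => // s' hs.
have small t : unit_interval t ->
    op_norm (P s t) * op_norm (minus (pencil s t) (pencil s' t)) <= / 2.
  move=> ut; have h := pencil_near s s' t t.
  rewrite (_ : gam t - gam t = 0)%C in h; last by ring.
  rewrite Cmod_0 Rplus_0_l in h.
  have h1 : Rabs (s' - s) <= / (2 * M * (op_norm T + 1)).
    by have := Rmin_l (/ (2 * M * (op_norm T + 1))) (e / (c + 1)); rewrite -/d; lra.
  have h2 : op_norm (minus (pencil s t) (pencil s' t)) <= / (2 * M * (op_norm T + 1)) * (op_norm T + 1).
    apply: Rle_trans h _; apply: Rmult_le_compat => //; [exact: Rabs_pos | lra].
  apply: Rle_trans (Rmult_le_compat _ _ _ _ (op_norm_ge0 _) (op_norm_ge0 _) (hM t ut) h2) _.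
  by right; field; split; lra.
(* The derivative is two-sided, so [s'] may leave [[0,1]], where invertibility is not assumed; it
   follows from nearness to [s]. *)
have inv' t : unit_interval t -> invertible (pencil s' t).
  move=> ut; have [S [hS _]] := is_inverse_near complete (pencil_inverse us ut) (small t ut).
  by exists S.
have cs : continuous_on unit_interval (fun t => w t * l (P s t))%C.
  by apply: continuous_on_Cmult => //; exact: resolvent_continuous.
have cs' : continuous_on unit_interval (fun t => w t * l (P s' t))%C.
  apply: continuous_on_Cmult => //; apply: (op_continuous_functional hl).
  exact: (op_continuous_inverse complete) (@pencil_continuous s') inv'.
have cd : continuous_on unit_interval (fun t => w t * l (op_comp T (P2 s t)))%C.
  apply: continuous_on_Cmult => //.
  exact: (resolvent2_continuous us (functional_comp T hl)).
rewrite -(cint_scale C1) // -(cint_minus C1) // -(cint_minus C1) //; last first.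
- exact: continuous_on_scale.
- exact: continuous_on_Cminus.
have hb : forall t, unit_interval t -> Cmod (w t * l (P s' t) - w t * l (P s t)
    - RtoC (s' - s) * (w t * l (op_comp T (P2 s t))))%C <=
    W * (Ml * (2 * M ^ 3 * (Rabs (s' - s) * op_norm T) ^ 2)).
  move=> t ut; have iS := pencil_inverse us ut.
  have cm := commute_inverse (pencil_commute s t) iS.
  have h := inverse_second_order complete iS (small t ut).
  have e1 : op_comp (P s t) (op_comp (minus (pencil s t) (pencil s' t)) (P s t)) =
      op_scal (RtoC (s' - s)) (op_comp T (P2 s t)).
    rewrite pencil_minus (_ : gam t - gam t = 0)%C; last by ring.
    rewrite op_compDl !op_compZl op_comp1l op_compDr !op_compZr op_compA cm -op_compA.
    have -> : op_scal (RtoC 0) (P2 s t) = zero.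
      exact: (@scal_zero_l C_Ring (bop_ModuleSpace U)).
    by rewrite plus_zero_l.
  rewrite e1 in h.
  have -> : (w t * l (P s' t) - w t * l (P s t) - RtoC (s' - s) * (w t * l (op_comp T (P2 s t))) =
     w t * l (minus (minus (P s' t) (P s t)) (op_scal (RtoC (s' - s)) (op_comp T (P2 s t)))))%C.
    rewrite !functional_minus // (functional_scal hl); ring.
  rewrite Cmod_mult; apply: Rmult_le_compat; try exact: Cmod_ge_0; first exact: hW.
  apply: Rle_trans (hMl _) _; apply: Rmult_le_compat_l => //; apply: Rle_trans h _.
  have n0 := op_norm_ge0 (P s t); have n1 := op_norm_ge0 (minus (pencil s t) (pencil s' t)).
  apply: Rmult_le_compat.
  - by apply: Rmult_le_pos; [lra | exact: pow_le].
  - exact: pow2_ge_0.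
  - by apply: Rmult_le_compat_l; [lra | apply: pow_incr; split=> //; exact: hM].
  - apply: pow_incr; split=> //; apply: Rle_trans (pencil_near _ _ _ _) _.
    rewrite (_ : gam t - gam t = 0)%C; last by ring.
    by rewrite Cmod_0 Rplus_0_l; right.
apply: Rle_trans (hG _ _ _ hb) _.
  by apply: continuous_on_Cminus; [exact: continuous_on_Cminus | exact: continuous_on_scale].
have -> : W * (Ml * (2 * M ^ 3 * (Rabs (s' - s) * op_norm T) ^ 2)) * G =
  c * Rabs (s' - s) * Rabs (s' - s) by rewrite /c; ring.
apply: Rmult_le_compat_r; first exact: Rabs_pos.
have h1 : Rabs (s' - s) <= e / (c + 1).
  by have := Rmin_r (/ (2 * M * (op_norm T + 1))) (e / (c + 1)); rewrite -/d; lra.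
apply: Rle_trans (Rmult_le_compat_l _ _ _ c0 h1) _.
have -> : c * (e / (c + 1)) = e - e / (c + 1) by field; lra.
have : 0 < e / (c + 1) by apply: Rdiv_lt_0_compat; lra.
lra.
Qed.

Lemma resolvent_derive l s t dg : op_functional l -> unit_interval s -> 0 < t < 1 ->
  is_derive (V := C_R_NormedModule) gam t dg ->
  is_derive (V := C_R_NormedModule) (fun t' => l (P s t')) t (- l (P2 s t) * dg)%C.
Proof.
move=> hl us ht /is_derive_CP hg; apply/is_derive_CP => e e0.
have ut : unit_interval t by rewrite /unit_interval; lra.
have iS := pencil_inverse us ut.
have [Ml Ml0 hMl] := functional_bound hl.
set S := P s t in iS *; have s0 := op_norm_ge0 S.
pose A := Cmod dg + 1; have A0 : 0 < A by have := Cmod_ge_0 dg; rewrite /A; lra.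
pose c1 := Ml * (2 * op_norm S ^ 3) * A ^ 2.
pose c2 := Ml * op_norm (op_comp S S).
have c10 : 0 <= c1.
  rewrite /c1; apply: Rmult_le_pos (pow2_ge_0 _); apply: Rmult_le_pos => //.
  by apply: Rmult_le_pos; [lra | exact: pow_le].
have c20 : 0 <= c2 by apply: Rmult_le_pos => //; exact: op_norm_ge0.
pose e' := Rmin 1 (e / (2 * (c2 + 1))).
have e'0 : 0 < e' by apply: Rmin_pos; [lra | apply: Rdiv_lt_0_compat; lra].
have e'1 : e' <= 1 := Rmin_l _ _.
have [d d0 hd] := hg e' e'0.
pose d2 := / (2 * (op_norm S + 1) * A).
have d20 : 0 < d2 by apply: Rinv_0_lt_compat; apply: Rmult_lt_0_compat; lra.
have d30 : 0 < e / (2 * (c1 + 1)) by apply: Rdiv_lt_0_compat; lra.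
exists (Rmin d (Rmin d2 (e / (2 * (c1 + 1))))); first by do 2?apply: Rmin_pos.
move=> y hy.
have q1 := Rmin_l d (Rmin d2 (e / (2 * (c1 + 1)))).
have q2 := Rmin_r d (Rmin d2 (e / (2 * (c1 + 1)))).
have q3 := Rmin_l d2 (e / (2 * (c1 + 1))); have q4 := Rmin_r d2 (e / (2 * (c1 + 1))).
have h := hd y ltac:(lra).
set r := (gam y - gam t - _)%C in h; set x := Rabs (y - t) in h hy *.
have x0 : 0 <= x := Rabs_pos _.
have hgam : Cmod (gam t - gam y)%C <= A * x.
  have -> : (gam t - gam y = - (RtoC (y - t) * dg + r))%C by rewrite /r; ring.
  rewrite Cmod_opp; apply: Rle_trans (Cmod_triangle _ _) _.
  rewrite Cmod_mult Cmod_R -/x /A; nra.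
have hX : op_norm (minus (pencil s t) (pencil s y)) <= A * x.
  apply: Rle_trans (pencil_near _ _ _ _) _.
  by rewrite Rminus_diag Rabs_R0 Rmult_0_l Rplus_0_r.
have small : op_norm S * op_norm (minus (pencil s t) (pencil s y)) <= / 2.
  have xd2 : x <= d2 by lra.
  apply: (@Rle_trans _ ((op_norm S + 1) * (A * d2))).
    apply: Rmult_le_compat => //; [exact: op_norm_ge0 | lra |].
    by apply: Rle_trans hX _; apply: Rmult_le_compat_l; lra.
  by right; rewrite /d2; field; split; lra.
have h2 := inverse_second_order complete iS small.
have e1 : op_comp S (op_comp (minus (pencil s t) (pencil s y)) S) =
    op_scal (gam t - gam y)%C (op_comp S S).
  rewrite pencil_minus Rminus_diag op_compDl !op_compZl op_comp1l op_compDr !op_compZr.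
  have -> : op_scal (RtoC 0) (op_comp S (op_comp T S)) = zero.
    exact: (@scal_zero_l C_Ring (bop_ModuleSpace U)).
  by rewrite plus_zero_r.
rewrite e1 in h2.
set Z := minus (minus (P s y) S) _ in h2.
have -> : (l (P s y) - l S - RtoC (y - t) * (- l (op_comp S S) * dg) =
    l Z + - (r * l (op_comp S S)))%C.
  rewrite /Z !functional_minus // (functional_scal hl) /r; ring.
apply: Rle_trans (Cmod_triangle _ _) _; rewrite Cmod_opp Cmod_mult.
have b1 : Cmod (l Z) <= c1 * x * x.
  apply: Rle_trans (hMl _) _.
  have -> : c1 * x * x = Ml * (2 * op_norm S ^ 3 * (A * x) ^ 2) by rewrite /c1; ring.
  apply: Rmult_le_compat_l => //; apply: Rle_trans h2 _; apply: Rmult_le_compat_l.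
    by apply: Rmult_le_pos; [lra | exact: pow_le].
  by apply: pow_incr; split=> //; exact: op_norm_ge0.
have b2 : Cmod r * Cmod (l (op_comp S S)) <= e' * x * c2.
  by apply: Rmult_le_compat => //; exact: Cmod_ge_0.
have b3 : c1 * x <= e / 2.
  have xle : x <= e / (2 * (c1 + 1)) by lra.
  apply: Rle_trans (Rmult_le_compat_l _ _ _ c10 xle) _.
  have -> : c1 * (e / (2 * (c1 + 1))) = e / 2 - e / (2 * (c1 + 1)) by field; lra.
  lra.
have b4 : e' * c2 <= e / 2.
  apply: Rle_trans (Rmult_le_compat_r _ _ _ c20 (Rmin_r _ _)) _.
  have -> : e / (2 * (c2 + 1)) * c2 = e / 2 - e / (2 * (c2 + 1)) by field; lra.
  have : 0 < e / (2 * (c2 + 1)) by apply: Rdiv_lt_0_compat; lra.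
  lra.
have := Rmult_le_compat_r _ _ _ x0 b3; have := Rmult_le_compat_r _ _ _ x0 b4.
lra.
Qed.

(** The derivative in [s] is the integral of [l (T P^2)], of which [- l (T P)] is a primitive along
    the curve; a closed curve gives it the same value at both ends. *)
Lemma cint_resolvent_const l s : op_functional l -> unit_interval s ->
  cint dgam (fun t => l (P s t)) = cint dgam (fun t => l (P 0 t)).
Proof.
move=> hl us.
have d s' : unit_interval s' ->
    is_derive (V := C_R_NormedModule) (fun s' => cint dgam (fun t => l (P s' t))) s' (RtoC 0).
  move=> us'; have := cint_resolvent_derive (w := fun=> RtoC 1) _ hl us'.
  have -> : (fun s' => cint dgam (fun t => RtoC 1 * l (P s' t))%C) =
      (fun s' => cint dgam (fun t => l (P s' t))).
    apply: functional_extensionality => z; apply: cint_ext => t _; exact: Cmult_1_l.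
  have -> : cint dgam (fun t => RtoC 1 * l (op_comp T (P2 s' t)))%C = RtoC 0.
    have hl' := functional_comp T hl.
    rewrite (cint_FTC C1 (F := fun t => - l (op_comp T (P s' t)))%C).
    - by rewrite /pencil closed; ring.
    - apply/continuous_on_CP => t ut e e0.
      have [d d0 hd] := proj1 (continuous_on_CP _) (resolvent_continuous us' hl') t ut e e0.
      exists d => // t' ut' ht; have := hd t' ut' ht; rewrite -Cmod_opp.
      by congr (Cmod _ < e); ring.
    - apply: continuous_on_scale; exact: resolvent2_continuous us' hl'.
    - move=> t dg ht hg; have := resolvent_derive hl' us' ht hg => h.
      have := @is_derive_opp _ C_R_NormedModule _ _ _ h.
      have -> : opp (- l (op_comp T (P2 s' t)) * dg : C_R_NormedModule)%C =
        (RtoC 1 * l (op_comp T (P2 s' t)) * dg)%C.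
        by change ((- (- l (op_comp T (P2 s' t)) * dg))%C =
           (RtoC 1 * l (op_comp T (P2 s' t)) * dg)%C :> C); ring.
      by [].
  by apply; move=> t ut; exact: filterlim_const.
case: us => s0 s1.
apply: (@const_finite_derive (fun s' => cint dgam (fun t => l (P s' t))) [::]) => //.
  move=> t ht; have := d t ltac:(rewrite /unit_interval; lra) => h.
  exact: (@ex_derive_continuous _ C_R_NormedModule _ _ (ex_intro _ _ h)).
by move=> t ht _; apply: d; rewrite /unit_interval; lra.
Qed.

(** The integral does not depend on [s], and at [s = 0] the inverse is the scalar
    [1 / (gam t - l0)]. *)
Lemma cint_resolvent l s : op_functional l -> unit_interval s ->
  (forall t, unit_interval t -> (gam t - l0)%C <> RtoC 0) ->
  cint dgam (fun t => l (P s t)) = (cint dgam (fun t => / (gam t - l0)) * l I)%C.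
Proof.
move=> hl us h0; rewrite cint_resolvent_const // Cmult_comm -(cint_scale C1).
  apply: cint_ext => t ut; have -> : P 0 t = op_scal (/ (gam t - l0))%C I.
    apply: op_inv_eq; rewrite /pencil.
    have -> : op_scal (RtoC 0) T = zero.
      exact: (@scal_zero_l C_Ring (bop_ModuleSpace U)).
    by rewrite minus_zero_r; apply: invertible_scalar; exact: h0.
  by rewrite (functional_scal hl) Cmult_comm.
apply: continuous_on_Cinv => //; apply: continuous_on_Cminus; first exact: gam_continuous C1.
by move=> t ut; exact: filterlim_const.
Qed.

Section Logarithm.
Variable M : R -> C.
Hypothesis M_continuous : continuous_on unit_interval M.
Hypothesis M_closed : M 0 = M 1.
Hypothesis gam_ne0 : forall t, unit_interval t -> gam t <> RtoC 0.
Hypothesis M_derive : forall t dg, 0 < t < 1 -> is_derive (V := C_R_NormedModule) gam t dg ->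
  is_derive (V := C_R_NormedModule) M t (/ gam t * dg)%C.

(** [M] models a branch of the logarithm followed along the curve. That it returns to its initial
    value means that the curve does not wind around 0. *)
Lemma cint_inv_log : cint dgam (fun t => / gam t)%C = RtoC 0.
Proof.
rewrite (cint_FTC C1 M_continuous) //; first by rewrite M_closed; ring.
by apply: continuous_on_Cinv => //; exact: gam_continuous C1.
Qed.

(** Integration by parts replaces [M T P^2] by [T P / gam]. With [W] the inverse of [T_s], one has
    [P / gam = W P - W / gam]; the last term integrates to 0 by [cint_inv_log], and the integral of
    [T W P] is given by [cint_resolvent]. *)
Lemma cint_log_derive l s W : op_functional l -> unit_interval s ->
  (forall t, unit_interval t -> (gam t - l0)%C <> RtoC 0) ->
  is_inverse (plus (op_scal l0 I) (op_scal (RtoC s) T)) W ->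
  is_derive (V := C_R_NormedModule) (fun s => cint dgam (fun t => M t * l (P s t))%C) s
    (cint dgam (fun t => / (gam t - l0)) * l (op_comp T W))%C.
Proof.
move=> hl us h0 iW; have := cint_resolvent_derive M_continuous hl us.
have hl' := functional_comp T hl.
have hl'' := functional_comp W hl'.
have cinv : continuous_on unit_interval (fun t => / gam t)%C.
  by apply: continuous_on_Cinv => //; exact: gam_continuous C1.
have c1 : continuous_on unit_interval (fun t => / gam t * l (op_comp T (P s t)))%C.
  by apply: continuous_on_Cmult => //; exact: resolvent_continuous us hl'.
have c2 : continuous_on unit_interval (fun t => M t * l (op_comp T (P2 s t)))%C.
  by apply: continuous_on_Cmult => //; exact: resolvent2_continuous us hl'.
have parts : cint dgam (fun t => / gam t * l (op_comp T (P s t)) - M t * l (op_comp T (P2 s t)))%C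
    = RtoC 0.
  rewrite (cint_FTC C1 (F := fun t => M t * l (op_comp T (P s t)))%C).
  - by rewrite M_closed /pencil closed; ring.
  - by apply: continuous_on_Cmult => //; exact: resolvent_continuous us hl'.
  - exact: continuous_on_Cminus.
  - move=> t dg ht hg.
    have -> : ((/ gam t * l (op_comp T (P s t)) - M t * l (op_comp T (P2 s t))) * dg =
        / gam t * dg * l (op_comp T (P s t)) + M t * (- l (op_comp T (P2 s t)) * dg))%C by ring.
    exact: is_derive_Cmult (M_derive ht hg) (resolvent_derive hl' us ht hg).
rewrite (cint_minus C1) // in parts.
have -> : cint dgam (fun t => M t * l (op_comp T (P2 s t)))%C =
    cint dgam (fun t => / gam t * l (op_comp T (P s t)))%C.
  by rewrite -[LHS]Cplus_0_r -parts; ring.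
have -> : cint dgam (fun t => / gam t * l (op_comp T (P s t)))%C =
    cint dgam (fun t => l (op_comp T (op_comp W (P s t))) - l (op_comp T W) * / gam t)%C.
  apply: cint_ext => t ut; have [SX XS] := pencil_inverse us ut; case: (iW) => [WT TW].
  set Ts := plus _ _ in WT TW.
  have eX : pencil s t = minus (op_scal (gam t) I) Ts.
    apply: bop_eq => x; rewrite /pencil /Ts !bop_minusE /=.
    rewrite (scal_minus_distr_r (gam t) l0 x) /minus opp_plus.
    by rewrite plus_assoc.
  have e1 : W = minus (op_scal (gam t) (op_comp W (P s t))) (P s t).
    have cW : op_comp W (pencil s t) = minus (op_scal (gam t) W) I.
      by rewrite eX op_compBr op_compZr op_comp1r WT.
    rewrite -[W in LHS]op_comp1r -XS op_compA cW op_compBl op_compZl op_comp1l //.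
  have -> : l (op_comp T W) = (gam t * l (op_comp T (op_comp W (P s t))) - l (op_comp T (P s t)))%C.
    by rewrite [in LHS]e1 op_compBr functional_minus // op_compZr (functional_scal hl).
  by field; exact: gam_ne0.
rewrite (cint_minus C1).
- rewrite (cint_scale C1) // cint_inv_log Cmult_0_r.
  have -> : cint dgam (fun t => l (op_comp T (op_comp W (P s t)))) =
     (cint dgam (fun t => / (gam t - l0)) * l (op_comp T W))%C.
    by rewrite (cint_resolvent hl'' us h0) /= op_comp1r.
  by rewrite /Cminus Copp_0 Cplus_0_r.
- exact: (resolvent_continuous us hl'').
- exact: continuous_on_scale.
Qed.

End Logarithm.
End ResolventIntegral.

(** * Exponential and logarithm *)

Lemma Cexp_plus a b : Cexp (a + b)%C = (Cexp a * Cexp b)%C.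
Proof.
rewrite /Cexp /= exp_plus cos_plus sin_plus.
by apply: injective_projections => /=; ring.
Qed.

Lemma Cexp_0 : Cexp (RtoC 0) = RtoC 1.
Proof. by rewrite /Cexp /= exp_0 cos_0 sin_0; apply: injective_projections => /=; ring. Qed.

Lemma Cexp_neq0 z : Cexp z <> RtoC 0.
Proof.
move=> h; have := Cexp_plus z (- z)%C.
rewrite h Cmult_0_l (_ : z + - z = RtoC 0)%C; last by ring.
by rewrite Cexp_0 => -[]; lra.
Qed.

Lemma Cexp_minus a b : Cexp (a - b)%C = (Cexp a / Cexp b)%C.
Proof.
have h := Cexp_plus (a - b) b; rewrite (_ : a - b + b = a)%C in h; last by ring.
by rewrite h; field; exact: Cexp_neq0.
Qed.

Lemma Cexp_first_order e : 0 < e -> exists2 d, 0 < d & forall w, Cmod w < d ->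
  Cmod (Cexp w - 1 - w)%C <= e * Cmod w.
Proof.
move=> e0; pose h := Rmin (/ 2) (e / 16).
have h0 : 0 < h by apply: Rmin_pos; lra.
have h1 : h <= / 2 := Rmin_l _ _.
have h2 : h <= e / 16 := Rmin_r _ _.
have d1 : is_derive exp 0 1 by have := is_derive_exp 0; rewrite exp_0.
have d2 : is_derive cos 0 0 by have := is_derive_cos 0; rewrite sin_0 Ropp_0.
have d3 : is_derive sin 0 1 by have := is_derive_sin 0; rewrite cos_0.
have [a a0 ha] := proj1 (is_derive_CRP _ _ _) d1 h h0.
have [b b0 hb] := proj1 (is_derive_CRP _ _ _) d2 h h0.
have [c c0 hc] := proj1 (is_derive_CRP _ _ _) d3 h h0.
exists (Rmin h (Rmin a (Rmin b c))); first by apply: Rmin_pos => //; apply: Rmin_pos => //; exact: Rmin_pos.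
move=> [x y] hw.
have q1 := Rmin_l h (Rmin a (Rmin b c)); have q2 := Rmin_r h (Rmin a (Rmin b c)).
have q3 := Rmin_l a (Rmin b c); have q4 := Rmin_r a (Rmin b c).
have q5 := Rmin_l b c; have q6 := Rmin_r b c.
have hx := Cmod_fst (x, y); have hy := Cmod_snd (x, y); rewrite /= in hx hy.
set m := Cmod _ in hw hx hy *.
have {}ha := ha x; have {}hb := hb y; have {}hc := hc y.
rewrite Rminus_0_r exp_0 in ha; rewrite Rminus_0_r cos_0 in hb.
rewrite Rminus_0_r sin_0 in hc.
have {}ha : Rabs (exp x - 1 - x * 1) <= h * Rabs x by apply: ha; lra.
have {}hb : Rabs (cos y - 1 - y * 0) <= h * Rabs y by apply: hb; lra.
have {}hc : Rabs (sin y - 0 - y * 1) <= h * Rabs y by apply: hc; lra.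
have e3 : Rabs (exp x) <= 3.
  have -> : exp x = (exp x - 1 - x * 1) + (1 + x) by ring.
  apply: Rle_trans (Rabs_triang _ _) _.
  have := Rabs_triang 1 x; rewrite Rabs_R1.
  have := Rabs_pos x; nra.
have e1 : Rabs (exp x - 1) <= 2 * Rabs x.
  have -> : exp x - 1 = (exp x - 1 - x * 1) + x by ring.
  apply: Rle_trans (Rabs_triang _ _) _; have := Rabs_pos x; nra.
have e2 : Rabs (cos y - 1) <= h * Rabs y.
  by have -> : cos y - 1 = cos y - 1 - y * 0 by ring.
have e4 : Rabs (sin y - y) <= h * Rabs y.
  by have -> : sin y - y = sin y - 0 - y * 1 by ring.
have -> : (Cexp (x, y) - 1 - (x, y))%C =
   (RtoC ((exp x - 1 - x * 1) + exp x * (cos y - 1)) +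
    Ci * RtoC (exp x * (sin y - y) + (exp x - 1) * y))%C.
  by apply: injective_projections => /=; ring.
apply: Rle_trans (Cmod_triangle _ _) _; rewrite Cmod_mult Cmod_Ci Rmult_1_l !Cmod_R.
have t1 := Rabs_triang (exp x - 1 - x * 1) (exp x * (cos y - 1)).
have t2 := Rabs_triang (exp x * (sin y - y)) ((exp x - 1) * y).
rewrite !Rabs_mult in t1 t2.
have m0 : 0 <= m := Cmod_ge_0 _.
have x0 := Rabs_pos x; have y0 := Rabs_pos y; have p0 := Rabs_pos (exp x).
have r1 : Rabs (exp x) * Rabs (cos y - 1) <= 3 * (h * m).
  apply: Rmult_le_compat => //; [exact: Rabs_pos|].
  by apply: Rle_trans e2 _; apply: Rmult_le_compat_l; lra.
have r2 : Rabs (exp x) * Rabs (sin y - y) <= 3 * (h * m).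
  apply: Rmult_le_compat => //; [exact: Rabs_pos|].
  by apply: Rle_trans e4 _; apply: Rmult_le_compat_l; lra.
have r3 : Rabs (exp x - 1) * Rabs y <= 2 * h * m.
  by apply: Rmult_le_compat => //; [exact: Rabs_pos|lra].
have r4 : h * Rabs x <= h * m by apply: Rmult_le_compat_l; lra.
have r5 : h * m <= e / 16 * m by apply: Rmult_le_compat_r.
have : 0 <= e * m by apply: Rmult_le_pos; lra.
lra.
Qed.

Section LogBranch.
Variables (D : C -> Prop) (L : C -> C).
Hypothesis logL : log_branch D L.

Lemma log_domain_neq0 z : D z -> z <> RtoC 0.
Proof. by move=> Dz; rewrite -(log_exp logL Dz); exact: Cexp_neq0. Qed.

(** A branch is only assumed to be continuous. With [k = L w - L z], which is small by continuity,
    [Cexp k - 1 = (w - z) / z], and the first-order expansion of [Cexp] at 0 is inverted. *)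
Lemma log_first_order z : D z -> forall e, 0 < e -> exists2 d, 0 < d &
  forall w, Cmod (w - z)%C < d -> D w /\ Cmod (L w - L z - (w - z) / z)%C <= e * Cmod (w - z)%C.
Proof.
move=> Dz e e0; have z0 := log_domain_neq0 Dz.
have cz : 0 < Cmod z by apply/Cmod_gt_0.
pose h := Rmin (/ 2) (e * Cmod z / 2).
have h0 : 0 < h by apply: Rmin_pos; [lra | apply: Rdiv_lt_0_compat; [exact: Rmult_lt_0_compat | lra]].
have h1 : h <= / 2 := Rmin_l _ _.
have h2 : h <= e * Cmod z / 2 := Rmin_r _ _.
have [a a0 ha] := Cexp_first_order h0.
have [b b0 hb] := proj1 (locally_Cmod _ _) (proj1 (continuous_CP _ _) (log_continuous logL Dz) a a0).
have [c c0 hc] := open_Cmod (log_open logL) Dz.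
exists (Rmin b c); first exact: Rmin_pos.
move=> w hw; have Dw : D w by apply: hc; apply: Rlt_le_trans hw (Rmin_r _ _).
split=> //.
have hk := ha _ (hb _ (Rlt_le_trans _ _ _ hw (Rmin_l _ _))).
rewrite Cexp_minus (log_exp logL Dz) (log_exp logL Dw) in hk.
set k := (L w - L z)%C in hk *.
have ez : (w / z - 1 = (w - z) / z)%C by field.
rewrite ez in hk; set zeta := ((w - z) / z)%C in hk *.
(* From [|zeta - k| <= h |k|] and [h <= 1/2]. *)
have ek : Cmod k <= 2 * Cmod zeta.
  have : Cmod k <= Cmod zeta + Cmod (zeta - k)%C.
    have := Cmod_triangle zeta (- (zeta - k))%C; rewrite Cmod_opp.
    by rewrite (_ : zeta + - (zeta - k) = k)%C //; ring.
  have := Cmod_ge_0 k; nra.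
have -> : (k - zeta = - (zeta - k))%C by ring.
rewrite Cmod_opp; apply: Rle_trans hk _.
have ezeta : Cmod zeta = Cmod (w - z)%C / Cmod z by rewrite /zeta Cmod_div.
have w0 := Cmod_ge_0 (w - z)%C.
apply: (@Rle_trans _ (e * Cmod z / 2 * (2 * Cmod zeta))).
  by apply: Rmult_le_compat => //; [lra | exact: Cmod_ge_0].
by rewrite ezeta; right; field; lra.
Qed.

Lemma log_path_derive (g : R -> C) t dg : D (g t) ->
  is_derive (V := C_R_NormedModule) g t dg ->
  is_derive (V := C_R_NormedModule) (fun s => L (g s)) t (/ g t * dg)%C.
Proof.
move=> Dg /is_derive_CP hg; apply/is_derive_CP => e e0.
have z0 := log_domain_neq0 Dg; have cz : 0 < Cmod (g t) by apply/Cmod_gt_0.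
have dg0 := Cmod_ge_0 dg.
pose e1 := e / (2 * (Cmod dg + 1)).
have e10 : 0 < e1 by apply: Rdiv_lt_0_compat; lra.
have [a a0 ha] := log_first_order Dg e10.
pose e2 := Rmin 1 (e * Cmod (g t) / 2).
have e20 : 0 < e2 by apply: Rmin_pos; [lra | apply: Rdiv_lt_0_compat; [exact: Rmult_lt_0_compat | lra]].
have e21 : e2 <= 1 := Rmin_l _ _.
have e22 : e2 <= e * Cmod (g t) / 2 := Rmin_r _ _.
have [b b0 hb] := hg e2 e20.
have d0 : 0 < a / (Cmod dg + 1) by apply: Rdiv_lt_0_compat; lra.
exists (Rmin b (a / (Cmod dg + 1))); first exact: Rmin_pos.
move=> y hy; have h1 := hb y (Rlt_le_trans _ _ _ hy (Rmin_l _ _)).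
have h2 := Rlt_le_trans _ _ _ hy (Rmin_r _ _).
set r := (g y - g t - _)%C in h1; set x := Rabs (y - t) in h1 h2 hy *.
have x0 : 0 <= x := Rabs_pos _.
have eg : (g y - g t = RtoC (y - t) * dg + r)%C by rewrite /r; ring.
have hgy : Cmod (g y - g t)%C <= (Cmod dg + 1) * x.
  rewrite eg; apply: Rle_trans (Cmod_triangle _ _) _; rewrite Cmod_mult Cmod_R -/x; nra.
have [_ h3] : D (g y) /\ Cmod (L (g y) - L (g t) - (g y - g t) / g t)%C <= e1 * Cmod (g y - g t)%C.
  apply: ha; apply: Rle_lt_trans hgy _.
  have -> : a = (Cmod dg + 1) * (a / (Cmod dg + 1)) by field; lra.
  by apply: Rmult_lt_compat_l; lra.
have -> : (L (g y) - L (g t) - RtoC (y - t) * (/ g t * dg) =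
   (L (g y) - L (g t) - (g y - g t) / g t) + r / g t)%C by rewrite eg; field.
apply: Rle_trans (Cmod_triangle _ _) _; rewrite Cmod_div //.
have p1 : e1 * Cmod (g y - g t)%C <= e / 2 * x.
  apply: Rle_trans (Rmult_le_compat_l _ _ _ (Rlt_le _ _ e10) hgy) _.
  by right; rewrite /e1; field; lra.
have p2 : Cmod r / Cmod (g t) <= e / 2 * x.
  apply: (@Rle_trans _ (e * Cmod (g t) / 2 * x / Cmod (g t))); last by right; field; lra.
  apply: Rmult_le_compat_r; first by apply: Rlt_le; exact: Rinv_0_lt_compat.
  by apply: Rle_trans h1 _; apply: Rmult_le_compat_r.
lra.
Qed.

End LogBranch.

(** The factor 2 comes from applying the mean value theorem to the real and the imaginary part
    separately. *)
Lemma C_mean_value (phi dphi : R -> C) K :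
  (forall s, 0 <= s <= 1 -> is_derive (V := C_R_NormedModule) phi s (dphi s)) ->
  (forall s, 0 <= s <= 1 -> Cmod (dphi s) <= K) ->
  Cmod (phi 1 - phi 0)%C <= 2 * K.
Proof.
move=> hd hK.
have comp (f df : R -> R) : (forall s, 0 <= s <= 1 -> is_derive f s (df s)) ->
    (forall s, 0 <= s <= 1 -> Rabs (df s) <= K) -> Rabs (f 1 - f 0) <= K.
  move=> h1 h2; have [c [hc ->]] := MVT_gen f 0 1 df
    ltac:(rewrite Rmin_left ?Rmax_right; try lra; move=> x hx; apply: h1; lra)
    ltac:(rewrite Rmin_left ?Rmax_right; try lra; move=> x hx;
      apply/continuity_pt_filterlim; apply: ex_derive_continuous;
      exists (df x); exact: h1).
  rewrite Rminus_0_r Rmult_1_r; apply: h2.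
  by move: hc; rewrite Rmin_left ?Rmax_right; lra.
have f1 := comp (fun s => fst (phi s)) (fun s => fst (dphi s))
  (fun s hs => is_derive_Cfst (hd s hs)) (fun s hs => Rle_trans _ _ _ (Cmod_fst _) (hK s hs)).
have f2 := comp (fun s => snd (phi s)) (fun s => snd (dphi s))
  (fun s hs => is_derive_Csnd (hd s hs)) (fun s hs => Rle_trans _ _ _ (Cmod_snd _) (hK s hs)).
have -> : (phi 1 - phi 0 = RtoC (fst (phi 1) - fst (phi 0)) +
   Ci * RtoC (snd (phi 1) - snd (phi 0)))%C.
  by apply: injective_projections => /=; ring.
apply: Rle_trans (Cmod_triangle _ _) _; rewrite Cmod_mult Cmod_Ci !Cmod_R; lra.
Qed.

(** * Cauchy's formula for the logarithm *)

Notation SU := C_NormedModule.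

(** Complex numbers are treated as bounded operators on the one-dimensional space [C], read off by
    their value at 1, so that scalar Cauchy integrals become instances of the resolvent lemmas. *)
Definition eval_one (T : bounded_op SU) : C := T (RtoC 1 : SU).

Lemma eval_one_functional : op_functional eval_one.
Proof.
split=> //; exists 1; first lra.
move=> T; rewrite Rmult_1_l; have := norm_bop_le T (RtoC 1 : SU).
change (norm (RtoC 1 : SU)) with (Cmod (RtoC 1)); rewrite Cmod_1 Rmult_1_r.
by move=> h; apply: Rle_trans h; right.
Qed.

Lemma eval_one_id : eval_one (op_id SU) = RtoC 1.
Proof. by []. Qed.

Section ScalarContour.
Variables (gam dgam : R -> C).
Hypothesis C1 : piecewise_C1 gam dgam.
Hypothesis closed : gam 0 = gam 1.

Definition segment (a b : C) (s : R) : C := (a + RtoC s * (b - a))%C.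

Lemma segment0 a b : segment a b 0 = a.
Proof. by rewrite /segment; ring. Qed.
Lemma segment1 a b : segment a b 1 = b.
Proof. by rewrite /segment; ring. Qed.

Lemma scalar_pencil a b s t :
  pencil gam a (op_scal (b - a)%C (op_id SU)) s t = op_scal (gam t - segment a b s)%C (op_id SU).
Proof.
apply: bop_eq => x; rewrite /pencil bop_minusE /=.
change (((gam t - a) * x - RtoC s * ((b - a) * x))%C = ((gam t - segment a b s) * x)%C :> C).
by rewrite /segment; ring.
Qed.

Lemma scalar_pencil_inverse a b s t : gam t <> segment a b s ->
  is_inverse (pencil gam a (op_scal (b - a)%C (op_id SU)) s t)
    (op_scal (/ (gam t - segment a b s))%C (op_id SU)).
Proof.
move=> ne; rewrite scalar_pencil; apply: invertible_scalar => h; apply: ne.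
by rewrite -[RHS]Cplus_0_l -h; ring.
Qed.

Lemma eval_scalar_pencil a b s t : gam t <> segment a b s ->
  eval_one (op_inv (pencil gam a (op_scal (b - a)%C (op_id SU)) s t)) =
  (/ (gam t - segment a b s))%C.
Proof.
move=> ne; rewrite (op_inv_eq (scalar_pencil_inverse ne)).
by rewrite (functional_scal eval_one_functional) eval_one_id Cmult_1_r.
Qed.

Lemma Cminus_neq0 (a b : C) : a <> b -> (a - b)%C <> RtoC 0.
Proof. by move=> ne h; apply: ne; rewrite -[RHS]Cplus_0_l -h; ring. Qed.

Definition winding (p : C) : C := cint dgam (fun t => / (gam t - p))%C.

Lemma continuous_on_Cauchy_kernel p : (forall t, unit_interval t -> gam t <> p) ->
  continuous_on unit_interval (fun t => / (gam t - p))%C.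
Proof.
move=> ne; apply: continuous_on_Cinv; last by move=> t ut; apply: Cminus_neq0; exact: ne.
apply: continuous_on_Cminus; first exact: gam_continuous C1.
by move=> t ut; exact: filterlim_const.
Qed.

(** This is [cint_resolvent_const] in dimension one, the pencil being [gam t] minus the running
    point of the segment. *)
Lemma winding_segment a b :
  (forall s t, unit_interval s -> unit_interval t -> gam t <> segment a b s) ->
  winding b = winding a.
Proof.
move=> ne.
have u1 : unit_interval 1 by rewrite /unit_interval; lra.
have u0 : unit_interval 0 by rewrite /unit_interval; lra.
have h := @cint_resolvent_const _ C_seq_complete _ _ C1 closed a (op_scal (b - a)%C (op_id SU))
  (fun s t us ut => ex_intro _ _ (scalar_pencil_inverse (ne s t us ut))) _ 1 eval_one_functional u1.
rewrite /winding; transitivity (cint dgam (fun t => / (gam t - segment a b 1))%C).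
  by rewrite segment1.
transitivity (cint dgam (fun t => / (gam t - segment a b 0))%C); last by rewrite segment0.
etransitivity; last etransitivity; last first.
- by apply: cint_ext => t ut; apply: eval_scalar_pencil; exact: ne.
- exact: h.
- by apply: cint_ext => t ut; apply: esym; apply: eval_scalar_pencil; exact: ne.
Qed.

Section LogIntegral.
Variable M : R -> C.
Hypothesis M_continuous : continuous_on unit_interval M.
Hypothesis M_closed : M 0 = M 1.
Hypothesis gam_ne0 : forall t, unit_interval t -> gam t <> RtoC 0.
Hypothesis M_derive : forall t dg, 0 < t < 1 -> is_derive (V := C_R_NormedModule) gam t dg ->
  is_derive (V := C_R_NormedModule) M t (/ gam t * dg)%C.

Definition log_integral (p : C) : C := cint dgam (fun t => M t * / (gam t - p))%C.

(** This is [cint_log_derive] in dimension one. [Phi] will be a multiple of [L] along the segment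
    inside the region, and a constant outside, where the winding number is 0. *)
Lemma log_integral_segment a b (Phi : R -> C) :
  (forall s t, unit_interval s -> unit_interval t -> gam t <> segment a b s) ->
  (forall s, unit_interval s -> segment a b s <> RtoC 0) ->
  (forall s, unit_interval s ->
     is_derive (V := C_R_NormedModule) Phi s (winding a * ((b - a) / segment a b s))%C) ->
  (log_integral b - log_integral a = Phi 1 - Phi 0)%C.
Proof.
move=> ne n0 dPhi; pose T := op_scal (b - a)%C (op_id SU).
have u0 : unit_interval 0 by rewrite /unit_interval; lra.
have u1 : unit_interval 1 by rewrite /unit_interval; lra.
have h0 t : unit_interval t -> (gam t - a)%C <> RtoC 0.
  by move=> ut; apply: Cminus_neq0; have := ne 0 t u0 ut; rewrite segment0.
pose g s := cint dgam (fun t => M t * eval_one (op_inv (pencil gam a T s t)))%C.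
have gE s : unit_interval s -> g s = log_integral (segment a b s).
  by move=> us; apply: cint_ext => t ut; rewrite eval_scalar_pencil //; exact: ne.
have dg s : unit_interval s -> is_derive (V := C_R_NormedModule) g s
    (winding a * ((b - a) / segment a b s))%C.
  move=> us.
  have eT : plus (op_scal a (op_id SU)) (op_scal (RtoC s) T) = op_scal (segment a b s) (op_id SU).
    apply: bop_eq => x /=.
    change ((a * x + RtoC s * ((b - a) * x))%C = (segment a b s * x)%C :> C).
    by rewrite /segment; ring.
  have iW : is_inverse (plus (op_scal a (op_id SU)) (op_scal (RtoC s) T))
      (op_scal (/ segment a b s)%C (op_id SU)).
    by rewrite eT; apply: invertible_scalar; exact: n0.
  have := cint_log_derive C_seq_complete C1 closed
    (fun s t us ut => ex_intro _ _ (scalar_pencil_inverse (ne s t us ut)))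
    M_continuous M_closed gam_ne0 M_derive eval_one_functional us h0 iW.
  have -> : eval_one (op_comp T (op_scal (/ segment a b s)%C (op_id SU))) = ((b - a) / segment a b s)%C.
    by change (((b - a) * (/ segment a b s * 1))%C = ((b - a) / segment a b s)%C); rewrite Cmult_1_r.
  by [].
have : (g 1 - Phi 1 = g 0 - Phi 0)%C.
  apply: (@const_finite_derive (fun s => g s - Phi s)%C [::]) => [|s hs|s hs _]; first lra.
    apply: continuous_Cplus.
      exact: (@ex_derive_continuous _ C_R_NormedModule _ _ (ex_intro _ _ (dg s hs))).
    apply: continuous_Copp.
    exact: (@ex_derive_continuous _ C_R_NormedModule _ _ (ex_intro _ _ (dPhi s hs))).
  have us : unit_interval s by rewrite /unit_interval; lra.
  have := @is_derive_minus _ C_R_NormedModule _ _ _ _ _ (dg s us) (dPhi s us).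
  by rewrite minus_eq_zero.
rewrite !gE // segment0 segment1 => e.
transitivity (log_integral b - Phi 1 + Phi 1 - log_integral a)%C; first by ring.
by rewrite e; ring.
Qed.

End LogIntegral.
End ScalarContour.

Section LogCauchy.
Variables (S D : C -> Prop) (L : C -> C) (gam dgam : R -> C).
Hypotheses (openS : open S) (connS : connected (T := C_UniformSpace) S).
Hypothesis bp : boundary_path S gam dgam.
Hypothesis logL : log_branch D L.
Hypothesis SD : forall p, S p \/ boundary S p -> D p.

Let C1 := bpath_C1 bp.
Let closed := bpath_closed bp.

Lemma bpath_boundary t : unit_interval t -> boundary S (gam t).
Proof. by move=> ut; apply/(bpath_image bp); exists t. Qed.

Lemma bpath_domain t : unit_interval t -> D (gam t).
Proof. by move=> ut; apply: SD; right; exact: bpath_boundary. Qed.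

Lemma bpath_notin t p : unit_interval t -> S p -> gam t <> p.
Proof.
move=> ut Sp e; have [d hd] := openS Sp.
have [_ [y [by_ ny]]] := bpath_boundary ut d.
by apply: ny; apply: hd; rewrite -e.
Qed.

Lemma bpath_ne0 t : unit_interval t -> gam t <> RtoC 0.
Proof. by move=> ut; apply: (log_domain_neq0 logL); exact: bpath_domain. Qed.

Lemma bpath_log_continuous : continuous_on unit_interval (fun t => L (gam t)).
Proof.
move=> t ut; apply: filterlim_comp (gam_continuous C1 ut) _.
exact: (log_continuous logL (bpath_domain ut)).
Qed.

Lemma bpath_log_closed : L (gam 0) = L (gam 1).
Proof. by rewrite closed. Qed.

Lemma bpath_log_derive t dg : 0 < t < 1 -> is_derive (V := C_R_NormedModule) gam t dg ->
  is_derive (V := C_R_NormedModule) (fun s => L (gam s)) t (/ gam t * dg)%C.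
Proof.
move=> ht; apply: (log_path_derive logL); apply: bpath_domain.
by rewrite /unit_interval; lra.
Qed.

Lemma winding_inside p : S p -> winding gam dgam p = two_pi_i.
Proof.
move=> Sp; apply: cint_unique.
apply: (@is_RInt_ext C_R_NormedModule _ _ _ _ _ _ (bpath_winding bp Sp)) => t _.
exact: Cmult_comm.
Qed.

Notation g := (log_integral gam dgam (fun t => L (gam t))).

Lemma log_integral_ball p : S p -> exists2 e, 0 < e & forall p', Cmod (p' - p)%C < e ->
  S p' /\ (g p' - two_pi_i * L p' = g p - two_pi_i * L p)%C.
Proof.
move=> Sp; have [e e0 he] := open_Cmod openS Sp.
exists e => // p' hp'; split; first exact: he.
have seg s : unit_interval s -> S (segment p p' s).
  move=> [s0 s1]; apply: he; rewrite /segment.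
  have -> : (p + RtoC s * (p' - p) - p = RtoC s * (p' - p))%C by ring.
  rewrite Cmod_mult Cmod_R Rabs_pos_eq //.
  by have := Cmod_ge_0 (p' - p)%C; nra.
have dseg s : is_derive (V := C_R_NormedModule) (segment p p') s (p' - p)%C.
  apply/is_derive_CP => d d0; exists 1; first lra; move=> y _.
  rewrite /segment (_ : _ - _ = RtoC 0)%C; last by rewrite RtoC_minus; ring.
  by rewrite Cmod_0; apply: Rmult_le_pos; [lra | exact: Rabs_pos].
have := @log_integral_segment gam dgam C1 closed _ bpath_log_continuous bpath_log_closed
  bpath_ne0 bpath_log_derive p p' (fun s => two_pi_i * L (segment p p' s))%C.
rewrite segment0 segment1 winding_inside // => h.
have {}h : (g p' - g p = two_pi_i * L p' - two_pi_i * L p)%C.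
  apply: h.
  - by move=> s t us ut; apply: bpath_notin => //; exact: seg.
  - by move=> s us; apply: (log_domain_neq0 logL); apply: SD; left; exact: seg.
  - move=> s us.
    have n0 : segment p p' s <> RtoC 0.
      by apply: (log_domain_neq0 logL); apply: SD; left; exact: seg.
    have h1 := @log_path_derive D L logL _ s _ (SD (or_introl (seg s us))) (dseg s).
    have h2 := @is_derive_Cmult (fun=> two_pi_i) _ s (RtoC 0) _ (is_derive_const _ _) h1.
    have -> : (two_pi_i * ((p' - p) / segment p p' s) =
      RtoC 0 * L (segment p p' s) + two_pi_i * (/ segment p p' s * (p' - p)))%C by field.
    exact: h2.
transitivity (g p' - g p + g p - two_pi_i * L p')%C; first by ring.
by rewrite h; ring.
Qed.

(** The Cauchy integral minus [two_pi_i L] is locally constant on the connected region. That the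
    constant is 0 is the content of [log_cauchy]. *)
Lemma log_integral_inside p p' : S p -> S p' ->
  (g p' - two_pi_i * L p' = g p - two_pi_i * L p)%C.
Proof.
move=> Sp Sp'; apply: NNPP => ne.
pose psi p := (g p - two_pi_i * L p)%C.
pose A r := S r /\ psi r = psi p; pose A' r := S r /\ psi r <> psi p.
have [r [Sr [[_ h1] [_ h2]]]] : exists r, S r /\ A r /\ A' r.
  apply: connS.
  - move=> r [Sr hr]; have [e e0 he] := log_integral_ball Sr.
    apply/locally_Cmod; exists e => // r' hr'; have [Sr' er] := he r' hr'.
    by split=> //; rewrite /psi er.
  - move=> r [Sr hr]; have [e e0 he] := log_integral_ball Sr.
    apply/locally_Cmod; exists e => // r' hr'; have [Sr' er] := he r' hr'.
    by split=> //; rewrite /psi er.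
  - by move=> r Sr; case: (excluded_middle_informative (psi r = psi p)); [left|right].
  - by exists p.
  - by exists p'.
exact: h2.
Qed.

(** The outward ray that starts at a farthest point never meets the curve again; this gives access
    to the unbounded side without any topology of plane curves. *)
Lemma bpath_farthest : exists2 t0, unit_interval t0 &
  forall t, unit_interval t -> Cmod (gam t) <= Cmod (gam t0).
Proof.
have c t : 0 <= t <= 1 -> continuity_pt (fun s => Cmod (gam (clamp s))) t.
  move=> ht; apply/continuity_pt_filterlim.
  apply: (continuous_comp (fun s => gam (clamp s)) Cmod).
    exact: (@continuous_clamp C_UniformSpace gam t (gam_continuous C1)).
  move=> P [e he]; apply/locally_Cmod; exists e; first exact: cond_pos.
  move=> w hw; apply: he; apply: Rle_lt_trans hw.
  change (Rabs (Cmod w - Cmod (gam (clamp t))) <= Cmod (w - gam (clamp t))%C).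
  have h1 := Cmod_triangle (w - gam (clamp t)) (gam (clamp t)).
  have h2 := Cmod_triangle (gam (clamp t) - w) w.
  rewrite (_ : w - gam (clamp t) + gam (clamp t) = w)%C in h1; last by ring.
  rewrite (_ : gam (clamp t) - w + w = gam (clamp t))%C in h2; last by ring.
  rewrite (_ : gam (clamp t) - w = - (w - gam (clamp t)))%C in h2; last by ring.
  rewrite Cmod_opp in h2; apply/Rabs_le_between; lra.
have [t0 [h ht0]] := continuity_ab_maj _ 0 1 Rle_0_1 c.
exists t0 => // t ut; have := h t ut; by rewrite !clampE.
Qed.

End LogCauchy.

Lemma small_multiple_zero (x c : R) : 0 <= x -> (forall e, 0 < e -> x <= e * c) -> x = 0.
Proof.
move=> x0 h; apply: Rle_antisym x0; apply: le_epsilon => e e0.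
have c1 : 0 < Rabs c + 1 by have := Rabs_pos c; lra.
have := h (e / (Rabs c + 1)) (Rdiv_lt_0_compat _ _ e0 c1).
have h1 : e / (Rabs c + 1) * c <= e / (Rabs c + 1) * Rabs c.
  by apply: Rmult_le_compat_l (Rle_abs c); apply: Rlt_le; exact: Rdiv_lt_0_compat.
have h2 : e / (Rabs c + 1) * Rabs c = e - e / (Rabs c + 1) by field; lra.
have := Rdiv_lt_0_compat _ _ e0 c1; lra.
Qed.

(** * Vanishing beyond the farthest point, and the jump across the curve *)

Section LogCauchy.
Variables (S D : C -> Prop) (L : C -> C) (gam dgam : R -> C).
Hypotheses (openS : open S) (connS : connected (T := C_UniformSpace) S).
Hypothesis bp : boundary_path S gam dgam.
Hypothesis logL : log_branch D L.
Hypothesis SD : forall p, S p \/ boundary S p -> D p.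

Let C1 := bpath_C1 bp.
Let closed := bpath_closed bp.
Notation g := (log_integral gam dgam (fun t => L (gam t))).
Notation n := (winding gam dgam).

Section Ray.
Variable p0 : C.
Hypothesis far : forall t, unit_interval t -> Cmod (gam t) <= Cmod p0.
Hypothesis p0_ne0 : p0 <> RtoC 0.

Lemma Cmod_ray r : 1 < r -> Cmod (RtoC r * p0)%C = r * Cmod p0.
Proof. by move=> r1; rewrite Cmod_mult Cmod_R Rabs_pos_eq //; lra. Qed.

Lemma segment_ray r r' s : segment (RtoC r * p0)%C (RtoC r' * p0)%C s =
  (RtoC (r + s * (r' - r)) * p0)%C.
Proof. by rewrite /segment RtoC_plus RtoC_mult RtoC_minus; ring. Qed.

Lemma ray_param r r' s : 1 < r -> 1 < r' -> unit_interval s -> 1 < r + s * (r' - r).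
Proof.
move=> h h' [s0 s1]; case: (Rle_lt_dec r r') => hr.
  by have := Rmult_le_pos s (r' - r) s0 ltac:(lra); lra.
by have := Rmult_le_pos (1 - s) (r - r') ltac:(lra) ltac:(lra); lra.
Qed.

Lemma ray_off r t : 1 < r -> unit_interval t -> gam t <> (RtoC r * p0)%C.
Proof.
move=> r1 ut e; have := far ut; rewrite e Cmod_ray //.
have : 0 < Cmod p0 by apply/Cmod_gt_0.
nra.
Qed.

Lemma ray_kernel_bound r t : 1 < r -> unit_interval t ->
  Cmod (/ (gam t - RtoC r * p0))%C <= / ((r - 1) * Cmod p0).
Proof.
move=> r1 ut; have c0 : 0 < Cmod p0 by apply/Cmod_gt_0.
have ne : (gam t - RtoC r * p0)%C <> RtoC 0 by apply: Cminus_neq0; exact: ray_off.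
rewrite Cmod_inv //; apply: Rinv_le_contravar; first by apply: Rmult_lt_0_compat; lra.
have h := Cmod_triangle (gam t) (RtoC r * p0 - gam t)%C.
rewrite (_ : gam t + _ = RtoC r * p0)%C in h; last by ring.
rewrite (_ : RtoC r * p0 - gam t = - (gam t - RtoC r * p0))%C in h; last by ring.
by rewrite Cmod_opp Cmod_ray // in h; have := far ut; lra.
Qed.

(** [f] is constant along the ray, while its integrand tends to 0 uniformly as the point goes to
    infinity. *)
Lemma ray_vanish (f : R -> C) (k : R -> R -> C) :
  (forall r r', 1 < r -> 1 < r' -> f r = f r') ->
  (exists K, forall r t, 1 < r -> unit_interval t -> Cmod (k r t) <= K / ((r - 1) * Cmod p0)) ->
  (forall r, 1 < r -> continuous_on unit_interval (k r)) ->
  (forall r, 1 < r -> f r = cint dgam (k r)) ->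
  forall r, 1 < r -> f r = RtoC 0.
Proof.
move=> fc [K hK] ck fk r r1; apply: Cmod_eq_0.
have c0 : 0 < Cmod p0 by apply/Cmod_gt_0.
have [G G0 hG] := cint_bound C1.
apply: (@small_multiple_zero _ (Rabs K * G)); first exact: Cmod_ge_0.
(* Chosen so that [1 / ((b - 1) |p0|) = e]. *)
move=> e e0; pose b := 1 + / (e * Cmod p0).
have b1 : 1 < b.
  have : 0 < / (e * Cmod p0) by apply: Rinv_0_lt_compat; exact: Rmult_lt_0_compat.
  by rewrite /b; lra.
rewrite (fc r b) // fk //.
have -> : e * (Rabs K * G) = e * Rabs K * G by ring.
apply: hG; first exact: ck.
move=> t ut; apply: Rle_trans (hK b t b1 ut) _.
have -> : K / ((b - 1) * Cmod p0) = e * K by rewrite /b; field; split; lra.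
by apply: Rmult_le_compat_l; [lra | exact: Rle_abs].
Qed.

Lemma winding_ray r : 1 < r -> n (RtoC r * p0)%C = RtoC 0.
Proof.
move: r; apply: (@ray_vanish _ (fun r t => / (gam t - RtoC r * p0))%C) => //.
- move=> r r' h h'; apply: (winding_segment C1 closed) => s t us ut.
  by rewrite segment_ray; apply: ray_off => //; exact: ray_param.
- exists 1 => r t r1 ut; apply: Rle_trans (ray_kernel_bound r1 ut) _.
  by rewrite /Rdiv Rmult_1_l; right.
- by move=> r r1; apply: (continuous_on_Cauchy_kernel C1) => t ut; exact: ray_off.
Qed.

Lemma log_integral_ray r : 1 < r -> g (RtoC r * p0)%C = RtoC 0.
Proof.
have cL := bpath_log_continuous bp logL SD.
move: r; apply: (@ray_vanish _ (fun r t => L (gam t) * / (gam t - RtoC r * p0))%C) => //.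
- move=> r r' h h'.
  have := @log_integral_segment gam dgam C1 closed _ cL (bpath_log_closed L bp)
    (bpath_ne0 bp logL SD) (bpath_log_derive bp logL SD)
    (RtoC r' * p0)%C (RtoC r * p0)%C (fun=> RtoC 0).
  rewrite winding_ray // => e; rewrite -[LHS]Cplus_0_r.
  transitivity (g (RtoC r * p0) - g (RtoC r' * p0) + g (RtoC r' * p0))%C; first by ring.
  rewrite e; first by ring.
  + by move=> s t us ut; rewrite segment_ray; apply: ray_off => //; exact: ray_param.
  + move=> s us; rewrite segment_ray; apply: Cmult_neq_0 => //; apply: RtoC_neq0.
    by have := ray_param h' h us; lra.
  + by move=> s us; rewrite Cmult_0_l; exact: is_derive_const.
- have [K hK] := continuous_on_bounded cL; exists K => r t r1 ut.
  rewrite Cmod_mult; apply: Rmult_le_compat; try exact: Cmod_ge_0; first exact: hK.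
  exact: ray_kernel_bound.
- move=> r r1; apply: continuous_on_Cmult => //.
  by apply: (continuous_on_Cauchy_kernel C1) => t ut; exact: ray_off.
Qed.

End Ray.

(** The difference quotient of the logarithm is continuous up to the diagonal; it
    is compared at two points [p], [p'] near [p0] by integrating its derivative
    along the segments issued from [p] and [p']. *)
Lemma log_quotient_close p0 : D p0 -> forall e, 0 < e -> exists2 d, 0 < d &
  forall p p' t, Cmod (p - p0)%C < d -> Cmod (p' - p0)%C < d -> unit_interval t ->
    gam t <> p -> gam t <> p' ->
    Cmod ((L (gam t) - L p) / (gam t - p) - (L (gam t) - L p') / (gam t - p'))%C <= e.
Proof.
move=> Dp0 e e0.
have c0 : 0 < Cmod p0 by apply/Cmod_gt_0; exact: (log_domain_neq0 logL).
have [rD rD0 hrD] := open_Cmod (log_open logL) Dp0.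
pose r := Rmin rD (Cmod p0 / 2).
have r0 : 0 < r by apply: Rmin_pos; lra.
have rp : r <= Cmod p0 / 2 := Rmin_r _ _.
have inD w : Cmod (w - p0)%C < r -> D w.
  by move=> hw; apply: hrD; apply: Rlt_le_trans hw (Rmin_l _ _).
have low w : Cmod (w - p0)%C < r -> Cmod p0 / 2 <= Cmod w.
  move=> hw; have := Cmod_triangle w (p0 - w)%C.
  rewrite (_ : w + (p0 - w) = p0)%C; last by ring.
  by rewrite (_ : p0 - w = - (w - p0))%C; [rewrite Cmod_opp; lra | ring].
have [K hK] := continuous_on_bounded (bpath_log_continuous bp logL SD).
have K0 : 0 <= K by apply: Rle_trans (Cmod_ge_0 _) (hK 0 _); rewrite /unit_interval; lra.
have l0 := Cmod_ge_0 (L p0).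
pose K1 := K + Cmod (L p0) + 1.
have K10 : 0 < K1 by rewrite /K1; lra.
pose eta := Rmin 1 (e * r / 16).
have eta0 : 0 < eta by apply: Rmin_pos; [lra | apply: Rdiv_lt_0_compat; [exact: Rmult_lt_0_compat | lra]].
have [b b0 hb] := proj1 (locally_Cmod _ _) (proj1 (continuous_CP _ _) (log_continuous logL Dp0) eta eta0).
(* [d1] serves the points of the curve at distance at least [r] from [p0], where the denominators
   are bounded below, and [d2] the nearer ones, where both segments stay in a disc on which [L] is
   differentiable with bounded derivative. *)
pose d1 := e * r ^ 2 / (16 * K1).
have d10 : 0 < d1 by apply: Rdiv_lt_0_compat; [apply: Rmult_lt_0_compat => //; exact: pow_lt | lra].
pose d2 := e * Cmod p0 ^ 2 / 16.
have d20 : 0 < d2 by apply: Rdiv_lt_0_compat; [apply: Rmult_lt_0_compat => //; exact: pow_lt | lra].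
pose d := Rmin (Rmin (r / 2) b) (Rmin d1 d2).
have d0 : 0 < d by apply: Rmin_pos; apply: Rmin_pos => //; lra.
have dr : d <= r / 2 by apply: Rle_trans (Rmin_l _ _) (Rmin_l _ _).
have db : d <= b by apply: Rle_trans (Rmin_l _ _) (Rmin_r _ _).
have dd1 : d <= d1 by apply: Rle_trans (Rmin_r _ _) (Rmin_l _ _).
have dd2 : d <= d2 by apply: Rle_trans (Rmin_r _ _) (Rmin_r _ _).
exists d => // p p' t hp hp' ut np np'.
have np0 : (gam t - p)%C <> RtoC 0 by exact: Cminus_neq0.
have np0' : (gam t - p')%C <> RtoC 0 by exact: Cminus_neq0.
have hpp : Cmod (p' - p)%C <= 2 * d.
  have := Cmod_triangle (p' - p0)%C (p0 - p)%C.
  rewrite (_ : p' - p0 + (p0 - p) = p' - p)%C; last by ring.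
  by rewrite (_ : p0 - p = - (p - p0))%C; [rewrite Cmod_opp; lra | ring].
set w := gam t in np np' np0 np0' *.
case: (Rlt_le_dec (Cmod (w - p0)%C) r) => hw.
- pose phi a s := ((L (segment a w s) - L a) / (w - a))%C.
  have seg a s : Cmod (a - p0)%C < r -> unit_interval s -> Cmod (segment a w s - p0)%C < r.
    move=> ha [s0 s1].
    have -> : (segment a w s - p0 = RtoC (1 - s) * (a - p0) + RtoC s * (w - p0))%C.
      by rewrite /segment RtoC_minus; ring.
    apply: Rle_lt_trans (Cmod_triangle _ _) _.
    rewrite !Cmod_mult !Cmod_R !Rabs_pos_eq; try lra.
    have [->|s0'] := Req_dec s 0; first lra.
    by have := Cmod_ge_0 (a - p0)%C; nra.
  have dphi a s : Cmod (a - p0)%C < r -> w <> a -> unit_interval s ->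
      is_derive (V := C_R_NormedModule) (phi a) s (/ segment a w s)%C.
    move=> ha nwa us.
    have dseg : is_derive (V := C_R_NormedModule) (segment a w) s (w - a)%C.
      apply/is_derive_CP => d' d0'; exists 1; first lra; move=> y _.
      rewrite /segment (_ : _ - _ = RtoC 0)%C; last by rewrite RtoC_minus; ring.
      by rewrite Cmod_0; apply: Rmult_le_pos; [lra | exact: Rabs_pos].
    have Ds := inD _ (seg a s ha us).
    have n0 := log_domain_neq0 logL Ds; have nwa0 := Cminus_neq0 nwa.
    have h1 := @log_path_derive D L logL _ s _ Ds dseg.
    have h2 := @is_derive_minus _ C_R_NormedModule _ _ _ _ _ h1
      (@is_derive_const _ C_R_NormedModule (L a) s).
    have h3 := is_derive_Cmult h2 (@is_derive_const _ C_R_NormedModule (/ (w - a))%C s).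
    have -> : (/ segment a w s = (/ segment a w s * (w - a) - RtoC 0) * / (w - a)
      + (L (segment a w s) - L a) * RtoC 0)%C by field.
    exact: h3.
  have rr : forall a, Cmod (a - p0)%C < d -> Cmod (a - p0)%C < r by move=> a ha; lra.
  have := @C_mean_value (fun s => phi p s - phi p' s)%C
    (fun s => / segment p w s - / segment p' w s)%C (e / 2) _ _.
  have -> : (phi p 1 - phi p' 1 - (phi p 0 - phi p' 0) =
      (L w - L p) / (w - p) - (L w - L p') / (w - p'))%C.
    by rewrite /phi !segment0 !segment1; field.
  move=> h; apply: Rle_trans (h _ _) _; last lra.
    move=> s hs.
    exact: (@is_derive_minus _ C_R_NormedModule _ _ _ _ _ (dphi p s (rr _ hp) np hs)
       (dphi p' s (rr _ hp') np' hs)).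
  move=> s hs; have s1 := seg p s (rr _ hp) hs; have s2 := seg p' s (rr _ hp') hs.
  have n1 := log_domain_neq0 logL (inD _ s1); have n2 := log_domain_neq0 logL (inD _ s2).
  have -> : (/ segment p w s - / segment p' w s =
     RtoC (1 - s) * (p' - p) * (/ segment p w s * / segment p' w s))%C.
    transitivity ((segment p' w s - segment p w s) * (/ segment p w s * / segment p' w s))%C.
      by field.
    by congr (_ * _)%C; rewrite /segment RtoC_minus; ring.
  rewrite !Cmod_mult !Cmod_inv // Cmod_R Rabs_pos_eq; last by move: hs; lra.
  have i1 : / Cmod (segment p w s) <= / (Cmod p0 / 2).
    by apply: Rinv_le_contravar; [lra | exact: low].
  have i2 : / Cmod (segment p' w s) <= / (Cmod p0 / 2).
    by apply: Rinv_le_contravar; [lra | exact: low].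
  have j1 : 0 <= / Cmod (segment p w s) by apply: Rlt_le; apply: Rinv_0_lt_compat; apply/Cmod_gt_0.
  have j2 : 0 <= / Cmod (segment p' w s) by apply: Rlt_le; apply: Rinv_0_lt_compat; apply/Cmod_gt_0.
  have i3 := Rmult_le_compat _ _ _ _ j1 j2 i1 i2.
  have i4 : (1 - s) * Cmod (p' - p)%C <= 2 * d by have := Cmod_ge_0 (p' - p)%C; move: hs; nra.
  have i5 : 0 <= (1 - s) * Cmod (p' - p)%C.
    by apply: Rmult_le_pos; [lra | exact: Cmod_ge_0].
  have i6 : 0 <= / Cmod (segment p w s) * / Cmod (segment p' w s) by exact: Rmult_le_pos.
  apply: Rle_trans (Rmult_le_compat _ _ _ _ i5 i6 i4 i3) _.
  apply: (@Rle_trans _ (2 * d2 * (/ (Cmod p0 / 2) * / (Cmod p0 / 2)))).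
    apply: Rmult_le_compat_r; last lra.
    by apply: Rmult_le_pos; apply: Rlt_le; apply: Rinv_0_lt_compat; lra.
  by right; rewrite /d2; field; lra.
- have dist a : Cmod (a - p0)%C < d -> r / 2 <= Cmod (w - a)%C.
    move=> ha; have := Cmod_triangle (w - a)%C (a - p0)%C.
    by rewrite (_ : w - a + (a - p0) = w - p0)%C; [lra | ring].
  have lb a : Cmod (a - p0)%C < d -> Cmod (L a - L p0)%C < eta by move=> ha; apply: hb; lra.
  have eta1 : eta <= 1 := Rmin_l _ _.
  have etae : eta <= e * r / 16 := Rmin_r _ _.
  have hLw : Cmod (L w - L p)%C <= K1.
    have := Cmod_triangle (L w - L p0)%C (- (L p - L p0))%C.
    rewrite (_ : L w - L p0 + - (L p - L p0) = L w - L p)%C; last by ring.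
    have := Cmod_triangle (L w) (- L p0)%C; rewrite !Cmod_opp.
    have := hK t ut; have := lb p hp; rewrite -/w /K1 /Cminus; lra.
  have hLp : Cmod (L p' - L p)%C <= 2 * eta.
    have := Cmod_triangle (L p' - L p0)%C (- (L p - L p0))%C.
    rewrite (_ : L p' - L p0 + - (L p - L p0) = L p' - L p)%C; last by ring.
    by rewrite Cmod_opp; have := lb p hp; have := lb p' hp'; lra.
  have -> : ((L w - L p) / (w - p) - (L w - L p') / (w - p') =
     - ((L w - L p) * (p' - p) * (/ (w - p) * / (w - p'))) + (L p' - L p) * / (w - p'))%C by field.
  apply: Rle_trans (Cmod_triangle _ _) _; rewrite Cmod_opp !Cmod_mult !Cmod_inv //.
  have i1 : / Cmod (w - p)%C <= / (r / 2) by apply: Rinv_le_contravar; [lra | exact: dist].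
  have i2 : / Cmod (w - p')%C <= / (r / 2) by apply: Rinv_le_contravar; [lra | exact: dist].
  have j1 : 0 <= / Cmod (w - p)%C by apply: Rlt_le; apply: Rinv_0_lt_compat; apply/Cmod_gt_0.
  have j2 : 0 <= / Cmod (w - p')%C by apply: Rlt_le; apply: Rinv_0_lt_compat; apply/Cmod_gt_0.
  have i3 := Rmult_le_compat _ _ _ _ j1 j2 i1 i2.
  have i4 := Rmult_le_compat _ _ _ _ (Cmod_ge_0 _) (Cmod_ge_0 _) hLw hpp.
  have i5 := Rmult_le_compat _ _ _ _ (Rmult_le_pos _ _ (Cmod_ge_0 _) (Cmod_ge_0 _))
     (Rmult_le_pos _ _ j1 j2) i4 i3.
  have i6 := Rmult_le_compat _ _ _ _ (Cmod_ge_0 _) j2 hLp i2.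
  have k1 : K1 * (2 * d) * (/ (r / 2) * / (r / 2)) <= e / 2.
    apply: (@Rle_trans _ (K1 * (2 * d1) * (/ (r / 2) * / (r / 2)))).
      apply: Rmult_le_compat_r.
        by apply: Rmult_le_pos; apply: Rlt_le; apply: Rinv_0_lt_compat; lra.
      by apply: Rmult_le_compat_l; lra.
    by right; rewrite /d1; field; lra.
  have k2 : 2 * eta * / (r / 2) <= e / 4.
    apply: (@Rle_trans _ (2 * (e * r / 16) * / (r / 2))).
      apply: Rmult_le_compat_r; last lra.
      by apply: Rlt_le; apply: Rinv_0_lt_compat; lra.
    by right; field; lra.
  lra.
Qed.

(** For [a] off the curve, let [k a] be the difference quotient of [L] between the curve and [a].
    Its integral is [g a - two_pi_i L a] for [a] in the region, and 0 for [a] on the ray beyond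
    [p0]. Near [p0] there are points of both kinds, and their integrals differ by little, so the
    constant of [log_integral_inside] is 0. *)
Lemma log_cauchy p : S p -> g p = (two_pi_i * L p)%C.
Proof.
move=> Sp.
have [t0 ut0 far] := bpath_farthest bp.
set p0 := gam t0 in far.
have Dp0 : D p0 by exact: (bpath_domain bp SD ut0).
have p0n : p0 <> RtoC 0 := log_domain_neq0 logL Dp0.
have c0 : 0 < Cmod p0 by apply/Cmod_gt_0.
have [rD rD0 hrD] := open_Cmod (log_open logL) Dp0.
have cL := bpath_log_continuous bp logL SD.
have [G G0 hG] := cint_bound C1.
pose k a t := ((L (gam t) - L a) / (gam t - a))%C.
have ck a : (forall t, unit_interval t -> gam t <> a) -> continuous_on unit_interval (k a).
  move=> na; apply: continuous_on_Cmult; last exact: (continuous_on_Cauchy_kernel C1).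
  by apply: continuous_on_Cminus => // t ut; exact: filterlim_const.
have kE a : (forall t, unit_interval t -> gam t <> a) ->
    cint dgam (k a) = (g a - L a * n a)%C.
  move=> na; have cK := continuous_on_Cauchy_kernel C1 na.
  rewrite -(cint_scale C1) // -(cint_minus C1).
  - by apply: cint_ext => t ut; rewrite /k /Cdiv; ring.
  - exact: continuous_on_Cmult.
  - exact: continuous_on_scale.
suff h : Cmod (g p - two_pi_i * L p)%C = 0.
  by move/Cmod_eq_0: h => h; rewrite -[RHS]Cplus_0_l -h; ring.
apply: (@small_multiple_zero _ G); first exact: Cmod_ge_0.
move=> e e0; have [d d0 hd] := log_quotient_close Dp0 e0.
have m0 : 0 < Rmin d rD by exact: Rmin_pos.
have [b [b1 hb]] : exists b, 1 < b /\ (b - 1) * Cmod p0 < Rmin d rD.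
  exists (1 + Rmin d rD / (2 * Cmod p0)); split.
    by have : 0 < Rmin d rD / (2 * Cmod p0); [apply: Rdiv_lt_0_compat | ]; lra.
  have -> : (1 + Rmin d rD / (2 * Cmod p0) - 1) * Cmod p0 = Rmin d rD / 2 by field; lra.
  lra.
have bd := bpath_boundary bp ut0.
have d4 : 0 < d / 2 by lra.
(* Balls in [C] are squares; passing to the modulus costs at most a factor 2. *)
have [[p' [hp' Sp']] _] := bd (mkposreal _ (ltac:(lra) : 0 < d / 4)).
have hp'' : Cmod (p' - p0)%C < d by have := ball_Cmod hp'; rewrite /= -/p0; lra.
rewrite (log_integral_inside openS connS bp logL SD Sp' Sp).
have na : forall t, unit_interval t -> gam t <> p'.
  by move=> t ut; exact: (bpath_notin openS bp ut Sp').
have nb : forall t, unit_interval t -> gam t <> (RtoC b * p0)%C.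
  by move=> t ut; exact: (ray_off far p0n b1 ut).
have hb' : Cmod (RtoC b * p0 - p0)%C < d.
  rewrite (_ : RtoC b * p0 - p0 = RtoC (b - 1) * p0)%C; last by rewrite RtoC_minus; ring.
  rewrite Cmod_mult Cmod_R Rabs_pos_eq; last lra.
  exact: Rlt_le_trans hb (Rmin_l _ _).
have e1 : (g p' - two_pi_i * L p' = cint dgam (fun t => k p' t - k (RtoC b * p0)%C t))%C.
  rewrite (cint_minus C1); [|exact: ck|exact: ck].
  rewrite !kE // (winding_inside bp Sp') (winding_ray far p0n b1) (log_integral_ray far p0n b1).
  ring.
rewrite e1; apply: hG; first by apply: continuous_on_Cminus; exact: ck.
move=> t ut; apply: hd => //; [exact: na | exact: nb].
Qed.

End LogCauchy.

(** * Discs and their boundaries *)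

Lemma polar_angle (x y : R) : x ^ 2 + y ^ 2 = 1 ->
  exists2 th, 0 <= th <= 2 * PI & x = cos th /\ y = sin th.
Proof.
move=> h; have hx : -1 <= x <= 1 by nra.
have hpi := PI_RGT_0; have [a0 a1] := acos_bound x.
have c := cos_acos x hx.
have s : sin (acos x) = sqrt (1 - x²) := sin_acos x hx.
have e : 1 - x² = y ^ 2 by rewrite /Rsqr; lra.
case: (Rle_lt_dec 0 y) => hy.
  exists (acos x); first lra.
  by split; [rewrite c | rewrite s e sqrt_pow2].
exists (2 * PI - acos x); first lra.
have p1 : cos (2 * PI) = 1 := cos_2PI; have p2 : sin (2 * PI) = 0 := sin_2PI.
split; first by rewrite cos_minus p1 p2 c; ring.
rewrite sin_minus p1 p2 s e (_ : y ^ 2 = (- y) ^ 2); last by ring.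
by rewrite sqrt_pow2; lra.
Qed.

Lemma polar (z : C) : exists2 th, 0 <= th <= 2 * PI & z = (RtoC (Cmod z) * (cos th, sin th))%C.
Proof.
have hpi := PI_RGT_0.
case: (excluded_middle_informative (z = RtoC 0)) => [->|z0].
  by exists 0; [lra | rewrite Cmod_0; ring].
have c0 : 0 < Cmod z by apply/Cmod_gt_0.
have h : (fst z / Cmod z) ^ 2 + (snd z / Cmod z) ^ 2 = 1.
  have h2 := Cmod2_alt z; rewrite /Re /Im in h2.
  transitivity ((fst z ^ 2 + snd z ^ 2) / Cmod z ^ 2); first by field; lra.
  by rewrite -h2; field; lra.
have [th hth [e1 e2]] := polar_angle h; exists th => //.
by rewrite -e1 -e2; apply: injective_projections => /=; field; lra.
Qed.

Lemma Cexp_surj (z : C) : z <> RtoC 0 -> exists l, Cexp l = z.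
Proof.
move=> z0; have c0 : 0 < Cmod z by apply/Cmod_gt_0.
have [th _ e] := polar z; exists (ln (Cmod z), th).
by rewrite /Cexp /= exp_ln // -e.
Qed.

Definition Clog (z : C) : C := (ln (Cmod z), atan (snd z / fst z)).

Lemma Cexp_Clog z : 0 < fst z -> Cexp (Clog z) = z.
Proof.
case: z => x y /= x0.
have h : Cmod (x, y) = x * sqrt (1 + (y / x)²).
  transitivity (sqrt (x ^ 2) * sqrt (1 + (y / x)²)); last by rewrite sqrt_pow2; lra.
  rewrite -sqrt_mult; [|exact: pow2_ge_0 | by have := Rle_0_sqr (y / x); lra].
  by rewrite /Cmod /=; congr sqrt; rewrite /Rsqr; field; lra.
have s0 : 0 < sqrt (1 + (y / x)²) by apply: sqrt_lt_R0; have := Rle_0_sqr (y / x); lra.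
rewrite /Cexp /Clog /= cos_atan sin_atan exp_ln; last by rewrite h; exact: Rmult_lt_0_compat.
by rewrite h; apply: injective_projections => /=; field; lra.
Qed.

Lemma continuous_Cmod z : continuous Cmod z.
Proof.
move=> P [e he]; apply/locally_Cmod; exists e; first exact: cond_pos.
move=> w hw; apply: he; apply: Rle_lt_trans hw.
change (Rabs (Cmod w - Cmod z) <= Cmod (w - z)%C).
have h1 := Cmod_triangle (w - z) z; have h2 := Cmod_triangle (z - w) w.
rewrite (_ : w - z + z = w)%C in h1; last by ring.
rewrite (_ : z - w + w = z)%C in h2; last by ring.
rewrite (_ : z - w = - (w - z))%C in h2; last by ring.
rewrite Cmod_opp in h2; apply/Rabs_le_between; lra.
Qed.

Lemma continuous_Clog z : 0 < fst z -> continuous Clog z.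
Proof.
move=> z0; apply: continuous_Cpair.
  apply: (continuous_comp Cmod ln); first exact: continuous_Cmod.
  apply: (@ex_derive_continuous _ R_NormedModule); exists (/ Cmod z).
  apply: is_derive_ln; apply/Cmod_gt_0 => e; rewrite e /= in z0; lra.
apply: (continuous_comp (fun w : C => snd w / fst w) atan).
  apply: (continuous_mult (K := R_AbsRing)); first exact: continuous_snd.
  apply: (continuous_comp fst Rinv); first exact: continuous_fst.
  by apply: continuous_Rinv => h; rewrite h in z0; lra.
apply: (@ex_derive_continuous _ R_NormedModule); eexists; exact: is_derive_atan.
Qed.

(** The right half plane rotated so that its axis passes through [m]: it carries a branch of the
    logarithm and contains every closed disc about [m] of radius less than [|m|]. *)
Definition half_plane (m : C) (w : C) : Prop := 0 < fst (w / m)%C.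

Lemma half_plane_log m : m <> RtoC 0 ->
  exists L, log_branch (half_plane m) L.
Proof.
move=> m0; have [lm hlm] := Cexp_surj m0.
have c w : continuous (fun w : C => w / m)%C w.
  by apply: continuous_Cmult; [exact: continuous_id | exact: continuous_const].
exists (fun w => lm + Clog (w / m))%C; split.
- move=> w hw.
  have h : locally w (fun w' => ball (fst (w / m)%C) (mkposreal _ hw) (fst (w' / m)%C)) :=
    continuous_Cfst (c w) (locally_ball _ (mkposreal _ hw)).
  apply: filter_imp h => w' hw'; have hw'' : Rabs (fst (w' / m)%C - fst (w / m)%C) < fst (w / m)%C := hw'.
  by move: hw''; rewrite /half_plane /Rabs; case: Rcase_abs => ? ?; lra.
- move=> w hw; apply: continuous_Cplus; first exact: continuous_const.
  by apply: (continuous_comp (fun w : C => w / m)%C Clog) => //; exact: continuous_Clog.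
- by move=> w hw; rewrite Cexp_plus hlm Cexp_Clog //; field.
Qed.

Definition disc (m : C) (r : R) (w : C) : Prop := Cmod (w - m)%C < r.

Lemma disc_open m r : open (disc m r).
Proof.
move=> w hw; apply/locally_Cmod; exists (r - Cmod (w - m)%C); first by rewrite /disc in hw; lra.
move=> w' hw'; rewrite /disc (_ : w' - m = (w' - w) + (w - m))%C; last by ring.
by apply: Rle_lt_trans (Cmod_triangle _ _) _; lra.
Qed.

Lemma disc_convex m r : convex (disc m r).
Proof.
move=> x y t hx hy ht; rewrite /disc.
have -> : (RtoC (1 - t) * x + RtoC t * y - m = RtoC (1 - t) * (x - m) + RtoC t * (y - m))%C.
  by rewrite RtoC_minus; ring.
apply: Rle_lt_trans (Cmod_triangle _ _) _; rewrite !Cmod_mult !Cmod_R !Rabs_pos_eq; try lra.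
rewrite /disc in hx hy; case: (Req_dec t 0) => [->|t0]; first lra.
nra.
Qed.

Lemma continuous_affine (x y : C) t :
  continuous (fun t : R => RtoC (1 - t) * x + RtoC t * y)%C t.
Proof.
apply: continuous_Cplus; apply: continuous_Cmult; try exact: continuous_const.
  apply: continuous_RtoC; apply: (continuous_minus (V := R_NormedModule)).
    exact: continuous_const.
  exact: continuous_id.
by apply: continuous_RtoC; exact: continuous_id.
Qed.

Lemma convex_connected (S : C -> Prop) : convex S -> connected (T := C_UniformSpace) S.
Proof.
move=> cS; apply: joined_connected => x y Sx Sy.
have e0 : (RtoC (1 - 0) * x + RtoC 0 * y = x)%C by rewrite Rminus_0_r; ring.
have e1 : (RtoC (1 - 1) * x + RtoC 1 * y = y)%C by rewrite Rminus_diag; ring.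
exists (fun t : R => RtoC (1 - t) * x + RtoC t * y)%C; split => //.
- by move=> t _; exact: continuous_affine.
- by move=> t ut; apply: cS.
Qed.

(** The loop is contracted to [m] along straight lines. *)
Lemma convex_simply_connected (S : C -> Prop) m : convex S -> S m -> simply_connected S.
Proof.
move=> cS Sm c cc c01 Sc.
exists (fun st => RtoC (1 - snd st) * c (fst st) + RtoC (snd st) * m)%C, m; split.
- move=> [s t] [/= us ut].
  have h1 : filterlim (fun st : R * R => c (fst st))
      (within (fun st => unit_interval (fst st) /\ unit_interval (snd st))
        (locally ((s, t) : prod_UniformSpace R_UniformSpace R_UniformSpace))) (locally (c s)).
    move=> P hP; have [d hd] := cc s us P hP.
    by exists d => -[s' t'] [/= hs _] [us' _]; apply: hd.
  have h2 (a b : R) : filterlim (fun st : R * R => RtoC (a + b * snd st))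
      (within (fun st => unit_interval (fst st) /\ unit_interval (snd st))
        (locally ((s, t) : prod_UniformSpace R_UniformSpace R_UniformSpace)))
      (locally (RtoC (a + b * t))).
    apply: (filterlim_filter_le_1 (F := locally ((s, t) : prod_UniformSpace R_UniformSpace R_UniformSpace))).
      exact: filter_le_within.
    refine (@continuous_RtoC (prod_UniformSpace R_UniformSpace R_UniformSpace)
      (fun st => a + b * snd st) (s, t) _).
    apply: (continuous_plus (V := R_NormedModule)); first exact: continuous_const.
    apply: (continuous_mult (K := R_AbsRing)); first exact: continuous_const.
    exact: continuous_snd.
  have e1 : RtoC (1 + -1 * t) = RtoC (1 - t) by congr RtoC; ring.
  have h3 := h2 1 (-1); rewrite e1 in h3.
  have h4 := h2 0 1; rewrite (_ : 0 + 1 * t = t) in h4; last by ring.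
  have FF : Filter (within (fun st : R * R => unit_interval (fst st) /\ unit_interval (snd st))
      (locally ((s, t) : prod_UniformSpace R_UniformSpace R_UniformSpace))) by exact: within_filter.
  have h5 := @filterlim_Cmult _ _ FF _ _ _ _ h3 h1.
  have h6 := @filterlim_Cmult _ _ FF _ _ _ _ h4 (filterlim_const m).
  have c7 := @continuous_Cplus (prod_UniformSpace C_UniformSpace C_UniformSpace) fst snd
    (RtoC (1 - t) * c s, RtoC t * m)%C
    (@continuous_fst C_UniformSpace C_UniformSpace _ _) (@continuous_snd C_UniformSpace C_UniformSpace _ _).
  apply: (filterlim_ext (fun st : R * R => (RtoC (1 + -1 * snd st) * c (fst st) +
     RtoC (0 + 1 * snd st) * m)%C)).
    move=> st; congr (RtoC _ * _ + RtoC _ * _)%C; ring.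
  refine (filterlim_comp_2 _ _ Cplus h5 (h6 FF) _) => P hP; have [e he] := c7 P hP.
  exists (ball (RtoC (1 - t) * c s)%C e) (ball (RtoC t * m)%C e).
  + exact: locally_ball.
  + exact: locally_ball.
  + by move=> x y hx hy; exact: (he (x, y)).
- by move=> [s t] [/= us ut]; apply: cS => //; exact: Sc.
- by move=> t _ /=; rewrite Rminus_0_r; ring.
- by move=> t _ /=; rewrite Rminus_diag; ring.
- by move=> s _ /=; rewrite c01.
Qed.

Lemma continuous_within (T W : UniformSpace) (f : T -> W) (P : T -> Prop) x :
  continuous f x -> filterlim f (within P (locally x)) (locally (f x)).
Proof. by move=> h Y hY; apply: filter_le_within; exact: h. Qed.

Section Circle.
Variables (m : C) (r : R).
Hypothesis r0 : 0 < r.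

Definition circle (t : R) : C := (m + RtoC r * (cos (2 * PI * t), sin (2 * PI * t)))%C.
Definition dcircle (t : R) : C := (two_pi_i * (circle t - m))%C.

Lemma circle_derive t : is_derive (V := C_R_NormedModule) circle t (dcircle t).
Proof.
have d1 : is_derive (fun t => cos (2 * PI * t)) t (- (2 * PI) * sin (2 * PI * t)).
  by auto_derive => //; ring.
have d2 : is_derive (fun t => sin (2 * PI * t)) t (2 * PI * cos (2 * PI * t)).
  by auto_derive => //; ring.
apply/is_derive_CP => e e0; have e2 : 0 < e / (2 * r) by apply: Rdiv_lt_0_compat; lra.
have [a a0 ha] := proj1 (is_derive_CRP _ _ _) d1 _ e2.
have [b b0 hb] := proj1 (is_derive_CRP _ _ _) d2 _ e2.
exists (Rmin a b); first exact: Rmin_pos.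
move=> y hy; have h1 := ha y (Rlt_le_trans _ _ _ hy (Rmin_l _ _)).
have h2 := hb y (Rlt_le_trans _ _ _ hy (Rmin_r _ _)).
set u := cos _ - cos _ - _ in h1; set v := sin _ - sin _ - _ in h2.
have -> : (circle y - circle t - RtoC (y - t) * dcircle t =
   RtoC r * (RtoC u + Ci * RtoC v))%C.
  by rewrite /dcircle /circle /two_pi_i /u /v; apply: injective_projections => /=; ring.
rewrite Cmod_mult Cmod_R Rabs_pos_eq; last lra.
have := Cmod_triangle (RtoC u) (Ci * RtoC v).
rewrite Cmod_mult Cmod_Ci !Cmod_R => h3.
apply: (@Rle_trans _ (r * (e / (2 * r) * Rabs (y - t) + e / (2 * r) * Rabs (y - t)))).
  by apply: Rmult_le_compat_l; lra.
by right; field; lra.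
Qed.

Lemma circle_continuous t : continuous circle t.
Proof. exact: (@ex_derive_continuous _ C_R_NormedModule _ _ (ex_intro _ _ (circle_derive t))). Qed.

Lemma dcircle_continuous t : continuous dcircle t.
Proof.
apply: continuous_Cmult; first exact: continuous_const.
apply: continuous_Cplus; first exact: circle_continuous.
exact: continuous_const.
Qed.

Lemma circle_C1 : piecewise_C1 circle dcircle.
Proof.
split; first by move=> t _; exact: continuous_within (@circle_continuous t).
split; first by exists [::] => t _ _; split; [exact: circle_derive | exact: dcircle_continuous].
by split=> t _; exists (dcircle t); exact: continuous_within (@dcircle_continuous t).
Qed.

Lemma circle_closed : circle 0 = circle 1.
Proof. by rewrite /circle Rmult_0_r Rmult_1_r cos_2PI sin_2PI cos_0 sin_0. Qed.

Lemma Cmod_circle t : Cmod (circle t - m)%C = r.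
Proof.
have -> : (circle t - m = RtoC r * (cos (2 * PI * t), sin (2 * PI * t)))%C by rewrite /circle; ring.
rewrite Cmod_mult Cmod_R Rabs_pos_eq; last lra.
have -> : Cmod (cos (2 * PI * t), sin (2 * PI * t)) = 1; last by ring.
rewrite /Cmod /= -[RHS]sqrt_1; congr sqrt.
by have := sin2_cos2 (2 * PI * t); rewrite /Rsqr; lra.
Qed.

Lemma circle_surj p : Cmod (p - m)%C = r -> exists2 t, unit_interval t & circle t = p.
Proof.
move=> hp; have hpi := PI_RGT_0; have [th hth e] := polar (p - m)%C.
exists (th / (2 * PI)).
  split; first by apply: Rdiv_le_0_compat; lra.
  by apply/(Rmult_le_reg_r (2 * PI)); [lra | rewrite /Rdiv Rmult_assoc Rinv_l; lra].
rewrite /circle (_ : 2 * PI * (th / (2 * PI)) = th); last by field; lra.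
by rewrite -hp -e; ring.
Qed.

Lemma circle_simple s t : 0 <= s < 1 -> 0 <= t < 1 -> circle s = circle t -> s = t.
Proof.
move=> hs ht e; have hpi := PI_RGT_0.
have e2 : (RtoC r * (cos (2 * PI * s), sin (2 * PI * s)) =
    RtoC r * (cos (2 * PI * t), sin (2 * PI * t)))%C.
  transitivity (circle s - m)%C; first by rewrite /circle; ring.
  by rewrite e /circle; ring.
have [e3 e4] : cos (2 * PI * s) = cos (2 * PI * t) /\ sin (2 * PI * s) = sin (2 * PI * t).
  case: e2 => /=; rewrite !Rmult_0_l !Rminus_0_r !Rplus_0_r => h1 h2.
  by split; apply: (Rmult_eq_reg_l r) => //; lra.
have c : cos (2 * PI * s - 2 * PI * t) = 1.
  by rewrite cos_minus e3 e4; have := sin2_cos2 (2 * PI * t); rewrite /Rsqr; lra.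
have [k hk] : exists k : Z, PI * (s - t) = IZR k * PI.
  apply: sin_eq_0_0; have := cos_2a_sin (PI * (s - t)).
  rewrite (_ : 2 * (PI * (s - t)) = 2 * PI * s - 2 * PI * t) ?c; last by ring.
  nra.
have hk2 : s - t = IZR k by apply: (Rmult_eq_reg_r PI); lra.
have : (-1 < k)%Z by apply: lt_IZR; lra.
have : (k < 1)%Z by apply: lt_IZR; lra.
move=> k1 k2; have k0 : k = 0%Z by lia.
by rewrite k0 in hk2; lra.
Qed.

Lemma disc_boundary p : boundary (disc m r) p <-> Cmod (p - m)%C = r.
Proof.
split=> [h|h eps].
- case: (Rtotal_order (Cmod (p - m)%C) r) => [lt|[//|gt]].
    have [d hd] := disc_open lt.
    by have [_ [y [hy ny]]] := h d; case: ny; apply: hd.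
  have d0 : 0 < (Cmod (p - m)%C - r) / 4 by lra.
  have [[x [/ball_Cmod /= hx dx]] _] := h (mkposreal _ d0).
  have := Cmod_triangle (x - m)%C (p - x)%C.
  rewrite (_ : x - m + (p - x) = p - m)%C; last by ring.
  rewrite (_ : p - x = - (x - p))%C; last by ring.
  by rewrite Cmod_opp; rewrite /disc in dx; lra.
- have e0 := cond_pos eps; split; last first.
    by exists p; split; [exact: ball_center | rewrite /disc; lra].
  pose s := Rmin (/ 2) (eps / (2 * r)).
  have s0 : 0 < s by apply: Rmin_pos; [lra | apply: Rdiv_lt_0_compat; lra].
  have s1 : s <= / 2 := Rmin_l _ _.
  have s2 : s * r < eps.
    have := Rmult_le_compat_r r _ _ (Rlt_le _ _ r0) (Rmin_r (/ 2) (eps / (2 * r))).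
    by rewrite (_ : eps / (2 * r) * r = eps / 2) -/s; [lra | field; lra].
  exists (p - RtoC s * (p - m))%C; split.
    apply: Cmod_ball; rewrite (_ : _ - _ = - (RtoC s * (p - m)))%C; last by ring.
    by rewrite Cmod_opp Cmod_mult h Cmod_R Rabs_pos_eq; lra.
  rewrite /disc (_ : _ - m = RtoC (1 - s) * (p - m))%C; last by rewrite RtoC_minus; ring.
  by rewrite Cmod_mult h Cmod_R Rabs_pos_eq; nra.
Qed.

Lemma two_pi_i_neq0 : two_pi_i <> RtoC 0.
Proof. by have := PI_RGT_0; rewrite /two_pi_i => h [] /=; lra. Qed.

Lemma circle_winding_center : winding circle dcircle m = two_pi_i.
Proof.
apply: cint_unique.
apply: (@is_RInt_ext C_R_NormedModule (fun=> two_pi_i)).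
  move=> t _; rewrite /dcircle.
  have n0 : (circle t - m)%C <> RtoC 0 by move=> h; have := Cmod_circle t; rewrite h Cmod_0; lra.
  by change (two_pi_i = (/ (circle t - m) * (two_pi_i * (circle t - m)))%C :> C); field.
have := @is_RInt_const C_R_NormedModule 0 1 two_pi_i.
by rewrite Rminus_0_r (@scal_one R_Ring).
Qed.

Lemma circle_notin p t : disc m r p -> circle t <> p.
Proof. by move=> hp e; have := Cmod_circle t; rewrite e; rewrite /disc in hp; lra. Qed.

(** The winding number is computed at the centre, where the integrand is constant, and carried along
    the segment from the centre to [p]. *)
Lemma circle_boundary_path : boundary_path (disc m r) circle dcircle.
Proof.
split.
- exact: circle_C1.
- exact: circle_closed.
- exact: circle_simple.
- move=> p; rewrite disc_boundary; split; first exact: circle_surj.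
  by move=> [t _ <-]; exact: Cmod_circle.
- move=> p hp.
  have hm : disc m r m by rewrite /disc (_ : m - m = RtoC 0)%C ?Cmod_0 //; ring.
  have <- : winding circle dcircle p = two_pi_i.
    rewrite -circle_winding_center; apply: (winding_segment circle_C1 circle_closed).
    move=> s t us _; apply: circle_notin.
    have := disc_convex hm hp us; congr disc; rewrite /segment RtoC_minus; ring.
  have := cint_correct circle_C1 (continuous_on_Cauchy_kernel circle_C1 (fun t _ => @circle_notin p t hp)).
  apply: (@is_RInt_ext C_R_NormedModule) => t _; exact: Cmult_comm.
Qed.

Lemma circle_cint_bound k e : continuous_on unit_interval k ->
  (forall t, unit_interval t -> Cmod (k t) <= e) -> Cmod (cint dcircle k) <= e * (2 * PI * r).
Proof.
move=> ck hk; have hpi := PI_RGT_0; rewrite -norm_C_R.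
have -> : e * (2 * PI * r) = (1 - 0) * (e * (2 * PI * r)) by ring.
apply: (norm_RInt_le_const _ 0 1 _ _ Rle_0_1 _ (cint_correct circle_C1 ck)) => t ht.
rewrite norm_C_R Cmod_mult; apply: Rmult_le_compat; try exact: Cmod_ge_0.
  exact: hk.
rewrite /dcircle /two_pi_i !Cmod_mult Cmod_circle Cmod_Ci Cmod_R Rabs_pos_eq; lra.
Qed.

End Circle.

(** * The logarithm of an operator *)

Section Pointwise.
Variable U : NormedModule C_AbsRing.
Implicit Types S T : bounded_op U.
Lemma op_scalE c T x : op_scal c T x = scal (c : C_Ring) (T x).
Proof. by []. Qed.
Lemma op_plusE S T x : (plus S T : bounded_op U) x = plus (S x) (T x).
Proof. by []. Qed.
Lemma op_idE x : op_id U x = x.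
Proof. by []. Qed.
Lemma op_scal0 T : op_scal (RtoC 0) T = zero.
Proof. exact: (@scal_zero_l C_Ring (bop_ModuleSpace U)). Qed.
Lemma op_scal_1 T : op_scal (RtoC 1) T = T.
Proof. exact: op_scal1. Qed.
Definition opE := (@bop_minusE U, op_scalE, op_plusE, op_idE).
End Pointwise.

(** * Spectra, their convex hulls, and nonemptiness *)

Section HolomorphicLogarithm.
Variable V : countType.
Notation H := (l2_NormedModule V).
Notation B := (bounded_op H).
Notation I := (op_id H).

Let complete : seq_complete H := @l2_seq_complete V.
Lemma l2_norm_delta y : l2_norm (delta y : l2 V) <= 1.
Proof.
apply: l2_norm_le => [|A]; first lra; rewrite /sumsq.
have z (s : seq V) : y \notin s ->
    \big[Rplus/0]_(x <- s) Cmod (RtoC (if x == y then 1 else 0)) ^ 2 = 0.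
  move=> ys; rewrite big_seq big1 // => x xs.
  case: eqP => [e|_]; first by rewrite -e xs in ys.
  by rewrite Cmod_0; ring.
case: (boolP (y \in A)) => hy; last by rewrite z //; lra.
rewrite (big_rem y) //= z ?eqxx; last by rewrite mem_rem_uniqF // fset_uniq.
by rewrite Cmod_1; lra.
Qed.

Lemma entry_le (T : B) x y : Cmod (entry T x y) <= op_norm T.
Proof.
apply: Rle_trans (Cmod_le_norm _ _) _; apply: Rle_trans (norm_bop_le T (delta y)) _.
rewrite -[X in _ <= X]Rmult_1_r; apply: Rmult_le_compat_l (op_norm_ge0 _) _.
exact: l2_norm_delta.
Qed.

Lemma entry_functional x y : op_functional (fun T : B => entry T x y).
Proof.
split=> //; exists 1; first lra.
by move=> T; rewrite Rmult_1_l; exact: entry_le.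
Qed.

Lemma entry_id x y : entry I x y = RtoC (if x == y then 1 else 0).
Proof. by []. Qed.

Lemma op_minus_near (c : C) (Z : B) k : op_norm Z <= k -> k < Cmod c ->
  exists2 S, is_inverse (minus (op_scal c I) Z) S & op_norm S <= / (Cmod c - k).
Proof.
move=> hZ hk; have k0 : 0 <= k := Rle_trans _ _ _ (op_norm_ge0 Z) hZ.
have c0 : c <> RtoC 0 by move=> e; rewrite e Cmod_0 in hk; lra.
have cc : 0 < Cmod c by lra.
have hY : op_norm (op_scal (/ c)%C Z) <= k / Cmod c.
  apply: Rle_trans (op_norm_scale _ _) _; rewrite Cmod_inv // Rmult_comm.
  by apply: Rmult_le_compat_r => //; apply: Rlt_le; exact: Rinv_0_lt_compat.
have hk1 : 0 <= k / Cmod c < 1.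
  split; first exact: Rdiv_le_0_compat.
  by apply/(Rmult_lt_reg_r (Cmod c)) => //; rewrite /Rdiv Rmult_assoc Rinv_l; lra.
have [S [[SY YS] nS _]] := neumann complete hk1 hY.
have e : minus (op_scal c I) Z = op_scal c (minus I (op_scal (/ c)%C Z)).
  apply: bop_eq => x; rewrite !opE.
  rewrite (scal_minus_distr_l c x); congr minus; rewrite scal_assoc.
  have -> : mult c (/ c)%C = one by change ((c * / c)%C = RtoC 1); field.
  exact/esym/(@scal_one C_Ring).
exists (op_scal (/ c)%C S).
  rewrite e; split; rewrite op_compZl op_compZr op_scalA ?SY ?YS.
    have -> : mult (/ c)%C c = one by change ((/ c * c)%C = RtoC 1); field.
    exact: op_scal1.
  have -> : mult c (/ c)%C = one by change ((c * / c)%C = RtoC 1); field.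
  exact: op_scal1.
apply: Rle_trans (op_norm_scale _ _) _; rewrite Cmod_inv //.
have -> : / (Cmod c - k) = / Cmod c * / (1 - k / Cmod c) by field; lra.
by apply: Rmult_le_compat_l => //; apply: Rlt_le; exact: Rinv_0_lt_compat.
Qed.

Lemma invertible_opp (T : B) : invertible T -> invertible (opp T).
Proof.
move=> [S [ST TS]]; exists (opp S); rewrite !op_oppE.
have e : mult (RtoC (-1)) (RtoC (-1)) = one.
  by apply: injective_projections; rewrite /= /mult /=; ring.
by split; rewrite op_compZl op_compZr op_scalA ?ST ?TS (_ : mult _ _ = one) ?op_scal1.
Qed.

Lemma invertible_scale (c : C) (T : B) : c <> RtoC 0 -> invertible T -> invertible (op_scal c T).
Proof.
move=> c0 [S [ST TS]]; exists (op_scal (/ c)%C S).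
split; rewrite op_compZl op_compZr op_scalA ?ST ?TS.
  have -> : mult (/ c)%C c = one by change ((/ c * c)%C = RtoC 1); field.
  exact: op_scal1.
have -> : mult c (/ c)%C = one by change ((c * / c)%C = RtoC 1); field.
exact: op_scal1.
Qed.

Section ConvexHull.
Variable T : B.

Lemma conv_convex (S : C -> Prop) : convex (conv S).
Proof. by move=> x y t hx hy ht P cP SP; apply: (cP) => //; [exact: hx | exact: hy]. Qed.

Lemma sub_conv (S : C -> Prop) p : S p -> conv S p.
Proof. by move=> Sp P _; apply. Qed.

Lemma not_spectrum_invertible l : ~ spectrum T l -> invertible (minus (op_scal l I) T).
Proof. exact: NNPP. Qed.

(** [T_s = l0 + s (T - l0)] has its spectrum in the convex hull of that of [T]. *)
Lemma conv_pencil_invertible l0 l s : conv (spectrum T) l0 -> ~ conv (spectrum T) l ->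
  unit_interval s ->
  invertible (minus (op_scal (l - l0)%C I) (op_scal (RtoC s) (minus T (op_scal l0 I)))).
Proof.
move=> c0 nc [s0 s1].
have ne : l <> l0 by move=> e; apply: nc; rewrite e.
case: (Req_dec s 0) => [->|sn].
  have -> : op_scal (RtoC 0) (minus T (op_scal l0 I)) = zero.
    exact: (@scal_zero_l C_Ring (bop_ModuleSpace H)).
  rewrite minus_zero_r; eexists; apply: invertible_scalar; exact: Cminus_neq0.
have sC : RtoC s <> RtoC 0 by exact: RtoC_neq0.
(* [l = (1 - s) l0 + s l'], so [l'] cannot lie in the spectrum, and the operator is [s (l' - T)]. *)
pose l' := (l0 + (l - l0) / RtoC s)%C.
have nl' : ~ spectrum T l'.
  move=> h; apply: nc.
  have -> : l = (RtoC (1 - s) * l0 + RtoC s * l')%C by rewrite /l' RtoC_minus; field.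
  by apply: conv_convex => //; exact: sub_conv.
have -> : minus (op_scal (l - l0)%C I) (op_scal (RtoC s) (minus T (op_scal l0 I))) =
    op_scal (RtoC s) (minus (op_scal l' I) T).
  apply: bop_eq => x; rewrite !opE !(scal_minus_distr_l (RtoC s)).
  rewrite /minus opp_plus opp_opp !scal_assoc.
  rewrite [X in plus _ X]plus_comm plus_assoc; congr plus.
  rewrite -(scal_distr_r (l - l0)%C (mult (RtoC s) l0) x); congr scal.
  by change ((l - l0 + RtoC s * l0)%C = (RtoC s * l')%C :> C); rewrite /l'; field.
by apply: invertible_scale => //; exact: not_spectrum_invertible.
Qed.

(** The previous lemma at [l = 0], up to sign. *)
Lemma conv_homotopy_invertible l0 s : conv (spectrum T) l0 -> ~ conv (spectrum T) (RtoC 0) ->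
  unit_interval s ->
  invertible (plus (op_scal l0 I) (op_scal (RtoC s) (minus T (op_scal l0 I)))).
Proof.
move=> c0 nc us; have := invertible_opp (conv_pencil_invertible c0 nc us).
congr invertible; rewrite /minus opp_plus opp_opp; congr plus.
apply: bop_eq => x; rewrite op_oppE !opE scal_assoc; congr scal.
by change ((RtoC (-1) * (RtoC 0 - l0))%C = l0 :> C); apply: injective_projections => /=; ring.
Qed.

End ConvexHull.

(** If the spectrum were empty, the integral of a diagonal entry of the resolvent over any circle
    about 0 would be [two_pi_i], by deformation of [T] to the zero operator; on small circles it is
    small, because the resolvent is bounded near 0. This takes the place of Liouville's theorem. *)
Lemma spectrum_nonempty (T : B) : (exists x : V, True) -> exists l, spectrum T l.
Proof.
move=> [x _]; apply: NNPP => nsp.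
have inv l : invertible (minus (op_scal l I) T).
  by apply: not_spectrum_invertible => h; apply: nsp; exists l.
pose lf := fun S : B => entry S x x; have hl : op_functional lf := entry_functional x x.
have lI : lf I = RtoC 1 by rewrite /lf entry_id eqxx.
have [S0 iS0] := inv (RtoC 0).
have n0 := op_norm_ge0 S0.
(* On circles of radius at most [r] the resolvent has norm at most twice that of [S0], by
   [is_inverse_near]. *)
pose r := / (2 * (op_norm S0 + 1)).
have r0 : 0 < r by apply: Rinv_0_lt_compat; lra.
have main r' : 0 < r' -> r' <= r -> 1 <= 2 * op_norm S0 * r'.
  move=> r'0 r'r; have C1 := circle_C1 (RtoC 0) r'0.
  have cl := circle_closed (RtoC 0) r'.
  have hc t : Cmod (circle (RtoC 0) r' t) = r'.
    by rewrite -[RHS](Cmod_circle (RtoC 0) r'0 t); congr Cmod; ring.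
  have cn t : (circle (RtoC 0) r' t - RtoC 0)%C <> RtoC 0.
    by rewrite (_ : _ - RtoC 0 = circle (RtoC 0) r' t)%C => [e|]; [have := hc t; rewrite e Cmod_0; lra | ring].
  have hinv s t : unit_interval s -> unit_interval t ->
      invertible (pencil (circle (RtoC 0) r') (RtoC 0) T s t).
    move=> us ut; rewrite /pencil; case: (Req_dec s 0) => [->|sn].
      have -> : op_scal (RtoC 0) T = zero by exact: (@scal_zero_l C_Ring (bop_ModuleSpace H)).
      by rewrite minus_zero_r; eexists; apply: invertible_scalar; exact: cn.
    have sC : RtoC s <> RtoC 0 by exact: RtoC_neq0.
    have -> : minus (op_scal (circle (RtoC 0) r' t - RtoC 0)%C I) (op_scal (RtoC s) T) =
       op_scal (RtoC s) (minus (op_scal ((circle (RtoC 0) r' t - RtoC 0) / RtoC s)%C I) T).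
      apply: bop_eq => y; rewrite !opE (scal_minus_distr_l (RtoC s)).
      congr minus; rewrite scal_assoc; congr scal.
      set z := (_ - _)%C; by change (z = (RtoC s * (z / RtoC s))%C :> C); field.
    by apply: invertible_scale => //; exact: inv.
  have u1 : unit_interval 1 by rewrite /unit_interval; lra.
  have := cint_resolvent complete C1 cl hinv hl u1 (fun t _ => cn t).
  rewrite lI Cmult_1_r -/(winding _ _ _) (circle_winding_center _ r'0) => e.
  have hb : Cmod two_pi_i <= 2 * op_norm S0 * (2 * PI * r').
    rewrite -e; apply: (@circle_cint_bound (RtoC 0) r' r'0).
      exact: (resolvent_continuous complete C1 hinv u1 hl).
    move=> t ut; apply: Rle_trans (entry_le _ _ _) _.
    have e1 : minus (minus (op_scal (RtoC 0) I) T) (pencil (circle (RtoC 0) r') (RtoC 0) T 1 t) =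
        op_scal (- circle (RtoC 0) r' t)%C I.
      rewrite /pencil op_scal_1 op_scal0 /minus plus_zero_l opp_plus opp_opp plus_comm -plus_assoc plus_opp_r plus_zero_r op_oppE op_scalA.
      congr op_scal; change ((RtoC (-1) * (circle (RtoC 0) r' t - RtoC 0))%C =
        (- circle (RtoC 0) r' t)%C :> C).
      by apply: injective_projections => /=; ring.
    have e2 : op_norm (minus (minus (op_scal (RtoC 0) I) T) (pencil (circle (RtoC 0) r') (RtoC 0) T 1 t)) <= r'.
      rewrite e1; apply: Rle_trans (op_norm_scale _ _) _; rewrite Cmod_opp hc.
      by have := op_norm_id H; nra.
    have e3 : op_norm S0 * op_norm (minus (minus (op_scal (RtoC 0) I) T)
        (pencil (circle (RtoC 0) r') (RtoC 0) T 1 t)) <= / 2.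
      apply: (@Rle_trans _ ((op_norm S0 + 1) * r)).
        by apply: Rmult_le_compat; [lra | exact: op_norm_ge0 | lra | lra].
      by right; rewrite /r; field; lra.
    have [S' [iS' nS']] := is_inverse_near complete iS0 e3.
    by rewrite (op_inv_eq iS').
  have hpi := PI_RGT_0.
  move: hb; rewrite /two_pi_i Cmod_mult Cmod_R Cmod_Ci Rabs_pos_eq; last lra.
  move=> hb; apply/(Rmult_le_reg_r (2 * PI)); lra.
pose r' := Rmin r (/ (2 * (2 * op_norm S0 + 1))).
have q0 : 0 < / (2 * (2 * op_norm S0 + 1)) by apply: Rinv_0_lt_compat; lra.
have r'0 : 0 < r' by exact: Rmin_pos.
have h := main r' r'0 (Rmin_l _ _).
have h2 : r' <= / (2 * (2 * op_norm S0 + 1)) := Rmin_r _ _.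
have h3 := Rmult_le_compat_l (2 * op_norm S0) _ _ ltac:(lra) h2.
have h4 : 2 * op_norm S0 * / (2 * (2 * op_norm S0 + 1)) = / 2 - / (2 * (2 * op_norm S0 + 1)).
  by field; lra.
lra.
Qed.

End HolomorphicLogarithm.

Lemma RtoC_m1 : RtoC (-1) = (- RtoC 1)%C.
Proof. by apply: injective_projections => /=; ring. Qed.

(** * Uniqueness and existence of the logarithm *)

Section LogOperator.
Variable X : graph.
Notation H := (l2_NormedModule (VX X)).
Notation B := (bounded_op H).
Notation I := (op_id H).

Let complete : seq_complete H := @l2_seq_complete (VX X).

Lemma functional_is_RInt (lf : B -> C) (f : R -> B) J : op_functional lf ->
  is_RInt (V := realify (bop_NormedModule H)) f 0 1 J ->
  is_RInt (V := C_R_NormedModule) (fun t => lf (f t)) 0 1 (lf J).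
Proof.
move=> hl; apply: (@is_RInt_additive (realify (bop_NormedModule H)) C_R_NormedModule lf).
- by move=> x y; exact: (functional_plus hl).
- move=> r x; rewrite (functional_scal hl (RtoC r) x : lf (scal r x) = _).
  apply: injective_projections.
    change (r * fst (lf x) - 0 * snd (lf x) = r * fst (lf x)); ring.
  change (r * snd (lf x) + 0 * fst (lf x) = r * snd (lf x)); ring.
- move=> x P /locally_Cmod [e e0 he].
  have [M M0 hM] := functional_bound hl.
  have d0 : 0 < e / (M + 1) by apply: Rdiv_lt_0_compat; lra.
  exists (mkposreal _ d0) => y hy; apply: he.
  have hy' : op_norm (minus y x) < e / (M + 1) := hy.
  rewrite -(functional_minus _ _ hl); apply: Rle_lt_trans (hM _) _.
  apply: Rle_lt_trans (Rmult_le_compat_l _ _ _ M0 (Rlt_le _ _ hy')) _.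
  have -> : M * (e / (M + 1)) = e - e / (M + 1) by field; lra.
  lra.
Qed.

Section LogValue.
Variables (S D : C -> Prop) (L : C -> C) (gam dgam : R -> C).
Hypotheses (openS : open S) (connS : connected (T := C_UniformSpace) S).
Hypothesis bp : boundary_path S gam dgam.
Hypothesis logL : log_branch D L.
Hypothesis SD : forall p, S p \/ boundary S p -> D p.
Variables (T : B) (l0 : C).
Hypothesis Sl0 : S l0.
Notation T0 := (minus T (op_scal l0 I)).
Hypothesis inv : forall s t, unit_interval s -> unit_interval t -> invertible (pencil gam l0 T0 s t).
Hypothesis hinv : forall s, unit_interval s ->
  invertible (plus (op_scal l0 I) (op_scal (RtoC s) T0)).

Lemma pencil1 t : pencil gam l0 T0 1 t = minus (op_scal (gam t) I) T.
Proof.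
rewrite /pencil op_scal_1; apply: bop_eq => x; rewrite !opE.
rewrite (scal_minus_distr_r (gam t) l0 x) /minus opp_plus opp_opp -!plus_assoc; congr plus.
by rewrite plus_comm -plus_assoc plus_opp_r plus_zero_r.
Qed.

(** The contour integral for [T_s] is known at [s = 0] from Cauchy's formula and has derivative
    [two_pi_i lf (T0 W)]. Allowing a comparison function [Psi] with only approximately this
    derivative serves two purposes: [K = 0], with the integral over another contour, gives
    uniqueness; [K] tending to 0, with truncated series, gives the expansion. *)
Lemma log_value lf (Psi dPsi : R -> C) K : op_functional lf ->
  (forall s, unit_interval s -> is_derive (V := C_R_NormedModule) Psi s (dPsi s)) ->
  (forall s W, unit_interval s -> is_inverse (plus (op_scal l0 I) (op_scal (RtoC s) T0)) W ->
     Cmod (two_pi_i * lf (op_comp T0 W) - dPsi s)%C <= K) ->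
  Cmod (cint dgam (fun t => L (gam t) * lf (op_inv (minus (op_scal (gam t) I) T)))%C -
        (Psi 1 - Psi 0 + two_pi_i * L l0 * lf I))%C <= 2 * K.
Proof.
move=> hl dP hK.
have C1 := bpath_C1 bp; have closed := bpath_closed bp.
have u0 : unit_interval 0 by rewrite /unit_interval; lra.
have u1 : unit_interval 1 by rewrite /unit_interval; lra.
have h0 t : unit_interval t -> (gam t - l0)%C <> RtoC 0.
  by move=> ut; apply: Cminus_neq0; exact: (bpath_notin openS bp ut Sl0).
pose g s := cint dgam (fun t => L (gam t) * lf (op_inv (pencil gam l0 T0 s t)))%C.
pose W s := op_inv (plus (op_scal l0 I) (op_scal (RtoC s) T0)).
have dg s : unit_interval s ->
    is_derive (V := C_R_NormedModule) g s (two_pi_i * lf (op_comp T0 (W s)))%C.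
  move=> us; rewrite -(winding_inside bp Sl0).
  apply: (cint_log_derive complete C1 closed inv (bpath_log_continuous bp logL SD)
    (bpath_log_closed L bp) (bpath_ne0 bp logL SD) (bpath_log_derive bp logL SD) hl us h0).
  by apply: op_invP; exact: hinv.
have g0 : g 0 = (two_pi_i * L l0 * lf I)%C.
  rewrite -(log_cauchy openS connS bp logL SD Sl0) /log_integral Cmult_comm.
  have cK : continuous_on unit_interval (fun t => L (gam t) * / (gam t - l0))%C.
    apply: continuous_on_Cmult; first exact: (bpath_log_continuous bp logL SD).
    apply: (continuous_on_Cauchy_kernel C1) => t ut; exact: (bpath_notin openS bp ut Sl0).
  rewrite -(cint_scale C1) //; apply: cint_ext => t ut.
  have -> : op_inv (pencil gam l0 T0 0 t) = op_scal (/ (gam t - l0))%C I.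
    apply: op_inv_eq; rewrite /pencil op_scal0 minus_zero_r.
    by apply: invertible_scalar; exact: h0.
  by rewrite (functional_scal hl); ring.
have -> : cint dgam (fun t => L (gam t) * lf (op_inv (minus (op_scal (gam t) I) T)))%C = g 1.
  by apply: cint_ext => t ut; rewrite pencil1.
have -> : (g 1 - (Psi 1 - Psi 0 + two_pi_i * L l0 * lf I) =
   (g 1 - Psi 1) - (g 0 - Psi 0))%C by rewrite g0; ring.
apply: (@C_mean_value (fun s => g s - Psi s)%C (fun s => two_pi_i * lf (op_comp T0 (W s)) - dPsi s)%C).
  by move=> s us; exact: (@is_derive_minus _ C_R_NormedModule _ _ _ _ _ (dg s us) (dP s us)).
by move=> s us; apply: hK => //; apply: op_invP; exact: hinv.
Qed.

End LogValue.

Lemma is_log_entry (S : C -> Prop) L gam dgam (T J : B) lf : op_functional lf ->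
  piecewise_C1 gam dgam ->
  is_RInt (V := realify (bop_NormedModule H))
    (fun t => op_scal (L (gam t) * dgam t)%C (op_inv (minus (op_scal (gam t) I) T))) 0 1 J ->
  lf J = cint dgam (fun t => L (gam t) * lf (op_inv (minus (op_scal (gam t) I) T)))%C.
Proof.
move=> hl C1 /(functional_is_RInt hl) h; apply/esym/cint_unique.
apply: (@is_RInt_ext C_R_NormedModule _ _ _ _ _ _ h) => t _.
by rewrite (functional_scal hl); change ((L (gam t) * dgam t * lf (op_inv (minus (op_scal (gam t) I) T)))%C =
  (L (gam t) * lf (op_inv (minus (op_scal (gam t) I) T)) * dgam t)%C :> C); ring.
Qed.

(** Both contour integrals have the same derivative along the homotopy, so they differ as their
    scalar values at [l0] do, and two branches differ there by some [d] with [Cexp d = 1]. *)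
Lemma is_log_unique (T Q1 Q2 : B) : (exists x : VX X, True) ->
  ~ conv (spectrum T) (RtoC 0) -> is_log T Q1 -> is_log T Q2 ->
  exists2 d, Cexp d = RtoC 1 & Q1 = plus Q2 (op_scal d I).
Proof.
move=> ne nc.
have [l0 sl0] := spectrum_nonempty T ne; have c0 := sub_conv sl0.
move=> [S1 [D1 [L1 [gam1 [dgam1 [J1 [[oS1 cS1 _ sub1] bp1 [log1 SD1] int1 ->]]]]]]].
move=> [S2 [D2 [L2 [gam2 [dgam2 [J2 [[oS2 cS2 _ sub2] bp2 [log2 SD2] int2 ->]]]]]]].
have inv (S : C -> Prop) gam dgam : open S -> boundary_path S gam dgam ->
    (forall p, conv (spectrum T) p -> S p) ->
    forall s t, unit_interval s -> unit_interval t ->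
    invertible (pencil gam l0 (minus T (op_scal l0 I)) s t).
  move=> oS bp sub s t us ut; apply: (conv_pencil_invertible c0 _ us).
  by move=> /sub h; exact: (bpath_notin oS bp ut h).
have hinv s : unit_interval s ->
    invertible (plus (op_scal l0 I) (op_scal (RtoC s) (minus T (op_scal l0 I)))).
  exact: conv_homotopy_invertible.
have S1l : S1 l0 by exact: sub1. have S2l : S2 l0 by exact: sub2.
exists (L1 l0 - L2 l0)%C.
  rewrite Cexp_minus (log_exp log1) ?(log_exp log2); [|by apply: SD2; left|by apply: SD1; left].
  have n0 : l0 <> RtoC 0 by apply: (log_domain_neq0 log1); apply: SD1; left.
  by field.
apply: entry_inj => x y; pose lf := fun S : B => entry S x y.
have hl : op_functional lf := entry_functional x y.
have C2 := bpath_C1 bp2; have closed2 := bpath_closed bp2.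
have u0 : unit_interval 0 by rewrite /unit_interval; lra.
have h0 t : unit_interval t -> (gam2 t - l0)%C <> RtoC 0.
  by move=> ut; apply: Cminus_neq0; exact: (bpath_notin oS2 bp2 ut S2l).
have inv2 := inv S2 gam2 dgam2 oS2 bp2 sub2.
pose T0 := minus T (op_scal l0 I).
(* The second contour integral along the homotopy is the comparison function for both logarithms. *)
pose Psi s := cint dgam2 (fun t => L2 (gam2 t) * lf (op_inv (pencil gam2 l0 T0 s t)))%C.
pose W s := op_inv (plus (op_scal l0 I) (op_scal (RtoC s) T0)).
have dPsi s : unit_interval s ->
    is_derive (V := C_R_NormedModule) Psi s (two_pi_i * lf (op_comp T0 (W s)))%C.
  move=> us; rewrite -(winding_inside bp2 S2l).
  apply: (cint_log_derive complete C2 closed2 inv2 (bpath_log_continuous bp2 log2 SD2)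
    (bpath_log_closed L2 bp2) (bpath_ne0 bp2 log2 SD2) (bpath_log_derive bp2 log2 SD2) hl us h0).
  by apply: op_invP; exact: hinv.
have zK s (W' : B) : unit_interval s ->
    is_inverse (plus (op_scal l0 I) (op_scal (RtoC s) T0)) W' ->
    Cmod (two_pi_i * lf (op_comp T0 W') - two_pi_i * lf (op_comp T0 (W s)))%C <= 0.
  move=> us iW; rewrite /W (op_inv_eq iW) (_ : (_ - _)%C = RtoC 0) ?Cmod_0; [lra | ring].
have k1 := log_value oS1 cS1 bp1 log1 SD1 S1l (inv S1 gam1 dgam1 oS1 bp1 sub1) hinv hl dPsi zK.
have k2 := log_value oS2 cS2 bp2 log2 SD2 S2l inv2 hinv hl dPsi zK.
rewrite -(is_log_entry S1 hl (bpath_C1 bp1) int1) Rmult_0_r in k1.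
rewrite -(is_log_entry S2 hl (bpath_C1 bp2) int2) Rmult_0_r in k2.
have e1 := Cmod_eq_0 _ (Rle_antisym _ _ k1 (Cmod_ge_0 _)).
have e2 := Cmod_eq_0 _ (Rle_antisym _ _ k2 (Cmod_ge_0 _)).
rewrite -/(lf (op_scal _ J1)) -/(lf (plus _ _)) (functional_plus hl) !(functional_scal hl).
have {}e1 : lf J1 = (Psi 1 - Psi 0 + two_pi_i * L1 l0 * lf I)%C by rewrite -[RHS]Cplus_0_l -e1; ring.
have {}e2 : lf J2 = (Psi 1 - Psi 0 + two_pi_i * L2 l0 * lf I)%C by rewrite -[RHS]Cplus_0_l -e2; ring.
have ti := two_pi_i_neq0.
by rewrite e1 e2; field.
Qed.

Definition log_term (Y : B) (n : nat) : B :=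
  op_scal (RtoC (- / INR n.+1)) (op_pow Y n.+1).

Lemma log_term_norm Y k n : 0 <= k < 1 -> op_norm Y <= k -> op_norm (log_term Y n) <= 1 * k ^ n.
Proof.
move=> hk hY; apply: Rle_trans (op_norm_scale _ _) _.
have hn : 1 <= INR n.+1 by rewrite S_INR; have := pos_INR n; lra.
have hi : / INR n.+1 <= 1 by rewrite -Rinv_1; apply: Rinv_le_contravar; lra.
have i0 : 0 < / INR n.+1 by apply: Rinv_0_lt_compat; lra.
rewrite Cmod_R Rabs_Ropp Rabs_pos_eq; last lra.
apply: Rmult_le_compat; [lra | exact: op_norm_ge0 | lra |].
apply: Rle_trans (op_pow_norm n.+1 hY) _ => /=.
have : 0 <= k ^ n by apply: pow_le; lra.
nra.
Qed.

Lemma op_pow_scal c (Y : B) n : op_pow (op_scal (RtoC c) Y) n = op_scal (RtoC (c ^ n)) (op_pow Y n).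
Proof.
elim: n => [|n IH] /=; first by rewrite op_scal_1.
by rewrite IH op_compZl op_compZr op_scalA; congr op_scal; exact/esym/RtoC_mult.
Qed.

(** The scalar [l] is chosen before [T]: one branch, on the half plane of [m], serves all operators
    near [m I], so that the expansion is uniform in [T]. *)
Lemma is_log_exists (m : C) : m <> RtoC 0 -> exists l, Cexp l = m /\
  forall (T : B) k, op_norm (minus T (op_scal m I)) <= k -> k < Cmod m ->
  exists2 Q, is_log T Q & forall n,
    op_norm (minus Q (plus (op_scal l I)
      (op_psum (log_term (op_scal (- / m)%C (minus T (op_scal m I)))) n))) <=
      (k / Cmod m) ^ n / (1 - k / Cmod m).
Proof.
move=> m0; have [L logL] := half_plane_log m0.
have Dm : half_plane m m.
  by rewrite /half_plane (_ : m / m = RtoC 1)%C /=; [lra | field].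
exists (L m); split; first exact: (log_exp logL Dm).
move=> T k hT hk; set T0 := minus T (op_scal m I) in hT *.
have k0 : 0 <= k := Rle_trans _ _ _ (op_norm_ge0 T0) hT.
have mc : 0 < Cmod m by lra.
(* Strictly between [k], so that the hull of the spectrum is inside the disc, and [|m|], so that the
   closed disc is inside the half plane. *)
pose r := (k + Cmod m) / 2; have r0 : 0 < r by rewrite /r; lra.
have kr : k < r by rewrite /r; lra.
have rm : r < Cmod m by rewrite /r; lra.
set Y := op_scal (- / m)%C T0.
pose kap := k / Cmod m.
have hkap : 0 <= kap < 1.
  split; first exact: Rdiv_le_0_compat.
  by apply/(Rmult_lt_reg_r (Cmod m)) => //; rewrite /kap /Rdiv Rmult_assoc Rinv_l; lra.
have hY : op_norm Y <= kap.
  apply: Rle_trans (op_norm_scale _ _) _; rewrite Cmod_opp Cmod_inv // Rmult_comm.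
  by apply: Rmult_le_compat_r => //; apply: Rlt_le; exact: Rinv_0_lt_compat.
have bp := circle_boundary_path m r0.
have C1 := bpath_C1 bp.
have Sm : disc m r m by rewrite /disc (_ : m - m = RtoC 0)%C ?Cmod_0 //; ring.
have oS := @disc_open m r.
have cS := convex_connected (@disc_convex m r).
have SD p : disc m r p \/ boundary (disc m r) p -> half_plane m p.
  rewrite disc_boundary // => hp.
  have {}hp : Cmod (p - m)%C <= r by case: hp => [|->]; rewrite /disc; lra.
  have e : (p / m = 1 + (p - m) / m)%C by field.
  have h1 : Cmod ((p - m) / m)%C < 1.
    rewrite Cmod_div //; apply/(Rmult_lt_reg_r (Cmod m)) => //.
    by rewrite /Rdiv Rmult_assoc Rinv_l; lra.
  have := Cmod_fst ((p - m) / m)%C; rewrite /half_plane e.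
  have -> : fst (1 + (p - m) / m)%C = 1 + fst ((p - m) / m)%C by [].
  by rewrite /Rabs; case: Rcase_abs => ? ?; lra.
have inv s t : unit_interval s -> unit_interval t -> invertible (pencil (circle m r) m T0 s t).
  move=> [s0 s1] ut; have [S iS _] : exists2 S, is_inverse (pencil (circle m r) m T0 s t) S & op_norm S <= / (Cmod (circle m r t - m)%C - k).
    apply: op_minus_near; last by rewrite Cmod_circle.
    apply: Rle_trans (op_norm_scale _ _) _; rewrite Cmod_R Rabs_pos_eq //.
    by have := op_norm_ge0 T0; nra.
  by exists S.
have hinv s : unit_interval s -> invertible (plus (op_scal m I) (op_scal (RtoC s) T0)).
  move=> [s0 s1].
  have [S iS _] : exists2 S, is_inverse (minus (op_scal m I) (op_scal (RtoC (- s)) T0)) S & op_norm S <= / (Cmod m - k).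
    apply: op_minus_near => //; apply: Rle_trans (op_norm_scale _ _) _.
    rewrite Cmod_R Rabs_Ropp Rabs_pos_eq //.
    by have := op_norm_ge0 T0; nra.
  exists S; move: iS; congr is_inverse; rewrite /minus; congr plus.
  rewrite op_oppE op_scalA; congr op_scal.
  by change ((RtoC (-1) * RtoC (- s))%C = RtoC s); apply: injective_projections => /=; ring.
have sub p : conv (spectrum T) p -> disc m r p.
  apply; first exact: disc_convex.
  move=> l hl; rewrite /disc; apply: Rnot_le_lt => hle; apply: hl.
  have [S iS _] := @op_minus_near (VX X) (l - m)%C T0 k hT ltac:(lra).
  exists S; move: iS; congr is_inverse.
  have := pencil1 (fun=> l) T m 0; rewrite /pencil op_scal_1 => e.
  exact: e.
have [Ser hSer] := op_series_cvg complete Rle_0_1 hkap (fun n => log_term_norm n hkap hY).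
pose F t := op_scal (L (circle m r t) * dcircle m r t)%C
  (op_inv (minus (op_scal (circle m r t) I) T)).
have [J hJ] : exists J, is_RInt (V := realify (bop_NormedModule H)) F 0 1 J.
  have cR : op_continuous_on (fun t => op_inv (minus (op_scal (circle m r t) I) T)).
    have e1 : (fun t => op_inv (minus (op_scal (circle m r t) I) T)) =
        (fun t => op_inv (pencil (circle m r) m T0 1 t)).
      by apply: functional_extensionality => t; rewrite pencil1.
    rewrite e1; apply: (op_continuous_inverse complete (@pencil_continuous _ _ _ C1 m T0 1)).
    by move=> t ut; apply: inv => //; rewrite /unit_interval; lra.
  have cw : continuous_on unit_interval (fun t => L (circle m r t) * dcircle m r t)%C.
    apply: continuous_on_Cmult; first exact: (bpath_log_continuous bp logL SD).
    by move=> t _; exact: continuous_within (@dcircle_continuous m r r0 t).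
  have cF : op_continuous_on F.
    move=> t ut e e0.
    have [K K0 hK] := op_continuous_bounded cR.
    have [K' hK'] := continuous_on_bounded cw.
    have K'0 : 0 <= K' by apply: Rle_trans (Cmod_ge_0 _) (hK' t ut).
    have e1 : 0 < e / (2 * K) by apply: Rdiv_lt_0_compat; lra.
    have e2 : 0 < e / (2 * (K' + 1)) by apply: Rdiv_lt_0_compat; lra.
    have [d d0 hd] := proj1 (continuous_on_CP _) cw t ut _ e1.
    have [d' d0' hd'] := cR t ut _ e2.
    exists (Rmin d d'); first exact: Rmin_pos.
    move=> t' ut' ht; have h1 := hd t' ut' (Rlt_le_trans _ _ _ ht (Rmin_l _ _)).
    have h2 := hd' t' ut' (Rlt_le_trans _ _ _ ht (Rmin_r _ _)).
    move: h1 h2 (hK t' ut') (hK' t ut); rewrite /F.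
    set a := (_ * _)%C; set b := (_ * _)%C; set P := op_inv _; set Q := op_inv _ => h1 h2 h3 h4.
    have -> : minus (op_scal a P) (op_scal b Q) = plus (op_scal (a - b)%C P) (op_scal b (minus P Q)).
      apply: bop_eq => x; rewrite !opE (scal_minus_distr_r a b (P x)) (scal_minus_distr_l b).
      by rewrite /minus -plus_assoc (plus_assoc _ (scal b (P x))) plus_opp_l plus_zero_l.
    apply: Rle_lt_trans (op_norm_plus _ _) _.
    have q1 := Rle_trans _ _ _ (op_norm_scale (a - b)%C P) (Rmult_le_compat _ _ _ _ (Cmod_ge_0 _) (op_norm_ge0 _) (Rlt_le _ _ h1) h3).
    have q2 := Rle_trans _ _ _ (op_norm_scale b (minus P Q)) (Rmult_le_compat _ _ _ _ (Cmod_ge_0 _) (op_norm_ge0 _) h4 (Rlt_le _ _ h2)).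
    have q3 : e / (2 * K) * K = e / 2 by field; lra.
    have q4 : K' * (e / (2 * (K' + 1))) = e / 2 - e / (2 * (K' + 1)) by field; lra.
    lra.
  pose RC := @complete_normed _ (realify (bop_NormedModule H)) (bop_seq_complete complete).
  have cF' : continuous_on unit_interval (F : R -> bop_UniformSpace H).
    move=> t ut P [e he]; have [d d0 hd] := cF t ut e (cond_pos e).
    by exists (mkposreal d d0) => y hy uy; apply: he; exact: (hd y uy hy).
  have [J hJ] := @ex_RInt_continuous RC (fun t => F (clamp t)) 0 1
    (fun z _ => @continuous_clamp (bop_UniformSpace H) F z cF').
  exists J; apply: (@is_RInt_ext (realify (bop_NormedModule H)) (fun t => F (clamp t))) hJ.
  by move=> t; rewrite Rmin_left ?Rmax_right; try lra; move=> ht; rewrite clampE //; lra.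
have ti := two_pi_i_neq0.
exists (op_scal (/ two_pi_i)%C J).
  exists (disc m r), (half_plane m), L, (circle m r), (dcircle m r), J; split => //.
  split=> //; exact: convex_simply_connected (@disc_convex m r) Sm.
have -> : op_scal (/ two_pi_i)%C J = plus (op_scal (L m) I) Ser.
  apply: entry_inj => x y; pose lf := fun S : B => entry S x y.
  have hl : op_functional lf := entry_functional x y.
  have [M M0 hM] := functional_bound hl.
  pose c n := lf (op_pow Y n.+1).
  (* [phi n s] is the integral from 0 to [s] of minus the entry of [Y] times the [n]-th partial sum
     of the Neumann series of [s Y]; at [s = 1] it is the entry of the partial sum of the
     logarithmic series. Times [two_pi_i], it is the comparison function for [log_value]. *)
  pose phi := fix phi (n : nat) (s : R) : C :=
    if n is n'.+1 then (phi n' s + RtoC (- s ^ n'.+1 / INR n'.+1) * c n')%C else RtoC 0.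
  have dphi n s : is_derive (V := C_R_NormedModule) (phi n) s
      (- lf (op_comp Y (op_psum (op_pow (op_scal (RtoC s) Y)) n)))%C.
    elim: n => [|n IH].
      have -> : (- lf (op_comp Y (op_psum (op_pow (op_scal (RtoC s) Y)) 0)))%C = RtoC 0.
        rewrite /= op_comp0r -(op_scal0 T) (functional_scal hl); ring.
      exact: is_derive_const.
    have d1 : is_derive (V := C_R_NormedModule) (fun s => RtoC (- s ^ n.+1 / INR n.+1)) s (RtoC (- s ^ n)).
      have hn : INR n.+1 <> 0 by apply: not_0_INR.
      have d2 : is_derive (fun s => - s ^ n.+1 / INR n.+1) s (- s ^ n).
        auto_derive => //.
        by change (- (1 * (INR n.+1 * s ^ n)) * / INR n.+1 = - s ^ n); field.
      apply/is_derive_CP => e e0; have [d d0 hd] := proj1 (is_derive_CRP _ _ _) d2 e e0.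
      exists d => // z hz; rewrite -RtoC_mult -!RtoC_minus Cmod_R; exact: hd.
    have d3 := is_derive_Cmult d1 (@is_derive_const _ C_R_NormedModule (c n) s).
    have := @is_derive_plus _ C_R_NormedModule _ _ _ _ _ IH d3.
    have -> : plus (- lf (op_comp Y (op_psum (op_pow (op_scal (RtoC s) Y)) n)) : C_R_NormedModule)%C
        (RtoC (- s ^ n) * c n + RtoC (- s ^ n.+1 / INR n.+1) * RtoC 0)%C =
        (- lf (op_comp Y (op_psum (op_pow (op_scal (RtoC s) Y)) n.+1)))%C.
      rewrite /= op_compDr (functional_plus hl) op_pow_scal op_compZr (functional_scal hl) RtoC_opp.
      by rewrite -/(op_pow Y n.+1) -/(c n); set u := lf _; change ((- u + (- RtoC (s ^ n) * c n + RtoC (- s ^ n.+1 / INR n.+1) * RtoC 0))%C = (- (u + RtoC (s ^ n) * c n))%C :> C); ring.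
    by [].
  have phi0 n : phi n 0 = RtoC 0.
    elim: n => [//|n IH] /=; rewrite IH.
    by have -> : - (0 * 0 ^ n) / INR n.+1 = 0 by [rewrite /Rdiv; ring]; ring.
  have phi1 n : phi n 1 = lf (op_psum (log_term Y) n).
    elim: n => [|n IH]; first by rewrite /= -(op_scal0 T) (functional_scal hl); ring.
    rewrite [LHS]/= IH [RHS]/= (functional_plus hl) (functional_scal hl); congr (_ + _ * _)%C.
    by congr RtoC; change (- (1 ^ n.+1) / INR n.+1 = - / INR n.+1); rewrite pow1 /Rdiv; ring.
  have close n s W : unit_interval s ->
      is_inverse (plus (op_scal m I) (op_scal (RtoC s) T0)) W ->
      Cmod (two_pi_i * lf (op_comp T0 W) - two_pi_i * - lf (op_comp Y (op_psum (op_pow (op_scal (RtoC s) Y)) n)))%C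
       <= Cmod two_pi_i * (M * (kap ^ n / (1 - kap))).
    move=> [s0 s1] [WT TW].
    have hsY : op_norm (op_scal (RtoC s) Y) <= kap.
      apply: Rle_trans (op_norm_scale _ _) _; rewrite Cmod_R Rabs_pos_eq //.
      by have := op_norm_ge0 Y; nra.
    have [S [iS _ hS]] := neumann complete hkap hsY.
    have eT : plus (op_scal m I) (op_scal (RtoC s) T0) = op_scal m (minus I (op_scal (RtoC s) Y)).
      apply: bop_eq => z; rewrite !opE (scal_minus_distr_l m) /minus; congr plus.
      rewrite !scal_assoc -scal_opp_l; congr scal.
      by change ((RtoC s)%C = (- (m * RtoC s * - / m))%C :> C); field.
    have iS' : is_inverse (minus I (op_scal (RtoC s) Y)) (op_scal m W).
      by rewrite eT op_compZl op_compZr in WT TW; split; rewrite ?op_compZl ?op_compZr.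
    have eS := is_inverse_unique iS iS'.
    (* Here [T_s = m (I - s Y)] and [T0 = - m Y]. *)
    have eTW : op_comp T0 W = op_scal (RtoC (-1)) (op_comp Y S).
      rewrite eS op_compZr op_scalA /Y op_compZl op_scalA -[LHS]op_scal_1; congr op_scal.
      by change (RtoC 1 = (RtoC (-1) * m * - / m)%C :> C); rewrite RtoC_m1; field.
    have -> : (two_pi_i * lf (op_comp T0 W) - two_pi_i * - lf (op_comp Y (op_psum (op_pow (op_scal (RtoC s) Y)) n)) =
       - (two_pi_i * lf (op_comp Y (minus S (op_psum (op_pow (op_scal (RtoC s) Y)) n)))))%C.
      rewrite eTW (functional_scal hl) op_compBr functional_minus // RtoC_m1; ring.
    rewrite Cmod_opp Cmod_mult; apply: Rmult_le_compat_l; first exact: Cmod_ge_0.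
    apply: Rle_trans (hM _) _; apply: Rmult_le_compat_l => //.
    apply: Rle_trans (op_norm_comp _ _) _; rewrite -[X in _ <= X]Rmult_1_l.
    apply: Rmult_le_compat; [exact: op_norm_ge0 | exact: op_norm_ge0 | lra | exact: hS].
  have dPsi n s : unit_interval s -> is_derive (V := C_R_NormedModule) (fun s => two_pi_i * phi n s)%C s
      (two_pi_i * - lf (op_comp Y (op_psum (op_pow (op_scal (RtoC s) Y)) n)))%C.
    move=> us; have := is_derive_Cmult (@is_derive_const _ C_R_NormedModule two_pi_i s) (dphi n s).
    by rewrite (_ : (zero * phi n s + two_pi_i * - lf (op_comp Y (op_psum (op_pow (op_scal (RtoC s) Y)) n)))%C =
      (two_pi_i * - lf (op_comp Y (op_psum (op_pow (op_scal (RtoC s) Y)) n)))%C) //;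
      change ((RtoC 0 * phi n s + two_pi_i * - lf (op_comp Y (op_psum (op_pow (op_scal (RtoC s) Y)) n)))%C =
      (two_pi_i * - lf (op_comp Y (op_psum (op_pow (op_scal (RtoC s) Y)) n)))%C); ring.
  have key n : Cmod (lf J - (two_pi_i * lf (op_psum (log_term Y) n) + two_pi_i * L m * lf I))%C <=
      2 * (Cmod two_pi_i * (M * (kap ^ n / (1 - kap)))).
    have := log_value oS cS bp logL SD Sm inv hinv hl (dPsi n) (close n).
    rewrite -(is_log_entry (disc m r) hl C1 hJ) phi0 phi1; congr (Cmod _ <= _); ring.
  have fin : Cmod (lf J - two_pi_i * (L m * lf I + lf Ser))%C = 0.
    have t0 := Cmod_ge_0 two_pi_i.
    apply: (@small_multiple_zero _ (Cmod two_pi_i * (2 * M + M))); first exact: Cmod_ge_0.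
    move=> e e0; have ik : 0 <= / (1 - kap) by apply: Rlt_le; apply: Rinv_0_lt_compat; lra.
    have [n hn] := pow_vanish hkap ik e0.
    have hn' : kap ^ n / (1 - kap) <= e by rewrite /Rdiv Rmult_comm; lra.
    have -> : (lf J - two_pi_i * (L m * lf I + lf Ser) =
       (lf J - (two_pi_i * lf (op_psum (log_term Y) n) + two_pi_i * L m * lf I))
       + - (two_pi_i * lf (minus Ser (op_psum (log_term Y) n))))%C.
      by rewrite functional_minus //; ring.
    apply: Rle_trans (Cmod_triangle _ _) _; rewrite Cmod_opp Cmod_mult.
    have h1 := key n; have h2 := hM (minus Ser (op_psum (log_term Y) n)).
    have h3 := hSer n; rewrite Rmult_1_l in h3.
    have h4 : Cmod (lf (minus Ser (op_psum (log_term Y) n))) <= M * e.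
      by apply: Rle_trans h2 _; apply: Rmult_le_compat_l => //; lra.
    have h5 := Rmult_le_compat_l _ _ _ t0 h4.
    have h6 : M * (kap ^ n / (1 - kap)) <= M * e by apply: Rmult_le_compat_l.
    have h7 := Rmult_le_compat_l _ _ _ t0 h6.
    lra.
  rewrite -/(lf (op_scal _ J)) -/(lf (plus _ _)) (functional_plus hl) !(functional_scal hl).
  have e1 := Cmod_eq_0 _ fin.
  have {}e1 : lf J = (two_pi_i * (L m * lf I + lf Ser))%C by rewrite -[RHS]Cplus_0_l -e1; ring.
  by rewrite e1; field.
move=> n; have := hSer n; rewrite Rmult_1_l -/kap => h.
apply: Rle_trans h; right; congr op_norm.
by rewrite /minus opp_plus plus_assoc; congr plus; rewrite plus_comm plus_assoc plus_opp_l plus_zero_l.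
Qed.

End LogOperator.

(** * Traces *)

Section SelfSimilarCombinatorics.
Variables (X : graph) (K : nat -> {fset VX X}) (G : nat -> seq (VX X -> VX X)).
Hypothesis ss : self_similar K G.
Variable d : nat.
Hypothesis deg_le : forall v : VX X, (deg v <= d)%N.
Notation V := (VX X).

Lemma gprod_le n m g : gprod K G n m g -> (n <= m)%N.
Proof. by elim=> // m' g' h _ le _ _; exact: leq_trans le (leqnSn _). Qed.

Lemma gprod_inv n m g : gprod K G n m g -> (m = n /\ g = fun x => x) \/
  exists m' h g', [/\ m = m'.+1, gprod K G n m' g', List.In h (G m'),
    (g' @` K n `<=` K m')%fset & g = h \o g'].
Proof.
case=> [|m' g' h gp hG sub]; first by left.
by right; exists m', h, g'.
Qed.

Lemma exhaustion_mono n m : (n <= m)%N -> (K n `<=` K m)%fset.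
Proof.
move=> /subnKC <-; elim: (m - n)%N => [|j IH]; first by rewrite addn0 fsubset_refl.
by rewrite addnS; apply: fsubset_trans IH (exhaustion_incr ss _).
Qed.

Lemma gprod_iso n m g : gprod K G n m g ->
  [/\ {in K n &, injective g}, {in K n &, forall x y, adj (g x) (g y) = adj x y}
    & forall x, x \in K n -> g x \in K m].
Proof.
elim=> [|m' g' h _ [inj ad sub] hG sub']; first by split.
have [hinj had] := similar_iso ss hG; split.
- by move=> x y hx hy /= /hinj e; apply: inj => //; apply: e; exact: sub.
- by move=> x y hx hy /=; rewrite had ?ad //; exact: sub.
- move=> x hx; apply/(similar_vertices ss); exists h => //=.
  by apply/imfsetP; exists (g' x) => //; exact: sub.
Qed.

Lemma gprod_cover n m y : (n <= m)%N -> y \in K m ->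
  exists2 g, gprod K G n m g & exists2 x, x \in K n & y = g x.
Proof.
elim: m y => [|m IH] y.
  by rewrite leqn0 => /eqP -> hy; exists (fun x => x); [exact: gprod_id | exists y].
rewrite leq_eqVlt => /orP[/eqP ->|lt] hy.
  by exists (fun x => x); [exact: gprod_id | exists y].
have [h hG /imfsetP [z /= hz ->]] := proj1 (similar_vertices ss m y) hy.
have [g gp [x hx ->]] := IH z lt hz.
exists (h \o g); last by exists x.
apply: gprod_step => //; apply/fsubsetP => _ /imfsetP [x' /= hx' ->].
by have [_ _ sub] := gprod_iso gp; exact: sub.
Qed.

(** Vertices that no copy of [K n] sends to its frontier: the neighbours of their images all stay in
    the copy. *)
Definition interior0 n : {fset V} := (K n `\` frontierG K G n)%fset.

(** Peels off [j] further layers: a walk of [j] steps from one of these vertices stays in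
    [interior0 n]. *)
Fixpoint interior n j : {fset V} :=
  if j is i.+1 then [fset x in interior n i | all (fun y => y \in interior n i) (nbr x)]%fset
  else interior0 n.

Lemma frontier_notin (S : {fset V}) x y : x \in S -> x \notin frontier S -> y \in nbr x -> y \in S.
Proof.
move=> xS; rewrite !inE /= xS /= => /hasPn h /h; by rewrite negbK.
Qed.

Lemma interior0_gprod n m g x : x \in interior0 n -> gprod K G n m g ->
  g x \notin frontier (g @` K n)%fset.
Proof.
rewrite inE => /andP[nf xK] gp; apply/negP => h; move/negP: nf; apply.
rewrite !inE /= xK /=; case: excluded_middle_informative => // ne; exfalso.
by apply: ne; exists m, g.
Qed.

Lemma interior0_sub n x : x \in interior0 n -> x \in K n.
Proof. by rewrite inE => /andP[]. Qed.

Lemma interior_sub0 n j x : x \in interior n j -> x \in interior0 n.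
Proof.
elim: j => [//|j IH] h; apply: IH; move: h.
by rewrite /= !inE /= => /andP[].
Qed.

Lemma interior_sub n j x : x \in interior n j -> x \in K n.
Proof. by move/interior_sub0/interior0_sub. Qed.

Lemma gprod_neighbours n m g x y : x \in interior0 n -> gprod K G n m g ->
  y \in nbr (g x) -> exists2 z, z \in K n & y = g z.
Proof.
move=> xi gp hy.
have := frontier_notin _ (interior0_gprod xi gp) hy.
rewrite in_imfset ?(interior0_sub xi) // => /(_ isT) /imfsetP [z /= zK ->].
by exists z.
Qed.

(** Induction on the length of the products. If the last factors differ, the overlap condition puts
    the common vertex on the frontier of the larger copy, so it has a neighbour outside that copy;
    but the neighbours of the image of an interior vertex stay in the copy of [K n], hence in the
    larger one. If the last factors agree, injectivity reduces to the shorter products. *)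
Lemma gprod_separated n m g g' x x' : gprod K G n m g -> gprod K G n m g' ->
  x \in interior0 n -> x' \in K n -> g x = g' x' -> {in K n, g =1 g'}.
Proof.
move=> gp gp' xi; elim: m g g' x' gp gp' => [|m IH] g g' x' gp gp' x'K e.
  have [[_ ->]|[? [? [? [//]]]]] := gprod_inv gp.
  by have [[_ ->]|[? [? [? [//]]]]] := gprod_inv gp'.
have [[en ->]|[m1 [h [g1 [[em] gp1 hG sub1 eg]]]]] := gprod_inv gp.
  have [[_ ->]//|[m1 [h [g1 [[em] gp1 _ _ _]]]]] := gprod_inv gp'.
  by have := gprod_le gp1; rewrite -en -em ltnn.
subst m1; have [[en _]|[m1 [h' [g1' [[em] gp1' hG' sub1' eg']]]]] := gprod_inv gp'.
  by have := gprod_le gp1; rewrite -en ltnn.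
subst m1; have xK := interior0_sub xi.
have [_ _ s1] := gprod_iso gp1; have [_ _ s1'] := gprod_iso gp1'.
case: (excluded_middle_informative {in K m, h =1 h'}) => [eh|neh].
  have e1 : g1 x = g1' x'.
    have [hinj _] := similar_iso ss hG; apply: hinj; [exact: s1 | exact: s1' |].
    by move: e; rewrite eg eg' /= => ->; rewrite eh //; exact: s1'.
  have ih := IH _ _ _ gp1 gp1' x'K e1.
  by move=> z zK; rewrite eg eg' /= ih // eh //; exact: s1'.
exfalso; have ov := similar_overlap ss hG hG' neh.
have : g x \in ((h @` K m) `&` (h' @` K m))%fset.
  rewrite inE; apply/andP; split; apply/imfsetP.
    by exists (g1 x) => /=; [exact: s1 | rewrite eg].
  by exists (g1' x') => /=; [exact: s1' | rewrite e eg'].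
rewrite ov inE => /andP[+ _]; rewrite !inE /= => /andP[_ /hasP [y hy ny]].
have [z zK ez] := gprod_neighbours xi gp hy.
move/negP: ny; apply; apply/imfsetP; exists (g1 z) => /=; first exact: s1.
by rewrite ez eg.
Qed.

Notation A := (adjacency X).
Notation walk k x y := (entry (op_pow A k) x y).

Lemma walk0 x y : walk 0 x y = RtoC (if x == y then 1 else 0).
Proof. by []. Qed.

Lemma walkS k x y : walk k.+1 x y = \big[Cplus/RtoC 0]_(z <- nbr x) walk k z y.
Proof. by []. Qed.

(** Entries of powers of the adjacency operator count walks. Those of length [k] from a vertex of
    [interior n k] never leave the part where [g] maps neighbourhoods onto neighbourhoods, so [g]
    carries them over bijectively. *)
Lemma gprod_walk n m g k x y : gprod K G n m g -> x \in interior n k -> y \in K n ->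
  walk k (g x) (g y) = walk k x y.
Proof.
move=> gp; have [inj ad sub] := gprod_iso gp.
elim: k x => [|k IH] x xi yK.
  rewrite !walk0; have -> : (g x == g y) = (x == y) => //.
  apply/eqP/eqP => [e|->//]; apply: inj => //; exact: interior_sub xi.
move: xi; rewrite /= !inE /= => /andP[xi /allP nx].
have xi0 := interior_sub0 xi; have xK := interior0_sub xi0.
rewrite !walkS; transitivity (\big[Cplus/RtoC 0]_(z <- map g (nbr x)) walk k z (g y)).
  apply: perm_big; apply: uniq_perm; first exact: nbr_uniq.
    rewrite map_inj_in_uniq; first exact: nbr_uniq.
    by move=> z z' /nx hz /nx hz'; apply: inj; [exact: interior_sub hz | exact: interior_sub hz'].
  move=> z; apply/idP/mapP => [hz|[z' hz' ->]].
    have [z' z'K e] := gprod_neighbours xi0 gp hz.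
    exists z' => //; move: hz; rewrite e => hz.
    by have := ad x z' xK z'K; rewrite /adj hz => <-.
  by have := ad x z' xK (interior_sub (nx _ hz')); rewrite /adj hz' => ->.
rewrite big_map big_seq [RHS]big_seq; apply: eq_bigr => z hz.
by apply: IH => //; exact: nx.
Qed.

(** A vertex missing after one more peeling was missing before or is a neighbour of such a vertex,
    whence a factor [d + 1] for each layer. *)
Lemma interior_card n k :
  (#|` (K n `\` interior n k)%fset| <= d.+1 ^ k * #|` frontierG K G n|)%N.
Proof.
elim: k => [|k IH].
  rewrite expn0 mul1n; apply: fsubset_leq_card; apply/fsubsetP => x.
  by rewrite !in_fsetD; case: (x \in frontierG K G n) => //=; case: (x \in K n).
set E := (K n `\` interior n k)%fset in IH *.
pose N := flatten [seq nbr z | z <- (E : seq V)].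
have sub : {subset (K n `\` interior n k.+1)%fset <= (E : seq V) ++ N}.
  move=> x; rewrite in_fsetD => /andP[nx xK]; rewrite mem_cat.
  case: (boolP (x \in E)) => //= nE.
  have xi : x \in interior n k by move: nE; rewrite /E in_fsetD xK andbT negbK.
  move: nx; rewrite /= !inE /= xi /= => /allPn [z hz nz].
  have zK : z \in K n.
    have xi0 := interior_sub0 xi.
    by apply: (frontier_notin (interior0_sub xi0) _ hz);
      have := interior0_gprod xi0 (gprod_id K G n); rewrite imfset_id.
  apply/flattenP; exists (nbr z); last by rewrite -nbr_sym.
  by apply: map_f; rewrite /E in_fsetD nz zK.
apply: leq_trans (uniq_leq_size (fset_uniq _) sub) _.
rewrite size_cat; apply: leq_trans (_ : #|` E| + d * #|` E| <= _)%N.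
  rewrite leq_add2l /N; elim: (E : seq V) => [|z s IHs] /=; first by rewrite muln0.
  by rewrite size_cat mulnS; apply: leq_add => //; exact: deg_le.
by rewrite -mulSn expnS -mulnA leq_mul2l IH orbT.
Qed.

Lemma walk_le k x y : Cmod (walk k x y) <= op_norm A ^ k.
Proof. by apply: Rle_trans (entry_le _ _ _) _; apply: op_pow_norm; exact: Rle_refl. Qed.

Lemma Csum_le (I : Type) (s : seq I) (f : I -> C) M : (forall i, Cmod (f i) <= M) ->
  Cmod (\big[Cplus/RtoC 0]_(i <- s) f i) <= INR (size s) * M.
Proof.
move=> h; elim: s => [|i s IH]; first by rewrite big_nil Cmod_0 /=; lra.
rewrite big_cons (_ : size (i :: s) = (size s).+1) // S_INR; apply: Rle_trans (Cmod_triangle _ _) _.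
by have := h i; lra.
Qed.

Lemma Csum_const (I : Type) (s : seq I) (c : C) :
  \big[Cplus/RtoC 0]_(i <- s) c = (RtoC (INR (size s)) * c)%C.
Proof.
elim: s => [|i s IH]; first by rewrite big_nil Cmult_0_l.
by rewrite big_cons IH (_ : size (i :: s) = (size s).+1) // S_INR RtoC_plus; ring.
Qed.

(** Copies of [K n] in [K m] are indexed by the images of a fixed interior vertex [x0], since by
    [gprod_separated] a copy is determined by the image of an interior vertex. The images of the
    interior are then disjoint, and [r] counts the vertices of [K m] in none of them; each of these
    is the image of a vertex of [K n] outside the interior. *)
Lemma copies n m k : (n <= m)%N -> interior n k != fset0 ->
  exists N r : nat, exists rest : C,
  [/\ (#|` K m| = N * #|` interior n k| + r)%N,
      (r <= N * #|` (K n `\` interior n k)%fset|)%N,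
      \big[Cplus/RtoC 0]_(x <- K m) walk k x x =
        (RtoC (INR N) * \big[Cplus/RtoC 0]_(x <- interior n k) walk k x x + rest)%C &
      Cmod rest <= INR r * op_norm A ^ k].
Proof.
move=> nm /fset0Pn [x0 hx0]; have x00 := interior_sub0 hx0; have x0K := interior0_sub x00.
pose Pset : {fset V} := [fset y in K m | excluded_middle_informative
   (exists2 g, gprod K G n m g & y = g x0)]%fset.
pose c y : V -> V := epsilon (inhabits (fun x => x)) (fun g => gprod K G n m g /\ y = g x0).
have cP y : y \in Pset -> gprod K G n m (c y) /\ y = c y x0.
  rewrite !inE /= => /andP[_]; case: excluded_middle_informative => // -[g gp e] _.
  exact: (epsilon_spec _ (fun g => gprod K G n m g /\ y = g x0) (ex_intro _ g (conj gp e))).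
have inP g : gprod K G n m g -> g x0 \in Pset.
  move=> gp; rewrite !inE /=; have [_ _ sub] := gprod_iso gp; rewrite sub //=.
  by case: excluded_middle_informative => // ne; exfalso; apply: ne; exists g.
pose L := [seq c y x | y <- (Pset : seq V), x <- (interior n k : seq V)].
have uL : uniq L.
  apply: allpairs_uniq; [exact: fset_uniq | exact: fset_uniq |].
  move=> [y x] [y' x'] /allpairsP [[u v] /= [hu hv [-> ->]]] /allpairsP [[u' v'] /= [hu' hv' [-> ->]]] e.
  have [gp eu] := cP _ hu; have [gp' eu'] := cP _ hu'.
  have s := gprod_separated gp gp' (interior_sub0 hv) (interior_sub hv') e.
  have euu : u = u' by rewrite eu eu' s.
  subst u'; congr (_, _); have [inj _ _] := gprod_iso gp.
  by apply: inj => //; [exact: interior_sub hv | exact: interior_sub hv'].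
pose Rs := [seq z <- (K m : seq V) | z \notin L].
have LK : {subset L <= K m}.
  move=> _ /allpairsP [[y x] /= [hy hx ->]]; have [gp _] := cP _ hy.
  by have [_ _ sub] := gprod_iso gp; apply: sub; exact: interior_sub hx.
have pe : perm_eq (K m) (L ++ Rs).
  apply: uniq_perm; first exact: fset_uniq.
    rewrite cat_uniq uL filter_uniq ?fset_uniq // andbT /=.
    by apply/hasPn => z; rewrite mem_filter => /andP[].
  move=> z; rewrite mem_cat mem_filter; case: (boolP (z \in L)) => //= zL.
  exact: LK.
exists #|` Pset|, (size Rs), (\big[Cplus/RtoC 0]_(z <- Rs) walk k z z); split.
- by rewrite (perm_size pe) size_cat size_allpairs.
- rewrite -(size_allpairs (fun y x => c y x)); apply: uniq_leq_size.
    by rewrite filter_uniq // fset_uniq.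
  move=> z; rewrite mem_filter => /andP[zL zK].
  have [g gp [x xK ez]] := gprod_cover nm zK.
  have [gp' e'] := cP _ (inP g gp).
  have s := gprod_separated gp gp' x00 x0K e'.
  apply/allpairsP; exists (g x0, x) => /=; split; [exact: inP | | by rewrite ez s].
  rewrite in_fsetD xK andbT; apply/negP => xi; move/negP: zL; apply.
  apply/allpairsP; exists (g x0, x) => /=; split=> //; [exact: inP | by rewrite ez s].
- rewrite (perm_big _ pe) big_cat /=; congr (_ + _)%C.
  rewrite big_allpairs_dep -Csum_const big_seq [RHS]big_seq; apply: eq_bigr => y hy.
  rewrite big_seq [RHS]big_seq; apply: eq_bigr => x hx.
  have [gp _] := cP _ hy; apply: (gprod_walk gp hx); exact: interior_sub hx.
- by apply: Csum_le => z; exact: walk_le.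
Qed.

Lemma interior_small k : is_lim_seq (fun n => INR #|` (K n `\` interior n k)%fset| / INR #|` K n|) 0.
Proof.
pose c := INR (d.+1 ^ k).
apply: (is_lim_seq_le_le (fun=> 0) _ (fun n => c * (INR #|` frontierG K G n| / INR #|` K n|))).
- move=> n; have i0 : 0 <= / INR #|` K n|.
    case: (Req_dec (INR #|` K n|) 0) => [->|h]; first by rewrite Rinv_0; lra.
    by apply: Rlt_le; apply: Rinv_0_lt_compat; have := pos_INR #|` K n|; lra.
  split; first by apply: Rmult_le_pos => //; exact: pos_INR.
  rewrite /Rdiv -Rmult_assoc; apply: Rmult_le_compat_r => //.
  rewrite /c -mult_INR; apply/le_INR/leP; exact: interior_card.
- exact: is_lim_seq_const.
- by have := is_lim_seq_scal_l _ c _ (similar_amenable ss); rewrite /= Rmult_0_r.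
Qed.

Definition average (T : bounded_op (l2_NormedModule V)) (n : nat) : C :=
  (RtoC (/ INR #|` K n|) * diag_sum T (K n))%C.

Hypothesis ne : exists x : V, True.

Lemma exhaustion_nonempty : exists n0, forall n, (n0 <= n)%N -> 0 < INR #|` K n|.
Proof.
have [x _] := ne; have [n0 hx] := exhaustion_union ss x; exists n0 => n le.
apply: lt_0_INR; apply/ltP; rewrite cardfs_gt0; apply/fset0Pn; exists x.
by move/fsubsetP: (exhaustion_mono le); apply.
Qed.

(** All but few vertices of [K m] lie deep inside a copy of [K n], where they have as many
    closed walks of length [k] as in [K n]. *)
Lemma average_cauchy k : norm_cauchy (V := C_NormedModule) (average (op_pow A k)).
Proof.
have [n0 hn0] := exhaustion_nonempty.
pose M := op_norm A ^ k; have M0 : 0 <= M by apply: pow_le; exact: op_norm_ge0.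
have half e : 0 < e -> exists N, forall n m, (N <= n)%N -> (n <= m)%N ->
    Cmod (average (op_pow A k) m - average (op_pow A k) n)%C < e.
  (* Below, [a] and [b] count the vertices of [K n] outside and inside the interior. From
     [a < del (a + b)] and [del <= 1/2] follows [a / b < 2 del], so the final bound [3 M (a / b)] is
     at most [6 M del < e]. *)
  move=> e0; pose del := Rmin (/ 2) (e / (6 * M + 1)).
  have del0 : 0 < del by apply: Rmin_pos; [lra | apply: Rdiv_lt_0_compat; lra].
  have [N1 hN1] := proj2 (is_lim_seq_spec _ _) (interior_small k) (mkposreal _ del0).
  exists (maxn n0 N1) => n m hn nm.
  have kn : 0 < INR #|` K n| by apply: hn0; apply: leq_trans hn; exact: leq_maxl.
  have km : 0 < INR #|` K m|.
    by apply: hn0; apply: leq_trans nm; apply: leq_trans hn; exact: leq_maxl.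
  have hs : INR #|` (K n `\` interior n k)%fset| / INR #|` K n| < del.
    have := hN1 n (elimT leP (leq_trans (leq_maxr _ _) hn)); rewrite /= Rminus_0_r.
    exact: Rle_lt_trans (Rle_abs _).
  have hcard : (#|` K n| = #|` interior n k| + #|` (K n `\` interior n k)%fset|)%N.
    rewrite -cardfsUI.
    have -> : (interior n k `&` (K n `\` interior n k) = fset0)%fset.
      by apply/fsetP => x; rewrite !inE; case: (x \in interior n k); rewrite ?andbF.
    rewrite cardfs0 addn0; congr (#|` _|); apply/fsetP => x; rewrite in_fsetU in_fsetD.
    by case: (boolP (x \in interior n k)) => //= /interior_sub ->.
  set a := INR #|` (K n `\` interior n k)%fset| in hs.
  set b := INR #|` interior n k|.
  have a0 : 0 <= a by exact: pos_INR.
  have b0 : 0 <= b by exact: pos_INR.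
  have ab : INR #|` K n| = b + a by rewrite hcard plus_INR.
  have hs' : a < del * (b + a).
    rewrite -ab; apply: (Rmult_lt_reg_r (/ INR #|` K n|)); first exact: Rinv_0_lt_compat.
    by rewrite Rmult_assoc Rinv_r; lra.
  have del2 : del <= / 2 := Rmin_l _ _.
  have bpos : a < b by rewrite ab in kn; nra.
  have ine : interior n k != fset0.
    by apply/negP => /eqP e'; rewrite /b e' cardfs0 /= in bpos; lra.
  have [N [r [rest [e1 e2 e3 e4]]]] := copies nm ine.
  set SI := \big[Cplus/RtoC 0]_(x <- interior n k) _ in e3.
  have r1 : INR #|` K m| = INR N * b + INR r by rewrite e1 plus_INR mult_INR.
  have r2 : INR r <= INR N * a by rewrite -mult_INR; apply/le_INR/leP.
  have rn := pos_INR r; have Nn := pos_INR N.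
  have [rest' [f1 f2]] : exists rest', \big[Cplus/RtoC 0]_(x <- K n) walk k x x = (SI + rest')%C
      /\ Cmod rest' <= a * M.
    exists (\big[Cplus/RtoC 0]_(x <- (K n `\` interior n k)%fset) walk k x x); split.
      rewrite -big_cat; apply: perm_big; apply: uniq_perm; first exact: fset_uniq.
        rewrite cat_uniq !fset_uniq andbT /=; apply/hasPn => x.
        by rewrite in_fsetD => /andP[].
      move=> x; rewrite mem_cat in_fsetD; case: (boolP (x \in interior n k)) => //=.
      by move/interior_sub.
    by apply: Csum_le => z; exact: walk_le.
  have hSI : Cmod SI <= b * M by apply: Csum_le => z; exact: walk_le.
  (* The main terms cancel up to [(N a - r) / |K n|]. The three remaining contributions are each at
     most [N a M], while [|K m|] is at least [N b]. *)
  have key : (average (op_pow A k) m - average (op_pow A k) n =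
     RtoC (/ INR #|` K m|) * (rest + (RtoC (- (INR r - INR N * a) / INR #|` K n|) * SI)
       + RtoC (- INR #|` K m| / INR #|` K n|) * rest'))%C.
    rewrite /average /diag_sum e3 f1.
    have en : RtoC (INR #|` K n|) = (RtoC b + RtoC a)%C by rewrite ab RtoC_plus.
    have em : RtoC (INR #|` K m|) = (RtoC (INR N) * RtoC b + RtoC (INR r))%C.
      by rewrite r1 RtoC_plus RtoC_mult.
    have nn0 : (RtoC b + RtoC a)%C <> RtoC 0 by rewrite -en; apply: RtoC_neq0; lra.
    have nm0 : (RtoC (INR N) * RtoC b + RtoC (INR r))%C <> RtoC 0.
      by rewrite -em; apply: RtoC_neq0; lra.
    rewrite !RtoC_div; try lra.
    rewrite !RtoC_inv; try lra.
    rewrite !RtoC_opp RtoC_minus RtoC_mult en em; field; split=> //.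
  have abs1 : Rabs (- (INR r - INR N * a) / INR #|` K n|) * Cmod SI <= INR N * a * M.
    have -> : Rabs (- (INR r - INR N * a) / INR #|` K n|) = (INR N * a - INR r) / INR #|` K n|.
      rewrite Rabs_pos_eq; first by rewrite /Rdiv; ring.
      by apply: Rmult_le_pos; [lra | apply: Rlt_le; exact: Rinv_0_lt_compat].
    have h1 : (INR N * a - INR r) / INR #|` K n| * Cmod SI <=
       (INR N * a) / INR #|` K n| * (INR #|` K n| * M).
      apply: Rmult_le_compat.
      - by apply: Rmult_le_pos; [lra | apply: Rlt_le; exact: Rinv_0_lt_compat].
      - exact: Cmod_ge_0.
      - by apply: Rmult_le_compat_r; [apply: Rlt_le; exact: Rinv_0_lt_compat | lra].
      - by apply: Rle_trans hSI _; apply: Rmult_le_compat_r => //; lra.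
    by apply: Rle_trans h1 _; right; field; lra.
  rewrite key Cmod_mult Cmod_R Rabs_pos_eq; last by apply: Rlt_le; exact: Rinv_0_lt_compat.
  have t1 := Cmod_triangle (rest + RtoC (- (INR r - INR N * a) / INR #|` K n|) * SI)
    (RtoC (- INR #|` K m| / INR #|` K n|) * rest').
  have t2 := Cmod_triangle rest (RtoC (- (INR r - INR N * a) / INR #|` K n|) * SI).
  rewrite !Cmod_mult !Cmod_R in t1 t2.
  have abs2 : Rabs (- INR #|` K m| / INR #|` K n|) * Cmod rest' <= INR N * a * M.
    have -> : Rabs (- INR #|` K m| / INR #|` K n|) = INR #|` K m| / INR #|` K n|.
      rewrite -Rabs_Ropp Rabs_pos_eq; first by rewrite /Rdiv; ring.
      rewrite /Rdiv -Ropp_mult_distr_l_reverse Ropp_involutive.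
      by apply: Rmult_le_pos; [lra | apply: Rlt_le; exact: Rinv_0_lt_compat].
    have h1 : INR #|` K m| / INR #|` K n| <= INR N.
      apply: (Rmult_le_reg_r (INR #|` K n|)) => //.
      by rewrite /Rdiv Rmult_assoc Rinv_l ?Rmult_1_r ?r1 ?ab; lra.
    have h2 := Rmult_le_compat _ _ _ _ _ (Cmod_ge_0 rest') h1 f2.
    have -> : INR N * a * M = INR N * (a * M) by ring.
    apply: h2; apply: Rmult_le_pos; [lra | by apply: Rlt_le; exact: Rinv_0_lt_compat].
  have rr : Cmod rest <= INR N * a * M.
    by apply: Rle_trans e4 _; apply: Rmult_le_compat_r.
  set Z := (_ + _ + _)%C in t1 *.
  have hZ : Cmod Z <= 3 * (INR N * a * M) by lra.
  have Nb : INR N * b <= INR #|` K m| by lra.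
  have Npos : 0 < INR N by case: (Req_dec (INR N) 0) => [h|h]; [rewrite h in r1 r2; nra | lra].
  have hfin : / INR #|` K m| * Cmod Z <= 3 * M * (a / b).
    apply: Rle_trans (Rmult_le_compat _ _ _ _ _ (Cmod_ge_0 _) (Rinv_le_contravar _ _ _ Nb) hZ) _.
    - by apply: Rlt_le; exact: Rinv_0_lt_compat.
    - by apply: Rmult_lt_0_compat; lra.
    - by right; field; lra.
  apply: Rle_lt_trans hfin _.
  have hab : a / b < 2 * del.
    by apply: (Rmult_lt_reg_r b); [lra | rewrite /Rdiv Rmult_assoc Rinv_l; nra].
  have hde : del * (6 * M + 1) <= e.
    have := Rmult_le_compat_r (6 * M + 1) _ _ ltac:(lra) (Rmin_r (/ 2) (e / (6 * M + 1))).
    by rewrite -/del (_ : e / (6 * M + 1) * (6 * M + 1) = e); [| field; lra].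
  have := Rmult_le_compat_l (3 * M) _ _ ltac:(lra) (Rlt_le _ _ hab).
  lra.
move=> e e0; have [N hN] := half e e0; exists N => n m hn hm.
case: (leqP n m) => nm.
  rewrite norm_minus_sym; exact: hN.
exact: hN hm (ltnW nm).
Qed.

End SelfSimilarCombinatorics.

(** * The trace on norm limits of polynomials in [A] *)

Section PolynomialClosure.
Variable X : graph.
Notation H := (l2_NormedModule (VX X)).
Notation B := (bounded_op H).
Notation I := (op_id H).
Notation A := (adjacency X).

Inductive op_poly : B -> Prop :=
| op_poly0 : op_poly zero
| op_polyD c k T : op_poly T -> op_poly (plus (op_scal c (op_pow A k)) T).

Lemma op_poly_plus S T : op_poly S -> op_poly T -> op_poly (plus S T).
Proof.
move=> hS hT; elim: hS => [|c k S' _ IH]; first by rewrite plus_zero_l.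
by rewrite -plus_assoc; exact: op_polyD.
Qed.

Lemma op_scalDr c (S T : B) : op_scal c (plus S T) = plus (op_scal c S) (op_scal c T).
Proof. by apply: bop_eq => x; rewrite !opE; exact: (@scal_distr_l C_Ring). Qed.

Lemma op_scal_zero c : op_scal c (zero : B) = zero.
Proof. exact: (@scal_zero_r C_Ring (bop_ModuleSpace H)). Qed.

Lemma op_poly_scal c T : op_poly T -> op_poly (op_scal c T).
Proof.
elim=> [|c' k S _ IH]; first by rewrite op_scal_zero; exact: op_poly0.
by rewrite op_scalDr op_scalA; exact: op_polyD.
Qed.

Lemma op_poly_pow k : op_poly (op_pow A k).
Proof.
have := op_polyD (RtoC 1) k op_poly0.
by rewrite plus_zero_r op_scal_1.
Qed.

Lemma op_poly_adj T : op_poly T -> op_poly (op_comp A T).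
Proof.
elim=> [|c k S _ IH]; first by rewrite op_comp0r; exact: op_poly0.
rewrite op_compDr op_compZr; exact: (op_polyD c k.+1 IH).
Qed.

Lemma op_poly_affine_pow a b n :
  op_poly (op_pow (plus (op_scal a I) (op_scal b A)) n).
Proof.
elim: n => [|n IH]; first exact: (op_poly_pow 0).
rewrite /= op_compDl !op_compZl op_comp1l.
by apply: op_poly_plus; apply: op_poly_scal => //; exact: op_poly_adj.
Qed.

Lemma op_poly_psum (a : nat -> B) n : (forall i, op_poly (a i)) -> op_poly (op_psum a n).
Proof.
by move=> h; elim: n => [|n IH]; [exact: op_poly0 | exact: op_poly_plus].
Qed.

(** Large enough to contain the logarithms constructed above, small enough for the existence of the
    trace to follow from its existence on powers of [A]. *)
Definition op_limit (T : B) : Prop :=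
  forall e, 0 < e -> exists2 S, op_poly S & op_norm (minus T S) < e.

Lemma op_poly_limit T : op_poly T -> op_limit T.
Proof.
by move=> h e e0; exists T => //; rewrite minus_eq_zero op_norm_zero.
Qed.

Lemma op_limit_plus S T : op_limit S -> op_limit T -> op_limit (plus S T).
Proof.
move=> hS hT e e0; have e2 : 0 < e / 2 by lra.
have [S' pS nS] := hS _ e2; have [T' pT nT] := hT _ e2.
exists (plus S' T'); first exact: op_poly_plus.
have -> : minus (plus S T) (plus S' T') = plus (minus S S') (minus T T').
  rewrite /minus opp_plus -!plus_assoc; congr plus.
  by rewrite plus_comm -plus_assoc; congr plus; exact: plus_comm.
by apply: Rle_lt_trans (op_norm_plus _ _) _; lra.
Qed.

Lemma op_minus_scal c (S T : B) : minus (op_scal c S) (op_scal c T) = op_scal c (minus S T).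
Proof. by apply: bop_eq => x; rewrite !opE -scal_minus_distr_l. Qed.

Lemma op_limit_scal c T : op_limit T -> op_limit (op_scal c T).
Proof.
move=> hT e e0; have c0 := Cmod_ge_0 c.
have e1 : 0 < e / (Cmod c + 1) by apply: Rdiv_lt_0_compat; lra.
have [S pS nS] := hT _ e1; exists (op_scal c S); first exact: op_poly_scal.
rewrite op_minus_scal; apply: Rle_lt_trans (op_norm_scale _ _) _.
apply: Rle_lt_trans (Rmult_le_compat_l _ _ _ c0 (Rlt_le _ _ nS)) _.
have -> : Cmod c * (e / (Cmod c + 1)) = e - e / (Cmod c + 1) by field; lra.
lra.
Qed.

Lemma op_limit_id : op_limit I.
Proof. exact: op_poly_limit (op_poly_pow 0). Qed.

Lemma op_poly_in_cstar T : op_poly T -> in_cstar T.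
Proof.
move=> h P cP PI PA; elim: h => [|c k S _ IH].
  by rewrite -(op_scal0 I); exact: (cstar_scal cP).
apply: (cstar_plus cP) => //; apply: (cstar_scal cP).
by elim: k => [//|k IHk]; exact: (cstar_comp cP).
Qed.

Lemma op_limit_in_cstar T : op_limit T -> in_cstar T.
Proof.
move=> h P cP PI PA; apply: (cstar_closed cP) => eps.
have [S pS nS] := h eps (cond_pos eps); exists S => //.
exact: op_poly_in_cstar.
Qed.

Lemma diag_sum_plus (S T : B) F : diag_sum (plus S T) F = (diag_sum S F + diag_sum T F)%C.
Proof. by rewrite /diag_sum -big_split; apply: eq_bigr. Qed.

Lemma diag_sum_scal c (T : B) F : diag_sum (op_scal c T) F = (c * diag_sum T F)%C.
Proof.
rewrite /diag_sum; elim: (F : seq _) => [|x s IH]; first by rewrite !big_nil Cmult_0_r.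
by rewrite !big_cons IH Cmult_plus_distr_l.
Qed.

Lemma diag_sum_le (T : B) F : Cmod (diag_sum T F) <= INR #|` F| * op_norm T.
Proof. by apply: Csum_le => x; exact: entry_le. Qed.

Lemma diag_sum_id F : diag_sum I F = RtoC (INR #|` F|).
Proof.
rewrite /diag_sum (eq_bigr (fun=> RtoC 1)); last by move=> x _; rewrite entry_id eqxx.
by rewrite Csum_const Cmult_1_r.
Qed.

(** What the determinant uses of either trace. The relation [tau] becomes a function [tr] on
    [op_limit]; that [tr I] is an integer makes the exponential of the trace insensitive to adding
    [d I] with [Cexp d = 1]. *)
Record trace_functional (tau : B -> C -> Prop) (tr : B -> C) (M : R) (N : nat) : Prop := {
  trace_spec : forall T t, op_limit T -> tau T t <-> t = tr T;
  trace_plus : forall S T, op_limit S -> op_limit T -> tr (plus S T) = (tr S + tr T)%C;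
  trace_scal : forall c T, op_limit T -> tr (op_scal c T) = (c * tr T)%C;
  trace_bound : forall T, op_limit T -> Cmod (tr T) <= M * op_norm T;
  trace_id : tr I = RtoC (INR N) }.

Lemma filterlim_norm_cvg (u : nat -> C) (l : C) :
  filterlim u eventually (locally l) <-> norm_cvg (V := C_NormedModule) u l.
Proof.
split=> [h e e0|h P /locally_Cmod [e e0 he]].
  have hl : locally l (fun w => Cmod (w - l)%C < e) by apply/locally_Cmod; exists e.
  by have [N hN] := h _ hl; exists N => n hn; apply: hN; exact/leP.
have [N hN] := h e e0; exists N => n /leP hn; apply: he; exact: hN.
Qed.

Variable d : nat.
Hypothesis deg_le : forall v : VX X, (deg v <= d)%N.
Hypothesis ne : exists x : VX X, True.

(** The averages of powers of [A] are Cauchy, hence so are those of polynomials. Since an average is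
    bounded by the operator norm, this extends to norm limits, and the bound passes to the trace. *)
Lemma self_similar_functional K G : self_similar K G ->
  exists tr, trace_functional (self_similar_trace K) tr 1 1.
Proof.
move=> ss; pose av := @average X K.
have av_plus S T n : av (plus S T) n = (av S n + av T n)%C.
  by rewrite /av /average diag_sum_plus; ring.
have av_scal c T n : av (op_scal c T) n = (c * av T n)%C.
  by rewrite /av /average diag_sum_scal; ring.
have av_minus S T n : av (minus S T) n = (av S n - av T n)%C.
  by rewrite /minus op_oppE av_plus av_scal RtoC_m1; ring.
have av_le T n : Cmod (av T n) <= op_norm T.
  have T0 := op_norm_ge0 T; rewrite /av /average Cmod_mult Cmod_R.
  (* [K n] may be empty; its average is then 0, because the inverse of 0 is 0. *)
  case: (Req_dec (INR #|` K n|) 0) => [->|h].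
    by rewrite Rinv_0 Rabs_R0 Rmult_0_l.
  have p : 0 < INR #|` K n| by have := pos_INR #|` K n|; lra.
  rewrite Rabs_pos_eq; last by apply: Rlt_le; exact: Rinv_0_lt_compat.
  apply: (@Rle_trans _ (/ INR #|` K n| * (INR #|` K n| * op_norm T))).
    by apply: Rmult_le_compat_l (diag_sum_le _ _); apply: Rlt_le; exact: Rinv_0_lt_compat.
  by right; field.
have cpoly T : op_poly T -> norm_cauchy (V := C_NormedModule) (av T).
  elim=> [|c k S _ IH] e e0.
    exists 0%N => n m _ _; change (Cmod (av zero n - av zero m)%C < e).
    rewrite -(op_scal0 I) !av_scal (_ : (_ - _)%C = RtoC 0) ?Cmod_0 //; ring.
  have c0 := Cmod_ge_0 c.
  have e1 : 0 < e / (2 * (Cmod c + 1)) by apply: Rdiv_lt_0_compat; lra.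
  have e2 : 0 < e / 2 by lra.
  have [N hN] := average_cauchy ss deg_le ne k e1.
  have [N' hN'] := IH _ e2.
  exists (maxn N N') => n m hn hm.
  have h1 : Cmod (av (op_pow A k) n - av (op_pow A k) m)%C < e / (2 * (Cmod c + 1)).
    by apply: hN; [exact: leq_trans (leq_maxl _ _) hn | exact: leq_trans (leq_maxl _ _) hm].
  have h2 : Cmod (av S n - av S m)%C < e / 2.
    by apply: hN'; [exact: leq_trans (leq_maxr _ _) hn | exact: leq_trans (leq_maxr _ _) hm].
  change (Cmod (av (plus (op_scal c (op_pow A k)) S) n - av (plus (op_scal c (op_pow A k)) S) m)%C < e).
  rewrite !av_plus !av_scal.
  have -> : (c * av (op_pow A k) n + av S n - (c * av (op_pow A k) m + av S m) =
     c * (av (op_pow A k) n - av (op_pow A k) m) + (av S n - av S m))%C by ring.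
  apply: Rle_lt_trans (Cmod_triangle _ _) _; rewrite Cmod_mult.
  have h3 := Rmult_le_compat_l _ _ _ c0 (Rlt_le _ _ h1).
  have h4 : Cmod c * (e / (2 * (Cmod c + 1))) = e / 2 - e / (2 * (Cmod c + 1)) by field; lra.
  lra.
have clim T : op_limit T -> exists l, norm_cvg (V := C_NormedModule) (av T) l.
  move=> hT; apply: C_seq_complete => e e0; have e3 : 0 < e / 3 by lra.
  have [S pS nS] := hT _ e3; have [N hN] := cpoly S pS _ e3.
  exists N => n m hn hm; change (Cmod (av T n - av T m)%C < e).
  have h : Cmod (av S n - av S m)%C < e / 3 := hN n m hn hm.
  have h1 := av_le (minus T S) n; have h2 := av_le (minus T S) m.
  have -> : (av T n - av T m = av (minus T S) n + ((av S n - av S m) + - av (minus T S) m))%C.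
    by rewrite !av_minus; ring.
  apply: Rle_lt_trans (Cmod_triangle _ _) _.
  have := Cmod_triangle (av S n - av S m) (- av (minus T S) m); rewrite Cmod_opp; lra.
pose tr T : C := epsilon (inhabits (RtoC 0)) (fun l => norm_cvg (V := C_NormedModule) (av T) l).
have trP T : op_limit T -> norm_cvg (V := C_NormedModule) (av T) (tr T).
  by move=> /clim h; exact: epsilon_spec h.
have trU T l : op_limit T -> norm_cvg (V := C_NormedModule) (av T) l -> tr T = l.
  by move=> hT; exact: (@norm_cvg_unique _ C_NormedModule _ _ _ (trP T hT)).
exists tr; split.
- move=> T t hT; split=> [[_ /filterlim_norm_cvg h]|->]; first by rewrite (trU _ _ hT h).
  split; first exact: op_limit_in_cstar.
  by apply/filterlim_norm_cvg; exact: trP.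
- move=> S T hS hT; apply: (trU _ _ (op_limit_plus hS hT)) => e e0.
  have e2 : 0 < e / 2 by lra.
  have [N hN] := trP S hS _ e2; have [N' hN'] := trP T hT _ e2.
  exists (maxn N N') => n hn; change (Cmod (av (plus S T) n - (tr S + tr T))%C < e).
  have h1 : Cmod (av S n - tr S)%C < e / 2 by apply: hN; exact: leq_trans (leq_maxl _ _) hn.
  have h2 : Cmod (av T n - tr T)%C < e / 2 by apply: hN'; exact: leq_trans (leq_maxr _ _) hn.
  rewrite av_plus (_ : av S n + av T n - (tr S + tr T) = (av S n - tr S) + (av T n - tr T))%C; last by ring.
  by apply: Rle_lt_trans (Cmod_triangle _ _) _; lra.
- move=> c T hT; apply: (trU _ _ (op_limit_scal c hT)) => e e0.
  have c0 := Cmod_ge_0 c; have e1 : 0 < e / (Cmod c + 1) by apply: Rdiv_lt_0_compat; lra.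
  have [N hN] := trP T hT _ e1; exists N => n hn.
  change (Cmod (av (op_scal c T) n - (c * tr T))%C < e).
  have h1 : Cmod (av T n - tr T)%C < e / (Cmod c + 1) := hN n hn.
  rewrite av_scal (_ : c * av T n - c * tr T = c * (av T n - tr T))%C; last by ring.
  rewrite Cmod_mult; apply: Rle_lt_trans (Rmult_le_compat_l _ _ _ c0 (Rlt_le _ _ h1)) _.
  have -> : Cmod c * (e / (Cmod c + 1)) = e - e / (Cmod c + 1) by field; lra.
  lra.
- move=> T hT; rewrite Rmult_1_l; apply: le_epsilon => e e0.
  have [N hN] := trP T hT e e0; have h : Cmod (av T N - tr T)%C < e := hN N (leqnn _).
  have := Cmod_triangle (av T N) (- (av T N - tr T))%C; rewrite Cmod_opp.
  rewrite (_ : av T N + - (av T N - tr T) = tr T)%C; last by ring.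
  by have := av_le T N; lra.
- apply: (trU _ _ op_limit_id) => e e0.
  have [n0 hn0] := exhaustion_nonempty ss ne; exists n0 => n hn.
  change (Cmod (av I n - RtoC (INR 1))%C < e).
  rewrite /av /average diag_sum_id -RtoC_mult Rinv_l; last by have := hn0 n hn; lra.
  by rewrite (_ : (_ - _)%C = RtoC 0) ?Cmod_0 //=; ring.
Qed.

Lemma periodic_functional F0 : trace_functional (periodic_trace F0)
  (fun T => diag_sum T F0) (INR #|` F0|) #|` F0|.
Proof.
split.
- move=> T t hT; split=> [[]//|->]; split=> //; exact: op_limit_in_cstar.
- by move=> S T _ _; exact: diag_sum_plus.
- by move=> c T _; exact: diag_sum_scal.
- by move=> T _; exact: diag_sum_le.
- exact: diag_sum_id.
Qed.

Lemma canonical_trace_functional tau : canonical_trace tau ->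
  exists tr M N, 0 <= M /\ trace_functional tau tr M N.
Proof.
case=> [Gam F0 _|K G ss].
  exists (fun T => diag_sum T F0), (INR #|` F0|), #|` F0|.
  by split; [exact: pos_INR | exact: periodic_functional].
have [tr h] := self_similar_functional ss; exists tr, 1, 1%N; split=> //; lra.
Qed.

End PolynomialClosure.

(** * Limits of polynomials in two variables *)

Definition unit_circle (x : R) : C := (cos x, sin x).

Lemma unit_circle_plus x y : unit_circle (x + y) = (unit_circle x * unit_circle y)%C.
Proof.
by rewrite /unit_circle cos_plus sin_plus; apply: injective_projections => /=; ring.
Qed.

Lemma unit_circle0 : unit_circle 0 = RtoC 1.
Proof. by rewrite /unit_circle cos_0 sin_0. Qed.

Lemma Cmod_unit_circle x : Cmod (unit_circle x) = 1.
Proof.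
rewrite /unit_circle /Cmod /= -[RHS]sqrt_1; congr sqrt.
by have := sin2_cos2 x; rewrite /Rsqr; lra.
Qed.

Lemma unit_circle_pow x n : (unit_circle x ^ n)%C = unit_circle (INR n * x).
Proof.
elim: n => [|n IH]; first by rewrite Rmult_0_l unit_circle0.
by rewrite S_INR Rmult_plus_distr_r Rmult_1_l Rplus_comm unit_circle_plus -IH.
Qed.

Lemma Cpow_mult (a b : C) n : ((a * b) ^ n)%C = (a ^ n * b ^ n)%C.
Proof. by elim: n => [|n IH] /=; [ring | rewrite IH; ring]. Qed.

Lemma Cmod_Cpow (z : C) n : Cmod (z ^ n)%C = Cmod z ^ n.
Proof. by elim: n => [|n IH] /=; [exact: Cmod_1 | rewrite Cmod_mult IH]. Qed.

Lemma Cgeom (z : C) n :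
  ((z - 1) * \big[Cplus/RtoC 0]_(0 <= p < n) z ^ p)%C = (z ^ n - 1)%C.
Proof.
elim: n => [|n IH]; first by rewrite big_geq //=; ring.
by rewrite big_nat_recr //= Cmult_plus_distr_l IH /=; ring.
Qed.

Lemma Cbig_scal (J : Type) (s : seq J) (c : C) (f : J -> C) :
  \big[Cplus/RtoC 0]_(i <- s) (c * f i)%C = (c * \big[Cplus/RtoC 0]_(i <- s) f i)%C.
Proof. by elim: s => [|i s IH]; rewrite ?big_nil ?big_cons ?IH; ring. Qed.

Lemma Cbig_prod (J J' : Type) (s : seq J) (s' : seq J') (c : C) (a : J -> C) (b : J' -> C) :
  \big[Cplus/RtoC 0]_(p <- s) \big[Cplus/RtoC 0]_(t <- s') (c * (a p * b t))%C =
  (c * (\big[Cplus/RtoC 0]_(p <- s) a p * \big[Cplus/RtoC 0]_(t <- s') b t))%C.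
Proof.
set b' := \big[Cplus/RtoC 0]_(t <- s') b t.
transitivity (\big[Cplus/RtoC 0]_(p <- s) (c * b' * a p)%C).
  by apply: eq_bigr => p _; rewrite !Cbig_scal -/b'; ring.
by rewrite Cbig_scal; ring.
Qed.

(** A geometric sum of powers of the root of unity [z] of angle [2 pi (j - i) / N]. For distinct
    [i], [j] one has [z^N = 1], and [z] is not 1 because [|j - i| < N]. *)
Lemma root_of_unity_sum N i j : (i < N)%N -> (j < N)%N ->
  \big[Cplus/RtoC 0]_(0 <= p < N)
    (unit_circle (2 * PI * INR p / INR N) ^ j * unit_circle (- (2 * PI * INR p / INR N)) ^ i)%C =
  if i == j then RtoC (INR N) else RtoC 0.
Proof.
move=> iN jN; have N0 : 0 < INR N by apply: lt_0_INR; apply/ltP; exact: leq_ltn_trans (leq0n i) iN.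
have hpi := PI_RGT_0.
pose th := 2 * PI * (INR j - INR i) / INR N.
transitivity (\big[Cplus/RtoC 0]_(0 <= p < N) (unit_circle th ^ p)%C).
  apply: eq_bigr => p _; rewrite !unit_circle_pow -unit_circle_plus; congr unit_circle.
  by rewrite /th; field; lra.
case: eqP => [e|ne].
  rewrite (eq_bigr (fun=> RtoC 1)); last first.
    move=> p _; rewrite unit_circle_pow /th e Rminus_diag.
    by rewrite (_ : INR p * (2 * PI * 0 / INR N) = 0) ?unit_circle0 //; rewrite /Rdiv; ring.
  by rewrite Csum_const size_iota subn0 Cmult_1_r.
have zN : (unit_circle th ^ N)%C = RtoC 1.
  rewrite unit_circle_pow.
  have -> : INR N * th = 2 * INR j * PI - 2 * INR i * PI by rewrite /th; field; lra.
  rewrite /unit_circle cos_minus sin_minus.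
  have := cos_period 0 j; have := cos_period 0 i.
  have := sin_period 0 j; have := sin_period 0 i.
  by rewrite !Rplus_0_l cos_0 sin_0 => -> -> -> ->; congr (_, _); ring.
have z1 : (unit_circle th - 1)%C <> RtoC 0.
  move=> h; have c : cos th = 1 by case: h => h _; lra.
  have hij : INR i < INR N /\ INR j < INR N by split; apply/lt_INR/ltP.
  have [i0 j0] : 0 <= INR i /\ 0 <= INR j by split; exact: pos_INR.
  have [k hk] : exists k : Z, th / 2 = IZR k * PI.
    apply: sin_eq_0_0; have := cos_2a_sin (th / 2).
    rewrite (_ : 2 * (th / 2) = th) ?c; last by field.
    nra.
  have hk2 : INR j - INR i = IZR k * INR N.
    have : PI * (INR j - INR i) = PI * (IZR k * INR N).
      transitivity (th / 2 * INR N); first by rewrite /th; field; lra.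
      by rewrite hk; ring.
    by move/Rmult_eq_reg_l; apply; lra.
  have k1 : (-1 < k)%Z.
    by apply: lt_IZR; apply: (Rmult_lt_reg_r (INR N)) => //; lra.
  have k2 : (k < 1)%Z.
    by apply: lt_IZR; apply: (Rmult_lt_reg_r (INR N)) => //; lra.
  have k0 : k = 0%Z by lia.
  by apply: ne; apply: INR_eq; rewrite k0 Rmult_0_l in hk2; lra.
have := Cgeom (unit_circle th) N; rewrite zN => h.
apply: NNPP => h0; apply: (Cmult_neq_0 _ _ z1 h0); rewrite h; ring.
Qed.

(** A monomial [c h^i k^j] is stored as [(c, i, j)]. *)
Notation monomial := (C * nat * nat)%type.

Definition mono_eval (l : seq monomial) (h k : C) : C :=
  \big[Cplus/RtoC 0]_(m <- l) (m.1.1 * (h ^ m.1.2 * k ^ m.2))%C.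

Definition mono_coef (l : seq monomial) (i j : nat) : C :=
  \big[Cplus/RtoC 0]_(m <- l) (if (m.1.2 == i) && (m.2 == j) then m.1.1 else RtoC 0).

Lemma mono_eval_cons m l h k :
  mono_eval (m :: l) h k = (m.1.1 * (h ^ m.1.2 * k ^ m.2) + mono_eval l h k)%C.
Proof. by rewrite /mono_eval big_cons. Qed.

Lemma mono_coef_cons m l i j : mono_coef (m :: l) i j =
  ((if (m.1.2 == i) && (m.2 == j) then m.1.1 else RtoC 0) + mono_coef l i j)%C.
Proof. by rewrite /mono_coef big_cons. Qed.

Lemma mono_eval_cat l l' h k : mono_eval (l ++ l') h k = (mono_eval l h k + mono_eval l' h k)%C.
Proof. by rewrite /mono_eval big_cat. Qed.

Lemma mono_coef_cat l l' i j : mono_coef (l ++ l') i j = (mono_coef l i j + mono_coef l' i j)%C.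
Proof. by rewrite /mono_coef big_cat. Qed.

Definition mono_scal (c : C) (l : seq monomial) : seq monomial :=
  [seq ((c * m.1.1)%C, m.1.2, m.2) | m <- l].

Lemma mono_eval_scal c l h k : mono_eval (mono_scal c l) h k = (c * mono_eval l h k)%C.
Proof.
rewrite /mono_eval big_map -Cbig_scal; apply: eq_bigr => m _ /=; exact/esym/Cmult_assoc.
Qed.

Lemma mono_coef_scal c l i j : mono_coef (mono_scal c l) i j = (c * mono_coef l i j)%C.
Proof.
rewrite /mono_coef big_map -Cbig_scal; apply: eq_bigr => m _ /=.
by case: (_ && _) => //; rewrite Cmult_0_r.
Qed.

Definition degree_lt (N : nat) (l : seq monomial) : bool :=
  all (fun m => (m.1.2 + m.2 < N)%N) l.

Lemma degree_lt_exists l N0 : exists2 N, (N0 <= N)%N & degree_lt N l.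
Proof.
elim: l => [|m l [N N0N hN]]; first by exists N0.
exists (maxn N (m.1.2 + m.2).+1); first by apply: leq_trans N0N (leq_maxl _ _).
rewrite /degree_lt /= leq_maxr /=; apply: sub_all hN => m' h.
exact: leq_trans h (leq_maxl _ _).
Qed.

(** As [N] exceeds every exponent, no two exponents coincide modulo [N], and orthogonality isolates
    one coefficient exactly. *)
Lemma fourier_coef N l (r : R) i j : (i < N)%N -> (j < N)%N -> degree_lt N l ->
  let u (p : nat) := (2 * PI * INR p / INR N) in
  \big[Cplus/RtoC 0]_(0 <= p < N) \big[Cplus/RtoC 0]_(0 <= s < N)
    (mono_eval l (RtoC r * unit_circle (u p)) (RtoC r * unit_circle (u s)) *
     (unit_circle (- u p) ^ i * unit_circle (- u s) ^ j))%C =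
  (RtoC (INR N) * RtoC (INR N) * (mono_coef l i j * (RtoC r ^ i * RtoC r ^ j)))%C.
Proof.
move=> iN jN hl u; elim: l hl => [|m l IH] /=.
  move=> _; rewrite /mono_coef big_nil Cmult_0_l Cmult_0_r big1 // => p _.
  by rewrite big1 // => s _; rewrite /mono_eval big_nil Cmult_0_l.
move=> /andP[hm hl].
pose t p s := (m.1.1 * (RtoC r ^ m.1.2 * RtoC r ^ m.2) *
  ((unit_circle (u p) ^ m.1.2 * unit_circle (- u p) ^ i) *
   (unit_circle (u s) ^ m.2 * unit_circle (- u s) ^ j)))%C.
transitivity (\big[Cplus/RtoC 0]_(0 <= p < N) \big[Cplus/RtoC 0]_(0 <= s < N) t p s +
  \big[Cplus/RtoC 0]_(0 <= p < N) \big[Cplus/RtoC 0]_(0 <= s < N)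
    (mono_eval l (RtoC r * unit_circle (u p)) (RtoC r * unit_circle (u s)) *
     (unit_circle (- u p) ^ i * unit_circle (- u s) ^ j)))%C.
  rewrite -big_split; apply: eq_bigr => p _; rewrite -big_split; apply: eq_bigr => s _ /=.
  by rewrite mono_eval_cons /t !Cpow_mult; ring.
rewrite IH // mono_coef_cons.
have m1 : (m.1.2 < N)%N by apply: leq_ltn_trans hm; exact: leq_addr.
have m2 : (m.2 < N)%N by apply: leq_ltn_trans hm; exact: leq_addl.
have -> : \big[Cplus/RtoC 0]_(0 <= p < N) \big[Cplus/RtoC 0]_(0 <= s < N) t p s =
   (m.1.1 * (RtoC r ^ m.1.2 * RtoC r ^ m.2) *
     ((if i == m.1.2 then RtoC (INR N) else RtoC 0) * (if j == m.2 then RtoC (INR N) else RtoC 0)))%C.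
  by rewrite -(root_of_unity_sum iN m1) -(root_of_unity_sum jN m2) -/u -Cbig_prod.
rewrite (eq_sym i) (eq_sym j); case: eqP => [<-|_]; case: eqP => [<-|_] /=; ring.
Qed.

(** Cauchy's estimate, with the integral over the torus replaced by an average over
    roots of unity. *)
Lemma mono_coef_bound (l : seq monomial) r M i j : 0 < r ->
  (forall h k, Cmod h <= r -> Cmod k <= r -> Cmod (mono_eval l h k) <= M) ->
  Cmod (mono_coef l i j) * (r ^ i * r ^ j) <= M.
Proof.
move=> r0 hM; have [N ijN hN] := degree_lt_exists l (i + j).+1.
have iN : (i < N)%N by apply: leq_ltn_trans ijN; exact: leq_addr.
have jN : (j < N)%N by apply: leq_ltn_trans ijN; exact: leq_addl.
have N0 : 0 < INR N by apply: lt_0_INR; apply/ltP; exact: leq_ltn_trans (leq0n i) iN.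
have := f_equal Cmod (fourier_coef r iN jN hN).
rewrite !Cmod_mult !Cmod_Cpow !Cmod_R !Rabs_pos_eq; try lra.
move=> e; apply: (Rmult_le_reg_l (INR N * INR N)); first exact: Rmult_lt_0_compat.
rewrite -e.
have hin (p : nat) : Cmod (\big[Cplus/RtoC 0]_(0 <= s < N)
    (mono_eval l (RtoC r * unit_circle (2 * PI * INR p / INR N)) (RtoC r * unit_circle (2 * PI * INR s / INR N)) *
     (unit_circle (- (2 * PI * INR p / INR N)) ^ i * unit_circle (- (2 * PI * INR s / INR N)) ^ j))%C) <= INR N * M.
  rewrite -[X in INR X * M](subn0 N) -(size_iota 0 (N - 0)); apply: Csum_le => s.
  rewrite !Cmod_mult !Cmod_Cpow !Cmod_unit_circle !pow1 !Rmult_1_r; apply: hM.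
    by rewrite Cmod_mult Cmod_unit_circle Cmod_R Rabs_pos_eq; lra.
  by rewrite Cmod_mult Cmod_unit_circle Cmod_R Rabs_pos_eq; lra.
rewrite Rmult_assoc -[X in INR X * (_ * M)](subn0 N) -(size_iota 0 (N - 0)); exact: Csum_le.
Qed.

Lemma sum_n_big (f : nat -> C) n :
  sum_n (G := C_AbelianMonoid) f n = \big[Cplus/RtoC 0]_(0 <= i < n.+1) f i.
Proof.
elim: n => [|n IH]; first by rewrite sum_O big_nat1.
by rewrite sum_Sn IH [RHS]big_nat_recr.
Qed.

Definition homogeneous_part (a : nat -> nat -> C) (h k : C) (n : nat) : C :=
  \big[Cplus/RtoC 0]_(0 <= i < n.+1) (a i (n - i)%N * h ^ i * k ^ (n - i))%C.

Lemma mono_eval_parts l h k n : degree_lt n.+1 l ->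
  mono_eval l h k = \big[Cplus/RtoC 0]_(0 <= m < n.+1) homogeneous_part (mono_coef l) h k m.
Proof.
elim: l => [|m l IH] /=.
  move=> _; rewrite /mono_eval big_nil big1 // => p _; rewrite /homogeneous_part big1 // => i _.
  by rewrite /mono_coef big_nil; ring.
move=> /andP[hm hl]; rewrite mono_eval_cons (IH hl).
pose t p i := (if (m.1.2 == i) && (m.2 == (p - i)%N) then m.1.1 * (h ^ i * k ^ (p - i)) else RtoC 0)%C.
have -> : (m.1.1 * (h ^ m.1.2 * k ^ m.2))%C =
    \big[Cplus/RtoC 0]_(0 <= p < n.+1) \big[Cplus/RtoC 0]_(0 <= i < p.+1) t p i.
  pose c := (m.1.1 * (h ^ m.1.2 * k ^ m.2))%C.
  transitivity (\big[Cplus/RtoC 0]_(0 <= p < n.+1) if p == (m.1.2 + m.2)%N then c else RtoC 0).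
    by rewrite -big_mkcond big_nat1_eq /= hm.
  apply: eq_bigr => p _.
  transitivity (\big[Cplus/RtoC 0]_(0 <= i < p.+1)
      if i == m.1.2 then (if p == (m.1.2 + m.2)%N then c else RtoC 0) else RtoC 0).
    rewrite -big_mkcond big_nat1_eq /= ltnS; case: (leqP m.1.2 p) => // lt.
    case: eqP => // e; exfalso; move: lt; rewrite e ltnNge leq_addr //.
  rewrite big_nat [RHS]big_nat; apply: eq_bigr => i /andP[_]; rewrite ltnS => ip.
  rewrite /t (eq_sym m.1.2); case: (i =P m.1.2) => //= ei.
  have -> : (p == (m.1.2 + m.2)%N) = (m.2 == (p - i)%N).
    by rewrite -ei -{1}(subnKC ip) eqn_add2l eq_sym.
  by case: eqP => // e; rewrite /c -ei -e.
rewrite -big_split; apply: eq_bigr => p _; rewrite -big_split; apply: eq_bigr => i _ /=.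
by rewrite mono_coef_cons /t; case: (_ && _); ring.
Qed.

Lemma succ_le_pow2 n : INR n.+1 <= 2 ^ n.
Proof.
elim: n => [|n IH]; first by rewrite /=; lra.
rewrite S_INR -tech_pow_Rmult; have := pow_R1_Rle 2 n ltac:(lra); lra.
Qed.

(** Each of the [n + 1] terms is at most [M / 4^n], and [n + 1 <= 2^n]. This is why the series is
    summed on a polydisc of a quarter of the radius. *)
Lemma homogeneous_part_bound (a : nat -> nat -> C) h k n r M : 0 < r ->
  Cmod h <= r / 4 -> Cmod k <= r / 4 ->
  (forall i j, Cmod (a i j) * (r ^ i * r ^ j) <= M) ->
  (\big[Rplus/0]_(0 <= i < n.+1) Cmod (a i (n - i)%N * h ^ i * k ^ (n - i))%C) <= M * (/ 2) ^ n.
Proof.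
move=> r0 hh hk ha.
have M0 : 0 <= M.
  by apply: Rle_trans (ha 0%N 0%N); rewrite /= !Rmult_1_r; exact: Cmod_ge_0.
have term i : (i <= n)%N -> Cmod (a i (n - i)%N * h ^ i * k ^ (n - i))%C <= M * (/ 4) ^ n.
  move=> le; rewrite !Cmod_mult !Cmod_Cpow.
  have h1 : Cmod h ^ i <= (r / 4) ^ i by apply: pow_incr; split=> //; exact: Cmod_ge_0.
  have h2 : Cmod k ^ (n - i) <= (r / 4) ^ (n - i) by apply: pow_incr; split=> //; exact: Cmod_ge_0.
  have p1 : 0 <= Cmod h ^ i by apply: pow_le; exact: Cmod_ge_0.
  have p2 : 0 <= Cmod k ^ (n - i) by apply: pow_le; exact: Cmod_ge_0.
  have h3 := Rmult_le_compat _ _ _ _ p1 p2 h1 h2.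
  rewrite Rmult_assoc; apply: Rle_trans (Rmult_le_compat_l _ _ _ (Cmod_ge_0 _) h3) _.
  have -> : (/ 4) ^ n = (/ 4) ^ i * (/ 4) ^ (n - i) by rewrite -pow_add plusE subnKC.
  rewrite /Rdiv !Rpow_mult_distr.
  have -> : Cmod (a i (n - i)%N) * (r ^ i * (/ 4) ^ i * (r ^ (n - i) * (/ 4) ^ (n - i))) =
    Cmod (a i (n - i)%N) * (r ^ i * r ^ (n - i)) * ((/ 4) ^ i * (/ 4) ^ (n - i)) by ring.
  apply: Rmult_le_compat_r (ha _ _).
  by apply: Rmult_le_pos; apply: pow_le; lra.
apply: (@Rle_trans _ (\big[Rplus/0]_(0 <= i < n.+1) (M * (/ 4) ^ n))).
  by apply: Rsum_le => i; rewrite mem_index_iota => /andP[_]; rewrite ltnS; exact: term.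
have -> : \big[Rplus/0]_(0 <= i < n.+1) (M * (/ 4) ^ n) = INR n.+1 * (M * (/ 4) ^ n).
  elim: n.+1 => [|j IH]; first by rewrite big_geq //=; ring.
  by rewrite big_nat_recr //= IH -/(INR j.+1) S_INR; ring.
have q0 : 0 <= (/ 4) ^ n by apply: pow_le; lra.
have -> : (/ 2) ^ n = 2 ^ n * (/ 4) ^ n by rewrite -Rpow_mult_distr; congr (_ ^ _); lra.
have := Rmult_le_compat_r _ _ _ (Rmult_le_pos _ _ M0 q0) (succ_le_pow2 n).
lra.
Qed.

Lemma Csum_n_bound (f : nat -> C) n M : 0 <= M -> (forall i, Cmod (f i) <= M * (/ 2) ^ i) ->
  Cmod (\big[Cplus/RtoC 0]_(0 <= i < n) f i) <= 2 * M.
Proof.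
move=> M0 hf; suff h : Cmod (\big[Cplus/RtoC 0]_(0 <= i < n) f i) <= 2 * M * (1 - (/ 2) ^ n).
  have : 0 <= (/ 2) ^ n by apply: pow_le; lra.
  by move=> q; nra.
elim: n => [|n IH]; first by rewrite big_geq // Cmod_0 Rminus_diag Rmult_0_r; exact: Rle_refl.
rewrite big_nat_recr //; apply: Rle_trans (Cmod_triangle _ _) _.
have := hf n; rewrite -tech_pow_Rmult => h; apply: Rle_trans (Rplus_le_compat _ _ _ _ IH h) _; lra.
Qed.

Lemma Cbig_le (J : Type) (s : seq J) (f : J -> C) :
  Cmod (\big[Cplus/RtoC 0]_(i <- s) f i) <= \big[Rplus/0]_(i <- s) Cmod (f i).
Proof.
elim: s => [|i s IH]; first by rewrite !big_nil Cmod_0; exact: Rle_refl.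
by rewrite !big_cons; apply: Rle_trans (Cmod_triangle _ _) _; exact: Rplus_le_compat_l.
Qed.

Lemma sum_n_Rbig (f : nat -> R) n :
  sum_n (G := R_AbelianMonoid) f n = \big[Rplus/0]_(0 <= i < n.+1) f i.
Proof.
elim: n => [|n IH]; first by rewrite sum_O big_nat1.
by rewrite sum_Sn IH [RHS]big_nat_recr.
Qed.

Lemma homogeneous_part_minus (a b : nat -> nat -> C) h k n :
  (homogeneous_part a h k n - homogeneous_part b h k n)%C =
  homogeneous_part (fun i j => a i j - b i j)%C h k n.
Proof.
have e : homogeneous_part a h k n = (homogeneous_part (fun i j => a i j - b i j)%C h k n
    + homogeneous_part b h k n)%C.
  by rewrite /homogeneous_part -big_split; apply: eq_bigr => i _ /=; ring.
by rewrite e; ring.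
Qed.

(** Analyticity is reached in this form because it is stable under sums, products, uniform limits
    and the exponential, without composing or multiplying power series. *)
Definition poly_limit (r : R) (f : C -> C -> C) : Prop :=
  forall e, 0 < e -> exists l, forall h k, Cmod h <= r -> Cmod k <= r ->
    Cmod (f h k - mono_eval l h k)%C <= e.

Lemma mono_eval_bounded l r : 0 <= r -> exists2 M, 0 <= M &
  forall h k, Cmod h <= r -> Cmod k <= r -> Cmod (mono_eval l h k) <= M.
Proof.
move=> r0; elim: l => [|m l [M M0 hM]].
  by exists 0; [lra | move=> h k _ _; rewrite /mono_eval big_nil Cmod_0; lra].
exists (Cmod m.1.1 * (r ^ m.1.2 * r ^ m.2) + M).
  apply: Rplus_le_le_0_compat => //; apply: Rmult_le_pos (Cmod_ge_0 _) _.
  by apply: Rmult_le_pos; exact: pow_le.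
move=> h k hh hk; rewrite mono_eval_cons; apply: Rle_trans (Cmod_triangle _ _) _.
apply: Rplus_le_compat (hM h k hh hk); rewrite !Cmod_mult !Cmod_Cpow.
apply: Rmult_le_compat_l (Cmod_ge_0 _) _; apply: Rmult_le_compat.
- by apply: pow_le; exact: Cmod_ge_0.
- by apply: pow_le; exact: Cmod_ge_0.
- by apply: pow_incr; split=> //; exact: Cmod_ge_0.
- by apply: pow_incr; split=> //; exact: Cmod_ge_0.
Qed.

(** Cauchy's estimate applied to differences of approximants makes each coefficient converge, with
    an error of at most [en n / (r^i r^j)]. On the polydisc of radius [r/4] these errors add up
    geometrically, so the series of the limits stays close to a polynomial that is itself close to
    [F]. *)
Lemma analytic_of_poly_limit (F : C * C -> C) (p : C * C) r : 0 < r ->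
  poly_limit r (fun h k => F (fst p + h, snd p + k)%C) -> analytic_at F p.
Proof.
move=> r0 hF.
pose en (n : nat) := / (INR n + 1).
have en0 n : 0 < en n by apply: Rinv_0_lt_compat; have := pos_INR n; lra.
have small e : 0 < e -> exists N : nat, forall n, (N <= n)%N -> en n < e.
  move=> e0; have [N [hN N0]] := archimed_cor1 e e0; exists N => n le; apply: Rle_lt_trans hN.
  have h0 := lt_0_INR _ N0; have /leP/le_INR h1 := le.
  by apply: Rinv_le_contravar; lra.
pose l n := projT1 (constructive_indefinite_description _ (hF (en n) (en0 n))).
have lP n h k : Cmod h <= r -> Cmod k <= r ->
    Cmod (F (fst p + h, snd p + k) - mono_eval (l n) h k)%C <= en n.
  exact: (projT2 (constructive_indefinite_description _ (hF (en n) (en0 n)))).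
have dl n m i j : Cmod (mono_coef (l n) i j - mono_coef (l m) i j)%C * (r ^ i * r ^ j) <= en n + en m.
  have -> : (mono_coef (l n) i j - mono_coef (l m) i j)%C =
      mono_coef (l n ++ mono_scal (RtoC (-1)) (l m)) i j.
    by rewrite mono_coef_cat mono_coef_scal RtoC_m1; ring.
  apply: mono_coef_bound => // h k hh hk; rewrite mono_eval_cat mono_eval_scal RtoC_m1.
  have -> : (mono_eval (l n) h k + - (1) * mono_eval (l m) h k =
     - (F (fst p + h, snd p + k) - mono_eval (l n) h k) +
     (F (fst p + h, snd p + k) - mono_eval (l m) h k))%C by ring.
  apply: Rle_trans (Cmod_triangle _ _) _; rewrite Cmod_opp.
  by have := lP n h k hh hk; have := lP m h k hh hk; lra.
have rij i j : 0 < r ^ i * r ^ j by apply: Rmult_lt_0_compat; exact: pow_lt.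
have hlim i j : exists c, norm_cvg (V := C_NormedModule) (fun n => mono_coef (l n) i j) c.
  apply: C_seq_complete => e e0.
  have e1 : 0 < e * (r ^ i * r ^ j) / 2.
    by apply: Rdiv_lt_0_compat; [exact: Rmult_lt_0_compat | lra].
  have [N hN] := small _ e1; exists N => n m hn hm.
  change (Cmod (mono_coef (l n) i j - mono_coef (l m) i j)%C < e).
  apply: (Rmult_lt_reg_r (r ^ i * r ^ j)) => //; apply: Rle_lt_trans (dl n m i j) _.
  by have := hN n hn; have := hN m hm; lra.
pose a i j := projT1 (constructive_indefinite_description _ (hlim i j)).
have aP i j : norm_cvg (V := C_NormedModule) (fun n => mono_coef (l n) i j) (a i j).
  exact: (projT2 (constructive_indefinite_description _ (hlim i j))).
have al n i j : Cmod (mono_coef (l n) i j - a i j)%C * (r ^ i * r ^ j) <= en n.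
  apply: le_epsilon => e e0; have e2 : 0 < e / 2 by lra.
  have e3 : 0 < e / 2 / (r ^ i * r ^ j) by exact: Rdiv_lt_0_compat.
  have [N hN] := small _ e2; have [N' hN'] := aP i j _ e3.
  pose m := maxn N N'; have h1 := hN m (leq_maxl _ _).
  have h2 : Cmod (mono_coef (l m) i j - a i j)%C < e / 2 / (r ^ i * r ^ j) := hN' m (leq_maxr _ _).
  have -> : (mono_coef (l n) i j - a i j = (mono_coef (l n) i j - mono_coef (l m) i j) +
     (mono_coef (l m) i j - a i j))%C by ring.
  apply: Rle_trans (Rmult_le_compat_r _ _ _ (Rlt_le _ _ (rij i j)) (Cmod_triangle _ _)) _.
  rewrite Rmult_plus_distr_r; have h3 := dl n m i j.
  have h4 := Rmult_le_compat_r _ _ _ (Rlt_le _ _ (rij i j)) (Rlt_le _ _ h2).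
  have h5 : e / 2 / (r ^ i * r ^ j) * (r ^ i * r ^ j) = e / 2.
    by field; split; apply: pow_nonzero; lra.
  lra.
have [M0' M0'0 hM0'] := mono_eval_bounded (l 0%N) (Rlt_le _ _ r0).
pose M := M0' + en 0%N.
have aM i j : Cmod (a i j) * (r ^ i * r ^ j) <= M.
  have h1 := mono_coef_bound i j r0 hM0'; have h2 := al 0%N i j.
  have h3 := Cmod_triangle (mono_coef (l 0%N) i j) (- (mono_coef (l 0%N) i j - a i j))%C.
  rewrite Cmod_opp (_ : mono_coef (l 0%N) i j + - (mono_coef (l 0%N) i j - a i j) = a i j)%C in h3; last by ring.
  have h4 := Rmult_le_compat_r _ _ _ (Rlt_le _ _ (rij i j)) h3.
  rewrite /M; lra.
have r4 : 0 < r / 4 by lra.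
exists (mkposreal _ r4), a => h k /= hh hk.
have hh' : Cmod h <= r / 4 by lra. have hk' : Cmod k <= r / 4 by lra.
split.
- apply: (@ex_series_le R_AbsRing R_CompleteNormedModule _ (fun n => scal M ((/ 2) ^ n))).
    move=> n; rewrite sum_n_Rbig.
    change (Rabs (\big[Rplus/0]_(0 <= i < n.+1) Cmod (a i (n - i)%N * h ^ i * k ^ (n - i))%C)
      <= M * (/ 2) ^ n).
    rewrite Rabs_pos_eq; first exact: (homogeneous_part_bound n r0 hh' hk' aM).
    by apply: Rsum_ge0 => i; exact: Cmod_ge_0.
  apply: ex_series_scal; apply: ex_series_geom; rewrite Rabs_pos_eq; lra.
- apply/filterlim_locally => eps.
  (* Three errors of size [en nu] occur: twice that between the partial sums, once between the
     polynomial and [F]. *)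
  have e4 : 0 < eps / 4 by have := cond_pos eps; lra.
  have [nu hnu] := small _ e4; have := hnu nu (leqnn nu) => {}hnu.
  have [N _ hN] := degree_lt_exists (l nu) 0.
  exists N => n /leP le; apply: Cmod_ball.
  have hn : degree_lt n.+1 (l nu).
    apply: sub_all hN => m' hm'; exact: leq_trans hm' (leqW le).
  set S := sum_n _ n.
  have -> : S = \big[Cplus/RtoC 0]_(0 <= m < n.+1) homogeneous_part a h k m.
    by rewrite /S sum_n_big; apply: eq_bigr => m _; rewrite sum_n_big.
  have e1 := mono_eval_parts h k hn.
  have hd m : Cmod (homogeneous_part (mono_coef (l nu)) h k m - homogeneous_part a h k m)%C
      <= en nu * (/ 2) ^ m.
    rewrite homogeneous_part_minus; apply: Rle_trans (Cbig_le _ _) _.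
    exact: (homogeneous_part_bound m r0 hh' hk' (al nu)).
  have h1 := Csum_n_bound n.+1 (Rlt_le _ _ (en0 nu)) hd.
  have h2 : Cmod h <= r by lra. have h3 : Cmod k <= r by lra.
  have h4 := lP nu h k h2 h3.
  have e2 : \big[Cplus/RtoC 0]_(0 <= m < n.+1)
      (homogeneous_part (mono_coef (l nu)) h k m - homogeneous_part a h k m)%C =
     (mono_eval (l nu) h k - \big[Cplus/RtoC 0]_(0 <= m < n.+1) homogeneous_part a h k m)%C.
    rewrite e1; elim: n.+1 => [|j IH]; first by rewrite !big_geq //; ring.
    by rewrite !big_nat_recr //= IH; ring.
  rewrite e2 in h1.
  set P := \big[Cplus/RtoC 0]_(0 <= m < n.+1) homogeneous_part a h k m in h1 *.
  have -> : (P - F (fst p + h, snd p + k) = - (mono_eval (l nu) h k - P) -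
      (F (fst p + h, snd p + k) - mono_eval (l nu) h k))%C by ring.
  apply: Rle_lt_trans (Cmod_triangle _ _) _; rewrite !Cmod_opp; lra.
Qed.

Definition mono_mult (l l' : seq monomial) : seq monomial :=
  flatten [seq [seq ((m.1.1 * m'.1.1)%C, (m.1.2 + m'.1.2)%N, (m.2 + m'.2)%N) | m' <- l'] | m <- l].

Lemma mono_eval_mult l l' h k :
  mono_eval (mono_mult l l') h k = (mono_eval l h k * mono_eval l' h k)%C.
Proof.
elim: l => [|m l IH]; first by rewrite /mono_eval !big_nil Cmult_0_l.
rewrite [mono_mult _ _]/(_ ++ mono_mult l l') mono_eval_cat IH mono_eval_cons.
rewrite Cmult_plus_distr_r; congr Cplus; rewrite /mono_eval big_map -Cbig_scal.
by apply: eq_bigr => m' _ /=; rewrite -!plusE !Cpow_add_r; ring.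
Qed.

(** * Operations on uniform limits of polynomials *)

Section PolyLimitClosure.
Variable r : R.
Hypothesis r0 : 0 <= r.
Implicit Types f g : C -> C -> C.

Lemma poly_limit_mono l : poly_limit r (mono_eval l).
Proof. by move=> e e0; exists l => h k _ _; rewrite (_ : (_ - _)%C = RtoC 0) ?Cmod_0; [lra | ring]. Qed.

Lemma poly_limit_uniform f : (forall e, 0 < e -> exists2 g, poly_limit r g &
    forall h k, Cmod h <= r -> Cmod k <= r -> Cmod (f h k - g h k)%C <= e) -> poly_limit r f.
Proof.
move=> hf e e0; have e2 : 0 < e / 2 by lra.
have [g hg fg] := hf _ e2; have [l hl] := hg _ e2; exists l => h k hh hk.
rewrite (_ : f h k - mono_eval l h k = (f h k - g h k) + (g h k - mono_eval l h k))%C; last by ring.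
by apply: Rle_trans (Cmod_triangle _ _) _; have := fg h k hh hk; have := hl h k hh hk; lra.
Qed.

Lemma poly_limit_ext f g : (forall h k, Cmod h <= r -> Cmod k <= r -> f h k = g h k) ->
  poly_limit r f -> poly_limit r g.
Proof.
move=> e hf e1 e0; have [l hl] := hf e1 e0; exists l => h k hh hk.
by rewrite -e //; exact: hl.
Qed.

Lemma poly_limit_const c : poly_limit r (fun _ _ => c).
Proof.
apply: poly_limit_ext (poly_limit_mono [:: (c, 0%N, 0%N)]) => h k _ _.
by rewrite /mono_eval big_seq1 /=; ring.
Qed.

Lemma poly_limit_fst : poly_limit r (fun h _ => h).
Proof.
apply: poly_limit_ext (poly_limit_mono [:: (RtoC 1, 1%N, 0%N)]) => h k _ _.
by rewrite /mono_eval big_seq1 /=; ring.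
Qed.

Lemma poly_limit_snd : poly_limit r (fun _ k => k).
Proof.
apply: poly_limit_ext (poly_limit_mono [:: (RtoC 1, 0%N, 1%N)]) => h k _ _.
by rewrite /mono_eval big_seq1 /=; ring.
Qed.

Lemma poly_limit_plus f g : poly_limit r f -> poly_limit r g ->
  poly_limit r (fun h k => f h k + g h k)%C.
Proof.
move=> hf hg e e0; have e2 : 0 < e / 2 by lra.
have [l hl] := hf _ e2; have [l' hl'] := hg _ e2; exists (l ++ l') => h k hh hk.
rewrite mono_eval_cat.
rewrite (_ : _ - _ = (f h k - mono_eval l h k) + (g h k - mono_eval l' h k))%C; last by ring.
by apply: Rle_trans (Cmod_triangle _ _) _; have := hl h k hh hk; have := hl' h k hh hk; lra.
Qed.

Lemma poly_limit_bounded f : poly_limit r f -> exists2 M, 0 < M &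
  forall h k, Cmod h <= r -> Cmod k <= r -> Cmod (f h k) <= M.
Proof.
move=> hf; have [l hl] := hf 1 Rlt_0_1; have [M M0 hM] := mono_eval_bounded l r0.
exists (M + 1); first lra; move=> h k hh hk.
have := Cmod_triangle (f h k - mono_eval l h k) (mono_eval l h k).
rewrite (_ : _ + _ = f h k)%C; last by ring.
by have := hl h k hh hk; have := hM h k hh hk; lra.
Qed.

Lemma poly_limit_mult f g : poly_limit r f -> poly_limit r g ->
  poly_limit r (fun h k => f h k * g h k)%C.
Proof.
move=> hf hg e e0; have [Mf Mf0 bf] := poly_limit_bounded hf.
have e1 : 0 < e / 2 / Mf by apply: Rdiv_lt_0_compat; lra.
have [l' hl'] := hg _ e1; have [M M0 hM] := mono_eval_bounded l' r0.
have e2 : 0 < e / 2 / (M + 1) by apply: Rdiv_lt_0_compat; lra.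
have [l hl] := hf _ e2; exists (mono_mult l l') => h k hh hk.
rewrite mono_eval_mult (_ : _ - _ = f h k * (g h k - mono_eval l' h k) +
  (f h k - mono_eval l h k) * mono_eval l' h k)%C; last by ring.
apply: Rle_trans (Cmod_triangle _ _) _; rewrite !Cmod_mult.
have p z := Cmod_ge_0 z.
have h1 := Rmult_le_compat _ _ _ _ (p _) (p _) (bf h k hh hk) (hl' h k hh hk).
have h2 := Rmult_le_compat _ _ _ _ (p _) (p _) (hl h k hh hk) (hM h k hh hk).
have h3 : Mf * (e / 2 / Mf) = e / 2 by field; lra.
have h4 : e / 2 / (M + 1) * M = e / 2 - e / 2 / (M + 1) by field; lra.
lra.
Qed.

Lemma poly_limit_pow f n : poly_limit r f -> poly_limit r (fun h k => f h k ^ n)%C.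
Proof.
move=> hf; elim: n => [|n IH]; first exact: poly_limit_const.
exact: poly_limit_mult.
Qed.

End PolyLimitClosure.

Lemma Cpow_minus_le (a b : C) m n : Cmod a <= m -> Cmod b <= m ->
  Cmod (a ^ n.+1 - b ^ n.+1)%C <= INR n.+1 * m ^ n * Cmod (a - b)%C.
Proof.
move=> ha hb; have m0 := Rle_trans _ _ _ (Cmod_ge_0 a) ha; elim: n => [|n IH].
  by rewrite !Cpow_1_r /= !Rmult_1_l; exact: Rle_refl.
have e : (a ^ n.+2 - b ^ n.+2)%C = (a * (a ^ n.+1 - b ^ n.+1) + (a - b) * b ^ n.+1)%C.
  change ((a * a ^ n.+1 - b * b ^ n.+1)%C = (a * (a ^ n.+1 - b ^ n.+1) + (a - b) * b ^ n.+1)%C).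
  ring.
rewrite e.
apply: Rle_trans (Cmod_triangle _ _) _; rewrite !Cmod_mult Cmod_Cpow.
have p z := Cmod_ge_0 z.
have h1 := Rmult_le_compat _ _ _ _ (p _) (p _) ha IH.
have h2 : Cmod b ^ n.+1 <= m ^ n.+1 by apply: pow_incr.
have h3 := Rmult_le_compat_l _ _ _ (p (a - b)%C) h2.
apply: Rle_trans (Rplus_le_compat _ _ _ _ h1 h3) _; right.
by rewrite (S_INR n.+1) -!tech_pow_Rmult; ring.
Qed.

Lemma Cmod_Cexp z : Cmod (Cexp z) = exp (fst z).
Proof.
rewrite /Cexp Cmod_mult (Cmod_unit_circle (snd z)) Rmult_1_r Cmod_R Rabs_pos_eq //.
exact/Rlt_le/exp_pos.
Qed.

Lemma Cexp_pow z n : Cexp (RtoC (INR n) * z)%C = (Cexp z ^ n)%C.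
Proof.
elim: n => [|n IH]; first by rewrite Cmult_0_l Cexp_0.
by rewrite S_INR RtoC_plus Cmult_plus_distr_r Cmult_1_l Cexp_plus IH Cmult_comm.
Qed.

(** With [v = w / (n+1)], [Cexp w] is the power [n+1] of [Cexp v]. Both [Cexp v] and [1 + v] have
    modulus at most [exp (b / (n+1))], so the powers differ by at most
    [(n+1) exp b |Cexp v - 1 - v|], which tends to 0. Euler's form, rather than the Taylor series,
    uses only the first-order expansion of [Cexp]. *)
Lemma Cexp_euler_limit b e : 0 < b -> 0 < e -> exists n : nat, forall w, Cmod w <= b ->
  Cmod (Cexp w - (1 + RtoC (/ INR n.+1) * w) ^ n.+1)%C <= e.
Proof.
move=> b0 e0; have hb := exp_pos b; have e1 : 0 < e / (b * exp b).
  by apply: Rdiv_lt_0_compat => //; exact: Rmult_lt_0_compat.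
have [d d0 hd] := Cexp_first_order e1.
have [N [hN N0]] := archimed_cor1 (d / b) (Rdiv_lt_0_compat _ _ d0 b0).
have n0 : 0 < INR N by exact: lt_0_INR.
case: N N0 hN n0 => [|n] _; first by rewrite /=; lra.
move=> hN n0; exists n => w hw.
have i0 : 0 < / INR n.+1 by exact: Rinv_0_lt_compat.
set v := (RtoC (/ INR n.+1) * w)%C.
have hv : Cmod v <= b / INR n.+1.
  rewrite /v Cmod_mult Cmod_R Rabs_pos_eq; last lra.
  by rewrite /Rdiv (Rmult_comm b); apply: Rmult_le_compat_l => //; lra.
have hvd : Cmod v < d.
  apply: Rle_lt_trans hv _; have := Rmult_lt_compat_l _ _ _ b0 hN.
  by rewrite (_ : b * (d / b) = d); [|field; lra].
have ew : Cexp w = (Cexp v ^ n.+1)%C.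
  rewrite -Cexp_pow /v Cmult_assoc -RtoC_mult Rinv_r; last lra.
  by rewrite Cmult_1_l.
have m1 : Cmod (Cexp v) <= exp (b / INR n.+1).
  rewrite Cmod_Cexp; have h : fst v <= b / INR n.+1.
    by apply: Rle_trans hv; apply: Rle_trans (Rle_abs _) (Cmod_fst v).
  by case: h => [h|->]; [left; exact: exp_increasing | right].
have m2 : Cmod (1 + v)%C <= exp (b / INR n.+1).
  apply: Rle_trans (Cmod_triangle _ _) _; rewrite Cmod_1.
  by apply: Rle_trans (exp_ineq1_le _); lra.
rewrite ew; apply: Rle_trans (Cpow_minus_le n m1 m2) _.
have h3 := hd v hvd.
rewrite (_ : Cexp v - (1 + v) = Cexp v - 1 - v)%C; last by ring.
have hp : exp (b / INR n.+1) ^ n <= exp b.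
  apply: (@Rle_trans _ (exp (b / INR n.+1) ^ n.+1)).
    have h := exp_ineq1_le (b / INR n.+1).
    have h0 : 0 < b / INR n.+1 by exact: Rdiv_lt_0_compat.
    have h1 : 0 <= exp (b / INR n.+1) ^ n by apply: pow_le; lra.
    by rewrite -tech_pow_Rmult; nra.
  right; rewrite -Rpower_pow; last exact: exp_pos.
  by rewrite /Rpower ln_exp; congr exp; field; lra.
have h4 : Cmod (Cexp v - 1 - v)%C <= e / (b * exp b) * (b / INR n.+1).
  by apply: Rle_trans h3 _; apply: Rmult_le_compat_l hv; lra.
have h5 : 0 <= INR n.+1 * exp (b / INR n.+1) ^ n.
  by apply: Rmult_le_pos; [lra | apply: pow_le; exact/Rlt_le/exp_pos].
apply: Rle_trans (Rmult_le_compat_l _ _ _ h5 h4) _.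
have et : INR n.+1 * exp b * (e / (b * exp b) * (b / INR n.+1)) = e by field; lra.
rewrite -[X in _ <= X]et.
apply: Rmult_le_compat_r; last by apply: Rmult_le_compat_l => //; lra.
by apply: Rmult_le_pos; apply: Rlt_le => //; exact: Rdiv_lt_0_compat.
Qed.

Lemma poly_limit_Cexp r f : 0 <= r -> poly_limit r f -> poly_limit r (fun h k => Cexp (f h k)).
Proof.
move=> r0 hf; have [b b0 hb] := poly_limit_bounded r0 hf.
apply: poly_limit_uniform => e e0; have [n hn] := Cexp_euler_limit b0 e0.
exists (fun h k => (1 + RtoC (/ INR n.+1) * f h k) ^ n.+1)%C; last first.
  by move=> h k hh hk; apply: hn; exact: hb.
apply: poly_limit_pow => //; apply: poly_limit_plus; first exact: poly_limit_const.
by apply: poly_limit_mult => //; exact: poly_limit_const.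
Qed.

(** * The determinant *)

Section AffineOperators.
Variable X : graph.
Notation H := (l2_NormedModule (VX X)).
Notation B := (bounded_op H).
Notation I := (op_id H).
Notation A := (adjacency X).

(** No scalar at distance [|m|] or more from [m] is in the spectrum, so the hull lies in the open
    disc about [m] whose circle passes through 0. *)
Lemma near_spectrum (T : B) m k : op_norm (minus T (op_scal m I)) <= k -> k < Cmod m ->
  ~ conv (spectrum T) (RtoC 0).
Proof.
move=> hT hk h0.
have : disc m (Cmod m) (RtoC 0).
  apply: h0; first exact: disc_convex.
  move=> l sl; apply: NNPP => hl; apply: sl.
  have hkl : k < Cmod (l - m)%C by rewrite /disc in hl; lra.
  have [S hS _] := op_minus_near hT hkl; exists S.
  rewrite (_ : minus (op_scal l I) T =
    minus (op_scal (l - m)%C I) (minus T (op_scal m I))) //.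
  apply: bop_eq => x; rewrite !opE (scal_minus_distr_r (l : C_Ring) m x).
  rewrite /minus opp_plus opp_opp -!plus_assoc; congr plus.
  by rewrite plus_comm -plus_assoc plus_opp_r plus_zero_r.
rewrite /disc (_ : RtoC 0 - m = - m)%C ?Cmod_opp; [lra | ring].
Qed.

Lemma affine_shift (c z m : C) :
  minus (minus (op_scal c I) (op_scal z A)) (op_scal m I) =
  plus (op_scal (c - m)%C I) (op_scal (- z)%C A).
Proof.
apply: bop_eq => x; rewrite !opE (scal_minus_distr_r (c : C_Ring) m x).
have -> : scal (Copp z : C_Ring) (A x) = opp (scal (z : C_Ring) (A x)) := scal_opp_l z (A x).
by rewrite /minus -!plus_assoc; congr plus; exact: plus_comm.
Qed.

Lemma affine_scale (e a b : C) : op_scal e (plus (op_scal a I) (op_scal b A)) =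
  plus (op_scal (e * a)%C I) (op_scal (e * b)%C A).
Proof. by rewrite op_scalDr !op_scalA. Qed.

Lemma op_poly_affine_pow_adj a b n j :
  op_poly (op_comp (op_pow (plus (op_scal a I) (op_scal b A)) n) (op_pow A j)).
Proof.
elim: n => [|n IH]; first by rewrite op_comp1l; exact: op_poly_pow.
rewrite /= op_compDl op_compDl !op_compZl op_comp1l -op_compA.
by apply: op_poly_plus; apply: op_poly_scal => //; exact: op_poly_adj.
Qed.

Lemma affine_powS a b n S (Y : B := plus (op_scal a I) (op_scal b A)) :
  op_comp (op_pow Y n.+1) S = plus (op_scal a (op_comp (op_pow Y n) S))
    (op_scal b (op_comp (op_pow Y n) (op_comp A S))).
Proof.
have -> : op_pow Y n.+1 = op_comp (op_pow Y n) Y by rewrite op_powSr.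
by rewrite -op_compA {2}/Y op_compDl !op_compZl op_comp1l op_compDr !op_compZr.
Qed.

Variables (tau : B -> C -> Prop) (tr : B -> C) (M : R) (N : nat).
Hypothesis trP : trace_functional tau tr M N.

Lemma trace_minus S T : op_limit S -> op_limit T -> tr (minus S T) = (tr S - tr T)%C.
Proof.
move=> hS hT; rewrite /minus op_oppE (trace_plus trP) ?(trace_scal trP) ?RtoC_m1 //.
  ring.
exact: op_limit_scal.
Qed.

(** The extra factor [A^j] makes the induction on [n] work: splitting off one factor [a I + b A]
    expresses the trace through those with [j] and [j + 1], and [a], [b] come out by linearity. *)
Lemma trace_affine_pow_poly_limit r (a b : C -> C -> C) n j : 0 <= r ->
  poly_limit r a -> poly_limit r b -> poly_limit r (fun h k =>
    tr (op_comp (op_pow (plus (op_scal (a h k) I) (op_scal (b h k) A)) n) (op_pow A j))).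
Proof.
move=> r0 ha hb; elim: n j => [|n IH] j; first exact: (poly_limit_const r (tr (op_comp I (op_pow A j)))).
apply: poly_limit_ext (poly_limit_plus (poly_limit_mult r0 ha (IH j))
  (poly_limit_mult r0 hb (IH j.+1))) => h k _ _.
have l i := op_poly_limit (op_poly_affine_pow_adj (a h k) (b h k) n i).
rewrite -(trace_scal trP _ (l j)) -(trace_scal trP _ (l j.+1)).
rewrite -(trace_plus trP (op_limit_scal _ (l j)) (op_limit_scal _ (l j.+1))).
by rewrite affine_powS.
Qed.

Definition log_approx (l : C) (Y : B) (n : nat) : B :=
  plus (op_scal l I) (op_psum (log_term Y) n).

Lemma op_poly_log_psum a b n :
  op_poly (op_psum (log_term (plus (op_scal a I) (op_scal b A))) n).
Proof. by apply: op_poly_psum => i; apply: op_poly_scal; exact: op_poly_affine_pow. Qed.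

Lemma op_poly_log_approx l a b n :
  op_poly (log_approx l (plus (op_scal a I) (op_scal b A)) n).
Proof.
by apply: op_poly_plus (op_poly_log_psum _ _ _); apply: op_poly_scal; exact: (op_poly_pow _ 0).
Qed.

Lemma trace_log_approx_poly_limit r l (a b : C -> C -> C) n : 0 <= r ->
  poly_limit r a -> poly_limit r b -> poly_limit r (fun h k =>
    tr (log_approx l (plus (op_scal (a h k) I) (op_scal (b h k) A)) n)).
Proof.
move=> r0 ha hb.
have hs : poly_limit r (fun h k =>
    tr (op_psum (log_term (plus (op_scal (a h k) I) (op_scal (b h k) A))) n)).
  elim: n => [|n IH]; first exact: (poly_limit_const r (tr zero)).
  have ht := poly_limit_mult r0 (poly_limit_const r (RtoC (- / INR n.+1)))
    (trace_affine_pow_poly_limit n.+1 0 r0 ha hb).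
  apply: poly_limit_ext (poly_limit_plus IH ht) => h k _ _.
  have l1 := op_poly_limit (op_poly_log_psum (a h k) (b h k) n).
  have l2 := op_poly_limit (@op_poly_affine_pow X (a h k) (b h k) n.+1).
  rewrite [op_psum _ n.+1]/(plus (op_psum _ n) (log_term _ n)).
  rewrite (trace_plus trP l1 (op_limit_scal _ l2)) (trace_scal trP _ l2).
  by rewrite op_comp1r.
apply: poly_limit_ext (poly_limit_plus (poly_limit_const r (tr (op_scal l I))) hs) => h k _ _.
rewrite -(trace_plus trP) //; first exact: op_limit_scal (op_limit_id X).
exact: op_poly_limit (op_poly_log_psum _ _ _).
Qed.

Variable d : nat.
Hypothesis deg_le : forall v : VX X, (deg v <= d)%N.
Hypothesis ne : exists x : VX X, True.
Hypothesis M0 : 0 <= M.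

(** By [affine_norm], the two inequalities bring [c I - z A] within [k] of [m I]. The branch value
    [l] and the function [t], the trace of a chosen logarithm, are fixed before [c] and [z], which
    allows approximation uniform in them. *)
Lemma affine_det m k : k < Cmod m -> exists l (t : C -> C -> C), forall c z,
  Cmod (c - m + RtoC (INR d) * z)%C <= k -> Cmod (c - m - RtoC (INR d) * z)%C <= k ->
  (forall w, is_det tau (minus (op_scal c I) (op_scal z A)) w <-> w = Cexp (t c z)) /\
  forall n, Cmod (t c z - tr (log_approx l
      (plus (op_scal (- / m * (c - m)) I) (op_scal (- / m * - z) A)) n))%C <=
    M * ((k / Cmod m) ^ n / (1 - k / Cmod m)).
Proof.
(* For negative [k] no [c] and [z] satisfy the inequalities, and any [l], [t] will do. *)
case: (Rle_lt_dec 0 k) => [k0 hk|k0 _]; last first.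
  by exists (RtoC 0), (fun _ _ => RtoC 0) => c z h; have := Cmod_ge_0 (c - m + RtoC (INR d) * z); lra.
have m1 : 0 < Cmod m by lra.
have m0 : m <> RtoC 0 by apply/Cmod_gt_0.
have [l [hl hQ]] := is_log_exists X m0.
pose T c z : B := minus (op_scal c I) (op_scal z A).
pose aff c z : B := plus (op_scal (- / m * (c - m))%C I) (op_scal (- / m * - z)%C A).
pose P c z Q := is_log (T c z) Q /\
  forall n, op_norm (minus Q (log_approx l (aff c z) n)) <= (k / Cmod m) ^ n / (1 - k / Cmod m).
exists l, (fun c z => tr (epsilon (inhabits I) (P c z))) => c z h1 h2.
have hT : op_norm (minus (T c z) (op_scal m I)) <= k.
  rewrite affine_shift; apply: (affine_norm deg_le).
    by rewrite (_ : _ + _ = c - m - RtoC (INR d) * z)%C //; ring.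
  by rewrite (_ : _ - _ = c - m + RtoC (INR d) * z)%C //; ring.
have nsp := near_spectrum hT hk.
have kap : 0 <= k / Cmod m < 1.
  split; first exact: Rdiv_le_0_compat.
  by apply: (Rmult_lt_reg_r (Cmod m)) => //; rewrite /Rdiv Rmult_assoc Rinv_l; lra.
have : P c z (epsilon (inhabits I) (P c z)).
  apply: epsilon_spec; have [Q lQ aQ] := hQ (T c z) k hT hk; exists Q; split=> // n.
  by have := aQ n; rewrite affine_shift affine_scale.
set Q := epsilon _ _; move=> [lQ aQ].
have limA n : op_limit (log_approx l (aff c z) n) by apply: op_poly_limit; exact: op_poly_log_approx.
have limQ : op_limit Q.
  move=> e e0; have i0 : 0 < / (1 - k / Cmod m) by apply: Rinv_0_lt_compat; lra.
  have [n hn] := pow_vanish kap (Rlt_le _ _ i0) e0.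
  exists (log_approx l (aff c z) n); first exact: op_poly_log_approx.
  by apply: Rle_lt_trans (aQ n) _; rewrite /Rdiv Rmult_comm.
split=> [w|n]; last first.
  rewrite -(trace_minus limQ (limA n)); apply: Rle_trans (trace_bound trP _) _.
    by rewrite /minus op_oppE; apply: op_limit_plus => //; exact: op_limit_scal.
  exact: Rmult_le_compat_l.
have polyT : op_poly (T c z).
  rewrite /T /minus op_oppE; apply: op_poly_plus; apply: op_poly_scal; first exact: (op_poly_pow _ 0).
  apply: op_poly_scal; rewrite -[A]op_comp1r; exact: (op_poly_pow _ 1).
split=> [[_ _ [Q' [t [lQ' tQ' ->]]]]|->]; last first.
  split=> //; first exact: op_poly_in_cstar.
  by exists Q, (tr Q); split=> //; apply/(trace_spec trP).
(* Another logarithm is [Q + dl I]; its trace is larger by [N dl], and [Cexp (N dl) = 1]. *)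
have [dl edl eQ] := is_log_unique ne nsp lQ' lQ.
have limI := op_limit_scal dl (op_limit_id X).
move: tQ'; rewrite eQ => /(trace_spec trP _ (op_limit_plus limQ limI)) ->.
rewrite (trace_plus trP limQ limI) (trace_scal trP _ (op_limit_id X)) (trace_id trP).
rewrite Cexp_plus (Cmult_comm dl) Cexp_pow edl.
by elim: N => [|n IH] /=; rewrite ?Cmult_1_r // Cmult_1_l.
Qed.
End AffineOperators.

(** The circle about [s (u + v)] through 0 cuts the ray of [u] at twice [s] times the real inner
    product of [u] and [u + v]; for unit vectors this is [s |u + v|^2]. *)
Lemma unit_sum_centre (u v : C) alpha s : Cmod u = 1 -> Cmod v = 1 -> 0 < alpha -> 0 < s ->
  alpha < s * (Cmod (u + v)%C) ^ 2 ->
  Cmod (RtoC alpha * u - RtoC s * (u + v))%C < Cmod (RtoC s * (u + v))%C.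
Proof.
move: u v => [u1 u2] [v1 v2].
have sq (z : C) : Cmod z ^ 2 = fst z ^ 2 + snd z ^ 2.
  by rewrite /Cmod pow2_sqrt //; nra.
move=> hu hv a0 s0 ha.
have eu : u1 ^ 2 + u2 ^ 2 = 1 by rewrite -(sq (u1, u2)) hu; ring.
have ev : v1 ^ 2 + v2 ^ 2 = 1 by rewrite -(sq (v1, v2)) hv; ring.
pose W := (u1 + v1) ^ 2 + (u2 + v2) ^ 2.
rewrite (_ : Cmod _ ^ 2 = W) in ha; last exact: sq.
apply: Rsqr_incrst_0; try exact: Cmod_ge_0.
rewrite !Rsqr_pow2 !sq.
have -> : fst (RtoC alpha * (u1, u2) - RtoC s * ((u1, u2) + (v1, v2)))%C =
  alpha * u1 - s * (u1 + v1) by rewrite /=; ring.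
have -> : snd (RtoC alpha * (u1, u2) - RtoC s * ((u1, u2) + (v1, v2)))%C =
  alpha * u2 - s * (u2 + v2) by rewrite /=; ring.
have -> : fst (RtoC s * ((u1, u2) + (v1, v2)))%C = s * (u1 + v1) by rewrite /=; ring.
have -> : snd (RtoC s * ((u1, u2) + (v1, v2)))%C = s * (u2 + v2) by rewrite /=; ring.
have h := Rmult_lt_0_compat alpha (s * W - alpha) a0 ltac:(lra).
have e : W = 2 * (u1 * (u1 + v1) + u2 * (u2 + v2)) by rewrite /W; lra.
rewrite e in h; clear - h eu; nra.
Qed.

(** The third hypothesis says that 0 is not on the segment from [a] to [b], tested at the point
    where the bisector of the angle meets it. The centre lies on that bisector, far enough from 0:
    [s |u + v|^2 = |a| + |b|] exceeds both moduli. *)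
Lemma disc_centre (a b : C) : a <> RtoC 0 -> b <> RtoC 0 ->
  (RtoC (Cmod b) * a + RtoC (Cmod a) * b)%C <> RtoC 0 ->
  exists m, Cmod (a - m)%C < Cmod m /\ Cmod (b - m)%C < Cmod m.
Proof.
move=> a0 b0 h.
have ca : 0 < Cmod a by apply/Cmod_gt_0.
have cb : 0 < Cmod b by apply/Cmod_gt_0.
have na : RtoC (Cmod a) <> RtoC 0 by move/RtoC_inj; lra.
have nb : RtoC (Cmod b) <> RtoC 0 by move/RtoC_inj; lra.
pose u := (a / RtoC (Cmod a))%C; pose v := (b / RtoC (Cmod b))%C.
have hu : Cmod u = 1 by rewrite /u Cmod_div // Cmod_R Rabs_pos_eq; [field | ]; lra.
have hv : Cmod v = 1 by rewrite /v Cmod_div // Cmod_R Rabs_pos_eq; [field | ]; lra.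
have w0 : (u + v)%C <> RtoC 0.
  move=> e; apply: h; transitivity (RtoC (Cmod a) * RtoC (Cmod b) * (u + v))%C.
    by rewrite /u /v; field; split.
  by rewrite e; ring.
have cw : 0 < Cmod (u + v)%C ^ 2 by apply: pow_lt; apply/Cmod_gt_0.
pose W := Cmod (u + v)%C ^ 2; pose s := (Cmod a + Cmod b) / W.
have s0 : 0 < s by apply: Rdiv_lt_0_compat cw; lra.
have es : s * W = Cmod a + Cmod b by rewrite /s; field; exact/not_eq_sym/Rlt_not_eq.
exists (RtoC s * (u + v))%C; split.
  have -> : (a - RtoC s * (u + v) = RtoC (Cmod a) * u - RtoC s * (u + v))%C.
    by congr Cminus; rewrite /u; field.
  by apply: unit_sum_centre => //; rewrite -/W es; lra.
have -> : (b - RtoC s * (u + v) = RtoC (Cmod b) * v - RtoC s * (v + u))%C.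
  by rewrite (Cplus_comm v); congr Cminus; rewrite /v; field.
by rewrite (Cplus_comm u); apply: unit_sum_centre => //; rewrite (Cplus_comm v) -/W es; lra.
Qed.

Lemma off_Omega_segment q p t : ~ Omega q p -> - INR q.+1 <= t <= INR q.+1 ->
  (ihara_coef q p - RtoC t * fst p)%C <> RtoC 0.
Proof.
move=> hp ht e; have z0 : fst p <> RtoC 0.
  move=> z0; move: e; case: p z0 {hp} => z u /= ->.
  rewrite (_ : _ - _ = RtoC 1)%C; last by ring.
  by move/RtoC_inj; lra.
apply: hp; split=> //; exists t; split=> //.
have -> : ihara_coef q p = (RtoC t * fst p)%C.
  transitivity (ihara_coef q p - RtoC t * fst p + RtoC t * fst p)%C; first by ring.
  by rewrite e; ring.
by field.
Qed.

Lemma off_Omega_centre q p : ~ Omega q p -> exists m,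
  Cmod (ihara_coef q p - m + RtoC (INR q.+1) * fst p)%C < Cmod m /\
  Cmod (ihara_coef q p - m - RtoC (INR q.+1) * fst p)%C < Cmod m.
Proof.
move=> hp; have hd := pos_INR q.+1; set c := ihara_coef q p; set d := INR q.+1 in hd *.
set z := fst p.
pose a := (c - RtoC (- d) * z)%C; pose b := (c - RtoC d * z)%C.
have a0 : a <> RtoC 0 by apply: off_Omega_segment => //; rewrite -/d; lra.
have b0 : b <> RtoC 0 by apply: off_Omega_segment => //; rewrite -/d; lra.
have ca : 0 < Cmod a by apply/Cmod_gt_0.
have cb : 0 < Cmod b by apply/Cmod_gt_0.
have ne : (RtoC (Cmod b) * a + RtoC (Cmod a) * b)%C <> RtoC 0.
  (* [c - t z] is the point of the segment that is proportional to [|b| a + |a| b], where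
     [a = c + d z] and [b = c - d z]. *)
  pose t := (Cmod a - Cmod b) / (Cmod a + Cmod b) * d.
  have ht : - d <= t <= d.
    have e1 : t + d = 2 * Cmod a / (Cmod a + Cmod b) * d by rewrite /t; field; lra.
    have e2 : d - t = 2 * Cmod b / (Cmod a + Cmod b) * d by rewrite /t; field; lra.
    have h1 : 0 <= 2 * Cmod a / (Cmod a + Cmod b) by apply: Rdiv_le_0_compat; lra.
    have h2 : 0 <= 2 * Cmod b / (Cmod a + Cmod b) by apply: Rdiv_le_0_compat; lra.
    by have := Rmult_le_pos _ _ h1 hd; have := Rmult_le_pos _ _ h2 hd; lra.
  have nt := off_Omega_segment hp ht.
  have ns : RtoC (Cmod a + Cmod b) <> RtoC 0 by move/RtoC_inj; lra.
  have et : RtoC t = ((RtoC (Cmod a) - RtoC (Cmod b)) / RtoC (Cmod a + Cmod b) * RtoC d)%C.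
    by rewrite /t RtoC_mult RtoC_div ?RtoC_minus //; lra.
  rewrite et -/c -/z in nt; move=> e; apply: (Cmult_neq_0 _ _ ns nt); rewrite -[RHS]e.
  move: (Cmod a) (Cmod b) ns => al be; rewrite RtoC_plus /a /b RtoC_opp => ns.
  by field.
have [m [h1 h2]] := disc_centre a0 b0 ne; exists m.
have -> : (c - m + RtoC d * z = a - m)%C by rewrite /a RtoC_opp; ring.
by have -> : (c - m - RtoC d * z = b - m)%C by rewrite /b; ring.
Qed.

Lemma ihara_coefE q p :
  ihara_coef q p = (1 + (1 - snd p) * (RtoC (INR q) + snd p) * (fst p * fst p))%C.
Proof. by case: p => z u; rewrite /ihara_coef /=; ring. Qed.

Lemma continuous_ihara_coef q (p : prod_UniformSpace C_UniformSpace C_UniformSpace) :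
  continuous (fun p : prod_UniformSpace C_UniformSpace C_UniformSpace => ihara_coef q p) p.
Proof.
apply: continuous_ext; first by move=> x; exact/esym/ihara_coefE.
have c1 : continuous (fun x : prod_UniformSpace C_UniformSpace C_UniformSpace => fst x : C) p.
  by case: (p) => z u; exact: continuous_fst.
have c2 : continuous (fun x : prod_UniformSpace C_UniformSpace C_UniformSpace => snd x : C) p.
  by case: (p) => z u; exact: continuous_snd.
apply: continuous_Cplus; first exact: continuous_const.
apply: continuous_Cmult; last exact: continuous_Cmult.
apply: continuous_Cmult; last by apply: continuous_Cplus => //; exact: continuous_const.
by apply: continuous_Cplus; [exact: continuous_const | exact: continuous_Copp].
Qed.

Lemma continuous_polydisc (f : prod_UniformSpace C_UniformSpace C_UniformSpace -> C) p M :
  continuous f p -> Cmod (f p) < M ->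
  exists2 r, 0 < r & forall h k, Cmod h <= r -> Cmod k <= r ->
    Cmod (f (fst p + h, snd p + k)%C) <= (Cmod (f p) + M) / 2.
Proof.
move=> cf hM; have e0 : 0 < (M - Cmod (f p)) / 2 by lra.
have : locally (f p) (fun w => Cmod (w - f p)%C < (M - Cmod (f p)) / 2).
  by apply/locally_Cmod; exists ((M - Cmod (f p)) / 2).
move/cf => [e he]; have e1 := cond_pos e; exists (e / 2); first lra.
move=> h k hh hk.
have : Cmod (f (fst p + h, snd p + k)%C - f p)%C < (M - Cmod (f p)) / 2.
  apply: he; split; apply: Cmod_ball => /=.
    by rewrite (_ : fst p + h - fst p = h)%C; [lra | ring].
  by rewrite (_ : snd p + k - snd p = k)%C; [lra | ring].
move=> hd; have := Cmod_triangle (f (fst p + h, snd p + k)%C - f p)%C (f p).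
rewrite (_ : _ - _ + _ = f (fst p + h, snd p + k))%C; [lra | ring].
Qed.

(** By continuity one centre [m] serves a whole polydisc; [kap] lies half way between the larger
    modulus at [p] and [|m|]. *)
Lemma off_Omega_polydisc q p : ~ Omega q p -> exists m kap r, [/\ kap < Cmod m, 0 < r &
  forall h k, Cmod h <= r -> Cmod k <= r -> let p' := (fst p + h, snd p + k)%C in
  Cmod (ihara_coef q p' - m + RtoC (INR q.+1) * fst p')%C <= kap /\
  Cmod (ihara_coef q p' - m - RtoC (INR q.+1) * fst p')%C <= kap].
Proof.
move=> /off_Omega_centre [m [h1 h2]].
pose S := prod_UniformSpace C_UniformSpace C_UniformSpace.
pose f1 (p : S) := (ihara_coef q p - m + RtoC (INR q.+1) * fst p)%C.
pose f2 (p : S) := (ihara_coef q p - m - RtoC (INR q.+1) * fst p)%C.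
have cz : continuous (fun x : S => RtoC (INR q.+1) * fst x)%C p.
  by apply: continuous_Cmult; [exact: continuous_const | case: (p) => z u; exact: continuous_fst].
have cc : continuous (fun x : S => ihara_coef q x - m)%C p.
  by apply: continuous_Cplus; [exact: continuous_ihara_coef | exact: continuous_const].
have c1 : continuous f1 p by exact: continuous_Cplus.
have c2 : continuous f2 p by apply: continuous_Cplus => //; exact: continuous_Copp.
have [r1 r10 b1] := continuous_polydisc c1 h1; have [r2 r20 b2] := continuous_polydisc c2 h2.
exists m, (Rmax ((Cmod (f1 p) + Cmod m) / 2) ((Cmod (f2 p) + Cmod m) / 2)), (Rmin r1 r2).
split=> [||h k hh hk].
- have h1' : Cmod (f1 p) < Cmod m := h1; have h2' : Cmod (f2 p) < Cmod m := h2.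
  by apply: Rmax_lub_lt; lra.
- exact: Rmin_pos.
- have m1 := Rmin_l r1 r2; have m2 := Rmin_r r1 r2; split.
    by apply: Rle_trans (Rmax_l _ _); apply: b1; lra.
  by apply: Rle_trans (Rmax_r _ _); apply: b2; lra.
Qed.

Lemma ihara_coef_poly_limit q (p : C * C) r : 0 <= r ->
  poly_limit r (fun h k => ihara_coef q (fst p + h, snd p + k)%C).
Proof.
move=> r0.
have hz : poly_limit r (fun h k => fst p + h)%C.
  exact: poly_limit_plus (poly_limit_const _ _) (poly_limit_fst _).
have hu c : poly_limit r (fun h k => c + k)%C.
  exact: poly_limit_plus (poly_limit_const _ _) (poly_limit_snd _).
have hn : poly_limit r (fun h k => (1 - snd p) + RtoC (-1) * k)%C.
  apply: poly_limit_plus (poly_limit_const _ _) _.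
  exact: poly_limit_mult (poly_limit_const _ _) (poly_limit_snd _).
apply: poly_limit_ext (poly_limit_plus (poly_limit_const r (RtoC 1)) (poly_limit_mult r0
  (poly_limit_mult r0 hn (hu (RtoC (INR q) + snd p)%C)) (poly_limit_mult r0 hz hz))) => h k _ _.
by rewrite ihara_coefE RtoC_m1 /=; ring.
Qed.

Theorem lemma2p3 (q : nat) (hq : (1 <= q)%N)
  (X : graph) (hreg : essentially_regular X q.+1) (hinf : infinite_graph X)
  (tau : bounded_op (l2_NormedModule (VX X)) -> C -> Prop) (htau : canonical_trace tau) :
  connected (T := prod_UniformSpace C_UniformSpace C_UniformSpace)
    (fun p => ~ Omega q p) /\
  exists F : C * C -> C,
    (forall p, ~ Omega q p -> forall w, is_det tau (ihara_op X q p) w <-> w = F p) /\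
    (forall p, ~ Omega q p -> analytic_at F p /\ F p <> RtoC 0).
Proof.
split; first exact: complement_connected.
have [_ [deg_le _]] := hreg.
have ne : exists x : VX X, True by have [x _] := hinf fset0; exists x.
have [tr [M [N [M0 trP]]]] := canonical_trace_functional deg_le ne htau.
(* A value of the determinant is chosen at every point; off [Omega] it exists and is unique, by
   [loc]. *)
pose F p := epsilon (inhabits (RtoC 0)) (is_det tau (ihara_op X q p)).
have FE p t : (forall w, is_det tau (ihara_op X q p) w <-> w = Cexp t) -> F p = Cexp t.
  move=> h; have : is_det tau (ihara_op X q p) (F p).
    by apply: epsilon_spec; exists (Cexp t); apply/h.
  by move/h.
(* Only [Cexp T] is determined by the operator; the trace [T] of a logarithm depends on the branch,
   which is chosen for each [p] separately and kept on the whole polydisc. *)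
have loc p : ~ Omega q p -> exists r T, [/\ 0 < r, poly_limit r T &
    forall h k, Cmod h <= r -> Cmod k <= r -> forall w,
      is_det tau (ihara_op X q (fst p + h, snd p + k)%C) w <-> w = Cexp (T h k)].
  move=> /off_Omega_polydisc [m [kap [r [hkap r0 hr]]]].
  have [l [t ht]] := affine_det trP deg_le ne M0 hkap.
  pose c h k := ihara_coef q (fst p + h, snd p + k)%C.
  pose z (h k : C) := (fst p + h)%C.
  have r0' := Rlt_le _ _ r0.
  exists r, (fun h k => t (c h k) (z h k)); split=> // [|h k hh hk]; last first.
    by have [h1 h2] := hr h k hh hk; exact: (proj1 (ht _ _ h1 h2)).
  apply: poly_limit_uniform => e e0.
  have k0 : 0 <= kap.
    have c0 : Cmod (RtoC 0) <= r by rewrite Cmod_0.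
    by have [h _] := hr _ _ c0 c0; exact: Rle_trans (Cmod_ge_0 _) h.
  have m0 : m <> RtoC 0 by apply/Cmod_gt_0; lra.
  have k1 : 0 <= kap / Cmod m < 1.
    split; first by apply: Rdiv_le_0_compat; lra.
    by apply: (Rmult_lt_reg_r (Cmod m)); rewrite /Rdiv ?Rmult_assoc ?Rinv_l; lra.
  have i0 : 0 < / (1 - kap / Cmod m) by apply: Rinv_0_lt_compat; lra.
  have [n hn] := pow_vanish k1 (Rmult_le_pos _ _ M0 (Rlt_le _ _ i0)) e0.
  have hc : poly_limit r c by exact: ihara_coef_poly_limit.
  have hz : poly_limit r z.
    exact: poly_limit_plus (poly_limit_const _ _) (poly_limit_fst _).
  exists (fun h k => tr (log_approx l (plus
      (op_scal (- / m * (c h k - m))%C (op_id _)) (op_scal (- / m * - z h k)%C (adjacency X))) n)).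
    apply: (trace_log_approx_poly_limit trP) => //; apply: poly_limit_mult => //.
    - exact: poly_limit_const.
    - exact: poly_limit_plus (poly_limit_const _ _).
    - exact: poly_limit_const.
    - apply: poly_limit_ext (poly_limit_mult r0' (poly_limit_const r (RtoC (-1))) hz) => h k _ _.
      by rewrite RtoC_m1; ring.
  move=> h k hh hk; have [h1 h2] := hr h k hh hk.
  have [_ h3] := ht _ _ h1 h2; apply: Rle_trans (h3 n) _; rewrite /Rdiv.
  by rewrite (Rmult_comm (_ ^ n)) -Rmult_assoc; exact: Rlt_le.
exists F; split=> p hp; have [r [T [r0 hT TP]]] := loc p hp.
  have e0 : (fst p + 0, snd p + 0)%C = p by rewrite !Cplus_0_r; case: (p).
  have z0 : Cmod (RtoC 0) <= r by rewrite Cmod_0; lra.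
  by have := TP _ _ z0 z0; rewrite e0 => h w; rewrite (FE _ _ h).
split.
  apply: (analytic_of_poly_limit r0).
  apply: poly_limit_ext (poly_limit_Cexp (Rlt_le _ _ r0) hT) => h k hh hk.
  by rewrite (FE _ _ (TP h k hh hk)).
have e0 : (fst p + 0, snd p + 0)%C = p by rewrite !Cplus_0_r; case: (p).
have z0 : Cmod (RtoC 0) <= r by rewrite Cmod_0; lra.
by have := TP _ _ z0 z0; rewrite e0 => h; rewrite (FE _ _ h); exact: Cexp_neq0.
Qed.
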